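(* Let $x>0$, $0<\theta,\psi<1$, and let $\nu\in\mathbb{C}\setminus\mathbb{Z}$ with $\Re(\nu)\geq 0$. Let $N$ be any integer with $N\geq\lfloor\frac{\Re(\nu)+1}{2}\rfloor$, and suppose $x\notin\{(n-\theta)(r-\psi):\ n,r\in\mathbb{N}\}$. Then \begin{align*} &8\pi x^{\nu/2}\sum_{n=1}^{\infty}n^{\nu/2}K_{\nu}(4\pi\sqrt{nx})\sum_{d\mid n}d^{-\nu}\sin(2\pi d\theta)\cos\left(\frac{2\pi n\psi}{d}\right) =-\frac{\pi}{2\sin(\frac{\pi\nu}{2})}\bigl(\zeta(1-\nu,\theta)-\zeta(1-\nu,1-\theta)\bigr)\\ &\quad+\frac{x^{\nu}}{2\cos(\frac{\pi\nu}{2})}\bigl(\zeta(1,\theta)-\zeta(1,1-\theta)\bigr)\bigl\{\zeta(1+\nu,\psi)+\zeta(1+\nu,1-\psi)\bigr\}\\ &\quad-\frac{1}{2\cos(\frac{\pi\nu}{2})}\sum_{j=1}^{N}x^{2j-1}\bigl(\zeta(2j-\nu,\theta)-\zeta(2j-\nu,1-\theta)\bigr)\bigl\{\zeta(2j,\psi)+\zeta(2j,1-\psi)\bigr\}\\ &\quad-\frac{1}{2\cos(\frac{\pi\nu}{2})}x^{2N+1}\sum_{m,n\geq 0}\Bigl\{G(n+\psi,m+\theta)+G(n+1-\psi,m+\theta)-G(n+\psi,m+1-\theta)-G(n+1-\psi,m+1-\theta)\Bigr\}, \end{align*} where for $u,v>0$ with $uv\neq x$, \[ G(u,v)=\frac{u^{-\nu-1}}{v}\cdot\frac{(uv)^{\nu-2N+1}-x^{\nu-2N+1}}{(uv)^2-x^2}.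 \]
   Context: $K_\nu$ denotes the modified Bessel function of the second kind of order $\nu$. $\zeta(s,\alpha)$ is the Hurwitz zeta function ($\sum_{n\ge0}(n+\alpha)^{-s}$ for $\Re s>1$, meromorphically continued to $\mathbb{C}$ with only pole at $s=1$); $\zeta(1,\theta)-\zeta(1,1-\theta)$ is understood as $\lim_{s\to1}(\zeta(s,\theta)-\zeta(s,1-\theta))$. $\mathbb{N}=\{1,2,\dots\}$; the double sum runs over all pairs of non-negative integers $m,n$.
   Formalization: The hypothesis on x still permits terms G(u,v) with uv = x (e.g. x = θψ with θ = ψ = 1/3), where G is undefined; there G is given its limiting value u^{-ν-1}/v · ((ν-2N+1)/2) x^{ν-2N-1}. The double sum is read as an iterated sum. *)

(* Defs.v *)
From Stdlib Require Import Reals List Lia.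
From Stdlib Require Import Classical ClassicalEpsilon.
From Coquelicot Require Import Coquelicot.
Open Scope R_scope.

Definition cexp (z : C) : C :=
  (exp (Re z) * cos (Im z), exp (Re z) * sin (Im z)).
Definition csin (z : C) : C :=
  ((cexp (Ci * z) - cexp (- (Ci * z))) / (2 * Ci))%C.
Definition ccos (z : C) : C :=
  ((cexp (Ci * z) + cexp (- (Ci * z))) / 2)%C.
Definition ccosh (z : C) : C := ((cexp z + cexp (- z)) / 2)%C.

Definition cpow (b : R) (s : C) : C := cexp (s * RtoC (ln b))%C.

(* Modified Bessel function of the second kind, for real z > 0:
   K_nu(z) = \int_0^oo exp(-z cosh t) cosh(nu t) dt  (DLMF 10.32.9) *)
Definition besselK (nu : C) (z : R) : C :=
  @RInt_gen C_R_CompleteNormedModule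
    (fun t => (RtoC (exp (- z * cosh t)) * ccosh (nu * RtoC t))%C)
    (at_point 0) (Rbar_locally p_infty).

Definition hurwitz_continuation (a : R) (F : C -> C) : Prop :=
  (forall s : C, s <> RtoC 1 -> @ex_derive C_AbsRing C_NormedModule F s) /\
  (forall s : C, 1 < Re s ->
     @is_series C_AbsRing C_NormedModule
       (fun n => cpow (INR n + a) (- s)%C) (F s)).

(* Hurwitz zeta(s, a) (value at s = 1 is irrelevant / arbitrary). *)
Definition hurwitz (s : C) (a : R) : C :=
  match excluded_middle_informative (exists F, hurwitz_continuation a F) with
  | left H => (proj1_sig (constructive_indefinite_description _ H)) s
  | right _ => RtoC 0
  end.

Definition hurwitz_diff_at1 (th : R) : C :=
  match excluded_middle_informative
     (exists L : C, filterlim (fun s => (hurwitz s th - hurwitz s (1 - th))%C)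
                      (locally' (RtoC 1)) (locally L)) with
  | left H => proj1_sig (constructive_indefinite_description _ H)
  | right _ => RtoC 0
  end.

Definition csum (l : list nat) (f : nat -> C) : C :=
  fold_right (fun k acc => (f k + acc)%C) (RtoC 0) l.

Definition divisors_list (n : nat) : list nat :=
  filter (fun d => Nat.eqb (n mod d) 0) (seq 1 n).

(* G(u,v) = u^{-nu-1}/v * ((uv)^{nu-2N+1} - x^{nu-2N+1}) / ((uv)^2 - x^2),
   extended by continuity (removable singularity) at uv = x, where the
   second factor equals ((nu-2N+1)/2) x^{nu-2N-1}. *)
Definition Gfun (x : R) (nu : C) (N : nat) (u v : R) : C :=
  let a := (nu - RtoC (2 * INR N) + 1)%C in
  if Req_EM_T (u * v) x then
    (cpow u (- nu - 1) / RtoC v * (a / 2 * cpow x (a - 2)))%C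
  else
    (cpow u (- nu - 1) / RtoC v *
       ((cpow (u * v) a - cpow x a) / RtoC ((u * v) ^ 2 - x ^ 2)))%C.

(* Main.v *)
Require Import Defs.
From Stdlib Require Import Reals List Lia Lra Psatz.
From Stdlib Require Import Classical ClassicalEpsilon FunctionalExtensionality.
From Coquelicot Require Import Coquelicot.
Open Scope R_scope.

(* For real [t > 0], the integral of [t^(nu-1) exp (- 2 pi d t - 2 pi m x / t)] is a Bessel function, so the
   series on the left is, up to a constant, the Mellin transform of [A t * B (x / t)] with the Lambert series
   [A t = sum_d sin (2 pi d theta) e^(-2 pi d t)] and [B s = sum_m cos (2 pi m psi) e^(-2 pi m s)].
   Both are parts of cotangents, whose partial fractions
   [A t = 1/(2 pi) sum +- v / (v^2 + t^2)] and [B s = -1/2 + 1/(2 pi) sum s / (u^2 + s^2)]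
   can be integrated term by term when [1/4 < Re nu < 3/4]: the constant [-1/2] gives [zeta (1 - nu, .)], and the
   double sum gives the [G]-series for [N = 0].  In that strip [N] is raised by peeling off one geometric term
   of [G] at a time, and for fixed [N] both sides are holomorphic in [-1 < Re nu < 2 N + 1] away from the integers,
   so the identity theorem finishes the proof; this also covers the lines [Re nu = 0] and [Re nu = 2 N - 1], where
   termwise integration would diverge.
   Since [hurwitz] is an arbitrary continuation chosen by epsilon, Goursat's theorem is needed to know that a
   merely differentiable function obeys the identity theorem. *)

(** All integrals are taken in [y = ln t], so a Mellin transform becomes a two-sided Laplace
    transform over the real line and exponential decay is the test of convergence: termwise
    integration asks for one rate [lam] and summable constants, holomorphy in [nu] for a rate
    exceeding [|Re nu|]. The full integrand decays faster than every exponential, so its transform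
    is entire; a single partial fraction decays only like a power of [t], which confines the
    termwise computation to a strip. There [1 / (k^2 + t^2) <= k^(-5/4) t^(-3/4)] is used: [5/4]
    makes the sum over [k] converge, at the price of a quarter at each end of [0 < Re nu < 1]. The
    index [m] attached to [theta] is expanded first, against the bounded function [B], which fixes
    the order of the iterated double sum. The excluded integers are real, so continuation moves
    horizontally at a fixed nonzero imaginary part. That the Hurwitz zeta function has a
    continuation is proved too, since [hurwitz] would otherwise be its default [0]; it comes from
    repeated differences with unit averages, each gaining one power of decay. *)

Lemma C_ext (a b : C) : Re a = Re b -> Im a = Im b -> a = b.
Proof. destruct a, b; simpl; intros; subst; reflexivity. Qed.

Lemma Cmod_minus_sym (a b : C) : Cmod (a - b) = Cmod (b - a).
Proof. rewrite <- Cmod_opp. f_equal. ring. Qed.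

Lemma Cmod_minus_le (a b : C) : Cmod (a - b) <= Cmod a + Cmod b.
Proof. unfold Cminus. rewrite <- (Cmod_opp b). apply Cmod_triangle. Qed.

Lemma Cmod_triangle_rev (a b : C) : Cmod a - Cmod b <= Cmod (a + b).
Proof.
  assert (H := Cmod_triangle (a + b) (- b)).
  replace (a + b + - b)%C with a in H by ring. rewrite Cmod_opp in H. lra.
Qed.

Lemma Cmod_triangle_via (a b c : C) : Cmod (a - c) <= Cmod (a - b) + Cmod (b - c).
Proof. replace (a - c)%C with ((a - b) + (b - c))%C by ring. apply Cmod_triangle. Qed.

Lemma im_le_Cmod (c : C) : Rabs (Im c) <= Cmod c.
Proof.
  apply Rle_trans with (2 := Rmax_Cmod c). apply Rmax_r.
Qed.

Lemma Cmod_le_Rabs (c : C) : Cmod c <= Rabs (Re c) + Rabs (Im c).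
Proof.
  destruct c as [a b]; simpl. 
  replace (a, b) with (RtoC a + Ci * RtoC b)%C by (apply C_ext; simpl; ring).
  eapply Rle_trans. apply Cmod_triangle. rewrite Cmod_mult, Cmod_Ci, !Cmod_R. lra.
Qed.

Lemma Cmod_small_eq (a b : C) : (forall eps, 0 < eps -> Cmod (a - b) <= eps) -> a = b.
Proof.
  intros H. apply Ceq_minus. apply Cmod_eq_0.
  destruct (Cmod_ge_0 (a - b)) as [h|h]; [|now symmetry].
  specialize (H (Cmod (a - b) / 2) ltac:(lra)). lra.
Qed.

Lemma Cmod_RtoC_pos (r : R) : 0 <= r -> Cmod (RtoC r) = r.
Proof. intros. rewrite Cmod_R. now apply Rabs_pos_eq. Qed.

Lemma Cmod_sqr (c : C) : Cmod c * Cmod c = Re c * Re c + Im c * Im c.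
Proof. assert (H := Cmod2_alt c). simpl in H. lra. Qed.

Lemma RtoC_neq_0 (r : R) : r <> 0 -> RtoC r <> RtoC 0.
Proof. intros H E. apply H. now apply RtoC_inj in E. Qed.

Lemma Cneq_0_Re (z : C) : Re z <> 0 -> z <> RtoC 0.
Proof. intros H E; subst; apply H; reflexivity. Qed.

Lemma Re_minus (a b : C) : Re (a - b) = Re a - Re b.
Proof. destruct a, b; simpl; ring. Qed.
Lemma Im_minus (a b : C) : Im (a - b) = Im a - Im b.
Proof. destruct a, b; simpl; ring. Qed.

Ltac Ccalc := apply C_ext;
  repeat (rewrite ?re_plus, ?im_plus, ?re_opp, ?im_opp, ?re_mult, ?im_mult, ?Re_minus, ?Im_minus, ?re_RtoC, ?im_RtoC);
  simpl; try ring.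

(** * Limits of complex sequences *)

Definition Clim (u : nat -> C) (l : C) : Prop :=
  forall eps, 0 < eps -> exists N, forall n, (N <= n)%nat -> Cmod (u n - l) < eps.

Lemma Clim_unique u l l' : Clim u l -> Clim u l' -> l = l'.
Proof.
  intros H1 H2. apply Cmod_small_eq. intros eps He.
  destruct (H1 (eps / 2) ltac:(lra)) as [N1 h1], (H2 (eps / 2) ltac:(lra)) as [N2 h2].
  specialize (h1 (N1 + N2)%nat ltac:(lia)). specialize (h2 (N1 + N2)%nat ltac:(lia)).
  assert (h := Cmod_triangle_via l (u (N1 + N2)%nat) l').
  rewrite Cmod_minus_sym in h1. lra.
Qed.

Lemma Clim_ext u v l : (forall n, u n = v n) -> Clim u l -> Clim v l.
Proof.
  intros E H eps He. destruct (H eps He) as [N h]. exists N. intros n Hn.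
  rewrite <- E. auto.
Qed.

Lemma Clim_ext_ev u v l N0 : (forall n, (N0 <= n)%nat -> u n = v n) -> Clim u l -> Clim v l.
Proof.
  intros E H eps He. destruct (H eps He) as [N h]. exists (N0 + N)%nat. intros n Hn.
  rewrite <- E by lia. apply h; lia.
Qed.

Lemma Clim_const c : Clim (fun _ => c) c.
Proof.
  intros eps He. exists O. intros. replace (c - c)%C with (RtoC 0) by ring.
  now rewrite Cmod_0.
Qed.

Lemma Clim_squeeze u l (v : nat -> R) :
  (forall n, Cmod (u n - l) <= v n) -> is_lim_seq v 0 -> Clim u l.
Proof.
  intros H Hv eps He. apply is_lim_seq_spec in Hv.
  destruct (Hv (mkposreal eps He)) as [N h]. exists N. intros n Hn.
  specialize (h n Hn). simpl in h. specialize (H n).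
  rewrite Rminus_0_r in h. apply Rabs_def2 in h. lra.
Qed.

Lemma Clim_mod u l : Clim u l -> is_lim_seq (fun n => Cmod (u n - l)) 0.
Proof.
  intros H. apply is_lim_seq_spec. intros eps. destruct (H eps (cond_pos eps)) as [N h].
  exists N. intros n Hn. rewrite Rminus_0_r, Rabs_pos_eq by apply Cmod_ge_0. auto.
Qed.

Lemma Clim_plus u v l m : Clim u l -> Clim v m -> Clim (fun n => u n + v n)%C (l + m)%C.
Proof.
  intros H1 H2. apply Clim_squeeze with (fun n => Cmod (u n - l) + Cmod (v n - m)).
  - intros n. replace (u n + v n - (l + m))%C with ((u n - l) + (v n - m))%C by ring.
    apply Cmod_triangle.
  - replace (Finite 0) with (Finite (0 + 0)) by (f_equal; ring).
    apply is_lim_seq_plus'; now apply Clim_mod.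
Qed.

Lemma Clim_scal c u l : Clim u l -> Clim (fun n => c * u n)%C (c * l)%C.
Proof.
  intros H. apply Clim_squeeze with (fun n => Cmod c * Cmod (u n - l)).
  - intros n. replace (c * u n - c * l)%C with (c * (u n - l))%C by ring.
    rewrite Cmod_mult. lra.
  - replace (Finite 0) with (Rbar_mult (Cmod c) 0) by (simpl; f_equal; ring).
    apply is_lim_seq_scal_l. now apply Clim_mod.
Qed.

Lemma Clim_opp u l : Clim u l -> Clim (fun n => - u n)%C (- l)%C.
Proof.
  intros H. apply Clim_ext with (fun n => RtoC (-1) * u n)%C.
  intros; ring. replace (- l)%C with (RtoC (-1) * l)%C by ring. now apply Clim_scal.
Qed.

Lemma Clim_minus u v l m : Clim u l -> Clim v m -> Clim (fun n => u n - v n)%C (l - m)%C.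
Proof. intros. apply Clim_plus; auto. now apply Clim_opp. Qed.

Lemma Clim_mult u v l m : Clim u l -> Clim v m -> Clim (fun n => u n * v n)%C (l * m)%C.
Proof.
  intros H1 H2.
  apply Clim_squeeze with (fun n => Cmod (u n - l) * Cmod (v n - m) + (Cmod l * Cmod (v n - m) + Cmod m * Cmod (u n - l))).
  - intros n. replace (u n * v n - l * m)%C with ((u n - l) * (v n - m) + (l * (v n - m) + m * (u n - l)))%C by ring.
    eapply Rle_trans. apply Cmod_triangle. rewrite Cmod_mult. apply Rplus_le_compat_l.
    eapply Rle_trans. apply Cmod_triangle. rewrite !Cmod_mult. lra.
  - apply Clim_mod in H1. apply Clim_mod in H2.
    replace (Finite 0) with (Finite (0 * 0 + (Cmod l * 0 + Cmod m * 0))) by (f_equal; ring).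
    apply is_lim_seq_plus'. now apply is_lim_seq_mult'.
    apply is_lim_seq_plus'; apply is_lim_seq_mult'; auto using is_lim_seq_const.
Qed.

Lemma Clim_inv u l : l <> RtoC 0 -> Clim u l -> Clim (fun n => / u n)%C (/ l)%C.
Proof.
  intros Hl H eps He. assert (pl := proj1 (Cmod_gt_0 l) Hl).
  set (e := Rmin (Cmod l / 2) (eps * Cmod l * Cmod l / 2)).
  assert (e0 : 0 < e). { unfold e. apply Rmin_pos; try lra.
    assert (0 < eps * Cmod l) by nra. nra. }
  destruct (H e e0) as [N h]. exists N. intros n Hn. specialize (h n Hn).
  assert (h1 : Cmod (u n - l) < Cmod l / 2) by (eapply Rlt_le_trans; [apply h|apply Rmin_l]).
  assert (h2 : Cmod (u n - l) < eps * Cmod l * Cmod l / 2) by (eapply Rlt_le_trans; [apply h|apply Rmin_r]).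
  assert (h3 : Cmod l / 2 < Cmod (u n)).
  { assert (t := Cmod_triangle_via l (u n) 0). rewrite Cmod_minus_sym in h1.
    replace (l - 0)%C with l in t by ring. replace (u n - 0)%C with (u n) in t by ring. lra. }
  assert (u0 : u n <> RtoC 0). { apply Cmod_gt_0. lra. }
  replace (/ u n - / l)%C with (- (u n - l) / (u n * l))%C by (field; auto).
  rewrite Cmod_div by (apply Cmult_neq_0; auto). rewrite Cmod_opp, Cmod_mult.
  apply Rlt_div_l. apply Rmult_lt_0_compat; lra.
  assert (0 < eps * Cmod l * (Cmod (u n) - Cmod l / 2)) by (repeat apply Rmult_lt_0_compat; lra). lra.
Qed.

Lemma Clim_RtoC (u : nat -> R) (l : R) : is_lim_seq u l -> Clim (fun n => RtoC (u n)) (RtoC l).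
Proof.
  intros H eps He. apply is_lim_seq_spec in H. destruct (H (mkposreal eps He)) as [N h].
  exists N. intros n Hn. rewrite <- RtoC_minus, Cmod_R. apply (h n Hn).
Qed.

Lemma Clim_Re u l : Clim u l -> is_lim_seq (fun n => Re (u n)) (Re l).
Proof.
  intros H. apply is_lim_seq_spec. intros eps. destruct (H eps (cond_pos eps)) as [N h].
  exists N. intros n Hn. rewrite <- Re_minus. eapply Rle_lt_trans. apply re_le_Cmod. auto.
Qed.

Lemma Clim_Im u l : Clim u l -> is_lim_seq (fun n => Im (u n)) (Im l).
Proof.
  intros H. apply is_lim_seq_spec. intros eps. destruct (H eps (cond_pos eps)) as [N h].
  exists N. intros n Hn. rewrite <- Im_minus. eapply Rle_lt_trans. apply im_le_Cmod. auto.
Qed.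

Lemma Clim_S u l : Clim u l -> Clim (fun n => u (S n)) l.
Proof.
  intros H eps He. destruct (H eps He) as [N h]. exists N. intros. apply h. lia.
Qed.

Lemma Clim_unS u l : Clim (fun n => u (S n)) l -> Clim u l.
Proof.
  intros H eps He. destruct (H eps He) as [N h]. exists (S N). intros [|n] Hn. lia.
  apply h. lia.
Qed.

Lemma Clim_mod_le u l B : Clim u l -> (forall n, Cmod (u n) <= B) -> Cmod l <= B.
Proof.
  intros H HB. apply Rnot_lt_le. intros h.
  destruct (H (Cmod l - B) ltac:(lra)) as [N hN]. specialize (hN N (Nat.le_refl _)).
  assert (t := Cmod_triangle_via l (u N) 0). rewrite Cmod_minus_sym in hN.
  replace (l - 0)%C with l in t by ring. replace (u N - 0)%C with (u N) in t by ring.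
  specialize (HB N). lra.
Qed.

Lemma Clim_mod_le_ev u l c B N0 : Clim u l -> (forall n, (N0 <= n)%nat -> Cmod (u n - c) <= B) -> Cmod (l - c) <= B.
Proof.
  intros H HB. apply Rnot_lt_le. intros h.
  destruct (H (Cmod (l - c) - B) ltac:(lra)) as [N hN]. specialize (hN (N0 + N)%nat ltac:(lia)).
  specialize (HB (N0 + N)%nat ltac:(lia)).
  assert (t := Cmod_triangle_via l (u (N0 + N)%nat) c). rewrite Cmod_minus_sym in hN. lra.
Qed.

(** * Series *)

(** [psum a n] has [n] terms, whereas [sum_n a n] has [n + 1]; starting from the empty sum keeps
    splitting and telescoping free of boundary cases. *)
Fixpoint psum (a : nat -> C) (n : nat) : C :=
  match n with O => RtoC 0 | S k => (psum a k + a k)%C end.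
Fixpoint rpsum (a : nat -> R) (n : nat) : R :=
  match n with O => 0 | S k => rpsum a k + a k end.

Definition Cser (a : nat -> C) (l : C) : Prop := Clim (psum a) l.
Definition Rser (a : nat -> R) (l : R) : Prop := is_lim_seq (rpsum a) l.

Lemma sum_n_psum (a : nat -> C) n : @sum_n C_AbelianMonoid a n = psum a (S n).
Proof.
  induction n. rewrite sum_O. symmetry. apply Cplus_0_l.
  rewrite sum_Sn, IHn. reflexivity.
Qed.

Lemma Cser_is_series a l :
  Cser a l <-> @is_series C_AbsRing C_NormedModule a l.
Proof.
  assert (Q := @filterlim_locally_ball_norm C_AbsRing nat C_NormedModule eventually (@filter_filter _ _ eventually_filter)
    (sum_n a) l).
  split.
  - intros H. apply Q. revert H. intros H eps. destruct (H eps (cond_pos eps)) as [N h]. exists N. intros n Hn.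
    unfold ball_norm. change (Cmod (sum_n (G := C_AbelianMonoid) a n - l)%C < eps).
    rewrite sum_n_psum. apply h. lia.
  - intros H eps He. destruct (proj1 Q H (mkposreal eps He)) as [N h]. exists (S N).
    intros [|n] Hn. lia. specialize (h n ltac:(lia)). unfold ball_norm in h.
    change (Cmod (sum_n (G := C_AbelianMonoid) a n - l)%C < eps) in h.
    rewrite sum_n_psum in h. exact h.
Qed.

Lemma psum_ext a b n : (forall k, (k < n)%nat -> a k = b k) -> psum a n = psum b n.
Proof. induction n; simpl; intros; auto. rewrite IHn, H; auto. Qed.
Lemma psum_plus a b n : psum (fun k => a k + b k)%C n = (psum a n + psum b n)%C.
Proof. induction n; simpl. ring. rewrite IHn. ring. Qed.
Lemma psum_scal c a n : psum (fun k => c * a k)%C n = (c * psum a n)%C.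
Proof. induction n; simpl. ring. rewrite IHn. ring. Qed.
Lemma psum_minus a b n : psum (fun k => a k - b k)%C n = (psum a n - psum b n)%C.
Proof. induction n; simpl. ring. rewrite IHn. ring. Qed.
Lemma psum_split a n m : psum a (n + m) = (psum a n + psum (fun k => a (n + k)%nat) m)%C.
Proof.
  induction m; simpl. rewrite Nat.add_0_r. ring.
  rewrite Nat.add_succ_r. simpl. rewrite IHm. ring.
Qed.
Lemma psum_shift a n : psum a (S n) = (a O + psum (fun k => a (S k)) n)%C.
Proof. change (S n) with (1 + n)%nat. rewrite psum_split. simpl. ring. Qed.
Lemma rpsum_ext a b n : (forall k, (k < n)%nat -> a k = b k) -> rpsum a n = rpsum b n.
Proof. induction n; simpl; intros; auto. rewrite IHn, H; auto. Qed.
Lemma rpsum_scal c a n : rpsum (fun k => c * a k) n = c * rpsum a n.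
Proof. induction n; simpl. ring. rewrite IHn. ring. Qed.
Lemma rpsum_plus a b n : rpsum (fun k => a k + b k) n = rpsum a n + rpsum b n.
Proof. induction n; simpl. ring. rewrite IHn. ring. Qed.
Lemma rpsum_pos a n : (forall k, 0 <= a k) -> 0 <= rpsum a n.
Proof. intros; induction n; simpl. lra. specialize (H n). lra. Qed.
Lemma rpsum_mono a n m : (forall k, 0 <= a k) -> (n <= m)%nat -> rpsum a n <= rpsum a m.
Proof. intros H; induction 1; simpl. lra. specialize (H m). lra. Qed.
Lemma rpsum_split a n m : rpsum a (n + m) = rpsum a n + rpsum (fun k => a (n + k)%nat) m.
Proof.
  induction m; simpl. rewrite Nat.add_0_r. ring.
  rewrite Nat.add_succ_r. simpl. rewrite IHm. ring.
Qed.

Lemma psum_mod a M n : (forall k, (k < n)%nat -> Cmod (a k) <= M k) -> Cmod (psum a n) <= rpsum M n.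
Proof.
  induction n; simpl; intros H. rewrite Cmod_0. lra.
  eapply Rle_trans. apply Cmod_triangle. apply Rplus_le_compat; auto.
Qed.

Lemma RtoC_rpsum a n : RtoC (rpsum a n) = psum (fun k => RtoC (a k)) n.
Proof. induction n; simpl. reflexivity. now rewrite RtoC_plus, IHn. Qed.

Lemma Cser_unique a l l' : Cser a l -> Cser a l' -> l = l'.
Proof. apply Clim_unique. Qed.
Lemma Cser_ext a b l : (forall k, a k = b k) -> Cser a l -> Cser b l.
Proof. intros H. apply Clim_ext. intros; now apply psum_ext. Qed.
Lemma Cser_plus a b l m : Cser a l -> Cser b m -> Cser (fun k => a k + b k)%C (l + m)%C.
Proof.
  intros H1 H2. eapply Clim_ext. intros; symmetry; apply psum_plus. now apply Clim_plus.
Qed.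
Lemma Cser_minus a b l m : Cser a l -> Cser b m -> Cser (fun k => a k - b k)%C (l - m)%C.
Proof.
  intros H1 H2. eapply Clim_ext. intros; symmetry; apply psum_minus. now apply Clim_minus.
Qed.
Lemma Cser_scal c a l : Cser a l -> Cser (fun k => c * a k)%C (c * l)%C.
Proof.
  intros H. eapply Clim_ext. intros; symmetry; apply psum_scal. now apply Clim_scal.
Qed.
Lemma Cser_telescope (g : nat -> C) l : Clim g l -> Cser (fun n => g n - g (S n))%C (g O - l)%C.
Proof.
  intros H. apply Clim_ext with (fun n => g O - g n)%C.
  - induction n; simpl. ring. rewrite <- IHn. ring.
  - apply Clim_minus; auto. apply Clim_const.
Qed.
Lemma Cser_Re a l : Cser a l -> Rser (fun k => Re (a k)) (Re l).
Proof.
  intros H. apply Clim_Re in H. eapply is_lim_seq_ext; [|apply H].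
  intros n. induction n; cbn [psum rpsum]. reflexivity. rewrite re_plus, IHn. reflexivity.
Qed.
Lemma Cser_Im a l : Cser a l -> Rser (fun k => Im (a k)) (Im l).
Proof.
  intros H. apply Clim_Im in H. eapply is_lim_seq_ext; [|apply H].
  intros n. induction n; cbn [psum rpsum]. reflexivity. rewrite im_plus, IHn. reflexivity.
Qed.
Lemma Cser_RtoC a l : Rser a l -> Cser (fun k => RtoC (a k)) (RtoC l).
Proof.
  intros H. eapply Clim_ext. intros; apply RtoC_rpsum. now apply Clim_RtoC.
Qed.

Lemma Rser_le a L n : (forall k, 0 <= a k) -> Rser a L -> rpsum a n <= L.
Proof.
  intros Ha H. assert (h := is_lim_seq_incr_compare _ _ H).
  apply h. intros m. simpl. specialize (Ha m). lra.
Qed.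

Lemma Rser_bounded a B : (forall k, 0 <= a k) -> (forall n, rpsum a n <= B) -> exists L, Rser a L.
Proof.
  intros Ha HB. destruct (ex_finite_lim_seq_incr (rpsum a) B) as [L h]; eauto.
  intros m. simpl. specialize (Ha m). lra.
Qed.

Lemma Rser_scal c a l : Rser a l -> Rser (fun k => c * a k) (c * l).
Proof.
  intros H. eapply is_lim_seq_ext. intros; symmetry; apply rpsum_scal.
  apply is_lim_seq_mult'; auto. apply is_lim_seq_const.
Qed.
Lemma Rser_plus a b l m : Rser a l -> Rser b m -> Rser (fun k => a k + b k) (l + m).
Proof.
  intros H H'. eapply is_lim_seq_ext. intros; symmetry; apply rpsum_plus.
  now apply is_lim_seq_plus'.
Qed.

Lemma Rser_tail a L : Rser a L -> is_lim_seq (fun n => L - rpsum a n) 0.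
Proof.
  intros H. replace (Finite 0) with (Finite (L - L)) by (f_equal; ring).
  apply is_lim_seq_minus'; auto. apply is_lim_seq_const.
Qed.

(** Completeness of the reals is applied to real and imaginary parts. The rate [t] is carried over
    to the limit because later arguments need the size of the error, not convergence alone. *)
Lemma Cauchy_Clim (u : nat -> C) (t : nat -> R) :
  (forall n m, (n <= m)%nat -> Cmod (u m - u n) <= t n) -> is_lim_seq t 0 ->
  exists l, Clim u l /\ forall n, Cmod (l - u n) <= t n.
Proof.
  intros H Ht.
  assert (HC : forall (p : C -> R), (forall z w, p (z - w)%C = p z - p w) -> (forall z, Rabs (p z) <= Cmod z) ->
     ex_finite_lim_seq (fun n => p (u n))).
  { intros p Hp1 Hp2. apply ex_lim_seq_cauchy_corr. intros eps.
    apply is_lim_seq_spec in Ht. destruct (Ht (pos_div_2 eps)) as [N hN]. exists N. intros n m Hn Hm.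
    rewrite <- Hp1. eapply Rle_lt_trans. apply Hp2.
    assert (h := Cmod_triangle_via (u n) (u N) (u m)).
    assert (h1 := H N n Hn). assert (h2 := H N m Hm). rewrite Cmod_minus_sym in h2.
    specialize (hN N (Nat.le_refl _)). rewrite Rminus_0_r in hN. apply Rabs_def2 in hN. simpl in hN. lra. }
  destruct (HC Re Re_minus re_le_Cmod) as [a Ha]. destruct (HC Im Im_minus im_le_Cmod) as [b Hb].
  assert (Hl : Clim u (a, b)).
  { apply Clim_squeeze with (fun n => Rabs (Re (u n) - a) + Rabs (Im (u n) - b)).
    - intros n. eapply Rle_trans. apply Cmod_le_Rabs. rewrite Re_minus, Im_minus. simpl. lra.
    - replace (Finite 0) with (Finite (Rabs 0 + Rabs 0)) by (rewrite Rabs_R0; f_equal; ring).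
      apply is_lim_seq_plus'; (apply is_lim_seq_abs with (l := Finite 0));
        [replace (Finite 0) with (Finite (a - a)) by (f_equal; ring)|replace (Finite 0) with (Finite (b - b)) by (f_equal; ring)];
        apply is_lim_seq_minus'; auto; apply is_lim_seq_const. }
  exists (a, b). split; auto. intros n. apply Clim_mod_le_ev with u n; auto.
Qed.

(** The error is a tail of [M], so it does not depend on any parameter hidden in [a]; every uniform
    estimate on a sum of functions rests on this. *)
Lemma Cser_dominated a M L :
  (forall k, Cmod (a k) <= M k) -> Rser M L ->
  exists l, Cser a l /\ forall n, Cmod (l - psum a n) <= L - rpsum M n.
Proof.
  intros H HM. apply Cauchy_Clim; [|now apply Rser_tail].
  intros n m Hnm. replace m with (n + (m - n))%nat by lia. rewrite psum_split.
  replace (psum a n + psum (fun k => a (n + k)%nat) (m - n) - psum a n)%C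
    with (psum (fun k => a (n + k)%nat) (m - n)) by ring.
  eapply Rle_trans. apply psum_mod with (M := fun k => M (n + k)%nat). auto.
  assert (h := rpsum_split M n (m - n)).
  assert (h2 : rpsum M (n + (m - n)) <= L). { apply Rser_le; auto. intros k. eapply Rle_trans; [apply Cmod_ge_0|apply H]. }
  lra.
Qed.

Lemma Cser_mod_le a l M L : (forall k, Cmod (a k) <= M k) -> Rser M L -> Cser a l -> Cmod l <= L.
Proof.
  intros H HM Hl. destruct (Cser_dominated a M L H HM) as [l' [h1 h2]].
  rewrite (Cser_unique _ _ _ Hl h1). specialize (h2 O). simpl in h2.
  replace (l' - 0)%C with l' in h2 by ring. lra.
Qed.

(** Dominated convergence for sums whose length [m n] grows: the terms past a fixed [K] amount to at
    most a tail of [M], and the first [K] converge one by one. It passes from finite cotangent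
    identities, and from truncated divisor sums, to infinite series. *)
Lemma tannery (f : nat -> nat -> C) (g : nat -> C) (u : nat -> C) (M : nat -> R) L l (m : nat -> nat) :
  (forall k, Clim (fun n => f n k) (g k)) ->
  (forall n k, (k < m n)%nat -> Cmod (f n k) <= M k) -> Rser M L ->
  (forall K, exists N, forall n, (N <= n)%nat -> (K <= m n)%nat) ->
  (forall n, u n = psum (f n) (m n)) ->
  Cser g l -> Clim u l.
Proof.
  intros Hf HM HL Hm Hu Hg eps He.
  assert (M0 : forall k, 0 <= M k).
  { intros k. destruct (Hm (S k)) as [N h]. specialize (h N (Nat.le_refl _)).
    eapply Rle_trans; [apply Cmod_ge_0|apply (HM N k); lia]. }
  assert (T := Rser_tail _ _ HL). apply is_lim_seq_spec in T.
  destruct (T (mkposreal (eps / 4) ltac:(lra))) as [K1 h1]. simpl in h1.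
  destruct (Hg (eps / 4) ltac:(lra)) as [K2 h2].
  set (K := (K1 + K2)%nat).
  assert (P : Clim (fun n => psum (f n) K) (psum g K)).
  { clear -Hf. induction K; simpl. apply Clim_const. apply Clim_plus; auto. }
  destruct (P (eps / 4) ltac:(lra)) as [N1 h3]. destruct (Hm K) as [N2 h4].
  exists (N1 + N2)%nat. intros n Hn. rewrite Hu.
  specialize (h3 n ltac:(lia)). specialize (h4 n ltac:(lia)). specialize (h2 K ltac:(unfold K; lia)).
  specialize (h1 K ltac:(unfold K; lia)). rewrite Rminus_0_r in h1. apply Rabs_def2 in h1.
  assert (h5 : Cmod (psum (f n) (m n) - psum (f n) K) <= L - rpsum M K).
  { replace (m n) with (K + (m n - K))%nat by lia. rewrite psum_split.
    replace (psum (f n) K + psum (fun k => f n (K + k)%nat) (m n - K) - psum (f n) K)%C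
      with (psum (fun k => f n (K + k)%nat) (m n - K)) by ring.
    eapply Rle_trans. apply psum_mod with (M := fun k => M (K + k)%nat). intros; apply HM; lia.
    assert (h := rpsum_split M K (m n - K)).
    assert (rpsum M (K + (m n - K)) <= L) by now apply Rser_le. lra. }
  assert (t1 := Cmod_triangle_via (psum (f n) (m n)) (psum (f n) K) l).
  assert (t2 := Cmod_triangle_via (psum (f n) K) (psum g K) l). lra.
Qed.

(** * Complex differentiability *)

Definition hder (f : C -> C) (z l : C) : Prop :=
  forall eps, 0 < eps -> exists d, 0 < d /\ forall h, Cmod h < d ->
    Cmod (f (z + h) - f z - l * h)%C <= eps * Cmod h.
Definition hol (f : C -> C) (z : C) : Prop := exists l, hder f z l.

(** The bridge to the derivative used in [hurwitz_continuation]: one direction certifies the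
    continuation that is built, the other reads off holomorphy of the one chosen by epsilon. *)
Lemma hder_is_derive f z l : hder f z l <-> @is_derive C_AbsRing C_NormedModule f z l.
Proof.
  split.
  - intros H. split. apply is_linear_scal_l.
    intros x Hx eps.
    assert (E : z = x). { apply (is_filter_lim_locally_unique (V := AbsRing_NormedModule C_AbsRing)) in Hx. exact Hx. }
    subst x. destruct (H eps (cond_pos eps)) as [d [d0 hd]].
    apply (@locally_le_locally_norm C_AbsRing (AbsRing_NormedModule C_AbsRing)). exists (mkposreal d d0). intros y Hy.
    change C in y.
    specialize (hd (y - z)%C Hy). replace (z + (y - z))%C with y in hd by ring.
    change (Cmod (f y - f z - (y - z) * l)%C <= eps * Cmod (y - z)%C).
    rewrite (Cmult_comm (y - z)). exact hd.
  - intros [_ H] eps He. specialize (H z (fun P HP => HP) (mkposreal eps He)).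
    apply (@locally_norm_le_locally C_AbsRing (AbsRing_NormedModule C_AbsRing)) in H. destruct H as [d hd].
    exists d. split. apply cond_pos. intros h Hh.
    assert (Hb : ball_norm (V := AbsRing_NormedModule C_AbsRing) z d (z + h)%C).
    { change (Cmod (z + h - z)%C < d). replace (z + h - z)%C with h by ring. exact Hh. }
    specialize (hd _ Hb).
    change (Cmod (f (z + h) - f z - (z + h - z) * l)%C <= eps * Cmod (z + h - z)%C) in hd.
    replace (z + h - z)%C with h in hd by ring. rewrite (Cmult_comm h) in hd. exact hd.
Qed.

Lemma hol_ex_derive f z : hol f z <-> @ex_derive C_AbsRing C_NormedModule f z.
Proof. split; intros [l H]; exists l; now apply hder_is_derive. Qed.

Lemma hder_const c z : hder (fun _ => c) z 0.
Proof.
  intros eps He. exists 1. split. lra. intros h _. replace (c - c - 0 * h)%C with (RtoC 0) by ring.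
  rewrite Cmod_0. apply Rmult_le_pos; [lra|apply Cmod_ge_0].
Qed.
Lemma hder_id z : hder (fun w => w) z 1.
Proof.
  intros eps He. exists 1. split. lra. intros h _. replace (z + h - z - 1 * h)%C with (RtoC 0) by ring.
  rewrite Cmod_0. apply Rmult_le_pos; [lra|apply Cmod_ge_0].
Qed.
Lemma hder_ext_loc f g z l d : 0 < d -> (forall w, Cmod (w - z) < d -> f w = g w) -> hder f z l -> hder g z l.
Proof.
  intros Hd E H eps He. destruct (H eps He) as [d1 [d10 h1]].
  exists (Rmin d d1). split. now apply Rmin_pos. intros h Hh.
  rewrite <- !E. apply h1. eapply Rlt_le_trans; [apply Hh|apply Rmin_r].
  replace (z - z)%C with (RtoC 0) by ring. now rewrite Cmod_0.
  replace (z + h - z)%C with h by ring. eapply Rlt_le_trans; [apply Hh|apply Rmin_l].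
Qed.
Lemma hder_ext f g z l : (forall w, f w = g w) -> hder f z l -> hder g z l.
Proof. intros E. apply hder_ext_loc with 1. lra. auto. Qed.

Lemma hder_plus f g z l m : hder f z l -> hder g z m -> hder (fun w => f w + g w)%C z (l + m)%C.
Proof.
  intros H1 H2 eps He. destruct (H1 (eps / 2) ltac:(lra)) as [d1 [p1 h1]].
  destruct (H2 (eps / 2) ltac:(lra)) as [d2 [p2 h2]].
  exists (Rmin d1 d2). split. now apply Rmin_pos. intros h Hh.
  specialize (h1 h (Rlt_le_trans _ _ _ Hh (Rmin_l _ _))). specialize (h2 h (Rlt_le_trans _ _ _ Hh (Rmin_r _ _))).
  replace (f (z + h) + g (z + h) - (f z + g z) - (l + m) * h)%C
    with ((f (z + h) - f z - l * h) + (g (z + h) - g z - m * h))%C by ring.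
  eapply Rle_trans. apply Cmod_triangle. lra.
Qed.

Lemma hder_lip f z l : hder f z l -> exists d, 0 < d /\ forall h, Cmod h < d -> Cmod (f (z + h) - f z)%C <= (Cmod l + 1) * Cmod h.
Proof.
  intros H. destruct (H 1 Rlt_0_1) as [d [p h]]. exists d. split; auto. intros k Hk. specialize (h k Hk).
  replace (f (z + k) - f z)%C with ((f (z + k) - f z - l * k) + l * k)%C by ring.
  eapply Rle_trans. apply Cmod_triangle. rewrite Cmod_mult. lra.
Qed.

Lemma hder_comp f g z l m : hder g z m -> hder f (g z) l -> hder (fun w => f (g w)) z (l * m)%C.
Proof.
  intros Hg Hf eps He. destruct (hder_lip _ _ _ Hg) as [d0 [p0 h0]].
  set (K := Cmod m + 1). assert (HK : 0 < K) by (unfold K; assert (h := Cmod_ge_0 m); lra).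
  set (L := Cmod l + 1). assert (HL : 0 < L) by (unfold L; assert (h := Cmod_ge_0 l); lra).
  destruct (Hf (eps / (2 * K))) as [d1 [p1 h1]]. apply Rdiv_lt_0_compat; lra.
  destruct (Hg (eps / (2 * L))) as [d2 [p2 h2]]. apply Rdiv_lt_0_compat; lra.
  exists (Rmin (Rmin d0 (d1 / K)) d2). split.
  repeat apply Rmin_pos; auto. now apply Rdiv_lt_0_compat.
  intros h Hh. assert (A0 : Cmod h < d0). { eapply Rlt_le_trans. apply Hh. eapply Rle_trans. apply Rmin_l. apply Rmin_l. }
  assert (A1 : Cmod h < d1 / K). { eapply Rlt_le_trans. apply Hh. eapply Rle_trans. apply Rmin_l. apply Rmin_r. }
  assert (A2 : Cmod h < d2). { eapply Rlt_le_trans. apply Hh. apply Rmin_r. }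
  specialize (h0 h A0). specialize (h2 h A2).
  set (k := (g (z + h) - g z)%C) in *. fold K in h0.
  assert (Hk : Cmod k < d1). { eapply Rle_lt_trans. apply h0. apply Rmult_lt_reg_r with (/ K).
    now apply Rinv_0_lt_compat. replace (K * Cmod h * / K) with (Cmod h) by (field; lra). exact A1. }
  specialize (h1 k Hk). replace (g z + k)%C with (g (z + h)%C) in h1 by (unfold k; ring).
  replace (f (g (z + h)) - f (g z) - l * m * h)%C with ((f (g (z + h)) - f (g z) - l * k) + l * (k - m * h))%C by ring.
  eapply Rle_trans. apply Cmod_triangle. rewrite Cmod_mult.
  assert (B1 : eps / (2 * K) * Cmod k <= eps / 2 * Cmod h).
  { apply Rle_trans with (eps / (2 * K) * (K * Cmod h)). apply Rmult_le_compat_l; auto.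
    apply Rlt_le, Rdiv_lt_0_compat; lra. right. field. lra. }
  assert (B2 : Cmod l * Cmod (k - m * h) <= eps / 2 * Cmod h).
  { apply Rle_trans with (L * (eps / (2 * L) * Cmod h)). apply Rmult_le_compat; auto using Cmod_ge_0.
    unfold L; lra. right. field. lra. }
  lra.
Qed.

Lemma hder_sqr z : hder (fun w => w * w)%C z (2 * z)%C.
Proof.
  intros eps He. exists eps. split; auto. intros h Hh.
  replace ((z + h) * (z + h) - z * z - 2 * z * h)%C with (h * h)%C by ring.
  rewrite Cmod_mult. apply Rmult_le_compat_r. apply Cmod_ge_0. lra.
Qed.

Lemma hder_scal c f z l : hder f z l -> hder (fun w => c * f w)%C z (c * l)%C.
Proof.
  intros H. assert (Hc : hder (fun w => c * w)%C (f z) c).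
  { intros eps He. exists 1. split. lra. intros h _. replace (c * (f z + h) - c * f z - c * h)%C with (RtoC 0) by ring.
    rewrite Cmod_0. apply Rmult_le_pos; [lra|apply Cmod_ge_0]. }
  apply (hder_comp _ _ _ _ _ H Hc).
Qed.
Lemma hder_eq f z l l' : l = l' -> hder f z l -> hder f z l'.
Proof. now intros <-. Qed.

Lemma hder_opp f z l : hder f z l -> hder (fun w => - f w)%C z (- l)%C.
Proof.
  intros H. apply hder_ext with (fun w => RtoC (-1) * f w)%C. intros; ring.
  apply hder_eq with (RtoC (-1) * l)%C. ring. now apply hder_scal.
Qed.
Lemma hder_minus f g z l m : hder f z l -> hder g z m -> hder (fun w => f w - g w)%C z (l - m)%C.
Proof. intros. apply hder_plus; auto. now apply hder_opp. Qed.
(* Polarization: [f g = ((f + g)^2 - (f - g)^2) / 4]. *)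
Lemma hder_mult f g z l m : hder f z l -> hder g z m -> hder (fun w => f w * g w)%C z (l * g z + f z * m)%C.
Proof.
  intros Hf Hg.
  apply hder_ext with (fun w => (/ 4) * ((f w + g w) * (f w + g w) - (f w - g w) * (f w - g w)))%C.
  intros; field.
  eapply hder_eq; [|apply hder_scal; apply hder_minus;
    [apply (hder_comp (fun w => w * w)%C (fun w => f w + g w)%C); [now apply hder_plus; eauto|apply hder_sqr]
    |apply (hder_comp (fun w => w * w)%C (fun w => f w - g w)%C); [now apply hder_minus; eauto|apply hder_sqr]]].
  simpl. field.
Qed.

Lemma hder_inv z : z <> RtoC 0 -> hder (fun w => / w)%C z (- / (z * z))%C.
Proof.
  intros Hz eps He. assert (pz := proj1 (Cmod_gt_0 z) Hz).
  exists (Rmin (Cmod z / 2) (eps * (Cmod z * Cmod z * Cmod z) / 2)). split.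
  apply Rmin_pos. lra. assert (0 < Cmod z * Cmod z * Cmod z) by (repeat apply Rmult_lt_0_compat; auto). nra.
  intros h Hh.
  assert (A1 : Cmod h < Cmod z / 2) by (eapply Rlt_le_trans; [apply Hh|apply Rmin_l]).
  assert (A2 : Cmod h < eps * (Cmod z * Cmod z * Cmod z) / 2) by (eapply Rlt_le_trans; [apply Hh|apply Rmin_r]).
  assert (A3 : Cmod z / 2 < Cmod (z + h)). { assert (t := Cmod_triangle_rev z h). lra. }
  assert (n0 : (z + h)%C <> RtoC 0) by (apply Cmod_gt_0; lra).
  replace (/ (z + h) - / z - - / (z * z) * h)%C with (h * h / (z * z * (z + h)))%C by (field; auto).
  rewrite Cmod_div by (repeat apply Cmult_neq_0; auto). rewrite !Cmod_mult.
  set (a := Cmod z) in *. set (b := Cmod (z + h)) in *. set (c := Cmod h) in *.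
  assert (c0 : 0 <= c) by apply Cmod_ge_0.
  apply Rle_div_l. repeat apply Rmult_lt_0_compat; lra.
  replace (eps * c * (a * a * b)) with (c * (eps * (a * a) * b)) by ring.
  apply Rmult_le_compat_l; auto.
  assert (0 < eps * (a * a)) by (repeat apply Rmult_lt_0_compat; auto). nra.
Qed.

Lemma hol_const c z : hol (fun _ => c) z.
Proof. eexists; apply hder_const. Qed.
Lemma hol_id z : hol (fun w => w) z.
Proof. eexists; apply hder_id. Qed.
Lemma hol_plus f g z : hol f z -> hol g z -> hol (fun w => f w + g w)%C z.
Proof. intros [l H] [m H']. eexists; apply hder_plus; eauto. Qed.
Lemma hol_minus f g z : hol f z -> hol g z -> hol (fun w => f w - g w)%C z.
Proof. intros [l H] [m H']. eexists; apply hder_minus; eauto. Qed.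
Lemma hol_opp f z : hol f z -> hol (fun w => - f w)%C z.
Proof. intros [l H]. eexists; apply hder_opp; eauto. Qed.
Lemma hol_mult f g z : hol f z -> hol g z -> hol (fun w => f w * g w)%C z.
Proof. intros [l H] [m H']. eexists; apply hder_mult; eauto. Qed.
Lemma hol_comp f g z : hol g z -> hol f (g z) -> hol (fun w => f (g w)) z.
Proof. intros [l H] [m H']. eexists; apply hder_comp; eauto. Qed.
Lemma hol_inv f z : f z <> RtoC 0 -> hol f z -> hol (fun w => / f w)%C z.
Proof. intros H0 H. apply (hol_comp Cinv f z H). eexists. now apply hder_inv. Qed.
Lemma hol_div f g z : g z <> RtoC 0 -> hol f z -> hol g z -> hol (fun w => f w / g w)%C z.
Proof. intros. apply hol_mult; auto. now apply hol_inv. Qed.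
Lemma hol_pow f n z : hol f z -> hol (fun w => f w ^ n)%C z.
Proof. intros H. induction n; simpl. apply hol_const. now apply hol_mult. Qed.
Lemma hol_ext_loc f g z d : 0 < d -> (forall w, Cmod (w - z) < d -> f w = g w) -> hol f z -> hol g z.
Proof. intros Hd E [l H]. exists l. now apply hder_ext_loc with f d. Qed.
Lemma hol_psum f z n : (forall k, (k < n)%nat -> hol (f k) z) -> hol (fun w => psum (fun k => f k w) n) z.
Proof. induction n; simpl; intros. apply hol_const. apply hol_plus; auto. Qed.

Lemma hol_cont f z : hol f z -> forall eps, 0 < eps -> exists d, 0 < d /\ forall w, Cmod (w - z) < d -> Cmod (f w - f z) < eps.
Proof.
  intros [l H] eps He. destruct (hder_lip _ _ _ H) as [d [d0 hd]].
  assert (K0 : 0 < Cmod l + 1) by (assert (h := Cmod_ge_0 l); lra).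
  exists (Rmin d (eps / (Cmod l + 1))). split. apply Rmin_pos; auto. now apply Rdiv_lt_0_compat.
  intros w Hw. specialize (hd (w - z)%C (Rlt_le_trans _ _ _ Hw (Rmin_l _ _))).
  replace (z + (w - z))%C with w in hd by ring. eapply Rle_lt_trans. apply hd.
  assert (h := Rlt_le_trans _ _ _ Hw (Rmin_r _ _)). rewrite Rmult_comm. apply Rlt_div_r; auto.
Qed.

(** * The exponential *)

Lemma exp_taylor1 (a : R) : Rabs (exp a - 1 - a) <= a * a * exp (Rabs a).
Proof.
  assert (h0 : 0 <= exp a - 1 - a). { assert (h := exp_ineq1_le a). lra. }
  rewrite Rabs_pos_eq by auto.
  assert (h1 : exp a - 1 <= a * exp a).
  { assert (h := exp_ineq1_le (- a)). rewrite exp_Ropp in h. assert (p := exp_pos a).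
    assert (exp a * (1 + - a) <= exp a * / exp a) by (apply Rmult_le_compat_l; lra).
    rewrite Rinv_r in H by lra. lra. }
  assert (h2 : a * (exp a - 1) <= a * a * exp (Rabs a)).
  { unfold Rabs. destruct (Rcase_abs a) as [n|p].
    - assert (hh := exp_ineq1_le a). assert (1 <= exp (- a)) by (assert (q := exp_ineq1_le (- a)); lra).
      assert (- a * (1 - exp a) <= - a * (- a)) by (apply Rmult_le_compat_l; lra).
      assert (a * a * 1 <= a * a * exp (- a)) by (apply Rmult_le_compat_l; nra). lra.
    - apply Rge_le in p. assert (a * (exp a - 1) <= a * (a * exp a)) by (apply Rmult_le_compat_l; lra). lra. }
  lra.
Qed.

Lemma exp_m1_le (a : R) : Rabs (exp a - 1) <= Rabs a * exp (Rabs a).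
Proof.
  unfold Rabs at 2 3. destruct (Rcase_abs a).
  - rewrite Rabs_left1. assert (h := exp_ineq1_le a). assert (1 <= exp (- a)) by (assert (q := exp_ineq1_le (- a)); lra). nra.
    rewrite <- exp_0. assert (exp a < exp 0) by (apply exp_increasing; lra). lra.
  - rewrite Rabs_pos_eq. assert (h := exp_ineq1_le (- a)). rewrite exp_Ropp in h. assert (p := exp_pos a).
    assert (exp a * (1 + - a) <= exp a * / exp a) by (apply Rmult_le_compat_l; lra).
    rewrite Rinv_r in H by lra. lra. assert (h := exp_ineq1_le a). lra.
Qed.

Lemma Rabs_sin_le (b : R) : Rabs (sin b) <= Rabs b.
Proof.
  assert (H : forall c, 0 <= c -> Rabs (sin c) <= c).
  { intros c Hc. destruct (Rle_lt_dec c 1).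
    - rewrite Rabs_pos_eq. destruct Hc as [Hc| <-]. left; apply sin_lt_x; lra. rewrite sin_0; lra.
      apply sin_ge_0; auto. assert (h := PI2_1). lra.
    - apply Rabs_le. assert (h := SIN_bound c). lra. }
  unfold Rabs at 2. destruct (Rcase_abs b).
  - replace b with (- - b) by ring. rewrite sin_neg, Rabs_Ropp. rewrite Ropp_involutive. apply H. lra.
  - apply H. lra.
Qed.

Lemma cos_m1_le (b : R) : Rabs (cos b - 1) <= b * b.
Proof.
  replace (cos b) with (cos (2 * (b / 2))) by (f_equal; field). rewrite cos_2a_sin.
  replace (1 - 2 * sin (b / 2) * sin (b / 2) - 1) with (- (2 * (sin (b / 2) * sin (b / 2)))) by ring.
  rewrite Rabs_Ropp, Rabs_mult, Rabs_mult, (Rabs_pos_eq 2) by lra.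
  assert (h := Rabs_sin_le (b / 2)). assert (h0 := Rabs_pos (sin (b / 2))).
  assert (h1 : Rabs (sin (b / 2)) * Rabs (sin (b / 2)) <= Rabs (b / 2) * Rabs (b / 2)) by (apply Rmult_le_compat; auto).
  rewrite <- (Rabs_mult (b / 2)) in h1. rewrite (Rabs_pos_eq (b / 2 * (b / 2))) in h1 by nra. nra.
Qed.

Lemma sin_m_le (b : R) : Rabs (sin b - b) <= b * b.
Proof.
  destruct (MVT_gen (fun t => sin t - t) 0 b (fun t => cos t - 1)) as [x [h e]].
  { intros t _. auto_derive; auto. ring. }
  { intros t _. apply derivable_continuous_pt. apply ex_derive_Reals_0. auto_derive; auto. }
  rewrite sin_0 in e. replace (sin b - b) with ((cos x - 1) * b) by lra.
  assert (Rabs (cos x - 1) <= Rabs b).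
  { replace (cos x) with (cos (2 * (x / 2))) by (f_equal; field). rewrite cos_2a_sin.
    replace (1 - 2 * sin (x / 2) * sin (x / 2) - 1) with (- (2 * (sin (x / 2) * sin (x / 2)))) by ring.
    rewrite Rabs_Ropp, Rabs_mult, Rabs_mult, (Rabs_pos_eq 2) by lra.
    assert (h1 := Rabs_sin_le (x / 2)). assert (h2 := Rabs_pos (sin (x / 2))).
    assert (h3 : Rabs (sin (x / 2)) <= 1). { apply Rabs_le. apply SIN_bound. }
    assert (h4 : Rabs (x / 2) = Rabs x / 2). { unfold Rdiv. rewrite Rabs_mult. rewrite (Rabs_pos_eq (/ 2)); lra. }
    assert (h5 : Rabs x <= Rabs b). { unfold Rmin, Rmax in h. destruct (Rle_dec 0 b); unfold Rabs; destruct (Rcase_abs x), (Rcase_abs b); lra. }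
    nra. }
  rewrite Rabs_mult. assert (Rabs b * Rabs b = b * b). rewrite <- Rabs_mult. apply Rabs_pos_eq. nra.
  rewrite <- H0. apply Rmult_le_compat_r; auto. apply Rabs_pos.
Qed.

(** Real and imaginary part split into four pieces, each at most [m^2 exp m] with [m = Cmod w]; the
    factor [5] leaves some room. *)
Lemma cexp_taylor1 (w : C) : Cmod (cexp w - 1 - w) <= 5 * (Cmod w * Cmod w) * exp (Cmod w).
Proof.
  destruct w as [a b]. set (m := Cmod (a, b)).
  assert (ha : Rabs a <= m) by apply (re_le_Cmod (a, b)).
  assert (hb : Rabs b <= m) by apply (im_le_Cmod (a, b)).
  assert (m0 : 0 <= m) by apply Cmod_ge_0.
  assert (E : exp (Rabs a) <= exp m). { destruct ha as [ha| ->]. left; now apply exp_increasing. right; auto. }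
  assert (Ea : exp a <= exp m). { apply Rle_trans with (exp (Rabs a)); auto. assert (h := Rle_abs a).
    destruct h as [h|h]. left; now apply exp_increasing. right; congruence. }
  assert (p := exp_pos a). assert (pm := exp_pos m).
  assert (a2 : a * a <= m * m). { rewrite <- (Rabs_pos_eq (a * a)) by nra. rewrite Rabs_mult. apply Rmult_le_compat; auto using Rabs_pos. }
  assert (b2 : b * b <= m * m). { rewrite <- (Rabs_pos_eq (b * b)) by nra. rewrite Rabs_mult. apply Rmult_le_compat; auto using Rabs_pos. }
  eapply Rle_trans. apply Cmod_le_Rabs. unfold cexp. simpl.
  replace (exp a * cos b + - (1) + - a) with ((exp a - 1 - a) + exp a * (cos b - 1)) by ring.
  replace (exp a * sin b + - 0 + - b) with (exp a * (sin b - b) + b * (exp a - 1)) by ring.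
  assert (h1 := exp_taylor1 a). assert (h2 := cos_m1_le b). assert (h3 := sin_m_le b). assert (h4 := exp_m1_le a).
  assert (k1 : Rabs (exp a - 1 - a) <= m * m * exp m).
  { eapply Rle_trans. apply h1. apply Rmult_le_compat; auto. nra. left; apply exp_pos. }
  assert (k2 : Rabs (exp a * (cos b - 1)) <= m * m * exp m).
  { rewrite Rabs_mult, (Rabs_pos_eq (exp a)), Rmult_comm by lra. apply Rmult_le_compat; auto using Rabs_pos; lra. }
  assert (k3 : Rabs (exp a * (sin b - b)) <= m * m * exp m).
  { rewrite Rabs_mult, (Rabs_pos_eq (exp a)), Rmult_comm by lra. apply Rmult_le_compat; auto using Rabs_pos; lra. }
  assert (k4 : Rabs (b * (exp a - 1)) <= m * m * exp m).
  { rewrite Rabs_mult. rewrite Rmult_assoc. apply Rmult_le_compat; auto using Rabs_pos.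
    eapply Rle_trans. apply h4. apply Rmult_le_compat; auto using Rabs_pos. left; apply exp_pos. }
  assert (t1 := Rabs_triang (exp a - 1 - a) (exp a * (cos b - 1))).
  assert (t2 := Rabs_triang (exp a * (sin b - b)) (b * (exp a - 1))).
  assert (0 <= m * m * exp m) by (repeat apply Rmult_le_pos; lra). lra.
Qed.

Lemma cexp_0 : cexp 0 = 1.
Proof. unfold cexp. simpl. rewrite exp_0, cos_0, sin_0. apply C_ext; simpl; ring. Qed.
Lemma cexp_plus z w : cexp (z + w) = (cexp z * cexp w)%C.
Proof.
  destruct z as [a b], w as [c d]. unfold cexp. simpl. rewrite exp_plus, cos_plus, sin_plus.
  apply C_ext; simpl; ring.
Qed.
Lemma Cmod_cexp z : Cmod (cexp z) = exp (Re z).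
Proof.
  unfold cexp. destruct z as [a b]. simpl. unfold Cmod. simpl.
  replace (exp a * cos b * (exp a * cos b * 1) + exp a * sin b * (exp a * sin b * 1)) with (exp a * exp a * (Rsqr (sin b) + Rsqr (cos b))) by (unfold Rsqr; ring).
  rewrite sin2_cos2, Rmult_1_r. apply sqrt_square. left; apply exp_pos.
Qed.
Lemma cexp_neq_0 z : cexp z <> RtoC 0.
Proof. apply Cmod_gt_0. rewrite Cmod_cexp. apply exp_pos. Qed.
Lemma cexp_opp z : cexp (- z) = (/ cexp z)%C.
Proof.
  assert (h : (cexp z * cexp (- z))%C = 1). { rewrite <- cexp_plus. replace (z + - z)%C with (RtoC 0) by ring. apply cexp_0. }
  assert (n := cexp_neq_0 z). replace (cexp (- z)) with (cexp z * cexp (- z) * / cexp z)%C by (field; auto).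
  rewrite h. ring.
Qed.
Lemma cexp_RtoC r : cexp (RtoC r) = RtoC (exp r).
Proof. unfold cexp. simpl. rewrite cos_0, sin_0. apply C_ext; simpl; ring. Qed.

Lemma hder_cexp z : hder cexp z (cexp z).
Proof.
  intros eps He.
  assert (p : 0 < exp (Re z)) by apply exp_pos.
  assert (p1 : 0 < exp 1) by apply exp_pos.
  set (K := exp (Re z) * 5 * exp 1). assert (K0 : 0 < K) by (unfold K; repeat apply Rmult_lt_0_compat; lra).
  exists (Rmin 1 (eps / K)). split. apply Rmin_pos. lra. now apply Rdiv_lt_0_compat.
  intros h Hh. replace (cexp (z + h) - cexp z - cexp z * h)%C with (cexp z * (cexp h - 1 - h))%C by (rewrite cexp_plus; ring).
  rewrite Cmod_mult, Cmod_cexp. assert (t := cexp_taylor1 h). set (m := Cmod h) in *. assert (m0 : 0 <= m) by apply Cmod_ge_0.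
  assert (h1 := Rlt_le_trans _ _ _ Hh (Rmin_l _ _)). assert (h2 := Rlt_le_trans _ _ _ Hh (Rmin_r _ _)).
  assert (e1 : exp m <= exp 1) by (left; apply exp_increasing; auto).
  apply Rle_trans with (exp (Re z) * (5 * (m * m) * exp 1)).
  - apply Rmult_le_compat_l. lra. eapply Rle_trans. apply t. apply Rmult_le_compat_l; auto. nra.
  - replace (exp (Re z) * (5 * (m * m) * exp 1)) with (m * K * m) by (unfold K; ring).
    apply Rmult_le_compat_r; auto. apply Rlt_le. apply Rlt_div_r; auto.
Qed.

Lemma hol_cexp f z : hol f z -> hol (fun w => cexp (f w)) z.
Proof. intros. apply (hol_comp cexp f); auto. eexists; apply hder_cexp. Qed.
Lemma hol_cpow b f z : hol f z -> hol (fun w => cpow b (f w)) z.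
Proof. intros. apply hol_cexp. apply hol_mult; auto. apply hol_const. Qed.
Lemma hol_csin f z : hol f z -> hol (fun w => csin (f w)) z.
Proof.
  intros. apply hol_mult. apply hol_minus; apply hol_cexp. apply hol_mult; auto using hol_const.
  apply hol_opp. apply hol_mult; auto using hol_const. apply hol_const.
Qed.
Lemma hol_ccos f z : hol f z -> hol (fun w => ccos (f w)) z.
Proof.
  intros. apply hol_mult. apply hol_plus; apply hol_cexp. apply hol_mult; auto using hol_const.
  apply hol_opp. apply hol_mult; auto using hol_const. apply hol_const.
Qed.

Lemma cpow_plus b s t : cpow b (s + t) = (cpow b s * cpow b t)%C.
Proof. unfold cpow. rewrite Cmult_plus_distr_r. apply cexp_plus. Qed.
Lemma cpow_opp b s : cpow b (- s) = (/ cpow b s)%C.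
Proof. unfold cpow. rewrite <- cexp_opp. f_equal. ring. Qed.
Lemma cpow_neq_0 b s : cpow b s <> RtoC 0.
Proof. apply cexp_neq_0. Qed.
Lemma Cmod_cpow b s : Cmod (cpow b s) = Rpower b (Re s).
Proof. unfold cpow. rewrite Cmod_cexp. unfold Rpower. f_equal. destruct s; simpl; ring. Qed.
Lemma cpow_RtoC b r : cpow b (RtoC r) = RtoC (Rpower b r).
Proof. unfold cpow, Rpower. rewrite <- RtoC_mult. apply cexp_RtoC. Qed.
Lemma cpow_1 b : 0 < b -> cpow b 1 = RtoC b.
Proof. intros. rewrite cpow_RtoC. now rewrite Rpower_1. Qed.
Lemma cpow_mult_base a b s : 0 < a -> 0 < b -> cpow (a * b) s = (cpow a s * cpow b s)%C.
Proof. intros. unfold cpow. rewrite ln_mult by auto. rewrite RtoC_plus, Cmult_plus_distr_l. apply cexp_plus. Qed.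

(** * Integrals of complex functions of a real variable *)

Definition ccont (f : R -> C) (t : R) : Prop :=
  forall eps, 0 < eps -> exists d, 0 < d /\ forall s, Rabs (s - t) < d -> Cmod (f s - f t) < eps.
Definition icont (f : R -> C) (a b : R) : Prop := forall t, a <= t <= b -> ccont f t.
Definition CI (f : R -> C) (a b : R) : C := @RInt C_R_CompleteNormedModule f a b.

Lemma ccont_continuous f t : ccont f t -> @continuous R_UniformSpace C_R_CompleteNormedModule f t.
Proof.
  intros H. unfold continuous.
  apply (proj2 (@filterlim_locally_ball_norm R_AbsRing R C_R_NormedModule (locally t) (@filter_filter _ _ (locally_filter t)) f (f t))).
  intros eps. destruct (H eps (cond_pos eps)) as [d [d0 h]].
  exists (mkposreal d d0). intros s Hs. unfold ball_norm. rewrite <- Cmod_norm. apply h. exact Hs.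
Qed.

Lemma ccont_const c t : ccont (fun _ => c) t.
Proof.
  intros eps He. exists 1. split. lra. intros. replace (c - c)%C with (RtoC 0) by ring. now rewrite Cmod_0.
Qed.
Lemma ccont_plus f g t : ccont f t -> ccont g t -> ccont (fun s => f s + g s)%C t.
Proof.
  intros H1 H2 eps He. destruct (H1 (eps / 2) ltac:(lra)) as [d1 [p1 h1]], (H2 (eps / 2) ltac:(lra)) as [d2 [p2 h2]].
  exists (Rmin d1 d2). split. now apply Rmin_pos. intros s Hs.
  specialize (h1 s (Rlt_le_trans _ _ _ Hs (Rmin_l _ _))). specialize (h2 s (Rlt_le_trans _ _ _ Hs (Rmin_r _ _))).
  replace (f s + g s - (f t + g t))%C with ((f s - f t) + (g s - g t))%C by ring.
  eapply Rle_lt_trans. apply Cmod_triangle. lra.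
Qed.
Lemma ccont_hol F f t : hol F (f t) -> ccont f t -> ccont (fun s => F (f s)) t.
Proof.
  intros HF Hf eps He. destruct (hol_cont F (f t) HF eps He) as [d [d0 h]].
  destruct (Hf d d0) as [d1 [p1 h1]]. exists d1. split; auto.
Qed.
Lemma ccont_ext f g t : (forall s, f s = g s) -> ccont f t -> ccont g t.
Proof. intros E H eps He. destruct (H eps He) as [d [d0 h]]. exists d. split; auto. intros. rewrite <- !E. auto. Qed.
Lemma ccont_scal c f t : ccont f t -> ccont (fun s => c * f s)%C t.
Proof. apply (ccont_hol (fun w => c * w)%C). apply hol_mult; auto using hol_const, hol_id. Qed.
Lemma ccont_opp f t : ccont f t -> ccont (fun s => - f s)%C t.
Proof. apply (ccont_hol (fun w => - w)%C). apply hol_opp, hol_id. Qed.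
Lemma ccont_minus f g t : ccont f t -> ccont g t -> ccont (fun s => f s - g s)%C t.
Proof. intros. apply ccont_plus; auto. now apply ccont_opp. Qed.
Lemma ccont_sqr f t : ccont f t -> ccont (fun s => f s * f s)%C t.
Proof. apply (ccont_hol (fun w => w * w)%C). apply hol_mult; apply hol_id. Qed.
(** Polarization once more, because [ccont_hol] composes with functions of one complex variable
    only. *)
Lemma ccont_mult f g t : ccont f t -> ccont g t -> ccont (fun s => f s * g s)%C t.
Proof.
  intros Hf Hg. apply ccont_ext with (fun s => (/ 4) * ((f s + g s) * (f s + g s) - (f s - g s) * (f s - g s)))%C.
  intros; field. apply ccont_scal. apply ccont_minus; apply (ccont_sqr (fun s => _)).
  now apply ccont_plus. now apply ccont_minus.
Qed.
Lemma ccont_inv f t : f t <> RtoC 0 -> ccont f t -> ccont (fun s => / f s)%C t.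
Proof. intros. apply (ccont_hol Cinv); auto. apply (hol_inv (fun w => w)); auto. apply hol_id. Qed.
Lemma ccont_div f g t : g t <> RtoC 0 -> ccont f t -> ccont g t -> ccont (fun s => f s / g s)%C t.
Proof. intros. apply ccont_mult; auto. now apply ccont_inv. Qed.
Lemma ccont_cexp f t : ccont f t -> ccont (fun s => cexp (f s)) t.
Proof. apply (ccont_hol cexp). eexists; apply hder_cexp. Qed.
Lemma ccont_RtoC (f : R -> R) t : continuous f t -> ccont (fun s => RtoC (f s)) t.
Proof.
  intros H eps He. unfold continuous in H. rewrite filterlim_locally in H.
  destruct (H (mkposreal eps He)) as [d hd]. exists d. split. apply cond_pos. intros s Hs.
  rewrite <- RtoC_minus, Cmod_R. apply (hd s Hs).
Qed.
Lemma ccont_id t : ccont RtoC t.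
Proof. apply (ccont_RtoC (fun s => s)). apply continuous_id. Qed.
Lemma ccont_comp_R f (u : R -> R) t : continuous u t -> ccont f (u t) -> ccont (fun s => f (u s)) t.
Proof.
  intros Hu Hf eps He. destruct (Hf eps He) as [d [d0 h]].
  unfold continuous in Hu. rewrite filterlim_locally in Hu. destruct (Hu (mkposreal d d0)) as [d1 h1].
  exists d1. split. apply cond_pos. intros s Hs. apply h. apply (h1 s Hs).
Qed.
Lemma ccont_psum (f : nat -> R -> C) t n : (forall k, ccont (f k) t) -> ccont (fun s => psum (fun k => f k s) n) t.
Proof. intros H. induction n; simpl. apply ccont_const. now apply ccont_plus. Qed.
Lemma ccont_Cmod f t : ccont f t -> continuous (fun s => Cmod (f s)) t.
Proof.
  intros H. unfold continuous. apply filterlim_locally. intros eps.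
  destruct (H eps (cond_pos eps)) as [d [d0 h]]. exists (mkposreal d d0). intros s Hs.
  specialize (h s Hs). change (Rabs (Cmod (f s) - Cmod (f t)) < eps).
  assert (t1 := Cmod_triangle_via (f s) (f t) 0). assert (t2 := Cmod_triangle_via (f t) (f s) 0).
  rewrite (Cmod_minus_sym (f t) (f s)) in t2.
  replace (f s - 0)%C with (f s) in * by ring. replace (f t - 0)%C with (f t) in * by ring.
  apply Rabs_def1; lra.
Qed.

Lemma icont_sub f a b c d : icont f a b -> a <= c -> d <= b -> icont f c d.
Proof. intros H ? ? t Ht. apply H. lra. Qed.
Lemma icont_plus f g a b : icont f a b -> icont g a b -> icont (fun s => f s + g s)%C a b.
Proof. intros ? ? t Ht. apply ccont_plus; auto. Qed.
Lemma icont_scal c f a b : icont f a b -> icont (fun s => c * f s)%C a b.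
Proof. intros ? t Ht. apply ccont_scal; auto. Qed.

Lemma icont_ex_RInt f a b : a <= b -> icont f a b -> @ex_RInt C_R_CompleteNormedModule f a b.
Proof.
  intros Hab H. apply ex_RInt_continuous. rewrite Rmin_left, Rmax_right by auto.
  intros z Hz. apply ccont_continuous. now apply H.
Qed.

Lemma CI_correct f a b : a <= b -> icont f a b -> @is_RInt C_R_CompleteNormedModule f a b (CI f a b).
Proof. intros. apply RInt_correct. now apply icont_ex_RInt. Qed.

Lemma CI_ext f g a b : a <= b -> (forall t, a <= t <= b -> f t = g t) -> CI f a b = CI g a b.
Proof.
  intros Hab H. apply (@RInt_ext C_R_CompleteNormedModule). rewrite Rmin_left, Rmax_right by auto.
  intros; apply H; lra.
Qed.
Lemma CI_point f a : CI f a a = RtoC 0.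
Proof. apply (@RInt_point C_R_CompleteNormedModule). Qed.
Lemma CI_Chasles f a b c : a <= b -> b <= c -> icont f a c -> (CI f a b + CI f b c)%C = CI f a c.
Proof.
  intros. apply (@RInt_Chasles C_R_CompleteNormedModule); apply icont_ex_RInt; auto;
    eapply icont_sub; eauto; lra.
Qed.
Lemma CI_plus f g a b : a <= b -> icont f a b -> icont g a b -> CI (fun t => f t + g t)%C a b = (CI f a b + CI g a b)%C.
Proof. intros. apply (@RInt_plus C_R_CompleteNormedModule); now apply icont_ex_RInt. Qed.

Lemma CI_pair f a b : a <= b -> icont f a b ->
  CI f a b = (RInt (fun t => Re (f t)) a b, RInt (fun t => Im (f t)) a b) /\
  ex_RInt (fun t => Re (f t)) a b /\ ex_RInt (fun t => Im (f t)) a b.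
Proof.
  intros Hab H. assert (h := CI_correct f a b Hab H).
  assert (h1 := @is_RInt_fct_extend_fst R_NormedModule R_NormedModule f a b _ h).
  assert (h2 := @is_RInt_fct_extend_snd R_NormedModule R_NormedModule f a b _ h).
  split; [|split; eexists; [apply h1|apply h2]].
  apply C_ext; simpl; symmetry; apply is_RInt_unique; assumption.
Qed.

(** The integral lives in a module over the reals, so a complex factor has to be moved out through
    the real and imaginary components. *)
Lemma CI_scal c f a b : a <= b -> icont f a b -> CI (fun t => c * f t)%C a b = (c * CI f a b)%C.
Proof.
  intros Hab H.
  destruct (CI_pair f a b Hab H) as [E [e1 e2]].
  destruct (CI_pair (fun t => c * f t)%C a b Hab (icont_scal c f a b H)) as [E' _].
  rewrite E, E'. apply C_ext; simpl.
  - apply is_RInt_unique.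
    apply (@is_RInt_minus R_NormedModule (fun t => fst c * Re (f t)) (fun t => snd c * Im (f t)));
    apply (@is_RInt_scal R_NormedModule); now apply (@RInt_correct R_CompleteNormedModule).
  - apply is_RInt_unique.
    apply (@is_RInt_plus R_NormedModule (fun t => fst c * Im (f t)) (fun t => snd c * Re (f t)));
    apply (@is_RInt_scal R_NormedModule); now apply (@RInt_correct R_CompleteNormedModule).
Qed.
Lemma CI_minus f g a b : a <= b -> icont f a b -> icont g a b -> CI (fun t => f t - g t)%C a b = (CI f a b - CI g a b)%C.
Proof.
  intros. rewrite (CI_ext _ (fun t => f t + RtoC (-1) * g t)%C); auto.
  rewrite CI_plus, CI_scal; auto. ring. now apply icont_scal. intros; ring.
Qed.
Lemma CI_psum (f : nat -> R -> C) a b n : a <= b -> (forall k, icont (f k) a b) ->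
  CI (fun t => psum (fun k => f k t) n) a b = psum (fun k => CI (f k) a b) n.
Proof.
  intros Hab H. induction n; simpl.
  - rewrite (CI_ext _ (fun t => RtoC 0 * RtoC 0)%C); auto. rewrite CI_scal; auto. ring.
    intros t _. apply ccont_const. intros; ring.
  - rewrite CI_plus; auto. now rewrite IHn. intros t Ht. apply ccont_psum. intros; now apply H.
Qed.

Lemma CI_mod_const f a b M : a <= b -> icont f a b -> (forall t, a <= t <= b -> Cmod (f t) <= M) -> Cmod (CI f a b) <= (b - a) * M.
Proof.
  intros Hab H HM. rewrite Cmod_norm.
  apply (@norm_RInt_le_const C_R_NormedModule f a b (CI f a b) M Hab).
  intros; rewrite <- Cmod_norm; auto. now apply CI_correct.
Qed.

Lemma CI_mod_fun f (g : R -> R) a b lg : a <= b -> icont f a b -> (forall t, a <= t <= b -> Cmod (f t) <= g t) ->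
  is_RInt g a b lg -> Cmod (CI f a b) <= lg.
Proof.
  intros Hab H HM Hg. rewrite Cmod_norm.
  apply (@norm_RInt_le C_R_NormedModule f g a b (CI f a b) lg Hab); auto.
  intros; rewrite <- Cmod_norm; auto. now apply CI_correct.
Qed.

Lemma CI_shift f a b c : a <= b -> icont f (a + c) (b + c) -> CI (fun t => f (t + c)) a b = CI f (a + c) (b + c).
Proof.
  intros Hab H. 
  assert (h := @RInt_comp_lin C_R_CompleteNormedModule f 1 c a b).
  rewrite !Rmult_1_l in h. unfold CI. rewrite <- h by (apply icont_ex_RInt; auto; lra).
  apply (@RInt_ext C_R_CompleteNormedModule). intros. rewrite Rmult_1_l. 
  symmetry. apply (@scal_one R_AbsRing C_R_ModuleSpace).
Qed.

Lemma CI_reflect f a b : a <= b -> icont f (- b) (- a) -> CI (fun t => f (- t)) a b = CI f (- b) (- a).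
Proof.
  intros Hab H.
  apply (@is_RInt_unique C_R_CompleteNormedModule).
  assert (e := CI_correct f (- b) (- a) ltac:(lra) H).
  apply (@is_RInt_swap C_R_NormedModule) in e.
  apply (@is_RInt_comp_opp C_R_NormedModule) in e.
  apply (@is_RInt_opp C_R_NormedModule) in e.
  rewrite (@opp_opp C_R_NormedModule) in e.
  eapply (@is_RInt_ext C_R_NormedModule); [|exact e].
  intros x _. apply (@opp_opp C_R_NormedModule).
Qed.

(** * Derivatives along lines *)

Definition rder (F : R -> C) (t : R) (l : C) : Prop :=
  forall eps, 0 < eps -> exists d, 0 < d /\ forall h, Rabs h < d ->
    Cmod (F (t + h)%R - F t - l * RtoC h)%C <= eps * Rabs h.

Lemma rder_is_derive F t l : rder F t l -> @is_derive R_AbsRing C_R_NormedModule F t l.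
Proof.
  intros H. split. apply is_linear_scal_l.
  intros x Hx eps. apply (is_filter_lim_locally_unique (V := R_NormedModule)) in Hx. subst x.
  destruct (H eps (cond_pos eps)) as [d [d0 h]]. exists (mkposreal d d0). intros s Hs.
  change R in s. change R in t. specialize (h (s - t) Hs). replace (t + (s - t)) with s in h by ring.
  rewrite <- Cmod_norm.
  change (Cmod (F s - F t - scal (V := C_R_NormedModule) (s - t)%R l)%C <= eps * Rabs (s - t)).
  rewrite scal_R_Cmult, Cmult_comm. exact h.
Qed.

Lemma hder_line F z0 d t l : hder F (z0 + RtoC t * d)%C l -> rder (fun s => F (z0 + RtoC s * d)%C) t (l * d)%C.
Proof.
  intros H.
  set (K := Cmod d + 1). assert (K0 : 0 < K) by (unfold K; assert (h := Cmod_ge_0 d); lra).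
  intros eps He. destruct (H (eps / K)) as [e [e0 h]]. now apply Rdiv_lt_0_compat.
  exists (e / K). split. now apply Rdiv_lt_0_compat. intros s Hs.
  assert (P : Cmod (RtoC s * d) <= Rabs s * K).
  { rewrite Cmod_mult, Cmod_R. apply Rmult_le_compat_l. apply Rabs_pos. unfold K; lra. }
  assert (Q : Cmod (RtoC s * d) < e). { eapply Rle_lt_trans. apply P. apply Rlt_div_r; auto. }
  specialize (h _ Q). replace (z0 + RtoC t * d + RtoC s * d)%C with (z0 + RtoC (t + s) * d)%C in h by (rewrite RtoC_plus; ring).
  replace (l * (RtoC s * d))%C with (l * d * RtoC s)%C in h by ring.
  eapply Rle_trans. apply h. apply Rle_trans with (eps / K * (Rabs s * K)). apply Rmult_le_compat_l; auto.
  apply Rlt_le, Rdiv_lt_0_compat; auto. right; field; lra.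
Qed.

Lemma CI_FTC F f a b : a <= b -> icont f a b -> (forall t, a <= t <= b -> rder F t (f t)) -> CI f a b = (F b - F a)%C.
Proof.
  intros Hab Hf H. apply (@is_RInt_unique C_R_CompleteNormedModule).
  apply (@is_RInt_derive C_R_CompleteNormedModule F f a b); rewrite Rmin_left, Rmax_right by auto.
  intros; apply rder_is_derive; auto. intros; apply ccont_continuous; auto.
Qed.

Lemma rder_Re F t l : rder F t l -> is_derive (fun s => Re (F s)) t (Re l).
Proof.
  intros H. apply is_derive_Reals. intros eps He.
  destruct (H (eps / 2) ltac:(lra)) as [d [d0 h]]. exists (mkposreal d d0). intros s Hs0 Hs. simpl in Hs.
  specialize (h s Hs).
  replace ((Re (F (t + s)) - Re (F t)) / s - Re l) with (Re (F (t + s)%R - F t - l * RtoC s)%C / s)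
    by (rewrite !Re_minus, re_scal_r; field; auto).
  unfold Rdiv. rewrite Rabs_mult, Rabs_inv. apply Rle_lt_trans with (eps / 2).
  apply Rle_div_l. now apply Rabs_pos_lt. eapply Rle_trans; [apply re_le_Cmod|]. lra. lra.
Qed.

(* Mean value inequality: apply the real theorem to [Re (conj w * F)], [w] the increment of [F]. *)
Lemma rder_mean_value F F' a b M : a <= b -> (forall t, a <= t <= b -> rder F t (F' t)) ->
  (forall t, a <= t <= b -> Cmod (F' t) <= M) -> Cmod (F b - F a) <= M * (b - a).
Proof.
  intros Hab HF HM. set (w := (F b - F a)%C).
  destruct (Req_dec (Cmod w) 0) as [e|n].
  { rewrite e. apply Rmult_le_pos; [|lra]. eapply Rle_trans; [apply Cmod_ge_0|apply (HM a); lra]. }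
  assert (w0 : 0 < Cmod w) by (assert (h := Cmod_ge_0 w); lra).
  assert (D : forall t, a <= t <= b -> is_derive (fun s => Re (Cconj w * F s)%C) t (Re (Cconj w * F' t)%C)).
  { intros t Ht. apply (rder_Re (fun s => Cconj w * F s)%C).
    intros eps He. destruct (HF t Ht (eps / Cmod w)) as [d [d0 h]]. now apply Rdiv_lt_0_compat.
    exists d. split; auto. intros s Hs. specialize (h s Hs).
    replace (Cconj w * F (t + s)%R - Cconj w * F t - Cconj w * F' t * s)%C with (Cconj w * (F (t + s)%R - F t - F' t * s))%C by ring.
    rewrite Cmod_mult, Cmod_conj. apply Rle_trans with (Cmod w * (eps / Cmod w * Rabs s)).
    apply Rmult_le_compat_l; auto. lra. right; field; lra. }
  destruct (MVT_gen (fun s => Re (Cconj w * F s)%C) a b (fun t => Re (Cconj w * F' t)%C)) as [c [Hc E]].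
  { rewrite Rmin_left, Rmax_right by auto. intros; apply D; lra. }
  { rewrite Rmin_left, Rmax_right by auto. intros t Ht. apply derivable_continuous_pt. apply ex_derive_Reals_0. eexists; apply D; lra. }
  rewrite Rmin_left, Rmax_right in Hc by auto.
  rewrite <- Re_minus in E. replace (Cconj w * F b - Cconj w * F a)%C with (w * Cconj w)%C in E by (unfold w; ring).
  rewrite <- Cmod2_conj in E. 
  assert (E2 : Cmod w * Cmod w <= Cmod w * M * (b - a)).
  { rewrite re_RtoC in E. replace (Cmod w ^ 2) with (Cmod w * Cmod w) in E by ring.
    rewrite E. apply Rmult_le_compat_r. lra. eapply Rle_trans. apply Rle_abs. eapply Rle_trans. apply re_le_Cmod.
    rewrite Cmod_mult, Cmod_conj. apply Rmult_le_compat_l. lra. auto. }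
  apply Rmult_le_reg_l with (Cmod w); auto. lra.
Qed.

(** * Goursat's theorem and its consequences *)

(** The contour integral taken counterclockwise round the boundary, [(x, y)] being the lower left
    corner; on vertical sides [dz = Ci ds]. *)
Definition rectint (g : C -> C) (x y w h : R) : C :=
  (CI (fun t => g (t, y)) x (x + w) + Ci * CI (fun s => g (x + w, s)%R) y (y + h)
   - CI (fun t => g (t, y + h)%R) x (x + w) - Ci * CI (fun s => g (x, s)) y (y + h))%C.
Definition hol_rect (g : C -> C) (x y w h : R) : Prop :=
  forall t s, x <= t <= x + w -> y <= s <= y + h -> hol g (t, s).

Lemma ccont_horizontal y t : ccont (fun t => (t, y)) t.
Proof.
  apply ccont_ext with (fun t => RtoC t + (0, y))%C. intros; apply C_ext; simpl; ring.
  apply ccont_plus. apply ccont_id. apply ccont_const.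
Qed.
Lemma ccont_vertical x s : ccont (fun s => (x, s)) s.
Proof.
  apply ccont_ext with (fun s => Ci * RtoC s + (x, 0))%C. intros; apply C_ext; simpl; ring.
  apply ccont_plus. apply ccont_scal. apply ccont_id. apply ccont_const.
Qed.

Lemma icont_horizontal g x y w h s : hol_rect g x y w h -> y <= s <= y + h -> icont (fun t => g (t, s)) x (x + w).
Proof. intros H Hs t Ht. apply (ccont_hol g (fun t => (t, s))). auto. apply ccont_horizontal. Qed.
Lemma icont_vertical g x y w h t : hol_rect g x y w h -> x <= t <= x + w -> icont (fun s => g (t, s)) y (y + h).
Proof. intros H Hs s Ht. apply (ccont_hol g (fun s => (t, s))). auto. apply ccont_vertical. Qed.

Lemma hol_rect_sub g x y w h x' y' w' h' : hol_rect g x y w h ->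
  x <= x' -> x' + w' <= x + w -> y <= y' -> y' + h' <= y + h -> hol_rect g x' y' w' h'.
Proof. intros H ? ? ? ? t s ? ?. apply H; lra. Qed.

(** Each inner side is traversed twice in opposite directions and cancels. *)
Lemma rectint_split g x y u v : 0 <= u -> 0 <= v -> hol_rect g x y (u + u) (v + v) ->
  rectint g x y (u + u) (v + v) = (rectint g x y u v + rectint g (x + u)%R y u v +
    rectint g x (y + v)%R u v + rectint g (x + u)%R (y + v)%R u v)%C.
Proof.
  intros Hu Hv H. unfold rectint. rewrite <- !Rplus_assoc.
  assert (Hh : forall s, y <= s <= y + (v + v) -> CI (fun t => g (t, s)) x (x + u + u) =
     (CI (fun t => g (t, s)) x (x + u) + CI (fun t => g (t, s)) (x + u) (x + u + u))%C).
  { intros s Hs. symmetry. apply CI_Chasles; try lra. rewrite Rplus_assoc. eapply icont_horizontal; eauto. }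
  assert (Hw : forall t, x <= t <= x + (u + u) -> CI (fun s => g (t, s)) y (y + v + v) =
     (CI (fun s => g (t, s)) y (y + v) + CI (fun s => g (t, s)) (y + v) (y + v + v))%C).
  { intros t Ht. symmetry. apply CI_Chasles; try lra. rewrite Rplus_assoc. eapply icont_vertical; eauto. }
  rewrite (Hh y), (Hh (y + v + v)), (Hw x), (Hw (x + u + u)) by lra. ring.
Qed.

(** Each side contributes the difference of [F] at its endpoints, and these differences cancel round
    the boundary. *)
Lemma rectint_primitive F g x y w h : 0 <= w -> 0 <= h -> hol_rect g x y w h ->
  (forall t s, x <= t <= x + w -> y <= s <= y + h -> hder F (t, s) (g (t, s))) -> rectint g x y w h = 0.
Proof.
  intros Hw Hh H HF. unfold rectint.
  assert (A1 : forall s, y <= s <= y + h -> CI (fun t => g (t, s)) x (x + w) = (F (x + w, s)%R - F (x, s))%C).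
  { intros s Hs. apply CI_FTC with (F := fun t => F (t, s)). lra. eapply icont_horizontal; eauto.
    intros t Ht. assert (E : forall t, ((0, s) + RtoC t * 1)%C = (t, s)) by (intros; apply C_ext; simpl; ring).
    assert (L := hder_line F (0, s) 1 t (g (t, s))). rewrite E in L. specialize (L (HF _ _ Ht Hs)).
    rewrite Cmult_1_r in L. intros e He. destruct (L e He) as [d [d0 hd]]. exists d. split; auto.
    intros k Hk. specialize (hd k Hk). rewrite !E in hd. exact hd. }
  assert (A2 : forall t, x <= t <= x + w -> (Ci * CI (fun s => g (t, s)) y (y + h) = (F (t, y + h)%R - F (t, y)))%C).
  { intros t Ht. assert (IC := icont_vertical _ _ _ _ _ t H Ht). rewrite <- CI_scal by (auto; lra).
    apply CI_FTC with (F := fun s => F (t, s)). lra. now apply icont_scal.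
    intros s Hs. assert (E : forall s, (RtoC t + RtoC s * Ci)%C = (t, s)) by (intros; apply C_ext; simpl; ring).
    assert (L := hder_line F t Ci s (g (t, s))). rewrite E in L. specialize (L (HF _ _ Ht Hs)).
    rewrite Cmult_comm in L. intros e He. destruct (L e He) as [d [d0 hd]]. exists d. split; auto.
    intros k Hk. specialize (hd k Hk). rewrite !E in hd. exact hd. }
  rewrite !A1, !A2 by lra. ring.
Qed.

Lemma rectint_plus f g x y w h : 0 <= w -> 0 <= h -> hol_rect f x y w h -> hol_rect g x y w h ->
  rectint (fun z => f z + g z)%C x y w h = (rectint f x y w h + rectint g x y w h)%C.
Proof.
  intros Hw Hh Hf Hg. unfold rectint.
  rewrite !(CI_plus (fun t => f (t, _)) (fun t => g (t, _))), !(CI_plus (fun t => f (_, t)) (fun t => g (_, t))).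
  ring. all: try lra.
  all: try (eapply icont_horizontal; eauto; lra).
  all: eapply icont_vertical; eauto; lra.
Qed.

Lemma rectint_mod g x y w h M : 0 <= w -> 0 <= h -> hol_rect g x y w h ->
  (forall t s, x <= t <= x + w -> y <= s <= y + h -> Cmod (g (t, s)) <= M) ->
  Cmod (rectint g x y w h) <= 2 * (w + h) * M.
Proof.
  intros Hw Hh H HM. unfold rectint.
  assert (A1 : forall s, y <= s <= y + h -> Cmod (CI (fun t => g (t, s)) x (x + w)) <= w * M).
  { intros s Hs. replace w with (x + w - x) at 2 by ring. apply CI_mod_const; auto. lra. eapply icont_horizontal; eauto. }
  assert (A2 : forall t, x <= t <= x + w -> Cmod (Ci * CI (fun s => g (t, s)) y (y + h)) <= h * M).
  { intros t Ht. rewrite Cmod_mult, Cmod_Ci, Rmult_1_l. replace h with (y + h - y) at 2 by ring. apply CI_mod_const; auto. lra. eapply icont_vertical; eauto. }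
  assert (B1 := A1 y ltac:(lra)). assert (B2 := A1 (y + h) ltac:(lra)). assert (B3 := A2 x ltac:(lra)). assert (B4 := A2 (x + w) ltac:(lra)).
  eapply Rle_trans. apply Cmod_minus_le. eapply Rle_trans. apply Rplus_le_compat_r. apply Cmod_minus_le.
  eapply Rle_trans. apply Rplus_le_compat_r, Rplus_le_compat_r. apply Cmod_triangle. lra.
Qed.

(** By the triangle inequality one quarter carries at least a fourth of the modulus. The hypotheses
    stand behind the existential so that a choice function exists for all arguments and can drive
    the recursion in [goursat]. *)
Lemma goursat_step g x y u v : exists p : R * R, 0 <= u -> 0 <= v -> hol_rect g x y (u + u) (v + v) ->
  (fst p = x \/ fst p = x + u) /\ (snd p = y \/ snd p = y + v) /\
  Cmod (rectint g x y (u + u) (v + v)) <= 4 * Cmod (rectint g (fst p) (snd p) u v).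
Proof.
  destruct (classic (0 <= u /\ 0 <= v /\ hol_rect g x y (u + u) (v + v))) as [[Hu [Hv H]]|n].
  2: { exists (0, 0). tauto. }
  assert (E := rectint_split g x y u v Hu Hv H).
  set (m := Cmod (rectint g x y (u + u) (v + v))) in *.
  assert (T : m <= Cmod (rectint g x y u v) + Cmod (rectint g (x + u) y u v) + Cmod (rectint g x (y + v) u v) + Cmod (rectint g (x + u) (y + v) u v)).
  { unfold m. rewrite E. eapply Rle_trans. apply Cmod_triangle. apply Rplus_le_compat_r.
    eapply Rle_trans. apply Cmod_triangle. apply Rplus_le_compat_r. apply Cmod_triangle. }
  destruct (Rle_lt_dec m (4 * Cmod (rectint g x y u v))). exists (x, y); simpl; tauto.
  destruct (Rle_lt_dec m (4 * Cmod (rectint g (x + u) y u v))). exists (x + u, y); simpl; tauto.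
  destruct (Rle_lt_dec m (4 * Cmod (rectint g x (y + v) u v))). exists (x, y + v); simpl; tauto.
  exists (x + u, y + v); simpl. intros _ _ _. split; [tauto|]. split; [tauto|]. lra.
Qed.

Lemma half_pow_pos n : 0 < / 2 ^ n.
Proof. apply Rinv_0_lt_compat, pow_lt. lra. Qed.

(** The point is the supremum of the left ends, since every right end is an upper bound of all of
    them. *)
Lemma nested_point (a : nat -> R) w : 0 <= w ->
  (forall n, a n <= a (S n) /\ a (S n) + w * / 2 ^ S n <= a n + w * / 2 ^ n) ->
  exists p, forall n, a n <= p <= a n + w * / 2 ^ n.
Proof.
  intros Hw H.
  assert (M : forall n m, (n <= m)%nat -> a n <= a m /\ a m + w * / 2 ^ m <= a n + w * / 2 ^ n).
  { intros n m Hnm. induction Hnm. lra. destruct (H m). lra. }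
  assert (P : forall n, 0 <= w * / 2 ^ n). { intros. apply Rmult_le_pos; auto. left; apply half_pow_pos. }
  assert (U : forall n m, a n <= a m + w * / 2 ^ m).
  { intros n m. destruct (M n (n + m)%nat ltac:(lia)). destruct (M m (n + m)%nat ltac:(lia)). specialize (P (n + m)%nat). lra. }
  destruct (completeness (fun t => exists n, t = a n)) as [p [h1 h2]].
  { exists (a O + w * / 2 ^ 0). intros t [n ->]. apply U. }
  { exists (a O), O. reflexivity. }
  exists p. intros n. split. apply h1. now exists n. apply h2. intros t [m ->]. apply U.
Qed.

(** Repeated quartering bounds the integral by [4^n] times the integral over the [n]-th of a nested
    sequence of rectangles. Differentiability at their common point makes that integral a small
    multiple of [4^(-n)]. *)
Theorem goursat g x y w h : 0 <= w -> 0 <= h -> hol_rect g x y w h -> rectint g x y w h = 0.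
Proof.
  intros Hw Hh H. apply Cmod_small_eq. intros eps He.
  replace (rectint g x y w h - 0)%C with (rectint g x y w h) by ring.
  set (step := fun x y u v => proj1_sig (constructive_indefinite_description _ (goursat_step g x y u v))).
  set (s := fix s n := match n with O => (x, y) | S k => step (fst (s k)) (snd (s k)) (w * / 2 ^ S k) (h * / 2 ^ S k) end).
  assert (W : forall n, w * / 2 ^ n = w * / 2 ^ S n + w * / 2 ^ S n). { intros; simpl; field. apply pow_nonzero; lra. }
  assert (V : forall n, h * / 2 ^ n = h * / 2 ^ S n + h * / 2 ^ S n). { intros; simpl; field. apply pow_nonzero; lra. }
  assert (W0 : forall n, 0 <= w * / 2 ^ n). { intros. apply Rmult_le_pos; auto. left; apply half_pow_pos. }
  assert (V0 : forall n, 0 <= h * / 2 ^ n). { intros. apply Rmult_le_pos; auto. left; apply half_pow_pos. }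
  assert (SP : forall n, hol_rect g (fst (s n)) (snd (s n)) (w * / 2 ^ n) (h * / 2 ^ n) ->
    (fst (s (S n)) = fst (s n) \/ fst (s (S n)) = fst (s n) + w * / 2 ^ S n) /\
    (snd (s (S n)) = snd (s n) \/ snd (s (S n)) = snd (s n) + h * / 2 ^ S n) /\
    Cmod (rectint g (fst (s n)) (snd (s n)) (w * / 2 ^ n) (h * / 2 ^ n)) <=
    4 * Cmod (rectint g (fst (s (S n))) (snd (s (S n))) (w * / 2 ^ S n) (h * / 2 ^ S n))).
  { intros n Hn. change (s (S n)) with (step (fst (s n)) (snd (s n)) (w * / 2 ^ S n) (h * / 2 ^ S n)).
    unfold step. destruct (constructive_indefinite_description _ (goursat_step g (fst (s n)) (snd (s n)) (w * / 2 ^ S n) (h * / 2 ^ S n))) as [p Hp].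
    simpl proj1_sig. rewrite <- W, <- V in Hp. apply Hp; auto. }
  assert (HR : forall n, hol_rect g (fst (s n)) (snd (s n)) (w * / 2 ^ n) (h * / 2 ^ n)).
  { induction n. replace (w * / 2 ^ 0) with w by (simpl; field). replace (h * / 2 ^ 0) with h by (simpl; field). exact H.
    destruct (SP n IHn) as [a1 [a2 _]]. specialize (W n). specialize (V n). specialize (W0 (S n)). specialize (V0 (S n)).
    eapply hol_rect_sub; [apply IHn|..]; destruct a1 as [a1|a1], a2 as [a2|a2]; rewrite ?a1, ?a2; lra. }
  assert (SQ := fun n => SP n (HR n)). clear SP.
  destruct (nested_point (fun n => fst (s n)) w Hw) as [px Hpx].
  { intros n. destruct (SQ n) as [[a|a] _]; rewrite a; specialize (W n); specialize (W0 (S n)); lra. }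
  destruct (nested_point (fun n => snd (s n)) h Hh) as [py Hpy].
  { intros n. destruct (SQ n) as [_ [[a|a] _]]; rewrite a; specialize (V n); specialize (V0 (S n)); lra. }
  set (pp := (px, py) : C).
  assert (Hp : hol g pp). { apply (HR O). apply (Hpx O). apply (Hpy O). }
  destruct Hp as [l Hl].
  (* The bound on the [n]-th rectangle will be [2 e (w + h)^2 / 4^n], and the [4^n] from the
     subdivision cancels; the [+ 1] keeps the denominator positive when [w = h = 0]. *)
  set (e := eps / (2 * (w + h + 1) * (w + h + 1))).
  assert (e0 : 0 < e). { unfold e. apply Rdiv_lt_0_compat; auto. repeat apply Rmult_lt_0_compat; lra. }
  destruct (Hl e e0) as [d [d0 hd]].
  assert (exists n, (w + h + 1) * / 2 ^ n < d) as [n Hn].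
  { assert (q := is_lim_seq_geom (/ 2)). rewrite Rabs_pos_eq in q by lra. specialize (q ltac:(lra)).
    apply is_lim_seq_spec in q. assert (dw : 0 < d / (w + h + 1)) by (apply Rdiv_lt_0_compat; lra).
    destruct (q (mkposreal _ dw)) as [N hN].
    exists N. specialize (hN N (Nat.le_refl _)). rewrite Rminus_0_r in hN. simpl in hN.
    apply Rabs_def2 in hN. rewrite pow_inv in hN. rewrite Rmult_comm. apply Rlt_div_r; lra. }
  assert (B : Cmod (rectint g (fst (s n)) (snd (s n)) (w * / 2 ^ n) (h * / 2 ^ n)) <=
    2 * (w * / 2 ^ n + h * / 2 ^ n) * (e * (w * / 2 ^ n + h * / 2 ^ n))).
  (* The affine part of [g] at [pp] has a primitive and integrates to zero, so only the remainder
     [rho], at most [e] times the distance to [pp], counts. *)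
  { set (aff := fun z : C => (g pp + l * (z - pp))%C).
    set (rho := fun z : C => (g z - aff z)%C).
    assert (Ha : forall z, hol aff z).
    { intros z. apply hol_plus. apply hol_const. apply hol_mult. apply hol_const. apply hol_minus. apply hol_id. apply hol_const. }
    assert (Hrho : hol_rect rho (fst (s n)) (snd (s n)) (w * / 2 ^ n) (h * / 2 ^ n)).
    { intros a b Ha1 Hb1. apply hol_minus; auto. now apply (HR n). }
    assert (E0 : rectint aff (fst (s n)) (snd (s n)) (w * / 2 ^ n) (h * / 2 ^ n) = 0).
    { apply rectint_primitive with (F := fun z => (g pp * z + l * (/ 2) * ((z - pp) * (z - pp)))%C); auto.
      intros a b _ _; auto. intros a b _ _.
      eapply hder_eq; [|apply hder_plus; [apply hder_scal; apply hder_id|apply hder_scal; 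
        apply (hder_comp (fun z : C => z * z)%C (fun z : C => z - pp)%C); [apply hder_minus; [apply hder_id|apply hder_const]|apply hder_sqr]]].
      unfold aff. field. }
    assert (E1 : rectint g (fst (s n)) (snd (s n)) (w * / 2 ^ n) (h * / 2 ^ n) = rectint rho (fst (s n)) (snd (s n)) (w * / 2 ^ n) (h * / 2 ^ n)).
    { assert (q := rectint_plus aff rho (fst (s n)) (snd (s n)) (w * / 2 ^ n) (h * / 2 ^ n) (W0 n) (V0 n) (fun a b _ _ => Ha _) Hrho).
      rewrite E0, Cplus_0_l in q. rewrite <- q.
      f_equal. apply functional_extensionality. intros z. unfold rho. ring. }
    rewrite E1. apply rectint_mod; auto. intros a b Ha1 Hb1.
    specialize (Hpx n). specialize (Hpy n). simpl in Hpx, Hpy.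
    assert (D : Cmod ((a, b) - pp) <= w * / 2 ^ n + h * / 2 ^ n).
    { eapply Rle_trans. apply Cmod_le_Rabs. simpl. apply Rplus_le_compat; apply Rabs_le; lra. }
    assert (D2 : Cmod ((a, b) - pp) < d).
    { eapply Rle_lt_trans. apply D. eapply Rle_lt_trans; [|apply Hn]. assert (q := half_pow_pos n). nra. }
    specialize (hd _ D2). replace (pp + ((a, b) - pp))%C with ((a, b) : C) in hd by (apply C_ext; simpl; ring).
    unfold rho, aff. replace (g (a, b) - (g pp + l * ((a, b) - pp)))%C with (g (a, b) - g pp - l * ((a, b) - pp))%C by ring.
    eapply Rle_trans. apply hd. apply Rmult_le_compat_l; lra. }
  assert (T : forall n, Cmod (rectint g x y w h) <= 4 ^ n * Cmod (rectint g (fst (s n)) (snd (s n)) (w * / 2 ^ n) (h * / 2 ^ n))).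
  { induction n0. replace (w * / 2 ^ 0) with w by (simpl; field). replace (h * / 2 ^ 0) with h by (simpl; field). simpl. lra.
    eapply Rle_trans. apply IHn0. destruct (SQ n0) as [_ [_ q]].
    replace (4 ^ S n0) with (4 ^ n0 * 4) by (simpl; ring). rewrite Rmult_assoc. apply Rmult_le_compat_l; auto. apply pow_le; lra. }
  eapply Rle_trans. apply (T n). eapply Rle_trans. apply Rmult_le_compat_l. apply pow_le; lra. apply B.
  replace (4 ^ n * (2 * (w * / 2 ^ n + h * / 2 ^ n) * (e * (w * / 2 ^ n + h * / 2 ^ n)))) with (2 * e * (w + h) * (w + h)).
  - replace eps with (2 * e * (w + h + 1) * (w + h + 1)) by (unfold e; field; lra).
    assert (0 <= e * (2 * (w + h) + 1)) by nra. nra.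
  - replace 4 with (2 * 2) by ring. rewrite Rpow_mult_distr. field. apply pow_nonzero; lra.
Qed.

(** * Cauchy's formula for the derivative *)

Lemma cexp_pair a b : cexp (a, b) = (RtoC (exp a) * (cos b, sin b))%C.
Proof. unfold cexp. simpl. apply C_ext; simpl; ring. Qed.

(** Circles are replaced by vertical segments through [z -> c + cexp z]: the function
    [g z = f (c + cexp z) * cexp (- z)] is holomorphic on a left half-plane and has period [2 PI]
    along the imaginary axis. Goursat's theorem on a rectangle of that height loses its horizontal
    sides, so the integral does not depend on the radius, and small radii produce the derivative. *)
Lemma cauchy_derivative f c R0 r l : 0 < r < R0 -> (forall z, Cmod (z - c) < R0 -> hol f z) -> hder f c l ->
  CI (fun y => f (c + cexp (ln r, y)) * cexp (- (ln r, y)))%C 0 (2 * PI) = (RtoC (2 * PI) * l)%C.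
Proof.
  intros Hr Hf Hl. assert (pi0 := PI_RGT_0).
  set (g := fun z => (f (c + cexp z) * cexp (- z))%C).
  assert (Hg : forall z, Re z < ln R0 -> hol g z).
  { intros z Hz. apply hol_mult.
    - apply (hol_comp f (fun z => c + cexp z)%C). apply hol_plus. apply hol_const. apply hol_cexp, hol_id.
      apply Hf. replace (c + cexp z - c)%C with (cexp z) by ring. rewrite Cmod_cexp.
      rewrite <- (exp_ln R0) by lra. now apply exp_increasing.
    - apply hol_cexp, hol_opp, hol_id. }
  set (I := fun a => CI (fun y => g (a, y)) 0 (2 * PI)).
  assert (IC : forall a, a < ln R0 -> icont (fun y => g (a, y)) 0 (2 * PI)).
  { intros a Ha t _. apply (ccont_hol g (fun s => (a, s))). now apply Hg. apply ccont_vertical. }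
  assert (K : forall a, a <= ln r -> I a = I (ln r)).
  { intros a Ha. assert (lnr : ln r < ln R0) by (apply ln_increasing; lra).
    assert (E := goursat g a 0 (ln r - a) (2 * PI) ltac:(lra) ltac:(lra)).
    assert (HR : hol_rect g a 0 (ln r - a) (2 * PI)). { intros t s Ht _. apply Hg. simpl. lra. }
    specialize (E HR). unfold rectint in E.
    replace (a + (ln r - a)) with (ln r) in E by ring. rewrite !Rplus_0_l in E.
    assert (P : CI (fun t => g (t, 2 * PI)) a (ln r) = CI (fun t => g (t, 0)) a (ln r)).
    { apply CI_ext; auto. intros t _. unfold g.
      assert (Q : cexp (t, 2 * PI) = cexp (t, 0)). { rewrite !cexp_pair, cos_2PI, sin_2PI, cos_0, sin_0. reflexivity. }
      rewrite !cexp_opp, Q. reflexivity. }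
    rewrite P in E. fold (I a) in E. fold (I (ln r)) in E.
    assert (E2 : (Ci * (I (ln r) - I a))%C = 0) by (rewrite <- E; ring).
    apply Ceq_minus. replace (I a - I (ln r))%C with (Ci * (Ci * (I (ln r) - I a)))%C. rewrite E2; ring.
    Ccalc. }
  enough (HI : I (ln r) = (RtoC (2 * PI) * l)%C) by exact HI. apply Cmod_small_eq. intros eps He.
  destruct (Hl (eps / (2 * PI))) as [d [d0 hd]]. apply Rdiv_lt_0_compat; lra.
  set (a := Rmin (ln r) (ln (d / 2))).
  assert (ar : a <= ln r) by apply Rmin_l. assert (lnr : ln r < ln R0) by (apply ln_increasing; lra).
  assert (ad : exp a < d). { apply Rle_lt_trans with (exp (ln (d / 2))).
    destruct (Rmin_r (ln r) (ln (d / 2))) as [q|q]; fold a in q. left; now apply exp_increasing. rewrite q; lra.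
    rewrite exp_ln; lra. }
  rewrite <- (K a ar). unfold I.
  assert (Z : CI (fun y => cexp (- (a, y))) 0 (2 * PI) = 0).
  { rewrite (CI_FTC (fun y => Ci * cexp (- (a, y)))%C); [|lra| |].
    - assert (Q : cexp (- (a, 2 * PI)) = cexp (- (a, 0))).
      { rewrite !cexp_opp. f_equal. rewrite !cexp_pair, cos_2PI, sin_2PI, cos_0, sin_0. reflexivity. }
      rewrite Q. ring.
    - intros t _. apply ccont_cexp, ccont_opp, ccont_vertical.
    - intros t _. assert (E : forall s, (RtoC a + RtoC s * Ci)%C = (a, s)) by (intros; apply C_ext; simpl; ring).
      assert (L : hder (fun z => Ci * cexp (- z))%C (RtoC a + RtoC t * Ci)%C (Ci * (cexp (- (a, t)) * -1))%C).
      { rewrite E. apply hder_scal. apply (hder_comp cexp (fun z => - z)%C). 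
        eapply hder_eq; [|apply hder_opp, hder_id]. ring. apply hder_cexp. }
      apply hder_line in L. intros e0 He0. destruct (L e0 He0) as [d1 [p1 h1]]. exists d1. split; auto.
      intros k Hk. specialize (h1 k Hk). rewrite !E in h1.
      replace (Ci * (cexp (- (a, t)) * -1) * Ci)%C with (cexp (- (a, t))) in h1. exact h1. Ccalc. }
  assert (Hcexp : icont (fun y => cexp (- (a, y))) 0 (2 * PI)). { intros t _. apply ccont_cexp, ccont_opp, ccont_vertical. }
  assert (CIl : CI (fun _ => l) 0 (2 * PI) = (RtoC (2 * PI) * l)%C).
  { rewrite (CI_FTC (fun y => RtoC y * l)%C). ring. lra. intros t _. apply ccont_const.
    intros t _ e0 He0. exists 1. split. lra. intros k _. rewrite RtoC_plus.
    replace ((t + k) * l - t * l - l * k)%C with (RtoC 0) by ring. rewrite Cmod_0. apply Rmult_le_pos. lra. apply Rabs_pos. }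
  rewrite <- CIl.
  (* Subtracting [f c] times a vanishing integral turns the integrand into the difference quotient
     of [f] at [c]. *)
  replace (CI (fun y => g (a, y)) 0 (2 * PI)) with (CI (fun y => g (a, y)) 0 (2 * PI) - f c * CI (fun y => cexp (- (a, y))) 0 (2 * PI))%C by (rewrite Z; ring).
  rewrite <- CI_scal by (auto; lra).
  assert (Hcl : icont (fun _ => l) 0 (2 * PI)) by (intros t _; apply ccont_const).
  assert (H1 : icont (fun y => g (a, y)) 0 (2 * PI)) by (apply IC; lra).
  assert (H2 := icont_scal (f c) _ _ _ Hcexp).
  assert (H3 : icont (fun t => g (a, t) - f c * cexp (- (a, t)))%C 0 (2 * PI)).
  { intros t Ht. apply ccont_minus; [apply H1|apply H2]; auto. }
  rewrite <- CI_minus by (auto; lra). rewrite <- CI_minus by (auto; lra).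
  replace eps with ((2 * PI - 0) * (eps / (2 * PI))) by (field; lra).
  apply CI_mod_const. lra.
  { intros t Ht. apply ccont_minus; [apply H3|apply Hcl]; auto. }
  intros t Ht. unfold g.
  assert (Q : Cmod (cexp (a, t)) = exp a) by apply Cmod_cexp.
  specialize (hd (cexp (a, t))). rewrite Q in hd. specialize (hd ad).
  assert (nz := cexp_neq_0 (a, t)). rewrite cexp_opp.
  replace (f (c + cexp (a, t)) * / cexp (a, t) - f c * / cexp (a, t) - l)%C
    with ((f (c + cexp (a, t)) - f c - l * cexp (a, t)) / cexp (a, t))%C by (field; auto).
  rewrite Cmod_div by auto. rewrite Q. apply Rle_div_l. apply exp_pos. exact hd.
Qed.

Lemma cauchy_estimate f c R0 r l M : 0 < r < R0 -> (forall z, Cmod (z - c) < R0 -> hol f z) -> hder f c l ->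
  (forall y, 0 <= y <= 2 * PI -> Cmod (f (c + cexp (ln r, y))%C) <= M) -> Cmod l <= M / r.
Proof.
  intros Hr Hf Hl HM. assert (pi0 := PI_RGT_0). assert (E := cauchy_derivative f c R0 r l Hr Hf Hl).
  assert (B : Cmod (RtoC (2 * PI) * l) <= (2 * PI - 0) * (M / r)).
  { rewrite <- E. apply CI_mod_const. lra.
    - intros t _. apply ccont_mult; [|apply ccont_cexp, ccont_opp, ccont_vertical].
      apply (ccont_hol f (fun y => c + cexp (ln r, y))%C).
      apply Hf. replace (c + cexp (ln r, t) - c)%C with (cexp (ln r, t)) by ring. rewrite Cmod_cexp. simpl. rewrite exp_ln; lra.
      apply ccont_plus. apply ccont_const. apply ccont_cexp, ccont_vertical.
    - intros t Ht. rewrite Cmod_mult, cexp_opp, Cmod_inv, Cmod_cexp by apply cexp_neq_0. simpl Re. rewrite exp_ln by lra.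
      apply Rmult_le_compat_r. left. apply Rinv_0_lt_compat. lra. auto. }
  rewrite Cmod_mult, Cmod_R, Rabs_pos_eq, Rminus_0_r in B by lra. apply Rmult_le_reg_l with (2 * PI); lra.
Qed.

(** The function [(z - c) * f z] has derivative [f c] at [c] and modulus at most [r * M] on the
    circle, so this is an instance of the estimate for derivatives. *)
Lemma mean_value_estimate f c R0 r M : 0 < r < R0 -> (forall z, Cmod (z - c) < R0 -> hol f z) ->
  (forall y, 0 <= y <= 2 * PI -> Cmod (f (c + cexp (ln r, y))%C) <= M) -> Cmod (f c) <= M.
Proof.
  intros Hr Hf HM. 
  assert (Hc : hol f c). { apply Hf. replace (c - c)%C with (RtoC 0) by ring. rewrite Cmod_0. lra. }
  replace M with (r * M / r) by (field; lra).
  destruct Hc as [l Hl].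
  apply cauchy_estimate with (f := fun z => ((z - c) * f z)%C) (c := c) (R0 := R0); auto.
  - intros z Hz. apply hol_mult; auto. apply hol_minus. apply hol_id. apply hol_const.
  - eapply hder_eq; [|apply hder_mult; [apply hder_minus; [apply hder_id|apply hder_const]|apply Hl]]. cbv beta; ring.
  - intros y Hy. rewrite Cmod_mult. replace (c + cexp (ln r, y) - c)%C with (cexp (ln r, y)) by ring.
    rewrite Cmod_cexp. simpl Re. rewrite exp_ln by lra. apply Rmult_le_compat_l; auto. lra.
Qed.

(** * The identity theorem *)

Lemma parallelogram (q s : C) : Cmod (q - s) * Cmod (q - s) + Cmod (q + s) * Cmod (q + s) = 2 * (Cmod q * Cmod q) + 2 * (Cmod s * Cmod s).
Proof. rewrite !Cmod_sqr, Re_minus, Im_minus, re_plus, im_plus. ring. Qed.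

(* With [a'] the midpoint of [a] and [p], the points of the circle around [p] where [D] need not vanish
   are farther from [a'] than [p] is; the mean value estimate for [D z / (z - a')^n] then kills [D p] as [n -> oo]. *)
Lemma vanishing_disc_grows D a rho : 0 < rho -> (forall z, Cmod (z - a) < 3 * rho -> hol D z) ->
  (forall z, Cmod (z - a) < rho -> D z = 0) -> forall p, Cmod (p - a) < 5 / 4 * rho -> D p = 0.
Proof.
  intros Hrho HD H0 p Hp.
  destruct (Rlt_le_dec (Cmod (p - a)) rho) as [h|h]; auto.
  set (d := Cmod (p - a)) in *. set (a' := (a + (p - a) / 2)%C).
  assert (aa : Cmod (a' - a) = d / 2).
  { unfold a'. replace (a + (p - a) / 2 - a)%C with ((p - a) / 2)%C by ring.
    rewrite Cmod_div, Cmod_R, Rabs_pos_eq by (try lra; apply RtoC_neq_0; lra). reflexivity. }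
  assert (pa : Cmod (p - a') = d / 2).
  { unfold a'. replace (p - (a + (p - a) / 2))%C with ((p - a) / 2)%C by field.
    rewrite Cmod_div, Cmod_R, Rabs_pos_eq by (try lra; apply RtoC_neq_0; lra). reflexivity. }
  (* By the parallelogram law a point at distance [rho] from [p] and at least [rho] from [a] has
     distance at least [m] from the midpoint [a']. The ratio [d / 2 / m] is below [1] once
     [d^2 < 2 rho^2], which the factor [5 / 4] ensures. *)
  set (m := sqrt (rho * rho - d * d / 4)).
  assert (dd : d * d < 25 / 16 * (rho * rho)) by nra.
  assert (rr : 0 < rho * rho) by nra.
  assert (mm : m * m = rho * rho - d * d / 4) by (apply sqrt_sqrt; nra).
  assert (m0 : 0 < m) by (apply sqrt_lt_R0; nra).
  assert (md : d / 2 < m) by nra.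
  assert (Hin : forall y, Cmod (p + cexp (ln rho, y) - a) < 3 * rho).
  { intros y. replace (p + cexp (ln rho, y) - a)%C with ((p - a) + cexp (ln rho, y))%C by ring.
    eapply Rle_lt_trans. apply Cmod_triangle. rewrite Cmod_cexp. simpl Re. rewrite exp_ln by auto. unfold d in *. lra. }
  assert (exists M, forall y, 0 <= y <= 2 * PI -> Cmod (D (p + cexp (ln rho, y))%C) <= M) as [M HM].
  { destruct (continuity_ab_maj (fun y => Cmod (D (p + cexp (ln rho, y))%C)) 0 (2 * PI)) as [y0 [hy _]].
    assert (q := PI_RGT_0); lra.
    intros c _. apply continuity_pt_filterlim. apply (ccont_Cmod (fun y => D (p + cexp (ln rho, y))%C)).
    apply (ccont_hol D). auto. apply ccont_plus. apply ccont_const. apply ccont_cexp, ccont_vertical.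
    eexists; intros; now apply hy. }
  assert (KEY : forall n, Cmod (D p) <= M * (d / 2 / m) ^ n).
  { intros n. set (hn := fun z => (D z * (/ (z - a')) ^ n)%C).
    assert (B : Cmod (hn p) <= M * (/ m) ^ n).
    { apply mean_value_estimate with (R0 := 7 / 4 * rho) (r := rho). lra.
      - intros z Hz.
        destruct (Rlt_le_dec (Cmod (z - a)) rho) as [h1|h1].
        (* Where [D] vanishes the quotient is identically [0], at [a'] as well, where the inverse
           has a meaningless value; so the pole does no harm. *)
        + apply hol_ext_loc with (fun _ => RtoC 0) (rho - Cmod (z - a)). lra.
          intros w Hw. unfold hn. rewrite H0. ring.
          assert (t := Cmod_triangle_via w z a). lra. apply hol_const.
        + apply hol_mult. apply HD. assert (t := Cmod_triangle_via z p a). fold d in t. lra.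
          apply hol_pow. apply hol_inv; [|apply hol_minus; auto using hol_id, hol_const].
          intros E. assert (t := Cmod_triangle_via z a' a). rewrite E, Cmod_0, aa in t. lra.
      - intros y Hy. unfold hn. set (z := (p + cexp (ln rho, y))%C).
        destruct (Rlt_le_dec (Cmod (z - a)) rho) as [h1|h1].
        + rewrite H0 by auto. rewrite Cmult_0_l, Cmod_0. apply Rmult_le_pos.
          eapply Rle_trans; [apply Cmod_ge_0|apply (HM y Hy)]. apply pow_le. left; now apply Rinv_0_lt_compat.
        + rewrite Cmod_mult, Cmod_pow. apply Rmult_le_compat; auto using Cmod_ge_0. apply pow_le, Cmod_ge_0. now apply HM.
          assert (zm : m <= Cmod (z - a')).
          { assert (P := parallelogram (z - a') ((p - a) / 2)).
            replace (z - a' - (p - a) / 2)%C with (cexp (ln rho, y)) in P by (unfold a', z; field).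
            replace (z - a' + (p - a) / 2)%C with (z - a)%C in P by (unfold a'; field).
            rewrite Cmod_div, Cmod_R, Rabs_pos_eq, Cmod_cexp in P by (try lra; apply RtoC_neq_0; lra).
            simpl Re in P. rewrite exp_ln in P by auto. fold d in P.
            assert (0 <= Cmod (z - a')) by apply Cmod_ge_0. nra. }
          apply pow_incr. split. apply Cmod_ge_0. rewrite Cmod_inv. apply Rinv_le_contravar; auto.
          intros E. rewrite E, Cmod_0 in zm. lra. }
    unfold hn in B. rewrite Cmod_mult, Cmod_pow, Cmod_inv, pa in B.
    2:{ intros E. rewrite E, Cmod_0 in pa. lra. }
    unfold Rdiv at 1. rewrite Rpow_mult_distr.
    replace (Cmod (D p)) with ((d / 2) ^ n * (Cmod (D p) * (/ (d / 2)) ^ n)).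
    2:{ rewrite pow_inv. field. apply pow_nonzero. lra. }
    replace (M * ((d / 2) ^ n * (/ m) ^ n)) with ((d / 2) ^ n * (M * (/ m) ^ n)) by ring.
    apply Rmult_le_compat_l; auto. apply pow_le. lra. }
  apply Cmod_eq_0. apply Rle_antisym; [|apply Cmod_ge_0].
  assert (q1 : Rabs (d / 2 / m) < 1). { rewrite Rabs_pos_eq. apply Rlt_div_l; lra. apply Rmult_le_pos. lra. left; now apply Rinv_0_lt_compat. }
  assert (L := is_lim_seq_geom _ q1). apply (is_lim_seq_scal_l _ M) in L. simpl in L. rewrite Rmult_0_r in L.
  assert (LE := is_lim_seq_le (fun _ => Cmod (D p)) _ (Cmod (D p)) 0 KEY (is_lim_seq_const _) L). exact LE.
Qed.

(** A chain of discs of radius [e] whose centres are less than [e / 4] apart: [vanishing_disc_grows]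
    enlarges each disc by the factor [5 / 4], which covers the next one. The choice [e <= r / 3]
    supplies the disc of triple radius that it asks for. *)
Theorem identity_along_segment D p q r rho : 0 < r -> 0 < rho ->
  (forall z t, 0 <= t <= 1 -> Cmod (z - (p + RtoC t * (q - p))) < r -> hol D z) ->
  (forall z, Cmod (z - p) < rho -> D z = 0) -> D q = 0.
Proof.
  intros Hr Hrho HD H0.
  set (e := Rmin rho (r / 3)). assert (e0 : 0 < e) by (apply Rmin_pos; lra).
  assert (er : 3 * e <= r) by (assert (h := Rmin_r rho (r / 3)); fold e in h; lra).
  destruct (nfloor_ex (4 * Cmod (q - p) / e)) as [k0 [_ hk]].
  { apply Rmult_le_pos. assert (h := Cmod_ge_0 (q - p)). lra. left; now apply Rinv_0_lt_compat. }
  set (K := S k0). assert (HK : 4 * Cmod (q - p) / e < INR K) by (unfold K; rewrite S_INR; lra).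
  assert (K0 : 0 < INR K) by (apply lt_0_INR; unfold K; lia).
  assert (IND : forall k, (k <= K)%nat -> forall z, Cmod (z - (p + RtoC (INR k / INR K) * (q - p))) < e -> D z = 0).
  { induction k; intros Hk z Hz.
    - apply H0. eapply Rlt_le_trans; [|apply (Rmin_l rho (r / 3))]. fold e.
      replace (z - p)%C with (z - (p + RtoC (INR 0 / INR K) * (q - p)))%C; auto.
      simpl. unfold Rdiv. rewrite Rmult_0_l. ring.
    - apply vanishing_disc_grows with (a := (p + RtoC (INR k / INR K) * (q - p))%C) (rho := e); auto.
      + intros w Hw. apply (HD w (INR k / INR K)); [|lra].
        assert (INR k <= INR K) by (apply le_INR; lia). split.
        apply Rmult_le_pos. apply pos_INR. left; now apply Rinv_0_lt_compat. apply Rle_div_l; lra.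
      + intros w Hw. apply IHk; auto. lia.
      + set (b := (p + RtoC (INR k / INR K) * (q - p))%C) in *.
        set (b' := (p + RtoC (INR (S k) / INR K) * (q - p))%C) in *.
        assert (t := Cmod_triangle_via z b' b).
        assert (bb : Cmod (b' - b) < e / 4).
        { replace (b' - b)%C with (RtoC (/ INR K) * (q - p))%C.
          2:{ unfold b, b'. rewrite S_INR. replace ((INR k + 1) / INR K) with (INR k / INR K + / INR K) by (field; lra). rewrite RtoC_plus. ring. }
          rewrite Cmod_mult, Cmod_R, Rabs_pos_eq by (left; now apply Rinv_0_lt_compat).
          apply Rlt_div_l in HK; auto. rewrite Rmult_comm. apply Rlt_div_l; auto. lra. }
        lra. }
  apply (IND K (Nat.le_refl _)). replace (INR K / INR K) with 1 by (field; lra).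
  replace (q - (p + 1 * (q - p)))%C with (RtoC 0) by ring. now rewrite Cmod_0.
Qed.

(** * Weierstrass' theorem for series *)

(** The series is differentiated term by term. Cauchy's estimate on circles of radius [r / 4] gives
    [Cmod (f n)' <= 4 / r * M n], so the derivatives are summable and the mean value inequality
    makes every Taylor remainder at most [8 / r * Cmod h * M n]. A finite head is then
    differentiable and the tail is small relative to [Cmod h]. *)
Theorem hol_series (f : nat -> C -> C) (F : C -> C) (M : nat -> R) L a r : 0 < r ->
  (forall n z, Cmod (z - a) < r -> hol (f n) z) ->
  (forall n z, Cmod (z - a) < r -> Cmod (f n z) <= M n) -> Rser M L ->
  (forall z, Cmod (z - a) < r -> Cser (fun n => f n z) (F z)) -> hol F a.
Proof.
  intros Hr Hf HM HL HF.
  assert (Ha : Cmod (a - a) < r). { replace (a - a)%C with (RtoC 0) by ring. now rewrite Cmod_0. }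
  assert (M0 : forall n, 0 <= M n). { intros n. eapply Rle_trans; [apply Cmod_ge_0|apply (HM n a Ha)]. }
  assert (DE : forall n z l, Cmod (z - a) < r / 2 -> hder (f n) z l -> Cmod l <= 4 / r * M n).
  { intros n z l Hz Hl. replace (4 / r * M n) with (M n / (r / 4)) by (field; lra).
    apply cauchy_estimate with (f n) z (r / 2); auto. lra.
    - intros w Hw. apply Hf. assert (t := Cmod_triangle_via w z a). lra.
    - intros y _. apply HM. replace (z + cexp (ln (r / 4), y) - a)%C with ((z - a) + cexp (ln (r / 4), y))%C by ring.
      eapply Rle_lt_trans. apply Cmod_triangle. rewrite Cmod_cexp. simpl Re. rewrite exp_ln; lra. }
  assert (exists l : nat -> C, forall n, hder (f n) a (l n)) as [l Hl].
  { exists (fun n => proj1_sig (constructive_indefinite_description _ (Hf n a Ha))).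
    intros n. apply (proj2_sig (constructive_indefinite_description _ (Hf n a Ha))). }
  assert (LIP : forall n h, Cmod h < r / 2 -> Cmod (f n (a + h) - f n a - l n * h)%C <= 8 / r * Cmod h * M n).
  { intros n h Hh.
    assert (EX : forall t, 0 <= t <= 1 -> hol (f n) (a + RtoC t * h)%C /\ Cmod (a + RtoC t * h - a)%C < r / 2).
    { intros t Ht. assert (Cmod (a + RtoC t * h - a)%C < r / 2).
      { replace (a + t * h - a)%C with (RtoC t * h)%C by ring. rewrite Cmod_mult, Cmod_R, Rabs_pos_eq by lra.
        assert (q := Cmod_ge_0 h). nra. }
      split; auto. apply Hf. lra. }
    assert (B : Cmod (f n (a + RtoC 1 * h)%C - f n (a + RtoC 0 * h)%C) <= 4 / r * M n * Cmod h * (1 - 0)).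
    (* A derivative along the segment is needed as a total function; the value [0] outside [[0, 1]]
       is a dummy. *)
    { apply (rder_mean_value (fun t => f n (a + RtoC t * h)%C)
        (fun t => match excluded_middle_informative (0 <= t <= 1) with
           | left Ht => proj1_sig (constructive_indefinite_description _ (proj1 (EX t Ht))) * h | right _ => 0 end)%C). lra.
      - intros t Ht. destruct excluded_middle_informative as [Ht'|]; [|tauto].
        apply hder_line. apply (proj2_sig (constructive_indefinite_description _ (proj1 (EX t Ht')))).
      - intros t Ht. destruct excluded_middle_informative as [Ht'|]; [|tauto].
        destruct constructive_indefinite_description as [m Hm]. simpl. rewrite Cmod_mult.
        apply Rmult_le_compat_r. apply Cmod_ge_0. apply (DE n (a + RtoC t * h)%C); auto. apply (EX t Ht). }
    replace (a + 1 * h)%C with (a + h)%C in B by ring. replace (a + 0 * h)%C with a in B by ring.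
    assert (B2 : Cmod (l n * h) <= 4 / r * M n * Cmod h).
    { rewrite Cmod_mult. apply Rmult_le_compat_r. apply Cmod_ge_0. apply (DE n a); auto.
      replace (a - a)%C with (RtoC 0) by ring. rewrite Cmod_0. lra. }
    eapply Rle_trans. apply Cmod_minus_le. replace (8 / r) with (2 * (4 / r)) by (field; lra). lra. }
  destruct (Cser_dominated l (fun n => 4 / r * M n) (4 / r * L)) as [lam [Hlam _]].
  { intros n. apply (DE n a); auto. replace (a - a)%C with (RtoC 0) by ring. rewrite Cmod_0. lra. }
  { now apply Rser_scal. }
  exists lam. intros eps He.
  assert (T := Rser_tail _ _ HL). apply is_lim_seq_spec in T.
  assert (ep : 0 < eps * r / 16). { assert (0 < eps * r) by nra. lra. }
  destruct (T (mkposreal _ ep)) as [K hK]. specialize (hK K (Nat.le_refl _)). simpl in hK. rewrite Rminus_0_r in hK. apply Rabs_def2 in hK.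
  assert (HP : hder (fun w => psum (fun k => f k w) K) a (psum l K)).
  { clear -Hl. induction K; simpl. apply hder_const. apply hder_plus; auto. }
  destruct (HP (eps / 2) ltac:(lra)) as [d [d0 hd]].
  exists (Rmin d (r / 2)). split. apply Rmin_pos; lra. intros h Hh.
  assert (h1 := Rlt_le_trans _ _ _ Hh (Rmin_l _ _)). assert (h2 := Rlt_le_trans _ _ _ Hh (Rmin_r _ _)).
  specialize (hd h h1).
  assert (S1 : Cser (fun n => f n (a + h) - f n a - l n * h)%C (F (a + h) - F a - lam * h)%C).
  { apply Cser_minus. apply Cser_minus. apply HF. replace (a + h - a)%C with h by ring. lra. now apply HF.
    apply Cser_ext with (fun n => h * l n)%C. intros; ring. rewrite (Cmult_comm lam). now apply Cser_scal. }
  destruct (Cser_dominated _ (fun n => 8 / r * Cmod h * M n) (8 / r * Cmod h * L) (fun n => LIP n h h2)) as [s [hs1 hs2]].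
  { now apply Rser_scal. }
  rewrite (Cser_unique _ _ _ hs1 S1) in hs2. specialize (hs2 K). rewrite rpsum_scal in hs2.
  rewrite !psum_minus in hs2. rewrite (psum_ext (fun k => l k * h)%C (fun k => h * l k)%C), psum_scal in hs2 by (intros; ring).
  set (X := (F (a + h) - F a - lam * h)%C) in *.
  set (Y := (psum (fun k => f k (a + h)%C) K - psum (fun k => f k a) K - h * psum l K)%C) in *.
  assert (hd' : Cmod Y <= eps / 2 * Cmod h). { unfold Y. rewrite (Cmult_comm h). exact hd. }
  assert (t := Cmod_triangle (X - Y) Y). replace (X - Y + Y)%C with X in t by ring.
  assert (tt : 8 / r * Cmod h * L - 8 / r * Cmod h * rpsum M K <= eps / 2 * Cmod h).
  { replace (8 / r * Cmod h * L - 8 / r * Cmod h * rpsum M K) with (8 / r * (L - rpsum M K) * Cmod h) by ring.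
    apply Rmult_le_compat_r. apply Cmod_ge_0. apply Rle_trans with (8 / r * (eps * r / 16)).
    apply Rmult_le_compat_l. left; apply Rdiv_lt_0_compat; lra. lra. right; field; lra. }
  lra.
Qed.

(** * Partial fractions of the cotangent *)

Lemma Rpower_decr c a b : 0 < a <= b -> 0 <= c -> Rpower b (- c) <= Rpower a (- c).
Proof.
  intros H Hc. unfold Rpower. assert (ln a <= ln b).
  { destruct H as [h0 [h| ->]]. left; now apply ln_increasing. right; auto. }
  destruct (Rle_lt_or_eq_dec (- c * ln b) (- c * ln a)) as [h|h]. nra.
  left; now apply exp_increasing. right; now rewrite h.
Qed.

(** Comparison with the integral of [t^(-p)], carried out by the mean value theorem on unit
    intervals so that the bounds telescope. *)
Lemma Rser_power p c : 1 < p -> 0 < c -> exists L, Rser (fun k => Rpower (INR k + c) (- p)) L.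
Proof.
  intros Hp Hc. apply Rser_bounded with (Rpower c (- p) + Rpower c (1 - p) / (p - 1)).
  { intros; left; apply exp_pos. }
  assert (K : forall n, rpsum (fun k => Rpower (INR (S k) + c) (- p)) n <= (Rpower c (1 - p) - Rpower (INR n + c) (1 - p)) / (p - 1)).
  { induction n; cbn [rpsum]. simpl. rewrite Rplus_0_l. unfold Rminus at 1. rewrite Rplus_opp_r. unfold Rdiv. lra.
    assert (n0 := pos_INR n).
    destruct (MVT_cor2 (fun t => Rpower t (1 - p)) (fun t => (1 - p) * Rpower t (- p)) (INR n + c) (INR (S n) + c)) as [x [e hx]].
    { rewrite S_INR; lra. }
    { intros t Ht. replace (- p) with (1 - p - 1) by ring. apply derivable_pt_lim_power. lra. }
    replace (INR (S n) + c - (INR n + c)) with 1 in e by (rewrite S_INR; ring).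
    assert (h := Rpower_decr p x (INR (S n) + c) ltac:(lra) ltac:(lra)).
    assert (Rpower (INR (S n) + c) (- p) <= (Rpower (INR n + c) (1 - p) - Rpower (INR (S n) + c) (1 - p)) / (p - 1)).
    { apply Rle_div_r. lra. nra. }
    unfold Rdiv in *. lra. }
  intros n. destruct n. simpl. apply Rplus_le_le_0_compat. left; apply exp_pos. apply Rmult_le_pos. left; apply exp_pos. left; apply Rinv_0_lt_compat; lra.
  assert (E : rpsum (fun k => Rpower (INR k + c) (- p)) (S n) = Rpower c (- p) + rpsum (fun k => Rpower (INR (S k) + c) (- p)) n).
  { change (S n) with (1 + n)%nat. rewrite rpsum_split. simpl rpsum at 1. simpl INR at 1. rewrite !Rplus_0_l. reflexivity. }
  rewrite E. apply Rplus_le_compat_l. eapply Rle_trans. apply K. unfold Rdiv. apply Rmult_le_compat_r.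
  left; apply Rinv_0_lt_compat; lra. assert (0 < Rpower (INR n + c) (1 - p)) by apply exp_pos. lra.
Qed.

Lemma Rser_inv_sqr : exists L, Rser (fun k => / ((INR k + 1) * (INR k + 1))) L.
Proof.
  destruct (Rser_power 2 1) as [L H]; try lra. exists L.
  eapply is_lim_seq_ext; [|apply H]. intros n. apply rpsum_ext. intros k _. assert (h := pos_INR k).
  rewrite Rpower_Ropp. f_equal. replace 2 with (INR 2) by reflexivity. rewrite Rpower_pow by lra. simpl. ring.
Qed.

Lemma Clim_bounded u l : Clim u l -> exists B, 0 <= B /\ forall n, Cmod (u n) <= B.
Proof.
  intros H. destruct (H 1 Rlt_0_1) as [N h]. 
  assert (P : forall n, 0 <= rpsum (fun k => Cmod (u k)) n) by (intros; apply rpsum_pos; intros; apply Cmod_ge_0).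
  exists (Cmod l + 1 + rpsum (fun k => Cmod (u k)) N). split.
  assert (t := Cmod_ge_0 l). specialize (P N). lra.
  intros n. destruct (Nat.le_gt_cases N n) as [hn|hn].
  - specialize (h n hn). assert (t := Cmod_triangle (u n - l) l). replace (u n - l + l)%C with (u n) in t by ring. specialize (P N). lra.
  - assert (Cmod (u n) <= rpsum (fun k => Cmod (u k)) N).
    { apply Rle_trans with (rpsum (fun k => Cmod (u k)) (S n)). simpl. specialize (P n). lra.
      apply rpsum_mono. intros; apply Cmod_ge_0. lia. }
    assert (t := Cmod_ge_0 l). lra.
Qed.

(** * Complex sine, cosine and cotangent *)

Definition ccot (z : C) : C := (ccos z / csin z)%C.

Lemma Ci_sqr : (Ci * Ci)%C = RtoC (-1).
Proof. Ccalc. Qed.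

Lemma csin_plus a b : csin (a + b) = (csin a * ccos b + ccos a * csin b)%C.
Proof.
  unfold csin, ccos. replace (Ci * (a + b))%C with (Ci * a + Ci * b)%C by ring. rewrite !cexp_opp, cexp_plus.
  assert (h1 := cexp_neq_0 (Ci * a)). assert (h2 := cexp_neq_0 (Ci * b)). field. repeat split; auto using Ci_nz.
Qed.
Lemma ccos_plus a b : ccos (a + b) = (ccos a * ccos b - csin a * csin b)%C.
Proof.
  unfold csin, ccos. replace (Ci * (a + b))%C with (Ci * a + Ci * b)%C by ring. rewrite !cexp_opp, cexp_plus.
  assert (h1 := cexp_neq_0 (Ci * a)). assert (h2 := cexp_neq_0 (Ci * b)).
  set (A := cexp (Ci * a)) in *. set (B := cexp (Ci * b)) in *.
  replace ((A - / A) / (2 * Ci) * ((B - / B) / (2 * Ci)))%C with ((A - / A) * (B - / B) / (4 * (Ci * Ci)))%C by (field; repeat split; auto using Ci_nz).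
  rewrite Ci_sqr. field. repeat split; auto.
Qed.
Lemma csin_opp a : csin (- a) = (- csin a)%C.
Proof. unfold csin. replace (Ci * - a)%C with (- (Ci * a))%C by ring. rewrite !cexp_opp. assert (h1 := cexp_neq_0 (Ci * a)). field. split; auto using Ci_nz. Qed.
Lemma ccos_opp a : ccos (- a) = ccos a.
Proof. unfold ccos. replace (Ci * - a)%C with (- (Ci * a))%C by ring. rewrite !cexp_opp. assert (h1 := cexp_neq_0 (Ci * a)). field. auto. Qed.
Lemma csin_minus a b : csin (a - b) = (csin a * ccos b - ccos a * csin b)%C.
Proof. unfold Cminus at 1. rewrite csin_plus, csin_opp, ccos_opp. ring. Qed.
Lemma ccos_minus a b : ccos (a - b) = (ccos a * ccos b + csin a * csin b)%C.
Proof. unfold Cminus at 1. rewrite ccos_plus, csin_opp, ccos_opp. ring. Qed.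

Lemma csin_pair x y : csin (x, y) = (sin x * cosh y, cos x * sinh y).
Proof.
  unfold csin. rewrite cexp_opp. unfold cexp. simpl.
  replace (0 * x - 1 * y) with (- y) by ring. replace (0 * y + 1 * x) with x by ring.
  assert (INV : Cinv (exp (- y) * cos x, exp (- y) * sin x) = (exp y * cos x, - (exp y * sin x))).
  - assert (sc := sin2_cos2 x). unfold Rsqr in sc. assert (ey := exp_pos y).
    unfold Cinv. simpl. rewrite exp_Ropp.
    replace (/ exp y * cos x * (/ exp y * cos x * 1) + / exp y * sin x * (/ exp y * sin x * 1)) with (/ (exp y * exp y)).
    2:{ field_simplify_eq; [|lra]. simpl. lra. }
    apply C_ext; simpl; field; lra.
  - rewrite INV. unfold cosh, sinh. apply C_ext; simpl; field; lra.
Qed.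
Lemma ccos_pair x y : ccos (x, y) = (cos x * cosh y, - (sin x * sinh y)).
Proof.
  replace ((x, y) : C) with ((x + PI / 2, y)%R - RtoC (PI / 2))%C by Ccalc.
  assert (E : forall r, csin (RtoC r) = RtoC (sin r)).
  { intros r. unfold RtoC at 1. rewrite csin_pair. unfold cosh, sinh. rewrite Ropp_0, exp_0. apply C_ext; simpl; field. }
  assert (E2 : ccos (RtoC (PI / 2)) = 0).
  { unfold ccos. rewrite cexp_opp. unfold cexp. simpl.
    replace (0 * (PI / 2) - 1 * 0) with 0 by ring. replace (0 * 0 + 1 * (PI / 2)) with (PI / 2) by ring. rewrite cos_PI2, sin_PI2, exp_0.
    apply C_ext; simpl; field. }
  assert (E3 := csin_minus (x + PI / 2, y) (RtoC (PI / 2) + RtoC (PI / 2))).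
  assert (E4 : ccos (x, y) = csin (x + PI / 2, y)).
  { replace ((x + PI / 2, y) : C) with ((x, y) + RtoC (PI / 2))%C by Ccalc. rewrite csin_plus, E2, E, sin_PI2. ring. }
  replace ((x + PI / 2, y)%R - RtoC (PI / 2))%C with ((x, y) : C) by Ccalc.
  rewrite E4, csin_pair, sin_plus, cos_plus, cos_PI2, sin_PI2. apply C_ext; simpl; ring.
Qed.

Lemma csin_RtoC r : csin (RtoC r) = RtoC (sin r).
Proof. unfold RtoC at 1. rewrite csin_pair. unfold cosh, sinh. rewrite Ropp_0, exp_0. apply C_ext; simpl; field. Qed.
Lemma ccos_RtoC r : ccos (RtoC r) = RtoC (cos r).
Proof. unfold RtoC at 1. rewrite ccos_pair. unfold cosh, sinh. rewrite Ropp_0, exp_0. apply C_ext; simpl; field. Qed.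

(** The square of [Cmod (csin (x, y))] is [sin^2 x + sinh^2 y]. *)
Lemma Cmod_csin_ge z : Rabs (sin (Re z)) <= Cmod (csin z).
Proof.
  destruct z as [x y]. rewrite csin_pair. simpl.
  apply Rsqr_incr_0_var; [|apply Cmod_ge_0]. unfold Rsqr. rewrite <- Rabs_mult, Rabs_pos_eq, Cmod_sqr by nra. simpl.
  assert (h : cosh y * cosh y = 1 + sinh y * sinh y).
  { unfold cosh, sinh. rewrite exp_Ropp. assert (p := exp_pos y). field. lra. }
  replace (sin x * cosh y * (sin x * cosh y)) with (sin x * sin x * (cosh y * cosh y)) by ring. rewrite h.
  assert (sc := sin2_cos2 x). unfold Rsqr in sc. nra.
Qed.

(** The bound [x - x^3 / 6] is at least [x / 3] up to [x = 2], and this range contains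
    [[0, PI / 2]]. *)
Lemma sin_ge_third x : 0 <= x <= 2 -> x / 3 <= sin x.
Proof.
  intros H. destruct (pre_sin_bound x 0) as [h _]; try lra.
  unfold sin_approx, sin_term in h. simpl in h. nra.
Qed.

Lemma hder_csin_0 : hder csin 0 1.
Proof.
  eapply hder_eq; [|apply hder_mult; [apply hder_minus; apply (hder_comp cexp); 
     [apply hder_scal, hder_id|apply hder_cexp|apply hder_opp, hder_scal, hder_id|apply hder_cexp]|apply hder_const]].
  cbv beta. rewrite Cmult_0_r, Copp_0, cexp_0. field. apply Ci_nz.
Qed.

(** This is the derivative of the sine at [0], along the increments [c / 2^n]. *)
Lemma scaled_csin c : Clim (fun n => RtoC (2 ^ n) * csin (c / RtoC (2 ^ n)))%C c.
Proof.
  assert (P : forall n, 0 < 2 ^ n) by (intros; apply pow_lt; lra).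
  assert (PC : forall n, RtoC (2 ^ n) <> 0) by (intros n; apply RtoC_neq_0; specialize (P n); lra).
  intros eps He. set (K := Cmod c + 1). assert (K0 : 0 < K) by (assert (h := Cmod_ge_0 c); unfold K; lra).
  destruct (hder_csin_0 (eps / 2 / K)) as [d [d0 hd]]. apply Rdiv_lt_0_compat; lra.
  assert (q := is_lim_seq_geom (/ 2)). rewrite Rabs_pos_eq in q by lra. specialize (q ltac:(lra)).
  apply is_lim_seq_spec in q. assert (dK : 0 < d / K) by (now apply Rdiv_lt_0_compat).
  destruct (q (mkposreal _ dK)) as [N hN]. exists N. intros n Hn. specialize (hN n Hn). simpl in hN.
  rewrite Rminus_0_r, pow_inv in hN. apply Rabs_def2 in hN. specialize (P n). specialize (PC n).
  assert (i0 : 0 < / 2 ^ n) by now apply Rinv_0_lt_compat.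
  assert (M : Cmod (c / RtoC (2 ^ n)) = Cmod c * / 2 ^ n). { rewrite Cmod_div, Cmod_R, Rabs_pos_eq; auto. lra. }
  assert (S : csin 0 = 0) by (rewrite csin_RtoC, sin_0; reflexivity).
  specialize (hd (c / RtoC (2 ^ n))%C). rewrite M in hd. rewrite Cplus_0_l, S in hd.
  assert (dn : Cmod c * / 2 ^ n < d).
  { apply Rle_lt_trans with (K * / 2 ^ n). unfold K; nra.
    destruct hN as [hN _]. apply Rlt_div_r in hN; auto. lra. }
  assert (hd' := hd dn).
  replace (RtoC (2 ^ n) * csin (c / RtoC (2 ^ n)) - c)%C with (RtoC (2 ^ n) * (csin (c / RtoC (2 ^ n)) - 0 - 1 * (c / RtoC (2 ^ n))))%C by (field; auto).
  rewrite Cmod_mult, Cmod_R, Rabs_pos_eq by lra.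
  apply Rle_lt_trans with (2 ^ n * (eps / 2 / K * (Cmod c * / 2 ^ n))). apply Rmult_le_compat_l; lra.
  replace (2 ^ n * (eps / 2 / K * (Cmod c * / 2 ^ n))) with (eps / 2 / K * Cmod c) by (field; lra).
  apply Rle_lt_trans with (eps / 2 / K * K). apply Rmult_le_compat_l. left; apply Rdiv_lt_0_compat; lra. unfold K; lra.
  replace (eps / 2 / K * K) with (eps / 2) by (field; lra). lra.
Qed.

Lemma psum_rev a n : psum (fun k => a (n - 1 - k)%nat) n = psum a n.
Proof.
  induction n. reflexivity. rewrite psum_shift. cbn [psum].
  replace (S n - 1 - 0)%nat with n by lia.
  rewrite (psum_ext (fun k => a (S n - 1 - S k)%nat) (fun k => a (n - 1 - k)%nat)).
  rewrite IHn. ring. intros; f_equal; lia.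
Qed.

Lemma sin_Re_pos z : 0 < Re z < PI -> csin z <> 0.
Proof.
  intros H. apply Cmod_gt_0. eapply Rlt_le_trans; [|apply Cmod_csin_ge].
  apply Rabs_pos_lt. assert (h := sin_gt_0 (Re z) ltac:(lra) ltac:(lra)). lra.
Qed.

(** The duplication formula [2 cot w = cot (w/2) - tan (w/2)], with the tangent written as a
    cotangent of the complement so that it can be iterated with cotangents alone. *)
Lemma ccot_half w : csin w <> 0 -> ccot w = (/ 2 * (ccot (w / 2) - ccot (RtoC (PI / 2) - w / 2)))%C.
Proof.
  intros H. assert (E : w = (w / 2 + w / 2)%C) by field.
  assert (S : csin w = (2 * csin (w / 2) * ccos (w / 2))%C). { rewrite E at 1. rewrite csin_plus. ring. }
  assert (K : ccos w = (ccos (w / 2) * ccos (w / 2) - csin (w / 2) * csin (w / 2))%C). { rewrite E at 1. apply ccos_plus. }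
  unfold ccot. rewrite csin_minus, ccos_minus, csin_RtoC, ccos_RtoC, sin_PI2, cos_PI2, S, K.
  assert (csin (w / 2) <> 0). { intros e. apply H. rewrite S, e. ring. }
  assert (ccos (w / 2) <> 0). { intros e. apply H. rewrite S, e. ring. }
  replace (RtoC 0 * ccos (w / 2) + 1 * csin (w / 2))%C with (csin (w / 2)) by ring.
  replace (RtoC 1 * ccos (w / 2) - 0 * csin (w / 2))%C with (ccos (w / 2)) by ring.
  field. split; auto.
Qed.

(** The cotangents at [k + z] and at [k + 1 - z] are kept together: the difference of two cotangents
    is a sine over a product of two sines, which decays quadratically in [k], while each of them
    alone would not be summable. *)
Definition cotpair (z : C) (n k : nat) : C :=
  (ccot (RtoC PI * (RtoC (INR k) + z) / RtoC (2 ^ n)) - ccot (RtoC PI * (RtoC (INR k + 1) - z) / RtoC (2 ^ n)))%C.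

Lemma pow2_INR n : 2 ^ n = INR (2 ^ n).
Proof. rewrite pow_INR. reflexivity. Qed.

Lemma Re_scal_div r z p : 0 < p -> Re (RtoC r * z / RtoC p)%C = r * Re z / p.
Proof. intros. unfold Cdiv. rewrite <- RtoC_inv by lra. rewrite re_scal_r, re_scal_l. reflexivity. Qed.

Lemma cotpair_sin z m k : 0 < Re z < 1 -> (k < 2 ^ m)%nat ->
  let a := (RtoC PI * (RtoC (INR k) + z) / RtoC (2 ^ S m))%C in
  let b := (RtoC PI * (RtoC (INR k + 1) - z) / RtoC (2 ^ S m))%C in
  (0 < Re a < PI / 2 /\ 0 < Re b < PI / 2) /\
  Re a = PI * (INR k + Re z) / 2 ^ S m /\ Re b = PI * (INR k + 1 - Re z) / 2 ^ S m.
Proof.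
  intros Hz Hk a b.
  assert (P : 0 < 2 ^ S m) by (apply pow_lt; lra).
  assert (ra : Re a = PI * (INR k + Re z) / 2 ^ S m). { unfold a. rewrite Re_scal_div, re_plus, re_RtoC; auto. }
  assert (rb : Re b = PI * (INR k + 1 - Re z) / 2 ^ S m). { unfold b. rewrite Re_scal_div, Re_minus, re_RtoC; auto. }
  split; auto. rewrite ra, rb.
  assert (hk : INR k + 1 <= 2 ^ m). { rewrite pow2_INR, <- S_INR. apply le_INR. lia. }
  assert (k0 := pos_INR k). assert (pp := PI_RGT_0). simpl pow in *.
  repeat split; try (apply Rdiv_lt_0_compat; [apply Rmult_lt_0_compat; lra|auto]).
  all: apply Rlt_div_l; auto; replace (PI / 2 * (2 * 2 ^ m)) with (PI * 2 ^ m) by field; apply Rmult_lt_compat_l; lra.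
Qed.

Lemma cotpair_double z m : 0 < Re z < 1 ->
  psum (cotpair z (S (S m))) (2 ^ S m) = (2 * psum (cotpair z (S m)) (2 ^ m))%C.
Proof.
  intros Hz. replace (2 ^ S m)%nat with (2 ^ m + 2 ^ m)%nat by (simpl; lia).
  (* Reversing the second half pairs the index [k] with [2^(m+1) - 1 - k], whose arguments are
     [PI / 2 - b / 2] and [PI / 2 - a / 2]: exactly those that [ccot_half] produces from [b] and
     [a]. *)
  rewrite psum_split. rewrite <- (psum_rev (fun k => cotpair z (S (S m)) (2 ^ m + k))).
  rewrite <- psum_plus, <- psum_scal. apply psum_ext. intros k Hk.
  destruct (cotpair_sin z m k Hz Hk) as [[Ha Hb] _].
  set (a := (RtoC PI * (RtoC (INR k) + z) / RtoC (2 ^ S m))%C) in *.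
  set (b := (RtoC PI * (RtoC (INR k + 1) - z) / RtoC (2 ^ S m))%C) in *.
  assert (pp := PI_RGT_0).
  unfold cotpair. fold a b. rewrite (ccot_half a), (ccot_half b) by (apply sin_Re_pos; lra).
  assert (N0 : RtoC (2 ^ m) <> 0). { apply RtoC_neq_0. apply pow_nonzero; lra. }
  assert (KK : INR (2 ^ m + (2 ^ m - 1 - k)) = 2 * 2 ^ m - 1 - INR k).
  { rewrite plus_INR, minus_INR, minus_INR, <- pow2_INR by lia. simpl. ring. }
  assert (P2 : RtoC (2 ^ S m) = (2 * RtoC (2 ^ m))%C) by (simpl; rewrite RtoC_mult; reflexivity).
  assert (P4 : RtoC (2 ^ S (S m)) = (4 * RtoC (2 ^ m))%C) by (simpl; rewrite !RtoC_mult, Cmult_assoc; f_equal; rewrite <- RtoC_mult; f_equal; ring).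
  rewrite KK.
  replace (PI * (INR k + z) / (2 ^ S (S m))%R)%C with (a / 2)%C by (unfold a; rewrite P2, P4; field; auto).
  replace (PI * ((INR k + 1)%R - z) / (2 ^ S (S m))%R)%C with (b / 2)%C by (unfold b; rewrite P2, P4; field; auto).
  replace (PI * ((2 * 2 ^ m - 1 - INR k)%R + z) / (2 ^ S (S m))%R)%C with (RtoC (PI / 2) - b / 2)%C.
  2:{ unfold b. rewrite P2, P4, RtoC_div, !RtoC_minus, RtoC_plus, RtoC_mult by lra. field; auto. }
  replace (PI * ((2 * 2 ^ m - 1 - INR k + 1)%R - z) / (2 ^ S (S m))%R)%C with (RtoC (PI / 2) - a / 2)%C.
  2:{ unfold a. rewrite P2, P4, RtoC_div, RtoC_plus, !RtoC_minus, RtoC_mult by lra. field; auto. }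
  field.
Qed.

Lemma ccot_pairs z m : 0 < Re z < 1 -> ccot (RtoC PI * z) = (/ RtoC (2 ^ S m) * psum (cotpair z (S m)) (2 ^ m))%C.
Proof.
  intros Hz. induction m.
  - simpl. rewrite ccot_half. unfold cotpair. simpl. 
    replace (RtoC (2 * 1)) with (RtoC 2) by (f_equal; ring).
    replace (PI * (0 + z) / 2)%C with (PI * z / 2)%C by field.
    replace (PI * ((0 + 1)%R - z) / 2)%C with (RtoC (PI / 2) - PI * z / 2)%C. field.
    rewrite RtoC_div, RtoC_plus by lra. field. apply sin_Re_pos. rewrite re_scal_l. assert (pp := PI_RGT_0). nra.
  - rewrite IHm, cotpair_double by auto. 
    assert (N0 : RtoC (2 ^ m) <> 0). { apply RtoC_neq_0. apply pow_nonzero; lra. }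
    simpl pow. rewrite !RtoC_mult. field; auto.
Qed.

(** Repeated doubling writes [PI * ccot (PI * z)] as a sum of [2^m] pairs at every level [m]. Each
    rescaled pair tends to a term of the series, and [tannery] exchanges limit and sum. *)
Theorem cot_partial_fractions z : 0 < Re z < 1 ->
  Cser (fun k => / (RtoC (INR k) + z) - / (RtoC (INR k + 1) - z))%C (RtoC PI * ccot (RtoC PI * z))%C.
Proof.
  intros Hz. assert (pp := PI_RGT_0).
  assert (N0 : forall m, 0 < 2 ^ m) by (intros; apply pow_lt; lra).
  assert (NC : forall m, RtoC (2 ^ m) <> 0). { intros m. apply RtoC_neq_0. specialize (N0 m); lra. }
  (* In [cot a - cot b = sin (b - a) / (sin a sin b)] every sine is multiplied by [2^n]; the surplus
     power cancels the factor in front of the sum, and each rescaled sine tends to its [c]. *)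
  set (sc := fun c n => (RtoC (2 ^ n) * csin (c / RtoC (2 ^ n)))%C).
  set (f := fun m k => (RtoC PI * / RtoC (2 ^ S m) * cotpair z (S m) k)%C).
  set (c0 := (RtoC PI * (1 - 2 * z))%C).
  set (ca := fun k => (RtoC PI * (RtoC (INR k) + z))%C). set (cb := fun k => (RtoC PI * (RtoC (INR k + 1) - z))%C).
  assert (F : forall m k, (k < 2 ^ m)%nat -> f m k = (RtoC PI * sc c0 (S m) * (/ sc (ca k) (S m) * / sc (cb k) (S m)))%C).
  { intros m k Hk. destruct (cotpair_sin z m k Hz Hk) as [[Ha Hb] _].
    unfold f, cotpair, sc. fold (ca k) (cb k). fold (ca k) in Ha. fold (cb k) in Hb.
    assert (sa : csin (ca k / RtoC (2 ^ S m)) <> 0) by (apply sin_Re_pos; lra).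
    assert (sb : csin (cb k / RtoC (2 ^ S m)) <> 0) by (apply sin_Re_pos; lra).
    replace (c0 / RtoC (2 ^ S m))%C with (cb k / RtoC (2 ^ S m) - ca k / RtoC (2 ^ S m))%C.
    2:{ unfold c0, ca, cb. rewrite RtoC_plus. field. auto. }
    rewrite csin_minus. unfold ccot. field. auto. }
  assert (Zk : forall k, ca k <> 0 /\ cb k <> 0).
  { intros k. assert (k0 := pos_INR k). split; apply Cneq_0_Re; unfold ca, cb; rewrite re_scal_l, ?re_plus, ?Re_minus, re_RtoC; nra. }
  destruct (Clim_bounded _ _ (scaled_csin c0)) as [B [B0 HB]].
  assert (G : forall k, Clim (fun m => f m k) (/ (RtoC (INR k) + z) - / (RtoC (INR k + 1) - z))%C).
  { intros k. apply Clim_ext_ev with (fun m => (RtoC PI * sc c0 (S m) * (/ sc (ca k) (S m) * / sc (cb k) (S m)))%C) k.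
    - intros m Hm. symmetry. apply F. assert (m < 2 ^ m)%nat by (apply Nat.pow_gt_lin_r; lia). lia.
    - destruct (Zk k) as [za zb].
      replace (/ (RtoC (INR k) + z) - / (RtoC (INR k + 1) - z))%C with (RtoC PI * c0 * (/ ca k * / cb k))%C.
      + apply Clim_mult. apply Clim_scal. apply (Clim_S (sc c0)), scaled_csin.
        apply Clim_mult; apply Clim_inv; auto. apply (Clim_S (sc (ca k))), scaled_csin. apply (Clim_S (sc (cb k))), scaled_csin.
      + unfold c0, ca, cb in *. assert (RtoC PI <> RtoC 0) by (apply RtoC_neq_0; lra). rewrite RtoC_plus in *. field.
        repeat split; auto; intros e; [apply zb|apply za]; rewrite e; ring. }
  set (x := Re z) in *. set (del := Rmin x (1 - x)).
  assert (d0 : 0 < del) by (apply Rmin_pos; lra).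
  assert (dx : del <= x) by apply Rmin_l. assert (dx' : del <= 1 - x) by apply Rmin_r.
  destruct Rser_inv_sqr as [L HL].
  (* [B] bounds the numerator, and each rescaled sine in the denominator is at least
     [PI * del * (k + 1) / 3] by [sin_ge_third]; hence the [9]. *)
  set (K := PI * B * (9 / (PI * PI * del * del))).
  apply (Rser_scal K) in HL.
  assert (DOM : forall m k, (k < 2 ^ m)%nat -> Cmod (f m k) <= K * / ((INR k + 1) * (INR k + 1))).
  { intros m k Hk. rewrite F by auto. destruct (cotpair_sin z m k Hz Hk) as [[Ha Hb] [ea eb]]. fold (ca k) in *. fold (cb k) in *. fold x in ea, eb.
    assert (k0 := pos_INR k). assert (p4 := PI_4). specialize (N0 (S m)).
    assert (SA : PI * del * (INR k + 1) / 3 <= Cmod (sc (ca k) (S m))).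
    { unfold sc. rewrite Cmod_mult, Cmod_R, Rabs_pos_eq by lra.
      apply Rle_trans with (2 ^ S m * (Re (ca k / RtoC (2 ^ S m))%C / 3)).
      - rewrite ea. replace (2 ^ S m * (PI * (INR k + x) / 2 ^ S m / 3)) with (PI * (INR k + x) / 3) by (field; lra).
        assert (del * (INR k + 1) <= INR k + x) by nra. nra.
      - apply Rmult_le_compat_l. lra. eapply Rle_trans; [|apply Cmod_csin_ge]. eapply Rle_trans; [|apply Rle_abs].
        apply sin_ge_third. lra. }
    assert (SB : PI * del * (INR k + 1) / 3 <= Cmod (sc (cb k) (S m))).
    { unfold sc. rewrite Cmod_mult, Cmod_R, Rabs_pos_eq by lra.
      apply Rle_trans with (2 ^ S m * (Re (cb k / RtoC (2 ^ S m))%C / 3)).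
      - rewrite eb. replace (2 ^ S m * (PI * (INR k + 1 - x) / 2 ^ S m / 3)) with (PI * (INR k + 1 - x) / 3) by (field; lra).
        assert (del * (INR k + 1) <= INR k + 1 - x) by nra. nra.
      - apply Rmult_le_compat_l. lra. eapply Rle_trans; [|apply Cmod_csin_ge]. eapply Rle_trans; [|apply Rle_abs].
        apply sin_ge_third. lra. }
    assert (P3 : 0 < PI * del * (INR k + 1) / 3).
    { apply Rdiv_lt_0_compat; [|lra]. apply Rmult_lt_0_compat; [|lra]. apply Rmult_lt_0_compat; lra. }
    assert (na : sc (ca k) (S m) <> 0) by (apply Cmod_gt_0; lra).
    assert (nb : sc (cb k) (S m) <> 0) by (apply Cmod_gt_0; lra).
    rewrite !Cmod_mult, !Cmod_inv, Cmod_R, Rabs_pos_eq by (auto; lra).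
    replace (K * / ((INR k + 1) * (INR k + 1))) with (PI * B * (/ (PI * del * (INR k + 1) / 3) * / (PI * del * (INR k + 1) / 3))).
    2:{ unfold K. field. lra. }
    assert (I1 := Rinv_le_contravar _ _ P3 SA). assert (I2 := Rinv_le_contravar _ _ P3 SB).
    apply Rmult_le_compat.
    - apply Rmult_le_pos. lra. apply Cmod_ge_0.
    - apply Rmult_le_pos; left; apply Rinv_0_lt_compat; lra.
    - apply Rmult_le_compat_l. lra. apply HB.
    - apply Rmult_le_compat; auto; left; apply Rinv_0_lt_compat; lra. }
  destruct (Cser_dominated (fun k => / (RtoC (INR k) + z) - / (RtoC (INR k + 1) - z))%C (fun k => K * / ((INR k + 1) * (INR k + 1))) (K * L)) as [l [Hl _]]; [|exact HL|].
  { intros k. apply Rle_trans with (Cmod (/ (RtoC (INR k) + z) - / (RtoC (INR k + 1) - z) - 0)%C).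
    right; f_equal; ring. apply Clim_mod_le_ev with (fun m => f m k) k. apply G.
    intros m Hm. replace (f m k - 0)%C with (f m k) by ring. apply DOM. assert (m < 2 ^ m)%nat by (apply Nat.pow_gt_lin_r; lia). lia. }
  assert (LIM := tannery f _ (fun _ => RtoC PI * ccot (RtoC PI * z))%C (fun k => K * / ((INR k + 1) * (INR k + 1))) (K * L) l (fun m => (2 ^ m)%nat) G DOM HL).
  rewrite (Clim_unique (fun _ => RtoC PI * ccot (RtoC PI * z))%C _ l (Clim_const _)). exact Hl.
  apply LIM; auto.
  - intros k. exists k. intros n Hn. assert (n < 2 ^ n)%nat by (apply Nat.pow_gt_lin_r; lia). lia.
  - intros n. unfold f. rewrite psum_scal. rewrite (ccot_pairs z n Hz). ring.
Qed.

(** * Integrals over the real line of exponentially decaying functions *)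

Definition fcont (f : R -> C) : Prop := forall t, ccont f t.
Definition edecay (f : R -> C) (c lam : R) : Prop := forall y, Cmod (f y) <= c * exp (- lam * Rabs y).
(** The improper integral over the real line with independent ends, so that a shift of the variable
    merely enlarges [L]. *)
Definition isI (f : R -> C) (l : C) : Prop :=
  forall eps, 0 < eps -> exists L, 0 < L /\ forall a b, a <= - L -> L <= b -> Cmod (CI f a b - l) < eps.

Lemma fcont_icont f a b : fcont f -> icont f a b.
Proof. intros H t _. apply H. Qed.

Lemma exp_le a b : a <= b -> exp a <= exp b.
Proof. intros [h| ->]. left; now apply exp_increasing. lra. Qed.

Lemma CI_tail_pos f c lam a b : 0 < lam -> fcont f -> edecay f c lam -> 0 <= a <= b ->
  Cmod (CI f a b) <= c / lam * exp (- lam * a).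
Proof.
  intros Hl Hf Hd Hab.
  assert (c0 : 0 <= c). { assert (h := Hd 0). rewrite Rabs_R0, Rmult_0_r, exp_0 in h. assert (h2 := Cmod_ge_0 (f 0)). lra. }
  assert (P : is_RInt (fun t => c * exp (- lam * t)) a b ((- c / lam * exp (- lam * b)) - (- c / lam * exp (- lam * a)))).
  { apply (@is_RInt_derive R_CompleteNormedModule (fun t => - c / lam * exp (- lam * t))).
    - intros x _. auto_derive; auto. field. lra.
    - intros x _. apply (ex_derive_continuous (fun t => c * exp (- lam * t))). auto_derive; auto. }
  eapply Rle_trans. apply (CI_mod_fun f (fun t => c * exp (- lam * t)) a b _); [lra|now apply fcont_icont| |exact P].
  - intros t Ht. eapply Rle_trans. apply Hd. rewrite Rabs_pos_eq by lra. lra.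
  - assert (0 <= c / lam * exp (- lam * b)). { apply Rmult_le_pos. apply Rmult_le_pos; auto. left; now apply Rinv_0_lt_compat. left; apply exp_pos. }
    unfold Rdiv in *. lra.
Qed.

Lemma fcont_reflect f : fcont f -> fcont (fun t => f (- t)).
Proof. intros H t. apply (ccont_comp_R f Ropp). apply (ex_derive_continuous Ropp). auto_derive; auto. apply H. Qed.

Lemma CI_reflect' f a b : a <= b -> fcont f -> CI f a b = CI (fun t => f (- t)) (- b) (- a).
Proof.
  intros Hab Hf. rewrite (CI_reflect f (- b) (- a)). now rewrite !Ropp_involutive. lra. now apply fcont_icont.
Qed.

Lemma CI_tail_neg f c lam a b : 0 < lam -> fcont f -> edecay f c lam -> a <= b <= 0 ->
  Cmod (CI f a b) <= c / lam * exp (lam * b).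
Proof.
  intros Hl Hf Hd Hab. rewrite CI_reflect' by (auto; lra).
  replace (lam * b) with (- lam * - b) by ring. apply CI_tail_pos; auto. now apply fcont_reflect.
  intros y. eapply Rle_trans. apply Hd. rewrite Rabs_Ropp. lra. lra.
Qed.

Lemma exp_INR_lim lam : 0 < lam -> is_lim_seq (fun n => exp (- lam * INR n)) 0.
Proof.
  intros Hl. apply is_lim_seq_ext with (fun n => (exp (- lam)) ^ n).
  - induction n; cbn [pow]. simpl. rewrite Rmult_0_r, exp_0. reflexivity. rewrite IHn, S_INR, <- exp_plus. f_equal. ring.
  - apply is_lim_seq_geom. rewrite Rabs_pos_eq by (left; apply exp_pos). rewrite <- exp_0. apply exp_increasing. lra.
Qed.

Lemma isI_exists f c lam : 0 < lam -> fcont f -> edecay f c lam ->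
  exists l, isI f l /\ Cmod l <= 2 * c / lam.
Proof.
  intros Hl Hf Hd.
  assert (c0 : 0 <= c / lam).
  { assert (h := Hd 0). rewrite Rabs_R0, Rmult_0_r, exp_0 in h. assert (h2 := Cmod_ge_0 (f 0)).
    apply Rmult_le_pos. lra. left; now apply Rinv_0_lt_compat. }
  set (t := fun n => 2 * (c / lam) * exp (- lam * INR n)).
  assert (D : forall n a b, a <= - INR n -> INR n <= b -> Cmod (CI f a b - CI f (- INR n) (INR n)) <= t n).
  { intros n a b Ha Hb. assert (n0 := pos_INR n).
    rewrite <- (CI_Chasles f a (- INR n) b), <- (CI_Chasles f (- INR n) (INR n) b) by (try lra; now apply fcont_icont).
    replace (CI f a (- INR n) + (CI f (- INR n) (INR n) + CI f (INR n) b) - CI f (- INR n) (INR n))%C with (CI f a (- INR n) + CI f (INR n) b)%C by ring.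
    eapply Rle_trans. apply Cmod_triangle.
    assert (h1 := CI_tail_neg f c lam a (- INR n) Hl Hf Hd ltac:(lra)).
    assert (h2 := CI_tail_pos f c lam (INR n) b Hl Hf Hd ltac:(lra)).
    replace (lam * - INR n) with (- lam * INR n) in h1 by ring. unfold t. lra. }
  assert (T : is_lim_seq t 0).
  { replace (Finite 0) with (Rbar_mult (2 * (c / lam)) 0) by (simpl; f_equal; ring).
    apply is_lim_seq_scal_l. now apply exp_INR_lim. }
  destruct (Cauchy_Clim (fun n => CI f (- INR n) (INR n)) t) as [l [h1 h2]]; auto.
  { intros n m Hnm. apply le_INR in Hnm. apply D; lra. }
  exists l. split.
  - intros eps He. apply is_lim_seq_spec in T. destruct (T (mkposreal (eps / 2) ltac:(lra))) as [N hN].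
    specialize (hN (S N) ltac:(lia)). simpl in hN. rewrite Rminus_0_r in hN. apply Rabs_def2 in hN.
    exists (INR (S N)). split. apply lt_0_INR; lia. intros a b Ha Hb.
    assert (q := Cmod_triangle_via (CI f a b) (CI f (- INR (S N)) (INR (S N))) l).
    assert (q1 := D (S N) a b Ha Hb). assert (q2 := h2 (S N)). rewrite Cmod_minus_sym in q2. 
    change (t (S N) < eps / 2 /\ - (eps / 2) < t (S N)) in hN. lra.
  - specialize (h2 O). simpl INR in h2. rewrite Ropp_0, CI_point in h2. replace (l - 0)%C with l in h2 by ring.
    unfold t in h2. simpl INR in h2. rewrite Rmult_0_r, exp_0 in h2. unfold Rdiv in *. lra.
Qed.

Lemma isI_Clim f l : isI f l -> Clim (fun n => CI f (- INR n) (INR n)) l.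
Proof.
  intros H eps He. destruct (H eps He) as [L [L0 h]].
  destruct (nfloor_ex L ltac:(lra)) as [n [_ hn]]. exists (S n). intros m Hm.
  apply le_INR in Hm. rewrite S_INR in Hm. apply h; lra.
Qed.
Lemma isI_unique f l l' : isI f l -> isI f l' -> l = l'.
Proof. intros H H'. exact (Clim_unique _ _ _ (isI_Clim _ _ H) (isI_Clim _ _ H')). Qed.
Lemma isI_bound f c lam l : 0 < lam -> fcont f -> edecay f c lam -> isI f l -> Cmod l <= 2 * c / lam.
Proof.
  intros Hl Hf Hd H. destruct (isI_exists f c lam Hl Hf Hd) as [l' [h1 h2]]. now rewrite (isI_unique _ _ _ H h1).
Qed.
Lemma isI_ext f g l : (forall y, f y = g y) -> isI f l -> isI g l.
Proof.
  intros E H eps He. destruct (H eps He) as [L [L0 h]]. exists L. split; auto. intros a b Ha Hb.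
  rewrite <- (CI_ext f g); auto. lra.
Qed.
Lemma isI_plus f g l m : fcont f -> fcont g -> isI f l -> isI g m -> isI (fun y => f y + g y)%C (l + m)%C.
Proof.
  intros Hf Hg H1 H2 eps He. destruct (H1 (eps / 2) ltac:(lra)) as [L1 [p1 h1]], (H2 (eps / 2) ltac:(lra)) as [L2 [p2 h2]].
  exists (Rmax L1 L2). assert (q1 := Rmax_l L1 L2). assert (q2 := Rmax_r L1 L2). split. lra. intros a b Ha Hb.
  rewrite CI_plus by (try lra; now apply fcont_icont).
  replace (CI f a b + CI g a b - (l + m))%C with ((CI f a b - l) + (CI g a b - m))%C by ring.
  specialize (h1 a b ltac:(lra) ltac:(lra)). specialize (h2 a b ltac:(lra) ltac:(lra)).
  eapply Rle_lt_trans. apply Cmod_triangle. lra.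
Qed.
Lemma isI_scal c f l : fcont f -> isI f l -> isI (fun y => c * f y)%C (c * l)%C.
Proof.
  intros Hf H eps He. assert (c0 := Cmod_ge_0 c).
  destruct (H (eps / (Cmod c + 1))) as [L [L0 h]]. apply Rdiv_lt_0_compat; lra.
  exists L. split; auto. intros a b Ha Hb. rewrite CI_scal by (try lra; now apply fcont_icont).
  replace (c * CI f a b - c * l)%C with (c * (CI f a b - l))%C by ring. rewrite Cmod_mult.
  specialize (h a b Ha Hb). apply Rle_lt_trans with (Cmod c * (eps / (Cmod c + 1))). apply Rmult_le_compat_l; lra.
  apply Rmult_lt_reg_r with (Cmod c + 1). lra. replace (Cmod c * (eps / (Cmod c + 1)) * (Cmod c + 1)) with (Cmod c * eps) by (field; lra). nra.
Qed.
Lemma fcont_scal c f : fcont f -> fcont (fun y => c * f y)%C.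
Proof. intros H t. now apply ccont_scal. Qed.
Lemma fcont_plus f g : fcont f -> fcont g -> fcont (fun y => f y + g y)%C.
Proof. intros H H' t. now apply ccont_plus. Qed.
Lemma isI_minus f g l m : fcont f -> fcont g -> isI f l -> isI g m -> isI (fun y => f y - g y)%C (l - m)%C.
Proof.
  intros Hf Hg H1 H2. apply isI_ext with (fun y => f y + RtoC (-1) * g y)%C. intros; ring.
  replace (l - m)%C with (l + RtoC (-1) * m)%C by ring. apply isI_plus; auto. now apply fcont_scal. now apply isI_scal.
Qed.
Lemma isI_shift f l c : fcont f -> isI f l -> isI (fun y => f (y + c)) l.
Proof.
  intros Hf H eps He. destruct (H eps He) as [L [L0 h]]. exists (L + Rabs c). assert (q := Rabs_pos c).
  assert (q1 := Rle_abs c). assert (q2 := Rle_abs (- c)). rewrite Rabs_Ropp in q2. split. lra. intros a b Ha Hb.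
  rewrite CI_shift by (try lra; now apply fcont_icont). apply h; lra.
Qed.

(** This plays the part of dominated convergence: with a common rate [lam] the remainder after [K]
    terms again decays at that rate, with the tail of [c] as its constant, so its integral is at
    most [2 / lam] times that tail. *)
Theorem isI_series (f : nat -> R -> C) (F : R -> C) (c : nat -> R) ct lam (l : nat -> C) : 0 < lam ->
  (forall k, fcont (f k)) -> (forall k, edecay (f k) (c k) lam) -> Rser c ct ->
  (forall y, Cser (fun k => f k y) (F y)) -> (forall k, isI (f k) (l k)) ->
  fcont F /\ edecay F ct lam /\ exists l', isI F l' /\ Cser l l'.
Proof.
  intros Hl Hf Hd Hc HF HI.
  assert (c0 : forall k, 0 <= c k).
  { intros k. assert (h := Hd k 0). rewrite Rabs_R0, Rmult_0_r, exp_0 in h. assert (h2 := Cmod_ge_0 (f k 0)). lra. }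
  assert (e1 : forall y, exp (- lam * Rabs y) <= 1). { intros y. rewrite <- exp_0. apply exp_le. assert (h := Rabs_pos y). nra. }
  assert (R1 : forall K, edecay (fun y => F y - psum (fun k => f k y) K)%C (ct - rpsum c K) lam).
  { intros K y. destruct (Cser_dominated (fun k => f k y) (fun k => exp (- lam * Rabs y) * c k) (exp (- lam * Rabs y) * ct)) as [s [h1 h2]].
    intros k. rewrite Rmult_comm. apply Hd. now apply Rser_scal.
    rewrite (Cser_unique _ _ _ h1 (HF y)) in h2. specialize (h2 K). rewrite rpsum_scal in h2. lra. }
  assert (T := Rser_tail _ _ Hc).
  assert (CF : fcont F).
  { intros t eps He. apply is_lim_seq_spec in T. destruct (T (mkposreal (eps / 3) ltac:(lra))) as [K hK].
    specialize (hK K (Nat.le_refl _)). simpl in hK. rewrite Rminus_0_r in hK. apply Rabs_def2 in hK.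
    destruct (ccont_psum f t K (fun k => Hf k t) (eps / 3) ltac:(lra)) as [d [d0 hd]].
    exists d. split; auto. intros s Hs. specialize (hd s Hs).
    assert (r1 := R1 K s). assert (r2 := R1 K t). simpl in r1, r2.
    assert (u1 := e1 s). assert (u2 := e1 t).
    assert (0 <= ct - rpsum c K) by (assert (h := Rser_le c ct K c0 Hc); lra).
    assert (r1' : Cmod (F s - psum (fun k => f k s) K) < eps / 3) by nra.
    assert (r2' : Cmod (F t - psum (fun k => f k t) K) < eps / 3) by nra.
    rewrite Cmod_minus_sym in r2'.
    assert (q1 := Cmod_triangle_via (F s) (psum (fun k => f k s) K) (F t)).
    assert (q2 := Cmod_triangle_via (psum (fun k => f k s) K) (psum (fun k => f k t) K) (F t)). lra. }
  assert (DF : edecay F ct lam). { intros y. assert (h := R1 O y). simpl in h. replace (F y - 0)%C with (F y) in h by ring. lra. }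
  split; auto. split; auto.
  destruct (isI_exists F ct lam Hl CF DF) as [l' [Hl' _]]. exists l'. split; auto.
  apply Clim_squeeze with (fun K => 2 * (ct - rpsum c K) / lam).
  - intros K.
    assert (IP : isI (fun y => psum (fun k => f k y) K) (psum l K) /\ fcont (fun y => psum (fun k => f k y) K)).
    { split; [|intros t; apply ccont_psum; intros k; apply Hf]. induction K; simpl.
      - intros eps He. exists 1. split. lra. intros a b Ha Hb. rewrite (CI_ext _ (fun _ => 0 * 0)%C), CI_scal; try lra.
        rewrite Cmult_0_l. replace (0 - 0)%C with (RtoC 0) by ring. now rewrite Cmod_0. intros t _; apply ccont_const.
        intros; ring.
      - apply isI_plus; auto. intros t; apply ccont_psum; intros k; apply Hf. }
    rewrite Cmod_minus_sym. apply isI_bound with (fun y => F y - psum (fun k => f k y) K)%C; auto.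
    intros t. apply ccont_minus. apply CF. apply IP. apply isI_minus; tauto.
  - replace (Finite 0) with (Rbar_mult (2 / lam) 0) by (simpl; f_equal; ring).
    eapply is_lim_seq_ext; [|apply is_lim_seq_scal_l; exact T]. intros; simpl. field. lra.
Qed.

Lemma fcont_cexp_lin s : fcont (fun y => cexp (s * RtoC y)%C).
Proof. intros t. apply ccont_cexp, ccont_scal, ccont_id. Qed.

Lemma Cmod_cexp_lin s y : Cmod (cexp (s * RtoC y)) = exp (Re s * y).
Proof. rewrite Cmod_cexp, re_scal_r. reflexivity. Qed.

(** Differentiation under the integral sign; the derivative is the transform of [y * f y]. Of the
    surplus rate [3], one unit absorbs the factor [y]. In the Taylor remainder two units absorb
    [y^2 exp |h y|] for [Cmod h < 1], through [a^2 <= 4 exp a], whence [20 = 5 * 4]. *)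
Lemma hol_laplace (f : R -> C) (S : C -> C) c lam nu r : fcont f -> edecay f c lam -> Rabs (Re nu) + 3 <= lam -> 0 < r ->
  (forall w, Cmod (w - nu) < r -> isI (fun y => cexp (w * RtoC y) * f y)%C (S w)) -> hol S nu.
Proof.
  intros Hf Hd Hlam Hr HS.
  assert (c0 : 0 <= c). { assert (h := Hd 0). rewrite Rabs_R0, Rmult_0_r, exp_0 in h. assert (h2 := Cmod_ge_0 (f 0)). lra. }
  assert (e1 : forall y, exp (Re nu * y) * exp (- lam * Rabs y) <= exp (- 3 * Rabs y)).
  { intros y. rewrite <- exp_plus. apply exp_le. assert (h := Rle_abs (Re nu * y)). rewrite Rabs_mult in h.
    assert (h2 := Rabs_pos y). assert (Rabs (Re nu) * Rabs y <= (lam - 3) * Rabs y) by (apply Rmult_le_compat_r; lra). lra. }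
  set (g := fun y => (cexp (nu * RtoC y) * f y)%C).
  assert (Hg : fcont g). { intros t. apply ccont_mult. apply fcont_cexp_lin. apply Hf. }
  assert (Dg : forall y, Cmod (g y) <= c * exp (- 3 * Rabs y)).
  { intros y. unfold g. rewrite Cmod_mult, Cmod_cexp_lin. specialize (Hd y). specialize (e1 y).
    assert (p := exp_pos (Re nu * y)). assert (q := Rmult_le_compat_l c _ _ c0 e1).
    assert (q2 := Rmult_le_compat_l _ _ _ (Rlt_le _ _ p) Hd). lra. }
  assert (Hyg : fcont (fun y => RtoC y * g y)%C). { intros t. apply ccont_mult. apply ccont_id. apply Hg. }
  assert (yle : forall y, Rabs y <= exp (Rabs y)). { intros y. assert (h := exp_ineq1_le (Rabs y)). lra. }
  destruct (isI_exists (fun y => RtoC y * g y)%C c 2) as [l [Hl _]]; auto. lra.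
  { intros y. rewrite Cmod_mult, Cmod_R. specialize (Dg y). specialize (yle y).
    replace (- (2) * Rabs y) with (Rabs y + - 3 * Rabs y) by ring. rewrite exp_plus.
    assert (q := Rmult_le_compat _ _ _ _ (Rabs_pos y) (Cmod_ge_0 (g y)) yle Dg). lra. }
  exists l. intros eps He.
  set (B := 40 * c + 1). assert (B0 : 0 < B) by (unfold B; lra).
  exists (Rmin (Rmin 1 r) (eps / B)). split. repeat apply Rmin_pos; try lra. now apply Rdiv_lt_0_compat.
  intros h Hh. assert (h1 : Cmod h < 1) by (eapply Rlt_le_trans; [apply Hh|]; eapply Rle_trans; apply Rmin_l).
  assert (h2 : Cmod h < r). { eapply Rlt_le_trans; [apply Hh|]. eapply Rle_trans. apply Rmin_l. apply Rmin_r. }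
  assert (h3 : Cmod h < eps / B) by (eapply Rlt_le_trans; [apply Hh|apply Rmin_r]).
  assert (I1 := HS (nu + h)%C ltac:(replace (nu + h - nu)%C with h by ring; auto)).
  assert (I0 := HS nu ltac:(replace (nu - nu)%C with (RtoC 0) by ring; rewrite Cmod_0; auto)).
  assert (F1 : fcont (fun y => cexp ((nu + h) * RtoC y) * f y)%C). { intros t. apply ccont_mult. apply fcont_cexp_lin. apply Hf. }
  assert (ID := isI_minus _ _ _ _ (fun t => ccont_minus _ _ t (F1 t) (Hg t)) (fcont_scal h _ Hyg) (isI_minus _ _ _ _ F1 Hg I1 I0) (isI_scal h _ _ Hyg Hl)).
  rewrite (Cmult_comm l).
  apply Rle_trans with (2 * (20 * c * (Cmod h * Cmod h)) / 1).
  - eapply isI_bound; [| | |exact ID]. lra.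
    { intros t. apply ccont_minus. apply ccont_minus; auto. now apply fcont_scal. }
    intros y. unfold g. replace ((nu + h) * RtoC y)%C with (nu * RtoC y + h * RtoC y)%C by ring. rewrite cexp_plus.
    replace (cexp (nu * y) * cexp (h * y) * f y - cexp (nu * y) * f y - h * (y * (cexp (nu * y) * f y)))%C
      with (cexp (nu * y) * f y * (cexp (h * RtoC y) - 1 - h * RtoC y))%C by ring.
    rewrite Cmod_mult. fold (g y).
    assert (t := cexp_taylor1 (h * RtoC y)). rewrite Cmod_mult, Cmod_R in t.
    set (m := Cmod h) in *. assert (m0 : 0 <= m) by apply Cmod_ge_0. set (a := Rabs y) in *. assert (a0 : 0 <= a) by apply Rabs_pos.
    assert (t1 : 5 * (m * a * (m * a)) * exp (m * a) <= 20 * (m * m) * exp (2 * a)).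
    { assert (aa : a * a <= 4 * exp a).
      { assert (h4 := exp_ineq1_le (a / 2)). assert (E : exp a = exp (a / 2) * exp (a / 2)) by (rewrite <- exp_plus; f_equal; field).
        rewrite E. assert ((1 + a / 2) * (1 + a / 2) <= exp (a / 2) * exp (a / 2)) by (apply Rmult_le_compat; lra). nra. }
      assert (em : exp (m * a) <= exp a) by (apply exp_le; nra).
      replace (exp (2 * a)) with (exp a * exp a) by (rewrite <- exp_plus; f_equal; ring).
      replace (5 * (m * a * (m * a)) * exp (m * a)) with (5 * (m * m) * (a * a * exp (m * a))) by ring.
      replace (20 * (m * m) * (exp a * exp a)) with (5 * (m * m) * (4 * exp a * exp a)) by ring.
      apply Rmult_le_compat_l. nra. apply Rmult_le_compat; auto. nra. left; apply exp_pos. }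
    apply Rle_trans with (c * exp (- 3 * a) * (20 * (m * m) * exp (2 * a))).
    apply Rmult_le_compat; try apply Cmod_ge_0. apply Dg. lra.
    right. replace (- (1) * a) with (- 3 * a + 2 * a) by ring. rewrite exp_plus. ring.
  - assert (m0 : 0 <= Cmod h) by apply Cmod_ge_0.
    replace (2 * (20 * c * (Cmod h * Cmod h)) / 1) with (40 * c * Cmod h * Cmod h) by field.
    apply Rmult_le_compat_r; auto. apply Rlt_div_r in h3; auto. unfold B in h3. nra.
Qed.

(** * The Mellin transform of [1 / (1 + t^2)] *)

Lemma CI_cexp_half (s : C) b : s <> 0 -> 0 <= b ->
  CI (fun y => cexp (- s * RtoC y)) 0 b = (/ s - cexp (- s * RtoC b) / s)%C.
Proof.
  intros Hs Hb. rewrite (CI_FTC (fun y => - / s * cexp (- s * RtoC y))%C).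
  - rewrite Cmult_0_r, cexp_0. field; auto.
  - auto.
  - intros t _. apply fcont_cexp_lin.
  - intros t _. 
    assert (L : hder (fun z => - / s * cexp (- s * z))%C (0 + RtoC t * 1)%C (- / s * (cexp (- s * RtoC t) * - s))%C).
    { replace (0 + t * 1)%C with (RtoC t) by ring. apply hder_scal. apply (hder_comp cexp (fun z => - s * z)%C).
      eapply hder_eq; [|apply hder_scal, hder_id]. ring. apply hder_cexp. }
    apply hder_line in L. intros e He. destruct (L e He) as [d [d0 hd]]. exists d. split; auto.
    intros k Hk. specialize (hd k Hk). 
    replace (0 + (t + k)%R * 1)%C with (RtoC (t + k)) in hd by ring. replace (0 + t * 1)%C with (RtoC t) in hd by ring.
    replace (- / s * (cexp (- s * RtoC t) * - s) * 1)%C with (cexp (- s * RtoC t)) in hd by (field; auto). exact hd.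
Qed.

Lemma CI_cexp_half_lim (s : C) : 0 < Re s -> Clim (fun n => CI (fun y => cexp (- s * RtoC y)) 0 (INR n)) (/ s)%C.
Proof.
  intros Hs. assert (s0 : s <> 0) by (apply Cneq_0_Re; lra).
  apply Clim_squeeze with (fun n => / Cmod s * exp (- Re s * INR n)).
  - intros n. rewrite CI_cexp_half by (auto; apply pos_INR).
    replace (/ s - cexp (- s * INR n) / s - / s)%C with (- (/ s * cexp (- s * RtoC (INR n))))%C by (field; auto).
    rewrite Cmod_opp, Cmod_mult, Cmod_inv, Cmod_cexp_lin, re_opp by auto. lra.
  - replace (Finite 0) with (Rbar_mult (/ Cmod s) 0) by (simpl; f_equal; ring).
    apply is_lim_seq_scal_l. now apply exp_INR_lim.
Qed.

(** With [t = exp y] this is [t^s / (1 + t^2)] times [dt / dy], that is [cexp (s y)] over twice the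
    hyperbolic cosine. *)
Definition sech2 (s : C) (y : R) : C := (cexp (s * RtoC y) / RtoC (exp y + exp (- y)))%C.

Lemma exp_sum_pos y : 0 < exp y + exp (- y).
Proof. assert (h := exp_pos y). assert (h2 := exp_pos (- y)). lra. Qed.

Lemma exp_Rabs_le y : exp (Rabs y) <= exp y + exp (- y).
Proof. assert (h := exp_pos y). assert (h2 := exp_pos (- y)). unfold Rabs. destruct Rcase_abs; lra. Qed.

Lemma fcont_sech2 s : fcont (sech2 s).
Proof.
  intros t. apply ccont_div. apply RtoC_neq_0. assert (h := exp_sum_pos t). lra. apply fcont_cexp_lin.
  apply ccont_RtoC. apply (ex_derive_continuous (fun y => exp y + exp (- y))). auto_derive; auto.
Qed.

Lemma edecay_sech2 s : edecay (sech2 s) 1 (1 - Rabs (Re s)).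
Proof.
  intros y. unfold sech2. assert (p := exp_sum_pos y). assert (p2 := exp_Rabs_le y). assert (p3 := exp_pos (Rabs y)).
  rewrite Cmod_div, Cmod_cexp_lin, Cmod_R, Rabs_pos_eq by (try apply RtoC_neq_0; lra).
  rewrite Rmult_1_l. replace (- (1 - Rabs (Re s)) * Rabs y) with (Rabs (Re s) * Rabs y + - Rabs y) by ring.
  rewrite exp_plus, (exp_Ropp (Rabs y)). unfold Rdiv. apply Rmult_le_compat. left; apply exp_pos. left; now apply Rinv_0_lt_compat.
  apply exp_le. rewrite <- Rabs_mult. apply Rle_abs. now apply Rinv_le_contravar.
Qed.

(** The geometric series in [- exp (- 2 y)] with consecutive terms paired and an exact remainder,
    which for [y > 0] is positive and small. *)
Lemma sech_geometric y M : / (exp y + exp (- y)) =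
  rpsum (fun m => exp (- (4 * INR m + 1) * y) - exp (- (4 * INR m + 3) * y)) M + exp (- (4 * INR M) * y) * / (exp y + exp (- y)).
Proof.
  assert (p := exp_sum_pos y). induction M; cbn [rpsum].
  - simpl. replace (- (4 * 0) * y) with 0 by ring. rewrite exp_0. ring.
  - rewrite IHM at 1. rewrite Rplus_assoc. f_equal. rewrite S_INR.
    apply Rmult_eq_reg_r with (exp y + exp (- y)); [|lra]. rewrite Rmult_plus_distr_r, !Rmult_assoc, !Rinv_l by lra.
    replace (- (4 * INR M + 1) * y) with (- (4 * INR M) * y + - y) by ring.
    replace (- (4 * INR M + 3) * y) with (- (4 * INR M) * y + (- y + (- y + - y))) by ring.
    replace (- (4 * (INR M + 1)) * y) with (- (4 * INR M) * y + (- y + (- y + (- y + - y)))) by ring.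
    rewrite !exp_plus, !exp_Ropp. assert (q := exp_pos y). field. lra.
Qed.

(** The angles [A = PI (1 - s) / 4] and [B = PI (1 + s) / 4] add up to [PI / 2]; hence
    [cot A + cot B = 1 / (sin A sin B)] and [cos (B - A) = 2 sin A sin B]. *)
Lemma ccot_sum s : Rabs (Re s) < 1 ->
  (/ 4 * (RtoC PI * ccot (RtoC PI * ((1 - s) / 4)) + RtoC PI * ccot (RtoC PI * ((1 + s) / 4))) = RtoC (PI / 2) / ccos (RtoC PI * s / 2))%C
  /\ ccos (RtoC PI * s / 2) <> 0.
Proof.
  intros Hs. apply Rabs_def2 in Hs. assert (pp := PI_RGT_0).
  set (A := (RtoC PI * ((1 - s) / 4))%C). set (B := (RtoC PI * ((1 + s) / 4))%C).
  assert (RA : Re A = PI * ((1 - Re s) / 4)). { unfold A. rewrite re_scal_l. f_equal. unfold Cdiv. rewrite <- RtoC_inv, re_scal_r, Re_minus, re_RtoC by lra. reflexivity. }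
  assert (RB : Re B = PI * ((1 + Re s) / 4)). { unfold B. rewrite re_scal_l. f_equal. unfold Cdiv. rewrite <- RtoC_inv, re_scal_r, re_plus, re_RtoC by lra. reflexivity. }
  assert (sa : csin A <> 0) by (apply sin_Re_pos; rewrite RA; split; nra).
  assert (sb : csin B <> 0) by (apply sin_Re_pos; rewrite RB; split; nra).
  assert (E1 : (A + B)%C = RtoC (PI / 2)) by (unfold A, B; rewrite RtoC_div by lra; field).
  assert (E2 : (B - A)%C = (RtoC PI * s / 2)%C) by (unfold A, B; field).
  assert (E3 : ccos (RtoC PI * s / 2) = (2 * csin A * csin B)%C).
  { rewrite <- E2. assert (q := ccos_plus A B). rewrite E1, ccos_RtoC, cos_PI2 in q.
    rewrite ccos_minus. assert (q' : (ccos A * ccos B)%C = (csin A * csin B)%C). { apply Ceq_minus. symmetry. exact q. }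
    rewrite (Cmult_comm (ccos B)), q'. ring. }
  assert (E4 : (csin A * ccos B + ccos A * csin B)%C = 1). { rewrite <- csin_plus, E1, csin_RtoC, sin_PI2. reflexivity. }
  split.
  - rewrite E3. unfold ccot.
    replace (/ 4 * (RtoC PI * (ccos A / csin A) + RtoC PI * (ccos B / csin B)))%C
      with (RtoC PI * (csin A * ccos B + ccos A * csin B) / (4 * csin A * csin B))%C by (field; auto).
    rewrite E4, RtoC_div by lra. field. auto.
  - rewrite E3. apply Cmult_neq_0; auto. apply Cmult_neq_0; auto. apply RtoC_neq_0; lra.
Qed.

(** The line is folded onto the half-line, the reciprocal of [exp y + exp (- y)] is expanded
    geometrically, and the integrated terms are recognized as two cotangent series. *)
Theorem isI_sech2 s : Rabs (Re s) < 1 -> isI (sech2 s) (RtoC (PI / 2) / ccos (RtoC PI * s / 2))%C.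
Proof.
  intros Hs. destruct (isI_exists (sech2 s) 1 (1 - Rabs (Re s)) ltac:(lra) (fcont_sech2 s) (edecay_sech2 s)) as [J [HJ _]].
  assert (Hs' := Rabs_def2 _ _ Hs).
  replace (RtoC (PI / 2) / ccos (RtoC PI * s / 2))%C with J; auto.
  (* The four half-line integrals [1/(4m+1-s) + 1/(4m+1+s) - 1/(4m+3-s) - 1/(4m+3+s)], regrouped as
     terms of the cotangent series at [(1 - s) / 4] and [(1 + s) / 4]. *)
  set (t := fun m => (/ 4 * ((/ (RtoC (INR m) + (1 - s) / 4) - / (RtoC (INR m + 1) - (1 - s) / 4)) +
      (/ (RtoC (INR m) + (1 + s) / 4) - / (RtoC (INR m + 1) - (1 + s) / 4))))%C).
  apply Clim_unique with (psum t).
  2:{ rewrite <- (proj1 (ccot_sum s Hs)). apply (Cser_scal (/ 4)%C). apply Cser_plus; apply cot_partial_fractions;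
      unfold Cdiv; rewrite <- RtoC_inv, re_scal_r, ?Re_minus, ?re_plus, re_RtoC by lra; lra. }
  (* After [S M] terms the remainder is at most the integral of [2 exp (- 4 (M + 1) y)] over the
     half-line, which is [1 / (2 (M + 1))]; the shift by one keeps this rate positive. *)
  apply Clim_unS. apply Clim_squeeze with (fun M => / 2 * / INR (S M)).
  2:{ replace (Finite 0) with (Rbar_mult (/ 2) 0) by (simpl; f_equal; ring). apply is_lim_seq_scal_l.
      apply (is_lim_seq_incr_1 (fun n => / INR n)).
      replace (Finite 0) with (Rbar_inv p_infty) by reflexivity. apply is_lim_seq_inv. apply is_lim_seq_INR. discriminate. }
  intros M0. rewrite Cmod_minus_sym. set (M := S M0).
  set (e := fun (c : C) n => CI (fun y => cexp (- c * RtoC y)) 0 (INR n)).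
  set (T := fun n m => (e (RtoC (4 * INR m + 1) - s) n + e (RtoC (4 * INR m + 1) + s) n
     - (e (RtoC (4 * INR m + 3) - s) n + e (RtoC (4 * INR m + 3) + s) n))%C).
  assert (LT : forall m, Clim (fun n => T n m) (t m)).
  { intros m. assert (m0 := pos_INR m).
    assert (pos : forall a, 1 <= a -> 0 < Re (RtoC a - s)%C /\ 0 < Re (RtoC a + s)%C).
    { intros a Ha. rewrite Re_minus, re_plus, re_RtoC. lra. }
    destruct (pos (4 * INR m + 1) ltac:(lra)) as [p1 p2]. destruct (pos (4 * INR m + 3) ltac:(lra)) as [p3 p4].
    replace (t m) with (/ (RtoC (4 * INR m + 1) - s) + / (RtoC (4 * INR m + 1) + s) - (/ (RtoC (4 * INR m + 3) - s) + / (RtoC (4 * INR m + 3) + s)))%C.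
    { apply Clim_minus; apply Clim_plus; now apply CI_cexp_half_lim. }
    assert (q1 := Cneq_0_Re _ (Rgt_not_eq _ _ p1)). assert (q2 := Cneq_0_Re _ (Rgt_not_eq _ _ p2)).
    assert (q3 := Cneq_0_Re _ (Rgt_not_eq _ _ p3)). assert (q4 := Cneq_0_Re _ (Rgt_not_eq _ _ p4)).
    unfold t. 
    replace (RtoC (INR m) + (1 - s) / 4)%C with ((RtoC (4 * INR m + 1) - s) / 4)%C by (rewrite RtoC_plus, RtoC_mult; field).
    replace (RtoC (INR m) + (1 + s) / 4)%C with ((RtoC (4 * INR m + 1) + s) / 4)%C by (rewrite RtoC_plus, RtoC_mult; field).
    replace (RtoC (INR m + 1) - (1 - s) / 4)%C with ((RtoC (4 * INR m + 3) + s) / 4)%C by (rewrite !RtoC_plus, RtoC_mult; field).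
    replace (RtoC (INR m + 1) - (1 + s) / 4)%C with ((RtoC (4 * INR m + 3) - s) / 4)%C by (rewrite !RtoC_plus, RtoC_mult; field).
    field. auto. }
  assert (LP : Clim (fun n => CI (sech2 s) (- INR n) (INR n) - psum (T n) M)%C (J - psum t M)%C).
  { apply Clim_minus. now apply isI_Clim. clear -LT. induction M; simpl. apply Clim_const. now apply Clim_plus. }
  apply Clim_mod_le with (1 := LP). intros n. assert (n0 := pos_INR n).
  set (term := fun m y => (RtoC (exp (- (4 * INR m + 1) * y) - exp (- (4 * INR m + 3) * y)) * (cexp (s * RtoC y) + cexp (- s * RtoC y)))%C).
  assert (rc : forall a t, ccont (fun y => RtoC (exp (a * y))) t).
  { intros a y. apply ccont_RtoC. apply (ex_derive_continuous (fun y => exp (a * y))). auto_derive; auto. }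
  assert (Fterm : forall m, fcont (term m)).
  { intros m y. apply ccont_mult. apply ccont_ext with (fun y => RtoC (exp (- (4 * INR m + 1) * y)) - RtoC (exp (- (4 * INR m + 3) * y)))%C.
    intros; now rewrite RtoC_minus. apply ccont_minus; apply rc. apply ccont_plus; apply fcont_cexp_lin. }
  assert (ET : forall m, CI (term m) 0 (INR n) = T n m).
  { intros m. unfold T, e.
    assert (FC : forall c, icont (fun y => cexp (- c * RtoC y)) 0 (INR n)) by (intros c y _; apply fcont_cexp_lin).
    rewrite <- !CI_plus by auto. rewrite <- CI_minus; auto; try (apply icont_plus; auto).
    apply CI_ext; auto. intros y _. unfold term. rewrite RtoC_minus, <- !cexp_RtoC.
    replace (- (RtoC (4 * INR m + 1) - s) * RtoC y)%C with (RtoC (- (4 * INR m + 1) * y) + s * RtoC y)%C by (rewrite RtoC_mult, RtoC_opp; ring).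
    replace (- (RtoC (4 * INR m + 1) + s) * RtoC y)%C with (RtoC (- (4 * INR m + 1) * y) + - s * RtoC y)%C by (rewrite RtoC_mult, RtoC_opp; ring).
    replace (- (RtoC (4 * INR m + 3) - s) * RtoC y)%C with (RtoC (- (4 * INR m + 3) * y) + s * RtoC y)%C by (rewrite RtoC_mult, RtoC_opp; ring).
    replace (- (RtoC (4 * INR m + 3) + s) * RtoC y)%C with (RtoC (- (4 * INR m + 3) * y) + - s * RtoC y)%C by (rewrite RtoC_mult, RtoC_opp; ring).
    rewrite !cexp_plus. ring. }
  rewrite <- (psum_ext (fun m => CI (term m) 0 (INR n)) (T n)) by (intros; apply ET).
  rewrite <- CI_psum by (auto; intros; now apply fcont_icont).
  assert (FS := fcont_sech2 s).
  rewrite <- (CI_Chasles (sech2 s) (- INR n) 0 (INR n)) by (try lra; now apply fcont_icont).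
  rewrite (CI_reflect' (sech2 s) (- INR n) 0), Ropp_0, Ropp_involutive by (auto; lra).
  assert (FR := fcont_reflect _ FS).
  rewrite <- CI_plus by (auto; now apply fcont_icont).
  assert (FP : fcont (fun y => psum (fun m => term m y) M)) by (intros y; apply ccont_psum; intros; apply Fterm).
  rewrite <- CI_minus; auto; try (now apply fcont_icont). 2:{ apply fcont_icont. now apply fcont_plus. }
  assert (MP : 0 < INR M) by (apply lt_0_INR; unfold M; lia).
  assert (P : forall w, 0 < w -> is_RInt (fun y => 2 * exp (- (4 * w) * y)) 0 (INR n) ((- / (2 * w) * exp (- (4 * w) * INR n)) - (- / (2 * w) * exp (- (4 * w) * 0)))).
  { intros w Hw. apply (@is_RInt_derive R_CompleteNormedModule (fun y => - / (2 * w) * exp (- (4 * w) * y))).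
    - intros x _. auto_derive; auto. field. lra.
    - intros x _. apply (ex_derive_continuous (fun y => 2 * exp (- (4 * w) * y))). auto_derive; auto. }
  eapply Rle_trans. apply (CI_mod_fun _ (fun y => 2 * exp (- (4 * INR M) * y)) 0 (INR n) _); [exact n0| | |exact (P _ MP)].
  { intros y _. apply ccont_minus. apply ccont_plus. apply FR. apply FS. apply FP. }
  2:{ rewrite Rmult_0_r, exp_0. assert (h := exp_pos (- (4 * INR M) * INR n)).
      assert (0 < / (2 * INR M)) by (apply Rinv_0_lt_compat; lra).
      replace (/ 2 * / INR M) with (/ (2 * INR M)) by (field; lra). nra. }
  intros y Hy. assert (sp := exp_sum_pos y).
  replace (sech2 s (- y) + sech2 s y - psum (fun m => term m y) M)%C
    with (RtoC (exp (- (4 * INR M) * y) * / (exp y + exp (- y))) * (cexp (s * RtoC y) + cexp (- s * RtoC y)))%C.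
  - rewrite Cmod_mult, Cmod_R, Rabs_pos_eq.
    2:{ apply Rmult_le_pos. left; apply exp_pos. left; now apply Rinv_0_lt_compat. }
    assert (em := exp_pos (- (4 * INR M) * y)).
    rewrite Rmult_assoc, (Rmult_comm 2). apply Rmult_le_compat_l. lra.
    rewrite Rmult_comm. apply Rle_div_l; auto.
    eapply Rle_trans. apply Cmod_triangle. rewrite !Cmod_cexp_lin, re_opp.
    assert (exp (Re s * y) <= exp y) by (apply exp_le; nra).
    assert (exp (- Re s * y) <= exp y) by (apply exp_le; nra). assert (h := exp_pos (- y)). lra.
  - unfold sech2. rewrite Ropp_involutive, RtoC_opp. replace (s * - RtoC y)%C with (- s * RtoC y)%C by ring.
    replace (exp (- y) + exp y) with (exp y + exp (- y)) by ring.
    unfold Cdiv. rewrite <- RtoC_inv by lra. rewrite (sech_geometric y M) at 2 3.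
    rewrite RtoC_plus, RtoC_rpsum.
    assert (E : psum (fun m => term m y) M = (psum (fun m => RtoC (exp (- (4 * INR m + 1) * y) - exp (- (4 * INR m + 3) * y))) M * (cexp (s * RtoC y) + cexp (- s * RtoC y)))%C).
    { rewrite Cmult_comm, <- psum_scal. apply psum_ext. intros; unfold term; ring. }
    rewrite E. ring.
Qed.

(** * The Hurwitz zeta function *)

Lemma is_derive_rder F t l : @is_derive R_AbsRing C_R_NormedModule F t l -> rder F t l.
Proof.
  intros [_ H] eps He. specialize (H t (fun P HP => HP) (mkposreal eps He)).
  destruct H as [d hd]. exists d. split. apply cond_pos. intros h Hh.
  assert (Hb : ball t d (t + h)). { change (Rabs (t + h - t) < d). now replace (t + h - t) with h by ring. }
  specialize (hd (t + h) Hb). rewrite <- Cmod_norm in hd.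
  change (Cmod (F (t + h)%R - F t - scal (V := C_R_NormedModule) (t + h - t)%R l)%C <= eps * Rabs (t + h - t)) in hd.
  rewrite scal_R_Cmult, Cmult_comm in hd. replace (t + h - t) with h in hd by ring. exact hd.
Qed.

Lemma rder_minus F G t l m : rder F t l -> rder G t m -> rder (fun t => F t - G t)%C t (l - m)%C.
Proof. intros H1 H2. apply is_derive_rder. apply (@is_derive_minus R_AbsRing C_R_NormedModule); now apply rder_is_derive. Qed.
Lemma rder_scal c F t l : rder F t l -> rder (fun t => c * F t)%C t (c * l)%C.
Proof.
  intros H eps He. assert (c0 := Cmod_ge_0 c). destruct (H (eps / (Cmod c + 1))) as [d [d0 hd]]. apply Rdiv_lt_0_compat; lra.
  exists d. split; auto. intros h Hh. specialize (hd h Hh).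
  replace (c * F (t + h)%R - c * F t - c * l * h)%C with (c * (F (t + h)%R - F t - l * RtoC h))%C by ring.
  rewrite Cmod_mult. assert (h0 := Rabs_pos h).
  apply Rle_trans with (Cmod c * (eps / (Cmod c + 1) * Rabs h)). apply Rmult_le_compat_l; auto.
  replace (Cmod c * (eps / (Cmod c + 1) * Rabs h)) with (Cmod c / (Cmod c + 1) * (eps * Rabs h)) by (field; lra).
  rewrite <- (Rmult_1_l (eps * Rabs h)) at 2. apply Rmult_le_compat_r. apply Rmult_le_pos; lra. apply Rle_div_l; lra.
Qed.
Lemma rder_shift F c t l : rder F (t + c) l -> rder (fun t => F (t + c)) t l.
Proof.
  intros H eps He. destruct (H eps He) as [d [d0 hd]]. exists d. split; auto. intros h Hh. specialize (hd h Hh).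
  now replace (t + h + c) with (t + c + h) by ring.
Qed.
Lemma rder_shift_l F c t l : rder F (c + t) l -> rder (fun t => F (c + t)) t l.
Proof.
  intros H eps He. destruct (H eps He) as [d [d0 hd]]. exists d. split; auto. intros h Hh. specialize (hd h Hh).
  now rewrite <- Rplus_assoc.
Qed.

Lemma rder_cpow s y : 0 < y -> rder (fun y => cpow y s) y (s * cpow y (s - 1))%C.
Proof.
  intros Hy. apply is_derive_rder.
  assert (L : rder (fun u => cexp (0 + RtoC u * s)%C) (ln y) (cpow y s * s)%C).
  { apply (hder_line cexp 0 s (ln y)). replace (0 + ln y * s)%C with (s * RtoC (ln y))%C by ring. apply hder_cexp. }
  apply rder_is_derive in L.
  assert (D := @is_derive_comp R_AbsRing C_R_NormedModule _ ln y _ (/ y) L).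
  assert (E : @eq C (scal (V := C_R_NormedModule) (/ y) (cpow y s * s)%C) (s * cpow y (s - 1))%C).
  { rewrite scal_R_Cmult. unfold Cminus. rewrite cpow_plus, cpow_opp, cpow_1, RtoC_inv by lra. ring. }
  rewrite <- E. eapply is_derive_ext; [|apply D]. intros t. apply (f_equal cexp). ring.
  apply is_derive_Reals. now apply derivable_pt_lim_ln.
Qed.

(* [k]-fold application of [u - int_0^1 u(. + t) dt] to [g j]; [g (j - 1)] serves as antiderivative of [g j]. *)
Fixpoint mdiff (g : nat -> R -> C) (k j : nat) (y : R) : C :=
  match k with
  | O => g j y
  | S k => (mdiff g k j y - (mdiff g k (pred j) (y + 1) - mdiff g k (pred j) y))%C
  end.

(** The condition [k <= j] is needed because every level refers back to [pred j], and [pred 0 = 0]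
    would break the chain of antiderivatives. *)
Lemma mdiff_rder g k : (forall j y, 0 < y -> rder (g j) y (g (S j) y)) -> forall j y, (k <= j)%nat -> 0 < y -> rder (mdiff g k j) y (mdiff g k (S j) y).
Proof.
  intros Hg. induction k; intros j y Hj Hy; simpl. now apply Hg.
  destruct j as [|j]; [lia|]. simpl pred.
  apply rder_minus. apply IHk; auto; lia. apply rder_minus.
  apply (rder_shift (mdiff g k j) 1). apply IHk; try lia; lra. apply IHk; auto; lia.
Qed.

Lemma mdiff_bound g k : (forall j y, 0 < y -> rder (g j) y (g (S j) y)) -> forall j y M, (k <= j)%nat -> 0 < y -> (forall t, y <= t -> Cmod (g (j + k)%nat t) <= M) ->
  Cmod (mdiff g k j y) <= M.
Proof.
  intros Hg. induction k; intros j y M Hj Hy HM.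
  - simpl. specialize (HM y (Rle_refl _)). now rewrite Nat.add_0_r in HM.
  - destruct j as [|j]; [lia|]. simpl.
    assert (M0 : 0 <= M). { eapply Rle_trans; [apply Cmod_ge_0|apply (HM y (Rle_refl _))]. }
    set (G := mdiff g k j).
    assert (D2 : forall t, 0 <= t <= 1 -> Cmod (mdiff g k (S j) (y + t) - mdiff g k (S j) y) <= M).
    { intros t Ht. apply Rle_trans with (M * (y + t - y)); [|replace (y + t - y) with t by ring; rewrite <- (Rmult_1_r M) at 2; apply Rmult_le_compat_l; lra].
      apply rder_mean_value with (fun u => mdiff g k (S (S j)) u). lra.
      - intros u Hu. apply mdiff_rder; [auto|lia|lra].
      - intros u Hu. apply IHk; try lia; try lra. intros w Hw. replace (S (S j) + k)%nat with (S j + S k)%nat by lia. apply HM. lra. }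
    assert (D1 : Cmod ((G (y + 1)%R - RtoC 1 * mdiff g k (S j) y) - (G (y + 0)%R - RtoC 0 * mdiff g k (S j) y)) <= M * (1 - 0)).
    { apply (rder_mean_value (fun t => G (y + t)%R - RtoC t * mdiff g k (S j) y)%C (fun t => mdiff g k (S j) (y + t)%R - mdiff g k (S j) y)%C). lra.
      - intros t Ht. apply rder_minus. apply rder_shift_l. apply mdiff_rder; [auto|lia|lra].
        intros e He. exists 1. split. lra. intros h _. rewrite RtoC_plus.
        replace ((t + h) * mdiff g k (S j) y - t * mdiff g k (S j) y - mdiff g k (S j) y * h)%C with (RtoC 0) by ring.
        rewrite Cmod_0. apply Rmult_le_pos. lra. apply Rabs_pos.
      - intros t Ht. apply D2; auto. }
    rewrite Rplus_0_r in D1. rewrite Cmod_minus_sym in D1.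
    replace (mdiff g k (S j) y - (G (y + 1)%R - G y))%C with (G y - 0 * mdiff g k (S j) y - (G (y + 1)%R - 1 * mdiff g k (S j) y))%C by ring.
    lra.
Qed.

Fixpoint ffact (z : C) (j : nat) : C :=
  match j with O => RtoC 1 | S j => (ffact z j * (z - RtoC (INR j)))%C end.

Lemma ffact_add z j m : ffact z (j + m) = (ffact z j * ffact (z - RtoC (INR j)) m)%C.
Proof.
  induction m; simpl. rewrite Nat.add_0_r. ring.
  rewrite Nat.add_succ_r. simpl. rewrite IHm, plus_INR, RtoC_plus. ring.
Qed.
Lemma hol_ffact f j z : hol f z -> hol (fun w => ffact (f w) j) z.
Proof.
  intros H. induction j; simpl. apply hol_const. apply hol_mult; auto. apply hol_minus; auto. apply hol_const.
Qed.
Lemma ffact_neq_0 z j : (forall i, (i < j)%nat -> z <> RtoC (INR i)) -> ffact z j <> 0.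
Proof.
  induction j; simpl; intros H. apply C1_nz. apply Cmult_neq_0. apply IHj; auto.
  intros E. apply (H j ltac:(lia)). now apply Ceq_minus.
Qed.
Lemma ffact_bound z j B : Cmod z <= B -> Cmod (ffact z j) <= (B + INR j) ^ j.
Proof.
  intros H. assert (B0 : 0 <= B) by (eapply Rle_trans; [apply Cmod_ge_0|apply H]).
  assert (K : forall m, (m <= j)%nat -> Cmod (ffact z m) <= (B + INR j) ^ m).
  { assert (j0 := pos_INR j). induction m; intros Hm; simpl. rewrite Cmod_1; lra.
    rewrite Cmod_mult, Rmult_comm. apply Rmult_le_compat; try apply Cmod_ge_0.
    eapply Rle_trans. apply Cmod_minus_le. rewrite Cmod_RtoC_pos by apply pos_INR.
    assert (INR m <= INR j) by (apply le_INR; lia). lra. apply IHm; lia. }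
  apply K; lia.
Qed.

(* The [j]-th derivative of the [K]-fold antiderivative of [y^(-s)], so that [pgerm K s K y = y^(-s)]. *)
Definition pgerm (K : nat) (s : C) (j : nat) (y : R) : C :=
  (ffact (RtoC (INR K) - s) j / ffact (RtoC (INR K) - s) K * cpow y (RtoC (INR K) - s - RtoC (INR j)))%C.

Lemma pgerm_rder K s j y : 0 < y -> rder (pgerm K s j) y (pgerm K s (S j) y).
Proof.
  intros Hy. unfold pgerm.
  replace (ffact (RtoC (INR K) - s) (S j) / ffact (RtoC (INR K) - s) K * cpow y (RtoC (INR K) - s - RtoC (INR (S j))))%C
    with (ffact (RtoC (INR K) - s) j / ffact (RtoC (INR K) - s) K * ((RtoC (INR K) - s - RtoC (INR j)) * cpow y (RtoC (INR K) - s - RtoC (INR j) - 1)))%C.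
  - apply rder_scal. now apply rder_cpow.
  - rewrite S_INR, RtoC_plus. replace (RtoC (INR K) - s - (RtoC (INR j) + 1))%C with (RtoC (INR K) - s - RtoC (INR j) - 1)%C by ring.
    simpl. unfold Cdiv. ring.
Qed.

Lemma Rpower_between y p p1 p2 : p1 <= p <= p2 -> Rpower y p <= Rpower y p1 + Rpower y p2.
Proof.
  intros H. unfold Rpower. assert (h1 := exp_pos (p1 * ln y)). assert (h2 := exp_pos (p2 * ln y)).
  destruct (Rle_lt_dec 0 (ln y)).
  - assert (exp (p * ln y) <= exp (p2 * ln y)) by (apply exp_le; nra). lra.
  - assert (exp (p * ln y) <= exp (p1 * ln y)) by (apply exp_le; nra). lra.
Qed.

Lemma Rpower_INR_lim c p : 0 < c -> 0 < p -> is_lim_seq (fun n => Rpower (INR n + c) (- p)) 0.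
Proof.
  intros Hc Hp. unfold Rpower. apply is_lim_seq_spec. intros eps.
  assert (e0 := cond_pos eps).
  destruct (nfloor_ex (exp (- (ln eps / p)))) as [N [_ hN]]. left; apply exp_pos.
  exists (S N). intros n Hn. rewrite Rminus_0_r, Rabs_pos_eq by (left; apply exp_pos).
  apply le_INR in Hn. rewrite S_INR in Hn.
  apply Rlt_le_trans with (exp (ln eps)); [|rewrite exp_ln; [lra|auto]]. apply exp_increasing.
  assert (h : - (ln eps / p) < ln (INR n + c)). { rewrite <- (ln_exp (- (ln eps / p))). apply ln_increasing. apply exp_pos. lra. }
  apply (Rmult_lt_compat_l p) in h; auto. replace (p * - (ln eps / p)) with (- ln eps) in h by (field; lra). lra.
Qed.

Lemma Cser_choice (a : nat -> C -> C) (P : C -> Prop) : (forall s, P s -> exists l, Cser (fun n => a n s) l) ->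
  exists F, forall s, P s -> Cser (fun n => a n s) (F s).
Proof.
  intros H. exists (fun s => match excluded_middle_informative (P s) with
    | left p => proj1_sig (constructive_indefinite_description _ (H s p)) | right _ => RtoC 0 end).
  intros s p. destruct excluded_middle_informative as [q|]; [|tauto].
  apply (proj2_sig (constructive_indefinite_description _ (H s q))).
Qed.

(** The form in which Weierstrass' theorem is applied: the sums are chosen for all points of [P] at
    once, and radius and majorant may vary with the point. *)
Lemma hol_series_choice (a : nat -> C -> C) (P : C -> Prop) :
  (forall s0, P s0 -> exists r M L, 0 < r /\ Rser M L /\ forall s, Cmod (s - s0) < r -> P s /\ forall n, hol (a n) s /\ Cmod (a n s) <= M n) ->
  exists F, forall s, P s -> hol F s /\ Cser (fun n => a n s) (F s).
Proof.
  intros H. destruct (Cser_choice a P) as [F HF].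
  - intros s p. destruct (H s p) as [r [M [L [r0 [HM h]]]]].
    destruct (Cser_dominated (fun n => a n s) M L) as [l [hl _]]; eauto.
    intros k. apply h. replace (s - s)%C with (RtoC 0) by ring. now rewrite Cmod_0.
  - exists F. intros s p. split; auto. destruct (H s p) as [r [M [L [r0 [HM h]]]]].
    apply (hol_series a F M L s r); auto; intros; try apply h; auto. apply HF. now apply h.
Qed.

Lemma pos_INR_plus n a : 0 < a -> 0 < INR n + a.
Proof. intros. assert (h := pos_INR n). lra. Qed.

Lemma Re_close s s0 r : Cmod (s - s0) < r -> Re s0 - r < Re s < Re s0 + r.
Proof.
  intros H. assert (h := re_le_Cmod (s - s0)). rewrite Re_minus in h.
  assert (h2 := Rle_lt_trans _ _ _ h H). apply Rabs_def2 in h2. lra.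
Qed.
Lemma Im_close s s0 r : Cmod (s - s0) < r -> Im s0 - r < Im s < Im s0 + r.
Proof.
  intros H. assert (h := im_le_Cmod (s - s0)). rewrite Im_minus in h.
  assert (h2 := Rle_lt_trans _ _ _ h H). apply Rabs_def2 in h2. lra.
Qed.

Lemma hurwitz_series a : 0 < a -> exists F, forall s, 1 < Re s ->
  hol F s /\ Cser (fun n => cpow (INR n + a) (- s)) (F s).
Proof.
  intros Ha. apply (hol_series_choice (fun n s => cpow (INR n + a) (- s)) (fun s => 1 < Re s)).
  intros s0 H0. set (r := (Re s0 - 1) / 2).
  destruct (Rser_power (Re s0 - r) a) as [L1 H1]; auto. unfold r; lra.
  destruct (Rser_power (Re s0 + r) a) as [L2 H2]; auto. unfold r; lra.
  assert (r0 : 0 < r) by (unfold r; lra).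
  exists r. eexists. exists (L1 + L2). split. exact r0. split. apply Rser_plus; eassumption.
  intros s Hs. apply Re_close in Hs. split. unfold r in Hs; lra. intros n. split.
  - apply hol_cpow, hol_opp, hol_id.
  - rewrite Cmod_cpow, re_opp. assert (q := Rpower_between (INR n + a) (- Re s) (- (Re s0 + r)) (- (Re s0 - r)) ltac:(lra)). lra.
Qed.

Lemma hol_mdiff_pgerm K k : forall j y s, (forall i, (i < K)%nat -> (RtoC (INR K) - s)%C <> RtoC (INR i)) ->
  hol (fun s => mdiff (pgerm K s) k j y) s.
Proof.
  induction k; intros j y s Hs; simpl.
  - unfold pgerm. assert (h : hol (fun s => RtoC (INR K) - s)%C s) by (apply hol_minus; auto using hol_const, hol_id).
    apply hol_mult. apply hol_div. now apply ffact_neq_0. apply (hol_ffact (fun s => RtoC (INR K) - s)%C); auto.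
    apply (hol_ffact (fun s => RtoC (INR K) - s)%C); auto. apply hol_cpow. apply hol_minus; auto using hol_const.
  - apply hol_minus; auto. apply hol_minus; auto.
Qed.

(** The denominator of [pgerm] vanishes at [s = 1, ..., K], and cutting at [Re s < 2] leaves only
    the true pole [s = 1]. *)
Lemma half_plane_pole_free K s : Re s < 2 -> s <> 1 -> forall i, (i < K)%nat -> (RtoC (INR K) - s)%C <> RtoC (INR i).
Proof.
  intros H2 H1 i Hi E. assert (s = RtoC (INR K - INR i)) by (rewrite RtoC_minus, <- E; ring).
  assert (I : INR K - INR i = INR (K - i)) by (rewrite minus_INR by lia; auto). rewrite I in H. subst s.
  destruct (K - i)%nat as [|[|n]] eqn:EE. lia. apply H1. reflexivity.
  rewrite re_RtoC in H2. rewrite !S_INR in H2. assert (h := pos_INR n). lra.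
Qed.

Lemma Cmod_pgerm K s j y : ffact (RtoC (INR K) - s) K <> 0 ->
  Cmod (pgerm K s j y) = Cmod (ffact (RtoC (INR K) - s) j / ffact (RtoC (INR K) - s) K) * Rpower y (INR K - Re s - INR j).
Proof. intros H. unfold pgerm. rewrite Cmod_mult, Cmod_cpow, !Re_minus, !re_RtoC. reflexivity. Qed.

(** Replacing [y^(-s)] by its [K]-fold difference with unit averages gives terms of size [y^(-s-K)],
    so the series [V] converges for [Re s > 1 - K]. For [Re s > 1] the differences can be undone one
    at a time: each changes the sum by a telescoping series, equal to a boundary term at [a] that is
    holomorphic away from [s = 1]. *)
Lemma hurwitz_left a K : 0 < a -> exists F, forall s, 1 - INR K < Re s < 2 -> s <> 1 ->
  hol F s /\ (1 < Re s -> Cser (fun n => cpow (INR n + a) (- s)) (F s)).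
Proof.
  intros Ha.
  destruct (hol_series_choice (fun n s => mdiff (pgerm K s) K K (INR n + a)) (fun s => 1 - INR K < Re s < 2 /\ s <> 1)) as [V HV].
  - intros s0 [H0 H1].
    assert (d1 : 0 < Cmod (s0 - 1)). { apply Cmod_gt_0. intros E. apply H1. now apply Ceq_minus. }
    set (r := Rmin (Cmod (s0 - 1)) (Rmin ((Re s0 - (1 - INR K)) / 2) (2 - Re s0))).
    assert (r0 : 0 < r) by (repeat apply Rmin_pos; lra).
    assert (ra : r <= Cmod (s0 - 1)) by apply Rmin_l.
    assert (rb : r <= (Re s0 - (1 - INR K)) / 2) by (eapply Rle_trans; [apply Rmin_r|apply Rmin_l]).
    assert (rc : r <= 2 - Re s0) by (eapply Rle_trans; [apply Rmin_r|apply Rmin_r]).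
    destruct (Rser_power (Re s0 - r + INR K) a) as [L1 P1]; auto. lra.
    destruct (Rser_power (Re s0 + r + INR K) a) as [L2 P2]; auto. lra.
    set (B := (Cmod s0 + r + INR K) ^ K).
    exists r. eexists. exists (B * (L1 + L2)). split; auto. split. apply Rser_scal, Rser_plus; eassumption.
    intros s Hs. assert (Rs := Re_close _ _ _ Hs).
    assert (s1 : s <> 1). { intros ->. rewrite Cmod_minus_sym in Hs. lra. }
    split. split; auto. lra. intros n.
    assert (PF := half_plane_pole_free K s ltac:(lra) s1).
    split. apply hol_mdiff_pgerm; auto.
    assert (np := pos_INR_plus n a Ha). assert (fn := ffact_neq_0 _ _ PF).
    apply mdiff_bound; auto. intros; now apply pgerm_rder.
    intros t Ht. rewrite Cmod_pgerm by auto. apply Rmult_le_compat. apply Cmod_ge_0. left; apply exp_pos.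
    (* The denominator cancels: the [K]-th derivative of [y^(-s)] carries the falling factorial of
       [- s], which is bounded near [s0]. *)
    + rewrite ffact_add. replace (ffact (INR K - s) K * ffact (INR K - s - INR K) K / ffact (INR K - s) K)%C with (ffact (INR K - s - INR K) K) by (field; auto).
      apply ffact_bound. replace (INR K - s - INR K)%C with (- s)%C by ring. rewrite Cmod_opp.
      assert (q := Cmod_triangle (s - s0) s0). replace (s - s0 + s0)%C with s in q by ring. lra.
    + rewrite plus_INR. replace (INR K - Re s - (INR K + INR K)) with (- (Re s + INR K)) by ring.
      eapply Rle_trans. apply (Rpower_decr (Re s + INR K) (INR n + a) t); lra.
      assert (q := Rpower_between (INR n + a) (- (Re s + INR K)) (- (Re s0 + r + INR K)) (- (Re s0 - r + INR K)) ltac:(lra)). lra.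
  - exists (fun s => V s - psum (fun k => mdiff (pgerm K s) k (pred K) a) K)%C.
    intros s Hs s1. destruct (HV s (conj Hs s1)) as [hV sV].
    assert (PF := half_plane_pole_free K s ltac:(lra) s1). assert (fn := ffact_neq_0 _ _ PF). split.
    + apply hol_minus; auto. apply (hol_psum (fun k s => mdiff (pgerm K s) k (pred K) a)). intros k _. now apply hol_mdiff_pgerm.
    + intros Hs1.
      assert (ST : forall k, (k <= K)%nat -> forall l, Cser (fun n => mdiff (pgerm K s) k K (INR n + a)) l ->
         Cser (fun n => cpow (INR n + a) (- s)) (l - psum (fun k => mdiff (pgerm K s) k (pred K) a) k)%C).
      { induction k; intros Hk l Hl.
        - simpl in *. replace (l - 0)%C with l by ring. eapply Cser_ext; [|apply Hl]. intros n. simpl. unfold pgerm.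
          replace (INR K - s - INR K)%C with (- s)%C by ring. field; auto.
        - set (G := mdiff (pgerm K s) k (pred K)).
          assert (LG : Clim (fun n => G (INR n + a)) 0).
          { apply Clim_squeeze with (fun n => Cmod (ffact (RtoC (INR K) - s) (pred K + k) / ffact (RtoC (INR K) - s) K) * Rpower (INR n + a) (- (Re s - 1 + INR k))).
            - intros n. replace (G (INR n + a)%R - 0)%C with (G (INR n + a)) by ring. assert (np := pos_INR_plus n a Ha).
              assert (k0 := pos_INR k).
              apply mdiff_bound; auto. intros; now apply pgerm_rder. lia. intros t Ht. rewrite Cmod_pgerm by auto.
              apply Rmult_le_compat_l. apply Cmod_ge_0. destruct K as [|K']; [lia|]. simpl pred. rewrite S_INR, plus_INR.
              replace (INR K' + 1 - Re s - (INR K' + INR k)) with (- (Re s - 1 + INR k)) by ring. apply Rpower_decr; lra.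
            - assert (k0 := pos_INR k).
              replace (Finite 0) with (Rbar_mult (Cmod (ffact (RtoC (INR K) - s) (pred K + k) / ffact (RtoC (INR K) - s) K)) 0) by (simpl; f_equal; ring).
              apply is_lim_seq_scal_l. apply Rpower_INR_lim; lra. }
          apply Cser_telescope in LG. change (INR 0) with 0 in LG. rewrite Rplus_0_l in LG.
          replace (l - psum (fun k => mdiff (pgerm K s) k (pred K) a) (S k))%C
            with ((l - (G a - 0)) - psum (fun k => mdiff (pgerm K s) k (pred K) a) k)%C by (simpl; unfold G; ring).
          apply IHk. lia. eapply Cser_ext; [|apply (Cser_minus _ _ _ _ Hl LG)].
          intros n. cbv beta. cbn [mdiff]. fold G.
          replace (INR (S n) + a) with (INR n + a + 1) by (rewrite S_INR; ring). ring. }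
      apply ST; auto.
Qed.

(** Off the real axis the segment from [s] to the middle of the known strip is horizontal and stays
    clear of exceptional real points. A real [s] at which [D] is holomorphic is then reached by
    continuity from above. *)
Lemma identity_strip D lo a b hi : lo <= a < b -> b <= hi ->
  (forall s, lo < Re s < hi -> Im s <> 0 -> hol D s) -> (forall s, a < Re s < b -> D s = 0) ->
  forall s, lo < Re s < hi -> hol D s -> D s = 0.
Proof.
  intros Hab Hb HD H0.
  assert (A : forall s, lo < Re s < hi -> Im s <> 0 -> D s = 0).
  { intros s Hs Hi. set (c := (a + b) / 2).
    set (m := Rmin (Rmin (Rmin (Re s - lo) (hi - Re s)) (Rmin (c - lo) (hi - c))) (Rabs (Im s))).
    assert (i0 := Rabs_pos_lt _ Hi).
    assert (m0 : 0 < m) by (repeat apply Rmin_pos; unfold c; lra).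
    assert (m4 : m <= Rabs (Im s)) by apply Rmin_r.
    assert (m5 : m <= Rmin (Rmin (Re s - lo) (hi - Re s)) (Rmin (c - lo) (hi - c))) by apply Rmin_l.
    assert (m1 : m <= Re s - lo /\ m <= hi - Re s /\ m <= c - lo /\ m <= hi - c).
    { repeat split; (eapply Rle_trans; [exact m5|]).
      eapply Rle_trans; apply Rmin_l. eapply Rle_trans; [apply Rmin_l|apply Rmin_r].
      eapply Rle_trans; [apply Rmin_r|apply Rmin_l]. eapply Rle_trans; apply Rmin_r. }
    apply identity_along_segment with (p := (c, Im s)) (r := m) (rho := (b - a) / 2); auto. lra.
    - intros z t Ht Hz. assert (hr := Re_close _ _ _ Hz). assert (hi' := Im_close _ _ _ Hz).
      rewrite re_plus, re_scal_l, Re_minus in hr. rewrite im_plus, im_scal_l, Im_minus in hi'. simpl in hr, hi'.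
      replace (Im s + t * (Im s - Im s)) with (Im s) in hi' by ring.
      apply HD. split; nra. unfold Rabs in m4. destruct Rcase_abs; lra.
    - intros z Hz. assert (hr := Re_close _ _ _ Hz). simpl in hr. apply H0. unfold c in hr. lra. }
  intros s Hs HDs. destruct (Req_dec (Im s) 0) as [e|n]; auto.
  apply Cmod_small_eq. intros eps He. replace (D s - 0)%C with (D s) by ring.
  destruct (hol_cont D s HDs eps He) as [d [d0 hd]].
  specialize (hd (s + Ci * RtoC (d / 2))%C). replace (s + Ci * (d / 2)%R - s)%C with (Ci * RtoC (d / 2))%C in hd by ring.
  rewrite Cmod_mult, Cmod_Ci, Cmod_R, Rabs_pos_eq in hd by lra. specialize (hd ltac:(lra)).
  rewrite A in hd. replace (0 - D s)%C with (- D s)%C in hd by ring. rewrite Cmod_opp in hd. lra.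
  - rewrite re_plus, re_scal_r. simpl Re. lra.
  - rewrite im_plus, im_scal_r. simpl Im. lra.
Qed.

Lemma Im_neq_0_neq_1 (s : C) : Im s <> 0 -> s <> 1.
Proof. intros H ->. now apply H. Qed.

(** Any two of the continuations [FK K] agree on their common domain, because both are sums of the
    Dirichlet series for [1 < Re s < 2] and [identity_strip] carries this to the left; so they can
    be glued. *)
Theorem hurwitz_continuation_exists a : 0 < a -> exists F, hurwitz_continuation a F.
Proof.
  intros Ha. destruct (hurwitz_series a Ha) as [Z HZ].
  assert (HL : forall K, exists F, forall s, 1 - INR K < Re s < 2 -> s <> 1 ->
    hol F s /\ (1 < Re s -> Cser (fun n => cpow (INR n + a) (- s)) (F s))) by (intros; now apply hurwitz_left).
  set (FK := fun K => proj1_sig (constructive_indefinite_description _ (HL K))).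
  assert (HF : forall K s, 1 - INR K < Re s < 2 -> s <> 1 ->
    hol (FK K) s /\ (1 < Re s -> Cser (fun n => cpow (INR n + a) (- s)) (FK K s))).
  { intros K. apply (proj2_sig (constructive_indefinite_description _ (HL K))). }
  assert (AG : forall K K', (1 <= K <= K')%nat -> forall s, 1 - INR K < Re s < 2 -> s <> 1 -> FK K s = FK K' s).
  { intros K K' HK s Hs s1. assert (K1 : INR K <= INR K') by (apply le_INR; lia). assert (K2 : INR 1 <= INR K) by (apply le_INR; lia). simpl in K2.
    apply Ceq_minus. apply (identity_strip (fun s => FK K s - FK K' s)%C (1 - INR K) 1 2 2); auto; try lra.
    - intros w Hw w1. apply Im_neq_0_neq_1 in w1. apply hol_minus; apply HF; auto; lra.
    - intros w Hw. assert (w1 : w <> 1). { intros ->. simpl in Hw. lra. } apply (proj1 (Ceq_minus _ _)).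
      apply Cser_unique with (fun n => cpow (INR n + a) (- w)); apply HF; auto; lra.
    - apply hol_minus; apply HF; auto; lra. }
  set (Ks := fun s => match Rle_dec 0 (1 - Re s) with left h => S (proj1_sig (nfloor_ex (1 - Re s) h)) | right _ => 1%nat end).
  assert (HK : forall s, (1 <= Ks s)%nat /\ 1 - INR (Ks s) < Re s).
  { intros s. unfold Ks. destruct Rle_dec as [h|h]. destruct nfloor_ex as [n hn]. simpl proj1_sig. rewrite S_INR. split. lia. lra.
    simpl. split. lia. lra. }
  (* The threshold lies inside [1 < Re s < 2], where both definitions are the sum of the same
     series, so no seam appears. *)
  set (F := fun s => if Rlt_dec (Re s) (3 / 2) then FK (Ks s) s else Z s).
  exists F. split.
  - intros s s1. apply hol_ex_derive. destruct (Rlt_le_dec (Re s) 2) as [h2|h2].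
    + destruct (HK s) as [k1 k2]. set (K0 := S (Ks s)).
      assert (EQ : forall w, 1 - INR K0 < Re w < 2 -> w <> 1 -> F w = FK K0 w).
      { intros w Hw w1. unfold F. destruct (Rlt_dec (Re w) (3 / 2)) as [h|h].
        - destruct (HK w) as [q1 q2]. destruct (Nat.le_ge_cases (Ks w) K0). apply AG; auto; lra. symmetry. apply AG; auto. unfold K0; lia.
        - apply Cser_unique with (fun n => cpow (INR n + a) (- w)). apply HZ; lra. apply HF; auto; lra. }
      assert (d1 : 0 < Cmod (s - 1)). { apply Cmod_gt_0. intros E. apply s1. now apply Ceq_minus. }
      apply hol_ext_loc with (FK K0) (Rmin (Cmod (s - 1)) (Rmin 1 (2 - Re s))).
      * repeat apply Rmin_pos; lra.
      * intros w Hw. assert (h := Re_close _ _ _ Hw).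
        assert (ra := Rmin_l (Cmod (s - 1)) (Rmin 1 (2 - Re s))).
        assert (rb := Rle_trans _ _ _ (Rmin_r (Cmod (s - 1)) (Rmin 1 (2 - Re s))) (Rmin_l _ _)).
        assert (rc := Rle_trans _ _ _ (Rmin_r (Cmod (s - 1)) (Rmin 1 (2 - Re s))) (Rmin_r _ _)).
        symmetry. apply EQ. unfold K0. rewrite S_INR. lra. intros ->. rewrite Cmod_minus_sym in Hw. lra.
      * apply HF; auto. unfold K0. rewrite S_INR. lra.
    + apply hol_ext_loc with Z (/ 2). lra. intros w Hw. apply Re_close in Hw. unfold F. destruct Rlt_dec; auto. lra. apply HZ. lra.
  - intros s Hs. apply Cser_is_series. unfold F. destruct Rlt_dec as [h|h].
    + destruct (HK s) as [q1 q2]. apply HF; auto. lra. intros ->. simpl in Hs. lra.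
    + apply HZ; auto.
Qed.

(** Existence of a continuation rules out the default branch, so the chosen function has the two
    defining properties; nothing else about it is ever needed. *)
Lemma hurwitz_spec a : 0 < a -> (forall s : C, s <> 1 -> hol (fun s => hurwitz s a) s) /\
  (forall s, 1 < Re s -> Cser (fun n => cpow (INR n + a) (- s)) (hurwitz s a)).
Proof.
  intros Ha. unfold hurwitz. destruct excluded_middle_informative as [h|n]; [|elim n; now apply hurwitz_continuation_exists].
  destruct constructive_indefinite_description as [F [H1 H2]]. simpl. split.
  - intros s Hs. exact (proj2 (hol_ex_derive F s) (H1 s Hs)).
  - intros s Hs. exact (proj2 (Cser_is_series _ _) (H2 s Hs)).
Qed.

(** * The difference of Hurwitz zeta functions at [th] and [1 - th] *)

Lemma cpow_diff_bound y y' s : 0 < y <= y' -> 0 <= Re s -> Cmod (cpow y' (- s) - cpow y (- s)) <= Cmod s * Rpower y (- (Re s + 1)) * (y' - y).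
Proof.
  intros Hy Hs. apply (rder_mean_value (fun t => cpow t (- s)) (fun t => (- s * cpow t (- s - 1))%C)). lra.
  - intros t Ht. apply rder_cpow. lra.
  - intros t Ht. rewrite Cmod_mult, Cmod_opp, Cmod_cpow. apply Rmult_le_compat_l. apply Cmod_ge_0.
    rewrite Re_minus, re_opp, re_RtoC. replace (- Re s - 1) with (- (Re s + 1)) by ring. apply Rpower_decr; lra.
Qed.

(** Pairing the terms gains one power of [n], so the series of differences converges for [Re s > 0]
    and its sum [D] is holomorphic at [s = 1] too: the two poles cancel. *)
Theorem hurwitz_diff th : 0 < th < 1 -> exists D, (forall s, 0 < Re s -> hol D s /\
   Cser (fun n => cpow (INR n + th) (- s) - cpow (INR n + (1 - th)) (- s))%C (D s)) /\
   (forall s, 0 < Re s -> s <> 1 -> (hurwitz s th - hurwitz s (1 - th))%C = D s).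
Proof.
  intros Hth.
  destruct (hol_series_choice (fun n s => cpow (INR n + th) (- s) - cpow (INR n + (1 - th)) (- s))%C (fun s => 0 < Re s)) as [D HD].
  - intros s0 H0. set (r := Re s0 / 2). set (c := Rmin th (1 - th)). assert (c0 : 0 < c) by (apply Rmin_pos; lra).
    assert (c1 : c <= th) by apply Rmin_l. assert (c2 : c <= 1 - th) by apply Rmin_r.
    assert (r0 : 0 < r) by (unfold r; lra).
    destruct (Rser_power (Re s0 - r + 1) c) as [L1 P1]; auto. unfold r; lra.
    destruct (Rser_power (Re s0 + r + 1) c) as [L2 P2]; auto. unfold r; lra.
    exists r. eexists. exists ((Cmod s0 + r) * (L1 + L2)). split. exact r0. split. apply Rser_scal, Rser_plus; eassumption.
    intros s Hs. assert (h := Re_close _ _ _ Hs). split. unfold r in h; lra. intros n. split.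
    apply hol_minus; apply hol_cpow, hol_opp, hol_id.
    assert (sb : Cmod s <= Cmod s0 + r). { assert (q := Cmod_triangle (s - s0) s0). replace (s - s0 + s0)%C with s in q by ring. lra. }
    assert (n0 := pos_INR n). assert (nc := pos_INR_plus n c c0).
    assert (K : forall y y', INR n + c <= y -> y <= y' -> y' <= y + 1 -> Cmod (cpow y' (- s) - cpow y (- s)) <= (Cmod s0 + r) * (Rpower (INR n + c) (- (Re s0 - r + 1)) + Rpower (INR n + c) (- (Re s0 + r + 1)))).
    { intros y y' hy hy' hy''. eapply Rle_trans. apply cpow_diff_bound. lra. unfold r in h; lra.
      assert (e1 : Rpower y (- (Re s + 1)) <= Rpower (INR n + c) (- (Re s + 1))) by (apply Rpower_decr; unfold r in h; lra).
      assert (e2 : Rpower (INR n + c) (- (Re s + 1)) <= Rpower (INR n + c) (- (Re s0 + r + 1)) + Rpower (INR n + c) (- (Re s0 - r + 1))) by (apply Rpower_between; lra).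
      assert (e3 : 0 < Rpower y (- (Re s + 1))) by apply exp_pos. assert (s0' := Cmod_ge_0 s).
      apply Rle_trans with (Cmod s * Rpower y (- (Re s + 1)) * 1). apply Rmult_le_compat_l. apply Rmult_le_pos; lra. lra.
      rewrite Rmult_1_r. apply Rmult_le_compat; lra. }
    destruct (Rle_lt_dec th (1 - th)). rewrite Cmod_minus_sym. apply K; lra. apply K; lra.
  - exists D. split; auto. 
    assert (Z1 := hurwitz_spec th ltac:(lra)). assert (Z2 := hurwitz_spec (1 - th) ltac:(lra)).
    assert (E1 : forall s, 1 < Re s -> (hurwitz s th - hurwitz s (1 - th))%C = D s).
    { intros s Hs. eapply Cser_unique. apply Cser_minus. apply Z1; auto. apply Z2; auto. apply HD. lra. }
    intros s Hs s1. destruct (Rlt_le_dec 1 (Re s)); auto.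
    assert (HH : forall w : C, 0 < Re w -> w <> 1 -> hol (fun s => hurwitz s th - hurwitz s (1 - th) - D s)%C w).
    { intros w Hw w1. apply hol_minus. apply hol_minus; [apply Z1|apply Z2]; auto. apply HD; lra. }
    apply Ceq_minus. apply (identity_strip (fun s => hurwitz s th - hurwitz s (1 - th) - D s)%C 0 1 2 2); auto; try lra.
    + intros w Hw w1. apply HH. lra. now apply Im_neq_0_neq_1.
    + intros w Hw. apply (proj1 (Ceq_minus _ _)). apply E1; lra.
Qed.

(** The limit exists because [D] is continuous at [1], so the default branch is excluded and the
    value is [D 1]. *)
Lemma hurwitz_diff_at1_spec th : 0 < th < 1 ->
  Cser (fun n => RtoC (/ (INR n + th) - / (INR n + (1 - th)))) (hurwitz_diff_at1 th).
Proof.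
  intros Hth. destruct (hurwitz_diff th Hth) as [D [HD HE]].
  assert (L : filterlim (fun s => (hurwitz s th - hurwitz s (1 - th))%C) (locally' (RtoC 1)) (locally (D 1))).
  { assert (h1 : hol D 1) by (apply HD; simpl; lra).
    intros P [eps HP].
    assert (K := hol_cont D 1 h1 eps (cond_pos eps)). destruct K as [d [d0 hd]].
    (* Neighbourhoods in [C] are squares here, so a point of the square of half-side [d'] is only
       known to satisfy [Cmod (s - 1) < 2 * d']; hence the halving. *)
    set (d' := Rmin d 1 / 2). assert (d'0 : 0 < d') by (unfold d'; assert (0 < Rmin d 1) by (apply Rmin_pos; lra); lra).
    exists (mkposreal d' d'0). intros s Hs s1. simpl in Hs.
    assert (B : Cmod (s - 1) < 2 * d').
    { destruct Hs as [hs1 hs2]. change (Rabs (Re s - 1) < d') in hs1. change (Rabs (Im s - 0) < d') in hs2.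
      eapply Rle_lt_trans. apply Cmod_le_Rabs. rewrite Re_minus, Im_minus. simpl (Re 1). simpl (Im 1). lra. }
    assert (B1 := Re_close _ _ _ B). simpl in B1.
    assert (q1 := Rmin_l d 1). assert (q2 := Rmin_r d 1).
    apply HP. rewrite HE; auto. apply C_NormedModule_mixin_compat1. apply hd. unfold d' in B; lra. unfold d' in B1; lra. }
  assert (E : hurwitz_diff_at1 th = D 1).
  { unfold hurwitz_diff_at1. destruct excluded_middle_informative as [h|n]; [|elim n; eauto].
    destruct constructive_indefinite_description as [L' HL']. simpl.
    rewrite <- (is_C_lim_unique _ _ _ HL'), <- (is_C_lim_unique _ _ _ L). reflexivity. }
  rewrite E. destruct (HD 1) as [_ S]. simpl; lra.
  eapply Cser_ext; [|apply S]. intros n. cbv beta. assert (n0 := pos_INR n).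
  rewrite !cpow_opp, !cpow_1, RtoC_minus, !RtoC_inv by lra. reflexivity.
Qed.

(** * Dirichlet products *)

Lemma csum_cons d l f : csum (d :: l) f = (f d + csum l f)%C.
Proof. reflexivity. Qed.
Lemma csum_app l l' f : csum (l ++ l') f = (csum l f + csum l' f)%C.
Proof. induction l as [|d l IH]. change (csum l' f = (RtoC 0 + csum l' f)%C). ring.
  simpl app. rewrite !csum_cons, IH. ring.
Qed.
Lemma csum_filter p l f : csum (filter p l) f = csum l (fun d => if p d then f d else RtoC 0).
Proof.
  induction l as [|d l IH]. reflexivity. simpl filter. rewrite csum_cons. destruct (p d); rewrite ?csum_cons, IH; auto. ring.
Qed.
Lemma csum_seq n f : csum (seq 1 n) f = psum (fun i => f (S i)) n.
Proof.
  induction n. reflexivity. rewrite seq_S, csum_app, IHn, csum_cons. simpl. change (csum nil f) with (RtoC 0). ring.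
Qed.
Lemma csum_ext l f g : (forall d, In d l -> f d = g d) -> csum l f = csum l g.
Proof.
  induction l as [|d l IH]; intros H. reflexivity. rewrite !csum_cons, (H d), IH; auto. intros; apply H; now right. now left.
Qed.
Lemma csum_scal c l f : csum l (fun d => c * f d)%C = (c * csum l f)%C.
Proof.
  induction l as [|d l IH]. change (RtoC 0 = (c * RtoC 0)%C). ring. rewrite !csum_cons, IH. ring.
Qed.
Lemma csum_mod l f M : (forall d, In d l -> Cmod (f d) <= M) -> Cmod (csum l f) <= INR (length l) * M.
Proof.
  induction l; intros H. simpl. rewrite Cmod_0. lra.
  change (csum (a :: l) f) with (f a + csum l f)%C. change (length (a :: l)) with (S (length l)). rewrite S_INR.
  eapply Rle_trans. apply Cmod_triangle. assert (h1 := H a (or_introl eq_refl)). assert (h2 := IHl (fun d hd => H d (or_intror hd))). lra.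
Qed.

Lemma divisors_list_spec n d : In d (divisors_list n) -> (1 <= d <= n)%nat /\ n = (d * (n / d))%nat.
Proof.
  unfold divisors_list. rewrite filter_In, in_seq. intros [h1 h2]. apply Nat.eqb_eq in h2. split. lia.
  assert (h := Nat.div_mod n d ltac:(lia)). lia.
Qed.
Lemma divisors_list_length n : (length (divisors_list n) <= n)%nat.
Proof. unfold divisors_list. rewrite <- (length_seq n 1) at 2. apply filter_length_le. Qed.

Lemma csum_divisors n f : csum (divisors_list n) f = psum (fun i => if Nat.eqb (n mod S i) 0 then f (S i) else RtoC 0) n.
Proof. unfold divisors_list. now rewrite csum_filter, csum_seq. Qed.

Lemma div_succ N d : (0 < d)%nat -> (S N / d = N / d + if Nat.eqb (S N mod d) 0 then 1 else 0)%nat.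
Proof.
  intros Hd. assert (h1 := Nat.div_mod N d ltac:(lia)). assert (h2 := Nat.mod_upper_bound N d ltac:(lia)).
  set (q := (N / d)%nat) in *. set (r := (N mod d)%nat) in *.
  destruct (Nat.eq_dec (S r) d) as [e|n].
  - rewrite <- (Nat.div_unique (S N) d (S q) 0), <- (Nat.mod_unique (S N) d (S q) 0) by nia. simpl. lia.
  - rewrite <- (Nat.div_unique (S N) d q (S r)), <- (Nat.mod_unique (S N) d q (S r)) by nia. simpl. lia.
Qed.

(** Induction on [N]: the quotient [N / d] grows by one in passing to [S N] exactly when [d] divides
    [S N], and that adds precisely the new divisor terms. *)
Lemma hyperbola (a b : nat -> C) N :
  psum (fun n => csum (divisors_list (S n)) (fun d => a d * b (S n / d)%nat)%C) N
  = psum (fun i => a (S i) * psum (fun j => b (S j)) (N / S i))%C N.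
Proof.
  induction N. reflexivity.
  cbn [psum]. rewrite IHN, csum_divisors. cbn [psum].
  assert (E : (S N / S N = 1)%nat) by (apply Nat.div_same; lia).
  rewrite E, Nat.Div0.mod_same, Nat.eqb_refl.
  rewrite Cplus_assoc, <- psum_plus.
  f_equal. 2:{ cbn [psum]. ring. }
  apply psum_ext. intros i Hi. rewrite div_succ by lia. destruct (Nat.eqb (S N mod S i) 0).
  - rewrite psum_split. cbn [psum]. rewrite Nat.add_0_r, Nat.add_1_r. ring.
  - rewrite Nat.add_0_r. ring.
Qed.

(** In the form given by [hyperbola] each inner sum tends to [B] and is bounded by [Lb], so
    [tannery] applies with the majorant [Lb * Ma i]. *)
Theorem dirichlet_product (a b : nat -> C) A B Ma Mb La Lb :
  Cser (fun i => a (S i)) A -> Cser (fun i => b (S i)) B ->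
  (forall i, Cmod (a (S i)) <= Ma i) -> Rser Ma La -> (forall i, Cmod (b (S i)) <= Mb i) -> Rser Mb Lb ->
  Cser (fun n => csum (divisors_list (S n)) (fun d => a d * b (S n / d)%nat)%C) (A * B)%C.
Proof.
  intros HA HB Ha HMa Hb HMb.
  assert (Mb0 : forall i, 0 <= Mb i) by (intros; eapply Rle_trans; [apply Cmod_ge_0|apply Hb]).
  apply tannery with (f := fun N i => (a (S i) * psum (fun j => b (S j)) (N / S i))%C) (g := fun i => (a (S i) * B)%C)
    (M := fun i => Lb * Ma i) (L := Lb * La) (m := fun N => N).
  - intros k. apply Clim_scal. intros eps He. destruct (HB eps He) as [N h]. exists (N * S k)%nat. intros n Hn.
    apply h. apply Nat.div_le_lower_bound; lia.
  - intros n k _. rewrite Cmod_mult, Rmult_comm. apply Rmult_le_compat; auto using Cmod_ge_0.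
    eapply Rle_trans. apply psum_mod. intros; apply Hb. now apply Rser_le.
  - now apply Rser_scal.
  - intros K. exists K. auto.
  - intros N. apply hyperbola.
  - apply Cser_ext with (fun k => B * a (S k))%C. intros; ring. rewrite Cmult_comm. now apply Cser_scal.
Qed.

(** * The Lambert-type generating functions *)

(** The exponential of [2 PI i (al + i t)], whose powers have the summands of the two Lambert series
    as imaginary and real parts. *)
Definition qexp (al t : R) : C := cexp (- (2 * PI * t), 2 * PI * al).

Lemma qexp_pow al t d : (qexp al t ^ d)%C = (exp (- (2 * PI * INR d * t)) * cos (2 * PI * INR d * al), exp (- (2 * PI * INR d * t)) * sin (2 * PI * INR d * al)).
Proof.
  assert (E : (qexp al t ^ d)%C = cexp (- (2 * PI * INR d * t), 2 * PI * INR d * al)).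
  { induction d. cbn [Cpow]. simpl INR. rewrite !Rmult_0_r, !Rmult_0_l, Ropp_0. symmetry. apply cexp_0.
    rewrite Cpow_S, IHd. unfold qexp. rewrite <- cexp_plus. f_equal. rewrite S_INR. apply C_ext; simpl; ring. }
  rewrite E. reflexivity.
Qed.

Lemma Cser_geometric (q : C) : Cmod q < 1 -> Cser (fun i => q ^ S i)%C (q / (1 - q))%C.
Proof.
  intros H. assert (q1 : (1 - q)%C <> 0). { intros e. assert (q = 1). { symmetry. now apply Ceq_minus. } subst q. rewrite Cmod_1 in H. lra. }
  assert (L : Clim (fun n => q ^ S n)%C 0).
  { apply Clim_squeeze with (fun n => Cmod q ^ S n). intros n. replace (q ^ S n - 0)%C with (q ^ S n)%C by ring. rewrite Cmod_pow; lra.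
    apply (is_lim_seq_incr_1 (fun n => Cmod q ^ n)). apply is_lim_seq_geom. rewrite Rabs_pos_eq; auto. apply Cmod_ge_0. }
  apply Cser_telescope in L. apply (Cser_scal (/ (1 - q))%C) in L.
  replace (q / (1 - q))%C with (/ (1 - q) * (q ^ 1 - 0))%C by (simpl; field; auto).
  eapply Cser_ext; [|apply L]. intros k. rewrite !Cpow_S. field. auto.
Qed.

Lemma Rser_geometric r : 0 <= r < 1 -> Rser (fun i => r ^ S i) (r / (1 - r)).
Proof.
  intros H. assert (h := Cser_Re _ _ (Cser_geometric (RtoC r) ltac:(rewrite Cmod_RtoC_pos; lra))).
  rewrite <- RtoC_minus, <- RtoC_div, re_RtoC in h by lra.
  eapply is_lim_seq_ext; [|apply h]. intros n. apply rpsum_ext. intros k _. now rewrite <- RtoC_pow, re_RtoC.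
Qed.

Lemma Cmod_qexp al t : Cmod (qexp al t) = exp (- (2 * PI * t)).
Proof. unfold qexp. now rewrite Cmod_cexp. Qed.
Lemma Cmod_qexp_lt1 al t : 0 < t -> Cmod (qexp al t) < 1.
Proof. intros. rewrite Cmod_qexp, <- exp_0. apply exp_increasing. assert (h := PI_RGT_0). nra. Qed.

Definition cotA (al t : R) : C := ccot (RtoC PI * (al, t)).

Lemma geom_cot al t : 0 < t -> (qexp al t / (1 - qexp al t))%C = (/ 2 * (Ci * cotA al t - 1))%C.
Proof.
  intros Ht. assert (h := Cmod_qexp_lt1 al t Ht). set (q := qexp al t) in *.
  assert (q1 : (1 - q)%C <> 0). { intros e. assert (q = 1). { symmetry. now apply Ceq_minus. } rewrite H, Cmod_1 in h. lra. }
  set (e := cexp (Ci * (RtoC PI * (al, t)))).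
  assert (E : q = (e * e)%C). { unfold q, e, qexp. rewrite <- cexp_plus. f_equal. Ccalc. }
  assert (e0 : e <> 0) by apply cexp_neq_0.
  unfold cotA, ccot, ccos, csin. rewrite cexp_opp. fold e.
  assert (ee : (e * e - 1)%C <> 0). { rewrite <- E. intros H. apply q1. replace (1 - q)%C with (- (q - 1))%C by ring. rewrite H. ring. }
  rewrite E. assert (ee' : (1 - e * e)%C <> 0) by (rewrite <- E; auto).
  replace (Ci * ((e + / e) / 2 / ((e - / e) / (2 * Ci))))%C with (Ci * Ci * (e * e + 1) / (e * e - 1))%C.
  rewrite Ci_sqr. field. split; auto. field. repeat split; auto using Ci_nz.
Qed.

(** [fA] and [fB] are the imaginary and the real part of [q / (1 - q)], rewritten with [geom_cot];
    in this form the partial fractions of the cotangent apply. *)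
Definition fA (al t : R) : R := / 2 * Re (cotA al t).
Definition fB (al t : R) : R := - / 2 - / 2 * Im (cotA al t).

Lemma lambert_A al t : 0 < t -> Rser (fun i => exp (- (2 * PI * INR (S i) * t)) * sin (2 * PI * INR (S i) * al)) (fA al t).
Proof.
  intros Ht. assert (h := Cser_Im _ _ (Cser_geometric _ (Cmod_qexp_lt1 al t Ht))). rewrite geom_cot in h by auto.
  replace (fA al t) with (Im (/ 2 * (Ci * cotA al t - 1))%C).
  eapply is_lim_seq_ext; [|apply h]. intros n. apply rpsum_ext. intros k _. rewrite qexp_pow. reflexivity.
  unfold fA. rewrite <- RtoC_inv, im_scal_l, Im_minus by lra. destruct (cotA al t). simpl. ring.
Qed.
Lemma lambert_B al t : 0 < t -> Rser (fun i => exp (- (2 * PI * INR (S i) * t)) * cos (2 * PI * INR (S i) * al)) (fB al t).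
Proof.
  intros Ht. assert (h := Cser_Re _ _ (Cser_geometric _ (Cmod_qexp_lt1 al t Ht))). rewrite geom_cot in h by auto.
  replace (fB al t) with (Re (/ 2 * (Ci * cotA al t - 1))%C).
  eapply is_lim_seq_ext; [|apply h]. intros n. apply rpsum_ext. intros k _. rewrite qexp_pow. reflexivity.
  unfold fB. rewrite <- RtoC_inv, re_scal_l, Re_minus by lra. destruct (cotA al t). simpl. field.
Qed.

(** * The Bessel series as a bilateral Laplace transform *)

Lemma exp_neg_pow K u : 0 < u -> (0 < K)%nat -> exp (- u) <= (INR K / u) ^ K.
Proof.
  intros Hu HK. assert (K0 : 0 < INR K) by now apply lt_0_INR.
  assert (E : exp (- u) = (exp (- (u / INR K))) ^ K).
  { clear HK. assert (P : forall n, (exp (- (u / INR K))) ^ n = exp (- (u / INR K) * INR n)).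
    { induction n; cbn [pow]. simpl. now rewrite Rmult_0_r, exp_0. rewrite IHn, <- exp_plus, S_INR. f_equal. ring. }
    rewrite P. f_equal. field. lra. }
  rewrite E. apply pow_incr. split. left; apply exp_pos. rewrite exp_Ropp.
  assert (uK : 0 < u / INR K) by now apply Rdiv_lt_0_compat.
  replace (INR K / u) with (/ (u / INR K)) by (field; lra). apply Rinv_le_contravar; auto.
  assert (h := exp_ineq1_le (u / INR K)). lra.
Qed.

Definition wexp (c x y : R) : R := exp (- (c * exp y) - c * x * exp (- y)).

(** The exponent grows exponentially in [|y|] on both sides, so any prescribed rate is reached:
    [exp (- c exp v)] is at most a constant times [exp (- n v)] with [n > mu]. *)
Lemma wexp_decay c x mu : 0 < c -> 0 < x -> exists K, 0 <= K /\ forall y, wexp c x y <= K * exp (- mu * Rabs y).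
Proof.
  intros Hc Hx. destruct (nfloor_ex (Rmax 0 mu)) as [k [_ hk]]. apply Rmax_l.
  set (n := S k). assert (hn : mu < INR n) by (unfold n; rewrite S_INR; assert (h := Rmax_r 0 mu); lra).
  assert (n0 : 0 < INR n) by (apply lt_0_INR; unfold n; lia).
  set (K1 := (INR n / c) ^ n). set (K2 := (INR n / (c * x)) ^ n).
  assert (cx : 0 < c * x) by nra.
  assert (k1 : 0 <= K1). { apply pow_le. left; now apply Rdiv_lt_0_compat. }
  assert (k2 : 0 <= K2). { apply pow_le. left; now apply Rdiv_lt_0_compat. }
  assert (P : forall u m, exp u ^ m = exp (u * INR m)).
  { intros u. induction m; cbn [pow]. simpl. now rewrite Rmult_0_r, exp_0. rewrite IHm, <- exp_plus, S_INR. f_equal. ring. }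
  exists (K1 + K2). split. lra. intros y.
  assert (B : forall d v, 0 < d -> 0 <= v -> exp (- (d * exp v)) <= (INR n / d) ^ n * exp (- mu * v)).
  { intros d v Hd Hv. assert (ev := exp_pos v). eapply Rle_trans. apply (exp_neg_pow n). nra. unfold n; lia.
    replace (INR n / (d * exp v)) with (INR n / d * exp (- v)) by (rewrite exp_Ropp; field; split; lra).
    rewrite Rpow_mult_distr, P. apply Rmult_le_compat_l. apply pow_le. left; now apply Rdiv_lt_0_compat.
    apply exp_le. nra. }
  assert (ey := exp_pos y). assert (ey' := exp_pos (- y)).
  unfold wexp. destruct (Rle_lt_dec 0 y).
  - rewrite Rabs_pos_eq by auto. apply Rle_trans with (exp (- (c * exp y))). apply exp_le. nra.
    assert (h := B c y Hc r). fold K1 in h. assert (p := exp_pos (- mu * y)). nra.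
  - rewrite Rabs_left by auto. apply Rle_trans with (exp (- (c * x * exp (- y)))). apply exp_le. nra.
    assert (h := B (c * x) (- y) cx ltac:(lra)). fold K2 in h. assert (p := exp_pos (- mu * - y)). nra.
Qed.

Definition hdm (x : R) (d m : nat) (y : R) : R := exp (- (2 * PI * INR d * exp y) - 2 * PI * INR m * x * exp (- y)).

(** For [d, m >= 1] half of the exponent dominates that of [wexp PI], which keeps the decay in [y].
    The other half is turned by [exp_neg_pow] into cubes [d^(-3)] and [m^(-3)], where the factors
    [exp (3 y)] and [exp (- 3 y)] cancel. Cubes are chosen since an integer [n] has up to [n]
    divisors, which leaves the summable [n^(-2)]. *)
Lemma hdm_bound x d m y : 0 < x -> (1 <= d)%nat -> (1 <= m)%nat ->
  hdm x d m y <= (27 / (PI * PI * PI)) ^ 2 / x ^ 3 * / (INR (d * m) ^ 3) * wexp PI x y.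
Proof.
  intros Hx Hd Hm. assert (pp := PI_RGT_0). apply le_INR in Hd. apply le_INR in Hm. simpl in Hd, Hm.
  assert (ey := exp_pos y). assert (ey' := exp_pos (- y)).
  apply Rle_trans with (exp (- (PI * INR d * exp y)) * exp (- (PI * INR m * x * exp (- y))) * wexp PI x y).
  - unfold hdm, wexp. rewrite <- !exp_plus. apply exp_le. 
    assert (0 <= PI * exp y * (INR d - 1)) by (apply Rmult_le_pos; [apply Rmult_le_pos|]; lra).
    assert (0 <= PI * x * exp (- y) * (INR m - 1)) by (apply Rmult_le_pos; [apply Rmult_le_pos; [apply Rmult_le_pos|]|]; lra). lra.
  - apply Rmult_le_compat_r. left; apply exp_pos.
    assert (u1 : 0 < PI * INR d * exp y) by (apply Rmult_lt_0_compat; [apply Rmult_lt_0_compat|]; lra).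
    assert (u2 : 0 < PI * INR m * x * exp (- y)) by (apply Rmult_lt_0_compat; [apply Rmult_lt_0_compat; [apply Rmult_lt_0_compat|]|]; lra).
    assert (h1 := exp_neg_pow 3 _ u1 ltac:(lia)). assert (h2 := exp_neg_pow 3 _ u2 ltac:(lia)).
    assert (e1 := exp_pos (- (PI * INR d * exp y))). assert (e2 := exp_pos (- (PI * INR m * x * exp (- y)))).
    eapply Rle_trans. apply Rmult_le_compat; [lra|lra|exact h1|exact h2].
    right. rewrite mult_INR, exp_Ropp. simpl INR. field. repeat split; lra.
Qed.

Lemma continuous_exp_comp (u : R -> R) t : ex_derive u t -> continuous (fun y => exp (u y)) t.
Proof. intros. apply (ex_derive_continuous (fun y => exp (u y))). auto_derive. auto. Qed.

Lemma fcont_hdm x d m : fcont (fun y => RtoC (hdm x d m y)).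
Proof. intros t. apply ccont_RtoC. unfold hdm. apply continuous_exp_comp. auto_derive. auto. Qed.

Lemma Cmod_laplace nu (g : R) c K lam y : 0 <= c -> Rabs g <= c * (K * exp (- (lam + Rabs (Re nu)) * Rabs y)) ->
  Cmod (cexp (nu * RtoC y) * RtoC g) <= c * K * exp (- lam * Rabs y).
Proof.
  intros Hc H. rewrite Cmod_mult, Cmod_cexp_lin, Cmod_R.
  assert (e := exp_pos (Re nu * y)).
  apply Rle_trans with (exp (Rabs (Re nu) * Rabs y) * (c * (K * exp (- (lam + Rabs (Re nu)) * Rabs y)))).
  apply Rmult_le_compat; auto using Rabs_pos. lra. apply exp_le. rewrite <- Rabs_mult. apply Rle_abs.
  right. replace (- (lam + Rabs (Re nu)) * Rabs y) with (- lam * Rabs y + - (Rabs (Re nu) * Rabs y)) by ring.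
  rewrite exp_plus, exp_Ropp. field. assert (q := exp_pos (Rabs (Re nu) * Rabs y)). lra.
Qed.

Lemma isI_hdm_exists x nu d m : 0 < x -> (1 <= d)%nat -> (1 <= m)%nat ->
  exists l, isI (fun y => cexp (nu * RtoC y) * RtoC (hdm x d m y))%C l.
Proof.
  intros Hx Hd Hm. assert (pp := PI_RGT_0).
  destruct (wexp_decay PI x (1 + Rabs (Re nu)) pp Hx) as [K [K0 HK]].
  set (c := (27 / (PI * PI * PI)) ^ 2 / x ^ 3 * / (INR (d * m) ^ 3)).
  assert (c0 : 0 <= c).
  { unfold c. assert (0 < INR (d * m)) by (apply lt_0_INR; nia). apply Rmult_le_pos. apply Rmult_le_pos. apply pow2_ge_0.
    left; apply Rinv_0_lt_compat, pow_lt; auto. left; apply Rinv_0_lt_compat, pow_lt; auto. }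
  destruct (isI_exists (fun y => cexp (nu * RtoC y) * RtoC (hdm x d m y))%C (c * K) 1) as [l [h _]]; eauto.
  lra. intros t. apply ccont_mult. apply fcont_cexp_lin. apply fcont_hdm.
  intros y. apply Cmod_laplace; auto. rewrite Rabs_pos_eq by (left; apply exp_pos).
  eapply Rle_trans. apply hdm_bound; auto. fold c. apply Rmult_le_compat_l; auto.
Qed.

(** The even function [cosh] folds the whole line onto the half-line: the two halves combine into
    [2 ccosh (nu t)], whence the factor [1 / 2]. *)
Lemma besselK_isI nu z l : isI (fun t => cexp (nu * RtoC t) * RtoC (exp (- z * cosh t)))%C l -> besselK nu z = (l / 2)%C.
Proof.
  intros H. unfold besselK.
  apply (@is_RInt_gen_unique C_R_CompleteNormedModule (at_point 0) (Rbar_locally p_infty) _ _).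
  set (f := fun t : R => (cexp (nu * RtoC t) * RtoC (exp (- z * cosh t)))%C) in *.
  assert (Hf : fcont f).
  { intros t. apply ccont_mult. apply fcont_cexp_lin. apply ccont_RtoC. apply continuous_exp_comp. unfold cosh. auto_derive. auto. }
  assert (E : forall t, (RtoC (exp (- z * cosh t)) * ccosh (nu * RtoC t))%C = (/ 2 * (f t + f (- t)%R))%C).
  { intros t. unfold f, ccosh. rewrite RtoC_opp. replace (nu * - RtoC t)%C with (- (nu * RtoC t))%C by ring.
    replace (cosh (- t)) with (cosh t) by (unfold cosh; rewrite Ropp_involutive; f_equal; ring). field. }
  intros P HP.
  apply (@locally_norm_le_locally R_AbsRing C_R_NormedModule) in HP. destruct HP as [eps HP].
  destruct (H (eps * 2)) as [L [L0 HL]]. assert (h := cond_pos eps); lra.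
  exists (fun a => a = 0) (fun b => L <= b).
  - reflexivity.
  - exists L. intros b Hb. lra.
  - intros a b -> Hb. simpl. exists (CI (fun t => RtoC (exp (- z * cosh t)) * ccosh (nu * RtoC t))%C 0 b).
    assert (Fr := fcont_reflect _ Hf). assert (Fs := fcont_plus _ _ Hf Fr).
    split.
    + apply CI_correct. lra. intros t _. eapply ccont_ext. intros s; symmetry; apply E. apply (fcont_scal _ _ Fs).
    + apply HP. unfold ball_norm. rewrite <- Cmod_norm.
      rewrite (CI_ext _ (fun t => / 2 * (f t + f (- t)%R))%C) by (auto; lra).
      rewrite CI_scal, CI_plus by (try lra; now apply fcont_icont).
      replace (CI (fun t => f (- t)) 0 b) with (CI f (- b) 0).
      2:{ rewrite CI_reflect' by (auto; lra). now rewrite Ropp_0, Ropp_involutive. }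
      rewrite Cplus_comm, CI_Chasles by (try lra; now apply fcont_icont).
      change (Cmod (/ 2 * CI f (- b) b - l / 2)%C < eps).
      replace (/ 2 * CI f (- b) b - l / 2)%C with (RtoC (/ 2) * (CI f (- b) b - l))%C by (rewrite RtoC_inv by lra; field).
      rewrite Cmod_mult, Cmod_R, Rabs_pos_eq by lra. specialize (HL (- b) b ltac:(lra) ltac:(lra)). lra.
Qed.

Lemma bessel_hdm x nu d m l : 0 < x -> (1 <= d)%nat -> (1 <= m)%nat ->
  isI (fun y => cexp (nu * RtoC y) * RtoC (hdm x d m y))%C l ->
  (RtoC (8 * PI) * cpow x (nu / 2) * (cpow (INR (d * m)) (nu / 2) * besselK nu (4 * PI * sqrt (INR (d * m) * x)) * cpow (INR d) (- nu)) = RtoC (4 * PI) * l)%C.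
Proof.
  intros Hx Hd Hm H. assert (pp := PI_RGT_0).
  assert (d0 : 0 < INR d) by (apply lt_0_INR; lia). assert (m0 : 0 < INR m) by (apply lt_0_INR; lia).
  (* Shifting [y] by [- c] balances the two parts of the exponent, since [d * exp (- c)] and
     [m * x * exp c] both equal [sqrt (d * m * x)]; the exponent becomes
     [- 4 PI sqrt (d * m * x) * cosh t]. *)
  set (c := (ln (INR d) - ln (INR m) - ln x) / 2).
  assert (SQ : sqrt (INR (d * m) * x) = exp ((ln (INR d) + ln (INR m) + ln x) / 2)).
  { rewrite mult_INR. assert (p1 : 0 < INR d * INR m) by nra. rewrite <- Rpower_sqrt by nra. unfold Rpower. f_equal. rewrite !ln_mult by auto. field. }
  assert (F : fcont (fun y => cexp (nu * RtoC y) * RtoC (hdm x d m y))%C).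
  { intros t. apply ccont_mult. apply fcont_cexp_lin. apply fcont_hdm. }
  assert (H2 := isI_shift _ _ (- c) F H). apply (isI_scal (cexp (nu * RtoC c))) in H2.
  2:{ intros t. apply (ccont_comp_R (fun y => cexp (nu * RtoC y) * RtoC (hdm x d m y))%C (fun t => t + - c)). 
      apply (ex_derive_continuous (fun t => t + - c)). auto_derive; auto. apply F. }
  rewrite (besselK_isI nu _ (cexp (nu * RtoC c) * l)).
  - unfold cpow. rewrite mult_INR, ln_mult, RtoC_plus by auto.
    assert (E : (cexp (nu / 2 * RtoC (ln x)) * (cexp (nu / 2 * (RtoC (ln (INR d)) + RtoC (ln (INR m)))) * cexp (nu * RtoC c) * cexp (- nu * RtoC (ln (INR d)))))%C = 1).
    { rewrite <- !cexp_plus. rewrite <- cexp_0. f_equal. unfold c. rewrite RtoC_div, !RtoC_minus by lra. field. }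
    set (e1 := cexp (nu / 2 * RtoC (ln x))) in *. set (e2 := cexp (nu / 2 * (RtoC (ln (INR d)) + RtoC (ln (INR m))))) in *.
    set (e3 := cexp (nu * RtoC c)) in *. set (e4 := cexp (- nu * RtoC (ln (INR d)))) in *.
    transitivity (RtoC (8 * PI) / 2 * l * (e1 * (e2 * e3 * e4)))%C. field.
    rewrite E, !RtoC_mult. field.
  - eapply isI_ext; [|exact H2]. intros t. cbv beta.
    rewrite Cmult_assoc, <- cexp_plus. f_equal. f_equal. rewrite RtoC_plus, RtoC_opp. ring.
    f_equal. unfold hdm. f_equal. rewrite SQ. unfold cosh.
    replace (- (t + - c)) with (- t + c) by ring. rewrite !exp_plus.
    assert (E1 : INR d * exp (- c) = exp ((ln (INR d) + ln (INR m) + ln x) / 2)).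
    { rewrite <- (exp_ln (INR d)) at 1 by auto. rewrite <- exp_plus. f_equal. unfold c. field. }
    assert (E2 : INR m * x * exp c = exp ((ln (INR d) + ln (INR m) + ln x) / 2)).
    { rewrite <- (exp_ln (INR m)) at 1 by auto. rewrite <- (exp_ln x) at 1 by auto. rewrite <- !exp_plus. f_equal. unfold c. field. }
    transitivity (- (2 * PI * exp t * (INR d * exp (- c))) - 2 * PI * exp (- t) * (INR m * x * exp c)). ring.
    rewrite E1, E2. field.
Qed.

Lemma fcont_csum l (F : nat -> R -> C) : (forall d, fcont (F d)) -> fcont (fun y => csum l (fun d => F d y)).
Proof.
  intros H. induction l as [|d l IH]; intros t. apply (ccont_const 0).
  apply (ccont_plus (F d) (fun y => csum l (fun d => F d y))). apply H. apply IH.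
Qed.
Lemma isI_csum l (F : nat -> R -> C) (v : nat -> C) : (forall d, fcont (F d)) -> (forall d, In d l -> isI (F d) (v d)) ->
  isI (fun y => csum l (fun d => F d y)) (csum l v).
Proof.
  intros HF H. induction l as [|d l IH].
  - intros eps He. exists 1. split. lra. intros a b Ha Hb. rewrite (CI_ext _ (fun _ => 0 * 0)%C), CI_scal; try lra.
    change (csum nil v) with (RtoC 0). rewrite Cmult_0_l. replace (0 - 0)%C with (RtoC 0) by ring. now rewrite Cmod_0.
    intros t _; apply ccont_const. intros t _. change (RtoC 0 = (0 * 0)%C). ring.
  - rewrite csum_cons. apply isI_plus; auto. now apply fcont_csum. apply H. now left. apply IH. intros; apply H. now right.
Qed.

Definition lapl (x th psi : R) (y : R) : C := RtoC (fA th (exp y) * fB psi (x * exp (- y))).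

(** The part with [d * m = n] of the product of the two Lambert series, at [t = exp y]; its
    transform is the [n]-th Bessel term. *)
Definition gterm (x th psi : R) (n : nat) (y : R) : C :=
  csum (divisors_list n) (fun d => RtoC (sin (2 * PI * INR d * th) * cos (2 * PI * INR (n / d) * psi) * hdm x d (n / d) y)).

Lemma gterm_series x th psi y : 0 < x -> Cser (fun k => gterm x th psi (S k) y) (lapl x th psi y).
Proof.
  intros Hx. assert (pp := PI_RGT_0). assert (ey := exp_pos y). assert (ey' := exp_pos (- y)).
  set (t := exp y). set (s := x * exp (- y)). assert (s0 : 0 < s) by (unfold s; nra).
  assert (GB : forall t, 0 < t -> exists L, Rser (fun i => exp (- (2 * PI * INR (S i) * t))) L).
  { intros r Hr. exists (exp (- (2 * PI * r)) / (1 - exp (- (2 * PI * r)))).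
    eapply is_lim_seq_ext; [|apply (Rser_geometric (exp (- (2 * PI * r))))].
    - intros n. apply rpsum_ext. intros k _.
      assert (q := Cmod_pow (qexp 0 r) (S k)). rewrite Cmod_qexp in q. rewrite <- q.
      assert (qq := Cmod_cexp (- (2 * PI * INR (S k) * r), 2 * PI * INR (S k) * 0)). rewrite qexp_pow. exact qq.
    - split. left; apply exp_pos. rewrite <- exp_0. apply exp_increasing. nra. }
  destruct (GB t ey) as [La HLa]. destruct (GB s s0) as [Lb HLb].
  unfold lapl. fold t s. rewrite RtoC_mult.
  assert (D := dirichlet_product (fun d => RtoC (exp (- (2 * PI * INR d * t)) * sin (2 * PI * INR d * th)))
    (fun m => RtoC (exp (- (2 * PI * INR m * s)) * cos (2 * PI * INR m * psi)))
    (RtoC (fA th t)) (RtoC (fB psi s)) (fun i => exp (- (2 * PI * INR (S i) * t))) (fun i => exp (- (2 * PI * INR (S i) * s))) La Lb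
    (Cser_RtoC _ _ (lambert_A th t ey)) (Cser_RtoC _ _ (lambert_B psi s s0))).
  eapply Cser_ext; [|apply D; [|exact HLa| |exact HLb]].
  - intros k. unfold gterm. apply csum_ext. intros d Hd. rewrite <- RtoC_mult. f_equal. unfold hdm. fold t.
    replace (- (2 * PI * INR d * t) - 2 * PI * INR (S k / d) * x * exp (- y)) with (- (2 * PI * INR d * t) + - (2 * PI * INR (S k / d) * s)) by (unfold s; ring).
    rewrite exp_plus. ring.
  - intros i. rewrite Cmod_R, Rabs_mult, Rabs_pos_eq by (left; apply exp_pos). rewrite <- Rmult_1_r.
    apply Rmult_le_compat_l. left; apply exp_pos. apply Rabs_le, SIN_bound.
  - intros i. rewrite Cmod_R, Rabs_mult, Rabs_pos_eq by (left; apply exp_pos). rewrite <- Rmult_1_r.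
    apply Rmult_le_compat_l. left; apply exp_pos. apply Rabs_le, COS_bound.
Qed.

Lemma gterm_bound x th psi mu : 0 < x -> exists K, forall k y,
  Cmod (gterm x th psi (S k) y) <= K * / ((INR k + 1) * (INR k + 1)) * exp (- mu * Rabs y).
Proof.
  intros Hx. assert (pp := PI_RGT_0).
  destruct (wexp_decay PI x mu pp Hx) as [K [K0 HK]].
  set (c := (27 / (PI * PI * PI)) ^ 2 / x ^ 3).
  assert (c0 : 0 <= c) by (unfold c; apply Rmult_le_pos; [apply pow2_ge_0|left; apply Rinv_0_lt_compat, pow_lt; auto]).
  exists (c * K). intros k y. assert (k0 := pos_INR k).
  eapply Rle_trans. apply csum_mod with (M := c * / (INR (S k) ^ 3) * wexp PI x y).
  - intros d Hd. apply divisors_list_spec in Hd. destruct Hd as [Hd E].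
    assert (m1 : (1 <= S k / d)%nat). { destruct (S k / d)%nat; lia. }
    rewrite Cmod_R, !Rabs_mult, (Rabs_pos_eq (hdm _ _ _ _)) by (left; apply exp_pos).
    assert (hb := hdm_bound x d (S k / d) y Hx ltac:(lia) m1). rewrite <- E in hb. fold c in hb.
    assert (s1 : Rabs (sin (2 * PI * INR d * th)) <= 1) by apply Rabs_le, SIN_bound.
    assert (s2 : Rabs (cos (2 * PI * INR (S k / d) * psi)) <= 1) by apply Rabs_le, COS_bound.
    assert (p1 := Rabs_pos (sin (2 * PI * INR d * th))). assert (p2 := Rabs_pos (cos (2 * PI * INR (S k / d) * psi))).
    assert (p3 : 0 <= hdm x d (S k / d) y) by (left; apply exp_pos).
    apply Rle_trans with (1 * hdm x d (S k / d) y); [|lra]. apply Rmult_le_compat_r; auto. nra.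
  - assert (L := le_INR _ _ (divisors_list_length (S k))). rewrite S_INR in *. specialize (HK y).
    assert (w0 : 0 <= wexp PI x y) by (left; apply exp_pos).
    assert (i0 : 0 < / (INR k + 1) ^ 3) by (apply Rinv_0_lt_compat, pow_lt; lra).
    apply Rle_trans with ((INR k + 1) * (c * / (INR k + 1) ^ 3 * wexp PI x y)).
    apply Rmult_le_compat_r; auto. apply Rmult_le_pos; auto. nra.
    replace ((INR k + 1) * (c * / (INR k + 1) ^ 3 * wexp PI x y)) with (c * / ((INR k + 1) * (INR k + 1)) * wexp PI x y) by (field; lra).
    assert (0 < / ((INR k + 1) * (INR k + 1))) by (apply Rinv_0_lt_compat; nra).
    assert (0 <= c * / ((INR k + 1) * (INR k + 1))) by nra. nra.
Qed.

Lemma fcont_gterm x th psi n : fcont (gterm x th psi n).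
Proof.
  apply (fcont_csum _ (fun d y => RtoC (sin (2 * PI * INR d * th) * cos (2 * PI * INR (n / d) * psi) * hdm x d (n / d) y))).
  intros d. intros t. eapply ccont_ext. intros s. symmetry. apply RtoC_mult. apply ccont_scal. apply fcont_hdm.
Qed.

Theorem bessel_series_laplace x th psi : 0 < x ->
  fcont (lapl x th psi) /\ (forall lam, 0 < lam -> exists c, edecay (lapl x th psi) c lam) /\
  forall nu, exists S Lsum, isI (fun y => cexp (nu * RtoC y) * lapl x th psi y)%C S /\
    Cser (fun k => let n := Datatypes.S k in
         (cpow (INR n) (nu / 2) * besselK nu (4 * PI * sqrt (INR n * x)) *
          csum (divisors_list n)
            (fun d => cpow (INR d) (- nu) *
                      RtoC (sin (2 * PI * INR d * th) *
                            cos (2 * PI * INR n * psi / INR d))))%C) Lsum /\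
    (RtoC (8 * PI) * cpow x (nu / 2) * Lsum)%C = (RtoC (4 * PI) * S)%C.
Proof.
  intros Hx. assert (pp := PI_RGT_0). destruct Rser_inv_sqr as [L2 HL2].
  assert (LJ : forall nu n, (1 <= n)%nat -> exists l,
     isI (fun y => cexp (nu * RtoC y) * gterm x th psi n y)%C l /\
     (RtoC (8 * PI) * cpow x (nu / 2) * (cpow (INR n) (nu / 2) * besselK nu (4 * PI * sqrt (INR n * x)) *
          csum (divisors_list n) (fun d => cpow (INR d) (- nu) * RtoC (sin (2 * PI * INR d * th) * cos (2 * PI * INR n * psi / INR d)))) = RtoC (4 * PI) * l)%C).
  { intros nu n Hn.
    (* The conditions are kept behind the existential so that one choice function serves all
       indices; its value at a zero index is a dummy. *)
    assert (EX : forall d m, exists l, (1 <= d)%nat -> (1 <= m)%nat -> isI (fun y => cexp (nu * RtoC y) * RtoC (hdm x d m y))%C l).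
    { intros d m. destruct (classic ((1 <= d)%nat /\ (1 <= m)%nat)) as [[h1 h2]|h]. destruct (isI_hdm_exists x nu d m) as [l hl]; eauto. exists 0. tauto. }
    set (v := fun d => proj1_sig (constructive_indefinite_description _ (EX d (n / d)%nat))).
    assert (Hv : forall d, In d (divisors_list n) -> isI (fun y => cexp (nu * RtoC y) * RtoC (hdm x d (n / d) y))%C (v d)).
    { intros d Hd. apply divisors_list_spec in Hd. apply (proj2_sig (constructive_indefinite_description _ (EX d (n / d)%nat))). lia.
      destruct Hd as [h1 h2]. destruct (n / d)%nat; lia. }
    set (sc := fun d => RtoC (sin (2 * PI * INR d * th) * cos (2 * PI * INR (n / d) * psi))).
    exists (csum (divisors_list n) (fun d => sc d * v d)%C). split.
    - eapply isI_ext; [|apply (isI_csum (divisors_list n) (fun d y => sc d * (cexp (nu * RtoC y) * RtoC (hdm x d (n / d) y)))%C (fun d => sc d * v d)%C)].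
      + intros y. unfold gterm. rewrite <- csum_scal. apply csum_ext. intros d _. unfold sc. rewrite !RtoC_mult. ring.
      + intros d. apply fcont_scal. intros t. apply ccont_mult. apply fcont_cexp_lin. apply fcont_hdm.
      + intros d Hd. apply isI_scal; auto. intros t. apply ccont_mult. apply fcont_cexp_lin. apply fcont_hdm.
    - rewrite <- !csum_scal. apply csum_ext. intros d Hd. assert (Hv' := Hv d Hd). apply divisors_list_spec in Hd. destruct Hd as [h1 h2].
      assert (d0 : 0 < INR d) by (apply lt_0_INR; lia).
      assert (m1 : (1 <= n / d)%nat) by (destruct (n / d)%nat; lia).
      assert (B := bessel_hdm x nu d (n / d) (v d) Hx ltac:(lia) m1 Hv'). rewrite <- h2 in B.
      unfold sc. replace (2 * PI * INR n * psi / INR d) with (2 * PI * INR (n / d) * psi).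
      2:{ rewrite h2 at 2. rewrite mult_INR. field. lra. }
      transitivity (RtoC (sin (2 * PI * INR d * th) * cos (2 * PI * INR (n / d) * psi)) * (RtoC (4 * PI) * v d))%C; [|ring].
      rewrite <- B. ring. }
  assert (GEN : forall nu lam, 0 < lam -> fcont (fun y => cexp (nu * RtoC y) * lapl x th psi y)%C /\
     (exists c, edecay (fun y => cexp (nu * RtoC y) * lapl x th psi y)%C c lam) /\
     exists S l, isI (fun y => cexp (nu * RtoC y) * lapl x th psi y)%C S /\ Cser l S /\
       forall k, (RtoC (8 * PI) * cpow x (nu / 2) * (cpow (INR (Datatypes.S k)) (nu / 2) * besselK nu (4 * PI * sqrt (INR (Datatypes.S k) * x)) *
          csum (divisors_list (Datatypes.S k)) (fun d => cpow (INR d) (- nu) * RtoC (sin (2 * PI * INR d * th) * cos (2 * PI * INR (Datatypes.S k) * psi / INR d)))) = RtoC (4 * PI) * l k)%C).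
  { intros nu lam Hl. destruct (gterm_bound x th psi (lam + Rabs (Re nu)) Hx) as [K HK].
    set (l := fun k => proj1_sig (constructive_indefinite_description _ (LJ nu (S k) ltac:(lia)))).
    assert (Hlk := fun k => proj2_sig (constructive_indefinite_description _ (LJ nu (S k) ltac:(lia)))).
    destruct (isI_series (fun k y => cexp (nu * RtoC y) * gterm x th psi (S k) y)%C (fun y => cexp (nu * RtoC y) * lapl x th psi y)%C
      (fun k => K * / ((INR k + 1) * (INR k + 1))) (K * L2) lam l) as [f1 [f2 [S [f3 f4]]]]; auto.
    - intros k t. apply ccont_mult. apply fcont_cexp_lin. apply fcont_gterm.
    - intros k y. rewrite Cmod_mult, Cmod_cexp_lin. specialize (HK k y).
      assert (e : exp (Re nu * y) * exp (- (lam + Rabs (Re nu)) * Rabs y) <= exp (- lam * Rabs y)).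
      { rewrite <- exp_plus. apply exp_le. assert (q := Rle_abs (Re nu * y)). rewrite Rabs_mult in q. lra. }
      assert (p := exp_pos (Re nu * y)). assert (p2 := exp_pos (- (lam + Rabs (Re nu)) * Rabs y)).
      assert (g0 := Cmod_ge_0 (gterm x th psi (S k) y)).
      assert (Kk : 0 <= K * / ((INR k + 1) * (INR k + 1))) by nra.
      apply Rle_trans with (exp (Re nu * y) * (K * / ((INR k + 1) * (INR k + 1)) * exp (- (lam + Rabs (Re nu)) * Rabs y))).
      apply Rmult_le_compat_l; lra. 
      replace (exp (Re nu * y) * (K * / ((INR k + 1) * (INR k + 1)) * exp (- (lam + Rabs (Re nu)) * Rabs y)))
        with (K * / ((INR k + 1) * (INR k + 1)) * (exp (Re nu * y) * exp (- (lam + Rabs (Re nu)) * Rabs y))) by ring.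
      apply Rmult_le_compat_l; auto.
    - now apply Rser_scal.
    - intros y. apply Cser_scal. now apply gterm_series.
    - intros k. apply (proj1 (Hlk k)).
    - split; auto. split. eexists; exact f2. exists S, l. split; auto. split; auto. intros k. apply (proj2 (Hlk k)). }
  (* At [nu = 0] the exponential factor is [1], so continuity and decay of [lapl] itself are
     instances of those of the transformed integrand. *)
  assert (E0 : forall y, (cexp (0 * RtoC y) * lapl x th psi y)%C = lapl x th psi y).
  { intros y. rewrite Cmult_0_l, cexp_0. ring. }
  split; [|split].
  - intros t. eapply ccont_ext. apply E0. apply (proj1 (GEN 0 1 Rlt_0_1)).
  - intros lam Hl. destruct (GEN 0 lam Hl) as [_ [[c hc] _]]. exists c. intros y. rewrite <- E0. apply hc.
  - intros nu. destruct (GEN nu 1 Rlt_0_1) as [_ [_ [S [l [h1 [h2 h3]]]]]].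
    set (w := (RtoC (8 * PI) * cpow x (nu / 2))%C).
    assert (w0 : w <> 0). { apply Cmult_neq_0. apply RtoC_neq_0. lra. apply cpow_neq_0. }
    exists S, (/ w * (RtoC (4 * PI) * S))%C. split; auto. split.
    + eapply Cser_ext; [|apply Cser_scal; apply (Cser_scal (RtoC (4 * PI)) _ _ h2)].
      intros k. cbv beta zeta. rewrite <- h3. fold w. field. auto.
    + fold w. field. auto.
Qed.

(** * Termwise integration in the strip [1/4 < Re nu < 3/4] *)

(** The Poisson kernel, the real part of [1 / (v + i t)]; [cpoissonk] below is its conjugate, minus
    the imaginary part. These are the terms that the cotangent series contributes to [fA] and
    [fB]. *)
Definition poissonk (v t : R) : R := v / (v * v + t * t).
Definition alphak (th : R) (k : nat) (t : R) : R := poissonk (INR k + th) t - poissonk (INR k + (1 - th)) t.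
Definition cpoissonk (u s : R) : R := s / (u * u + s * s).
Definition betak (psi : R) (k : nat) (s : R) : R := cpoissonk (INR k + psi) s + cpoissonk (INR k + (1 - psi)) s.

Lemma sum_sqr_pos v t : 0 < v -> 0 < v * v + t * t.
Proof. nra. Qed.

Lemma Cinv_pair a b : a * a + b * b <> 0 -> (/ ((a, b) : C))%C = (a / (a * a + b * b), - b / (a * a + b * b)).
Proof. intros H. unfold Cinv. simpl. rewrite !Rmult_1_r. reflexivity. Qed.

Lemma fA_expansion al t : 0 < al < 1 -> Rser (fun k => / (2 * PI) * alphak al k t) (fA al t).
Proof.
  intros Ha. assert (pp := PI_RGT_0). assert (h := Cser_Re _ _ (cot_partial_fractions (al, t) Ha)). fold (cotA al t) in h.
  replace (fA al t) with (/ (2 * PI) * Re (RtoC PI * cotA al t)%C).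
  2:{ unfold fA. rewrite re_scal_l. field. lra. }
  apply Rser_scal. eapply is_lim_seq_ext; [|apply h]. intros n. apply rpsum_ext. intros k _. assert (k0 := pos_INR k).
  replace (RtoC (INR k) + (al, t))%C with ((INR k + al, t) : C) by Ccalc.
  replace (RtoC (INR k + 1) - (al, t))%C with ((INR k + (1 - al), - t) : C) by Ccalc.
  rewrite Re_minus, !Cinv_pair by nra. unfold alphak, poissonk. simpl. f_equal. f_equal. f_equal. ring.
Qed.
Lemma fB_expansion al s : 0 < al < 1 -> Rser (fun k => / (2 * PI) * betak al k s) (fB al s + / 2).
Proof.
  intros Ha. assert (pp := PI_RGT_0). assert (h := Cser_Im _ _ (cot_partial_fractions (al, s) Ha)). fold (cotA al s) in h.
  replace (fB al s + / 2) with (- / (2 * PI) * Im (RtoC PI * cotA al s)%C).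
  2:{ unfold fB. rewrite im_scal_l. field. lra. }
  eapply is_lim_seq_ext; [|apply (Rser_scal (- / (2 * PI)) _ _ h)]. intros n. apply rpsum_ext. intros k _. assert (k0 := pos_INR k).
  replace (RtoC (INR k) + (al, s))%C with ((INR k + al, s) : C) by Ccalc.
  replace (RtoC (INR k + 1) - (al, s))%C with ((INR k + (1 - al), - s) : C) by Ccalc.
  rewrite Im_minus, !Cinv_pair by nra. unfold betak, cpoissonk. simpl. field. repeat split; nra.
Qed.

Lemma ccont_Im f t : ccont f t -> ccont (fun s => RtoC (Im (f s))) t.
Proof.
  intros H eps He. destruct (H eps He) as [d [d0 hd]]. exists d. split; auto. intros s Hs. specialize (hd s Hs).
  rewrite <- RtoC_minus, <- Im_minus, Cmod_R. eapply Rle_lt_trans. apply im_le_Cmod. auto.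
Qed.

Lemma sin_PI_pos al : 0 < al < 1 -> 0 < sin (PI * al).
Proof. intros H. assert (pp := PI_RGT_0). apply sin_gt_0; nra. Qed.

Lemma csin_PI_neq_0 z : 0 < Re z < 1 -> csin (RtoC PI * z) <> 0.
Proof. intros H. apply sin_Re_pos. rewrite re_scal_l. assert (pp := PI_RGT_0). nra. Qed.

Lemma fcont_fB al x : 0 < al < 1 -> fcont (fun y => RtoC (fB al (x * exp (- y)))).
Proof.
  intros Ha t.
  apply ccont_ext with (fun y => RtoC (- / 2) - RtoC (/ 2) * RtoC (Im (cotA al (x * exp (- y)))))%C.
  { intros y. unfold fB. rewrite RtoC_minus, RtoC_mult. reflexivity. }
  apply ccont_minus. apply ccont_const. apply ccont_scal. apply (ccont_Im (fun y => cotA al (x * exp (- y)))).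
  apply (ccont_hol (fun z => ccot (RtoC PI * z)) (fun y => (al, x * exp (- y)))).
  - apply hol_div. now apply csin_PI_neq_0. apply hol_ccos. apply hol_mult. apply hol_const. apply hol_id.
    apply hol_csin. apply hol_mult. apply hol_const. apply hol_id.
  - apply ccont_ext with (fun y => RtoC al + Ci * RtoC (x * exp (- y)))%C. intros; Ccalc.
    apply ccont_plus. apply ccont_const. apply ccont_scal. apply ccont_RtoC.
    apply (ex_derive_continuous (fun y => x * exp (- y))). auto_derive. auto.
Qed.

(** The squared modulus of the cotangent at [X + i Y] is [(cos^2 X + sinh^2 Y) / (sin^2 X + sinh^2
    Y)], hence at most [1 / sin^2 X]. *)
Lemma fB_bounded al : 0 < al < 1 -> exists B, 0 <= B /\ forall s, Rabs (fB al s) <= B.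
Proof.
  intros Ha. assert (sp := sin_PI_pos al Ha). assert (is := Rinv_0_lt_compat _ sp).
  exists (1 + / sin (PI * al)). split. lra.
  intros s. unfold fB.
  assert (H : Cmod (cotA al s) <= / sin (PI * al)).
  { unfold cotA, ccot. rewrite Cmod_div by now apply csin_PI_neq_0.
    assert (nz := csin_PI_neq_0 (al, s) Ha). apply Cmod_gt_0 in nz.
    apply Rle_div_l; auto. apply Rmult_le_reg_l with (sin (PI * al)); auto. rewrite <- Rmult_assoc, Rinv_r, Rmult_1_l by lra.
    replace (RtoC PI * (al, s))%C with ((PI * al, PI * s) : C) in * by Ccalc.
    rewrite csin_pair in *. rewrite ccos_pair.
    set (X := PI * al) in *. set (Y := PI * s) in *.
    apply Rsqr_incr_0_var; [|apply Cmod_ge_0]. unfold Rsqr.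
    replace (sin X * Cmod (cos X * cosh Y, - (sin X * sinh Y)) * (sin X * Cmod (cos X * cosh Y, - (sin X * sinh Y))))
      with (sin X * sin X * (Cmod (cos X * cosh Y, - (sin X * sinh Y)) * Cmod (cos X * cosh Y, - (sin X * sinh Y)))) by ring.
    rewrite !Cmod_sqr. simpl.
    assert (h : cosh Y * cosh Y = 1 + sinh Y * sinh Y).
    { unfold cosh, sinh. rewrite exp_Ropp. assert (p := exp_pos Y). field. lra. }
    assert (sc := sin2_cos2 X). unfold Rsqr in sc.
    set (c2 := cos X * cos X) in *. set (s2 := sin X * sin X) in *.
    assert (0 <= c2) by (unfold c2; nra). assert (0 <= s2) by (unfold s2; nra).
    replace (s2 * (cos X * cosh Y * (cos X * cosh Y) + - (sin X * sinh Y) * - (sin X * sinh Y))) with (s2 * (c2 * (cosh Y * cosh Y) + s2 * (sinh Y * sinh Y))) by (unfold c2, s2; ring).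
    replace (sin X * cosh Y * (sin X * cosh Y) + cos X * sinh Y * (cos X * sinh Y)) with (s2 * (cosh Y * cosh Y) + c2 * (sinh Y * sinh Y)) by (unfold c2, s2; ring).
    rewrite h. set (q := sinh Y * sinh Y). assert (0 <= q) by (unfold q; nra). 
    replace c2 with (1 - s2) by lra. assert (s2 <= 1) by lra. nra. }
  assert (h2 := im_le_Cmod (cotA al s)).
  assert (t := Rabs_triang (- / 2) (- (/ 2 * Im (cotA al s)))). rewrite !Rabs_Ropp in t. rewrite (Rabs_pos_eq (/ 2)), Rabs_mult, (Rabs_pos_eq (/ 2)) in t by lra.
  unfold Rminus. lra.
Qed.

(** A single kernel is only of order [1 / k] at bounded [t]; the difference carries the factor
    [(v - v') (t^2 - v v')], which brings it down to order [1 / (k^2 + t^2)]. *)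
Lemma alphak_bound th : 0 < th < 1 -> exists C, 0 <= C /\ forall k t, Rabs (alphak th k t) <= C / ((INR k + 1) * (INR k + 1) + t * t).
Proof.
  intros Hth. set (d := Rmin th (1 - th)). assert (d0 : 0 < d) by (apply Rmin_pos; lra).
  assert (d1 : d <= th) by apply Rmin_l. assert (d2 : d <= 1 - th) by apply Rmin_r.
  assert (dd : 0 < d * d) by nra.
  exists (2 / (d * d)). split. left; apply Rdiv_lt_0_compat; lra. intros k t. assert (k0 := pos_INR k).
  unfold alphak, poissonk. set (v := INR k + th). set (v' := INR k + (1 - th)).
  set (D := (INR k + 1) * (INR k + 1) + t * t). assert (D0 : 0 < D) by (unfold D; nra).
  assert (B : forall w, d * (INR k + 1) <= w -> / (w * w + t * t) <= / (d * d) * / D).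
  { intros w Hw. assert (h : d * d * D <= w * w + t * t).
    { unfold D. assert (d * (INR k + 1) * (d * (INR k + 1)) <= w * w) by (apply Rmult_le_compat; nra).
      assert (d * d <= 1) by nra. assert (d * d * (t * t) <= t * t) by nra. lra. }
    rewrite <- Rinv_mult. apply Rinv_le_contravar; auto. nra. }
  assert (hv : d * (INR k + 1) <= v) by (unfold v; nra). assert (hv' : d * (INR k + 1) <= v') by (unfold v'; nra).
  assert (b1 := B v hv). assert (b2 := B v' hv').
  assert (v0 : 0 < v) by nra. assert (v0' : 0 < v') by nra.
  assert (p1 := sum_sqr_pos v t v0). assert (p2 := sum_sqr_pos v' t v0').
  replace (v / (v * v + t * t) - v' / (v' * v' + t * t)) with ((v - v') * (t * t - v * v') * (/ (v * v + t * t) * / (v' * v' + t * t))) by (field; lra).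
  set (i1 := / (v * v + t * t)) in *. set (i2 := / (v' * v' + t * t)) in *.
  assert (i10 : 0 < i1) by now apply Rinv_0_lt_compat. assert (i20 : 0 < i2) by now apply Rinv_0_lt_compat.
  rewrite !Rabs_mult, (Rabs_pos_eq i1), (Rabs_pos_eq i2) by lra.
  assert (h1 : Rabs (v - v') <= 1). { unfold v, v'. apply Rabs_le. lra. }
  assert (h2 : Rabs (t * t - v * v') <= (v * v + t * t) + (v' * v' + t * t)). { apply Rabs_le. nra. }
  apply Rle_trans with (1 * ((v * v + t * t) + (v' * v' + t * t)) * (i1 * i2)).
  - apply Rmult_le_compat_r. nra. apply Rmult_le_compat; auto using Rabs_pos.
  - replace (1 * (v * v + t * t + (v' * v' + t * t)) * (i1 * i2)) with (i1 + i2) by (unfold i1, i2; field; lra).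
    unfold Rdiv. lra.
Qed.

Lemma betak_bound psi : 0 < psi < 1 -> exists C, 0 <= C /\ forall k s, 0 < s -> Rabs (betak psi k s) <= C * (s / ((INR k + 1) * (INR k + 1) + s * s)).
Proof.
  intros Hth. set (d := Rmin psi (1 - psi)). assert (d0 : 0 < d) by (apply Rmin_pos; lra).
  assert (d1 : d <= psi) by apply Rmin_l. assert (d2 : d <= 1 - psi) by apply Rmin_r.
  assert (dd : 0 < d * d) by nra.
  exists (2 / (d * d)). split. left; apply Rdiv_lt_0_compat; lra. intros k s Hs. assert (k0 := pos_INR k).
  unfold betak, cpoissonk. set (v := INR k + psi). set (v' := INR k + (1 - psi)).
  set (D := (INR k + 1) * (INR k + 1) + s * s). assert (D0 : 0 < D) by (unfold D; nra).
  assert (B : forall w, d * (INR k + 1) <= w -> / (w * w + s * s) <= / (d * d) * / D).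
  { intros w Hw. assert (h : d * d * D <= w * w + s * s).
    { unfold D. assert (d * (INR k + 1) * (d * (INR k + 1)) <= w * w) by (apply Rmult_le_compat; nra).
      assert (d * d <= 1) by nra. assert (d * d * (s * s) <= s * s) by nra. lra. }
    rewrite <- Rinv_mult. apply Rinv_le_contravar; auto. nra. }
  assert (b1 := B v ltac:(unfold v; nra)). assert (b2 := B v' ltac:(unfold v'; nra)).
  assert (p1 : 0 < / (v * v + s * s)) by (apply Rinv_0_lt_compat; nra). assert (p2 : 0 < / (v' * v' + s * s)) by (apply Rinv_0_lt_compat; nra).
  unfold Rdiv. rewrite Rabs_pos_eq by nra.
  replace (2 * / (d * d) * (s * / D)) with (s * (/ (d * d) * / D) + s * (/ (d * d) * / D)) by ring.
  apply Rplus_le_compat; apply Rmult_le_compat_l; lra.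
Qed.

Lemma fcont_rational (p q : R -> R) : (forall y, ex_derive p y) -> (forall y, ex_derive q y) -> (forall y, 0 < q y) ->
  fcont (fun y => RtoC (p y / q y)).
Proof.
  intros Hp Hq H y. apply ccont_RtoC. apply (ex_derive_continuous (fun y => p y / q y)). apply ex_derive_div; auto. specialize (H y). lra.
Qed.

Lemma fcont_poissonk v : 0 < v -> fcont (fun y => RtoC (poissonk v (exp y))).
Proof.
  intros Hv. apply (fcont_rational (fun _ => v) (fun y => v * v + exp y * exp y)).
  intros y; auto_derive; auto. intros y; auto_derive; auto. intros y. apply sum_sqr_pos; auto.
Qed.
Lemma fcont_cpoissonk u x : 0 < u -> fcont (fun y => RtoC (cpoissonk u (x * exp (- y)))).
Proof.
  intros Hv. apply (fcont_rational (fun y => x * exp (- y)) (fun y => u * u + x * exp (- y) * (x * exp (- y)))).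
  intros y; auto_derive; auto. intros y; auto_derive; auto. intros y. apply sum_sqr_pos; auto.
Qed.
Lemma fcont_alphak th k : 0 < th < 1 -> fcont (fun y => RtoC (alphak th k (exp y))).
Proof.
  intros H y. assert (k0 := pos_INR k). apply ccont_ext with (fun y => RtoC (poissonk (INR k + th) (exp y)) - RtoC (poissonk (INR k + (1 - th)) (exp y)))%C.
  intros; now rewrite <- RtoC_minus. apply ccont_minus; apply fcont_poissonk; lra.
Qed.
Lemma fcont_betak psi k x : 0 < psi < 1 -> fcont (fun y => RtoC (betak psi k (x * exp (- y)))).
Proof.
  intros H y. assert (k0 := pos_INR k). apply ccont_ext with (fun y => RtoC (cpoissonk (INR k + psi) (x * exp (- y))) + RtoC (cpoissonk (INR k + (1 - psi)) (x * exp (- y))))%C.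
  intros; now rewrite <- RtoC_plus. apply ccont_plus; apply fcont_cpoissonk; lra.
Qed.

Lemma fcont_mult f g : fcont f -> fcont g -> fcont (fun y => f y * g y)%C.
Proof. intros H H' t. now apply ccont_mult. Qed.

(** The larger of [kap^2] and [exp (2 y)] dominates any weighted geometric mean of the two. *)
Lemma weighted_amgm kap y p : 0 < kap -> 0 <= p <= 2 -> / (kap * kap + exp y * exp y) <= Rpower kap (- p) * exp (- (2 - p) * y).
Proof.
  intros Hk Hp.
  replace (Rpower kap (- p) * exp (- (2 - p) * y)) with (/ exp (p * ln kap + (2 - p) * y)).
  2:{ rewrite <- exp_Ropp. unfold Rpower. rewrite <- exp_plus. f_equal. ring. }
  apply Rinv_le_contravar. apply exp_pos.
  assert (E : kap * kap = exp (2 * ln kap)). { rewrite <- (exp_ln kap) at 1 2 by auto. rewrite <- exp_plus. f_equal. ring. }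
  rewrite E, <- exp_plus. assert (p1 := exp_pos (2 * ln kap)). assert (p2 := exp_pos (y + y)).
  destruct (Rle_lt_dec y (ln kap)).
  - assert (exp (p * ln kap + (2 - p) * y) <= exp (2 * ln kap)) by (apply exp_le; nra). lra.
  - assert (exp (p * ln kap + (2 - p) * y) <= exp (y + y)) by (apply exp_le; nra). lra.
Qed.

Lemma Rpower_ge1_decr kap p q : 1 <= kap -> p <= q -> Rpower kap (- q) <= Rpower kap (- p).
Proof.
  intros Hk Hpq. unfold Rpower. apply exp_le. assert (0 <= ln kap). { rewrite <- ln_1. destruct Hk as [h| <-]. left; apply ln_increasing; lra. lra. } nra.
Qed.

(** For [y >= 0] the weight [p = 5 / 4] leaves [exp (- 3 y / 4)], which beats [exp (sg y)] when
    [sg < 3 / 4]. For [y < 0] the factor [exp (sg y)] decays by itself, and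
    [kap^(-2) <= kap^(-5/4)]. *)
Lemma strip_bound_A sg lam kap y : 1 <= kap -> 0 < lam -> lam <= sg -> lam <= 3 / 4 - sg ->
  exp (sg * y) * / (kap * kap + exp y * exp y) <= Rpower kap (- (5 / 4)) * exp (- lam * Rabs y).
Proof.
  intros Hk Hl h1 h2. assert (es := exp_pos (sg * y)).
  destruct (Rle_lt_dec 0 y).
  - rewrite Rabs_pos_eq by auto. assert (w := weighted_amgm kap y (5 / 4) ltac:(lra) ltac:(lra)).
    eapply Rle_trans. apply Rmult_le_compat_l; [lra|exact w].
    replace (exp (sg * y) * (Rpower kap (- (5 / 4)) * exp (- (2 - 5 / 4) * y))) with (Rpower kap (- (5 / 4)) * (exp (sg * y) * exp (- (2 - 5 / 4) * y))) by ring.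
    apply Rmult_le_compat_l. left; apply exp_pos. rewrite <- exp_plus. apply exp_le. nra.
  - rewrite Rabs_left by auto. assert (w := weighted_amgm kap y 2 ltac:(lra) ltac:(lra)).
    assert (q := Rpower_ge1_decr kap (5 / 4) 2 Hk ltac:(lra)).
    replace (- (2 - 2) * y) with 0 in w by ring. rewrite exp_0, Rmult_1_r in w.
    rewrite Rmult_comm. apply Rmult_le_compat. left; apply Rinv_0_lt_compat. assert (e := exp_pos y). nra. lra. lra. apply exp_le. nra.
Qed.

(** The critical side is now [y < 0], where [s = x exp (- y)] is large: the weight [5 / 4] leaves
    [s^(1/4)], absorbed by [exp (sg y)] when [sg > 1 / 4]. For [y >= 0] the factor [s] itself
    supplies [exp (- y)]. *)
Lemma strip_bound_B sg lam kap x y : 1 <= kap -> 0 < x -> 0 < lam -> lam <= sg - / 4 -> lam <= 3 / 4 - sg ->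
  exp (sg * y) * / (1 + exp y * exp y) * (x * exp (- y) / (kap * kap + x * exp (- y) * (x * exp (- y))))
  <= (x + Rpower x (/ 4)) * Rpower kap (- (5 / 4)) * exp (- lam * Rabs y).
Proof.
  intros Hk Hx Hl h1 h2. assert (es := exp_pos (sg * y)). assert (ey := exp_pos y). assert (ey' := exp_pos (- y)).
  set (s := x * exp (- y)). assert (s0 : 0 < s) by (unfold s; nra).
  assert (Es : s = exp (ln x - y)). { unfold s. rewrite <- (exp_ln x) at 1 by auto. rewrite <- exp_plus. f_equal. }
  assert (r0 : 0 < Rpower x (/ 4)) by apply exp_pos. assert (k0 : 0 < Rpower kap (- (5 / 4))) by apply exp_pos.
  assert (i1 : / (1 + exp y * exp y) <= 1). { rewrite <- Rinv_1. apply Rinv_le_contravar; nra. }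
  assert (i0 : 0 < / (1 + exp y * exp y)) by (apply Rinv_0_lt_compat; nra).
  destruct (Rle_lt_dec 0 y).
  - rewrite Rabs_pos_eq by auto.
    assert (w := weighted_amgm kap (ln x - y) 2 ltac:(lra) ltac:(lra)). rewrite <- Es in w.
    replace (- (2 - 2) * (ln x - y)) with 0 in w by ring. rewrite exp_0, Rmult_1_r in w.
    assert (q := Rpower_ge1_decr kap (5 / 4) 2 Hk ltac:(lra)).
    assert (w1 : s / (kap * kap + s * s) <= s * Rpower kap (- (5 / 4))) by (unfold Rdiv; apply Rmult_le_compat_l; lra).
    assert (w2 : exp (sg * y) * / (1 + exp y * exp y) <= exp (sg * y)) by nra.
    assert (w3 : exp (sg * y) * exp (- y) <= exp (- lam * y)) by (rewrite <- exp_plus; apply exp_le; nra).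
    assert (p3 := exp_pos (- lam * y)).
    apply Rle_trans with (exp (sg * y) * (s * Rpower kap (- (5 / 4)))).
    apply Rmult_le_compat; auto. nra. left; apply Rdiv_lt_0_compat; nra.
    unfold s. replace (exp (sg * y) * (x * exp (- y) * Rpower kap (- (5 / 4)))) with (x * Rpower kap (- (5 / 4)) * (exp (sg * y) * exp (- y))) by ring.
    apply Rle_trans with (x * Rpower kap (- (5 / 4)) * exp (- lam * y)). apply Rmult_le_compat_l; nra.
    apply Rmult_le_compat_r. lra. apply Rmult_le_compat_r; lra.
  - rewrite Rabs_left by auto.
    assert (w := weighted_amgm kap (ln x - y) (5 / 4) ltac:(lra) ltac:(lra)). rewrite <- Es in w.
    assert (w1 : s / (kap * kap + s * s) <= Rpower kap (- (5 / 4)) * (Rpower x (/ 4) * exp (- y / 4))).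
    { unfold Rdiv at 1. eapply Rle_trans. apply Rmult_le_compat_l; [lra|exact w]. rewrite Es.
      right. rewrite (Rmult_comm (Rpower kap _)), <- Rmult_assoc, (Rmult_comm _ (Rpower kap _)). f_equal.
      unfold Rpower. rewrite <- !exp_plus. f_equal. field. }
    assert (w2 : exp (sg * y) * / (1 + exp y * exp y) <= exp (sg * y)) by nra.
    apply Rle_trans with (exp (sg * y) * (Rpower kap (- (5 / 4)) * (Rpower x (/ 4) * exp (- y / 4)))).
    apply Rmult_le_compat; auto. nra. left; apply Rdiv_lt_0_compat; nra.
    assert (w3 : exp (sg * y) * exp (- y / 4) <= exp (- lam * - y)) by (rewrite <- exp_plus; apply exp_le; nra).
    replace (exp (sg * y) * (Rpower kap (- (5 / 4)) * (Rpower x (/ 4) * exp (- y / 4)))) with (Rpower x (/ 4) * Rpower kap (- (5 / 4)) * (exp (sg * y) * exp (- y / 4))) by ring.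
    assert (p3 := exp_pos (- lam * - y)).
    apply Rle_trans with (Rpower x (/ 4) * Rpower kap (- (5 / 4)) * exp (- lam * - y)). apply Rmult_le_compat_l; nra.
    apply Rmult_le_compat_r. lra. apply Rmult_le_compat_r; lra.
Qed.

(** * The elementary integrals *)

Lemma isI_sech2_shift s c : 0 < c -> Rabs (Re s) < 1 -> isI (fun y => sech2 s (y - ln c)) (RtoC (PI / 2) / ccos (RtoC PI * s / 2))%C.
Proof. intros Hc Hs. apply (isI_shift (sech2 s) _ (- ln c)). apply fcont_sech2. now apply isI_sech2. Qed.

Lemma sech2_shift s c y : 0 < c -> sech2 s (y - ln c) = (cpow c (1 - s) * cexp ((s + 1) * RtoC y) / RtoC (c * c + exp y * exp y))%C.
Proof.
  intros Hc. unfold sech2, cpow. assert (ey := exp_pos y).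
  rewrite <- cexp_plus. rewrite RtoC_minus.
  replace ((1 - s) * RtoC (ln c) + (s + 1) * RtoC y)%C with (s * (RtoC y - RtoC (ln c)) + RtoC (ln c + y))%C by (rewrite RtoC_plus; ring).
  rewrite cexp_plus, cexp_RtoC.
  assert (E : exp (y - ln c) + exp (- (y - ln c)) = (c * c + exp y * exp y) / exp (ln c + y)).
  { replace (- (y - ln c)) with (ln c + - y) by ring. unfold Rminus. rewrite !exp_plus, !exp_Ropp, exp_ln by auto. field. lra. }
  rewrite E. assert (e2 := exp_pos (ln c + y)).
  rewrite RtoC_div by lra. field. split; apply RtoC_neq_0; [|lra]. nra.
Qed.

Lemma fcont_sech2_shift s c : fcont (fun y => sech2 s (y - ln c)).
Proof.
  intros t. apply (ccont_comp_R (sech2 s) (fun y => y - ln c)).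
  apply (ex_derive_continuous (fun y => y - ln c)). auto_derive; auto. apply fcont_sech2.
Qed.

Lemma csin_shift z : ccos (z - RtoC (PI / 2)) = csin z.
Proof. rewrite ccos_minus, ccos_RtoC, csin_RtoC, cos_PI2, sin_PI2. ring. Qed.

(** The basic integral at [s = nu - 1], shifted by [ln v]; the cosine of [PI (nu - 1) / 2] becomes
    the sine of the first term of the identity. *)
Lemma isI_poissonk nu v : 0 < v -> 0 < Re nu < 1 ->
  isI (fun y => cexp (nu * RtoC y) * RtoC (poissonk v (exp y)))%C (cpow v (nu - 1) * (RtoC (PI / 2) / csin (RtoC PI * nu / 2)))%C.
Proof.
  intros Hv Hnu.
  replace (csin (RtoC PI * nu / 2)) with (ccos (RtoC PI * (nu - 1) / 2)).
  2:{ rewrite <- csin_shift. f_equal. rewrite RtoC_div by lra. field. }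
  assert (R1 : Rabs (Re (nu - 1)%C) < 1) by (rewrite Re_minus, re_RtoC; apply Rabs_def1; lra).
  eapply isI_ext; [|apply isI_scal; [apply (fcont_sech2_shift (nu - 1) v)|apply isI_sech2_shift; auto]].
  intros y. cbv beta. rewrite sech2_shift by auto. unfold poissonk. assert (p := sum_sqr_pos v (exp y) Hv).
  replace (1 - (nu - 1))%C with (- (nu - 1) + 1)%C by ring. rewrite cpow_plus, cpow_opp, cpow_1 by auto.
  replace (nu - 1 + 1)%C with nu by ring. rewrite RtoC_div by lra. field. split; first [apply cpow_neq_0|apply RtoC_neq_0; lra].
Qed.

Definition ek (nu : C) (c y : R) : C := (cexp ((nu + 1) * RtoC y) / RtoC (c * c + exp y * exp y))%C.

Lemma ek_sech2 nu c y : 0 < c -> ek nu c y = (cpow c (nu - 1) * sech2 nu (y - ln c))%C.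
Proof.
  intros Hc. rewrite sech2_shift by auto. unfold ek. replace (1 - nu)%C with (- (nu - 1))%C by ring. rewrite cpow_opp.
  assert (p := sum_sqr_pos c (exp y) Hc). field. split; first [apply cpow_neq_0|apply RtoC_neq_0; lra].
Qed.
Lemma fcont_ek nu c : 0 < c -> fcont (ek nu c).
Proof.
  intros Hc t. eapply ccont_ext. intros s; symmetry; now apply ek_sech2. apply ccont_scal. apply fcont_sech2_shift.
Qed.
Lemma isI_ek nu c : 0 < c -> Rabs (Re nu) < 1 -> isI (ek nu c) (cpow c (nu - 1) * (RtoC (PI / 2) / ccos (RtoC PI * nu / 2)))%C.
Proof.
  intros Hc Hnu. eapply isI_ext. intros y; symmetry; now apply ek_sech2. apply isI_scal. apply fcont_sech2_shift. now apply isI_sech2_shift.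
Qed.
Lemma edecay_ek nu c : 0 < c -> exists K, edecay (ek nu c) K (1 - Rabs (Re nu)).
Proof.
  intros Hc. set (K := Cmod (cpow c (nu - 1)) * exp ((1 + Rabs (Re nu)) * Rabs (ln c))). exists K. intros y.
  rewrite ek_sech2, Cmod_mult by auto. unfold K. rewrite Rmult_assoc. apply Rmult_le_compat_l. apply Cmod_ge_0.
  eapply Rle_trans. apply edecay_sech2. rewrite Rmult_1_l, <- exp_plus. apply exp_le.
  assert (a := Rabs_pos (Re nu)). assert (l0 := Rabs_pos (ln c)).
  assert (t := Rabs_triang (y - ln c) (ln c)). replace (y - ln c + ln c) with y in t by ring.
  assert (t2 := Rabs_triang y (- ln c)). rewrite Rabs_Ropp in t2. unfold Rminus in *.
  set (Y := Rabs y) in *. set (Z := Rabs (y + - ln c)) in *. set (W := Rabs (ln c)) in *. set (A := Rabs (Re nu)) in *. nra.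
Qed.

Lemma isI_derivative H H' K lam : 0 < lam -> fcont H' -> edecay H K lam -> (forall t, rder H t (H' t)) -> isI H' 0.
Proof.
  intros Hl HF HD HR eps He.
  assert (L := exp_INR_lim lam Hl). apply is_lim_seq_spec in L.
  assert (K0 : 0 <= K). { assert (h := HD 0). rewrite Rabs_R0, Rmult_0_r, exp_0 in h. assert (h2 := Cmod_ge_0 (H 0)). lra. }
  assert (e0 : 0 < eps / (2 * K + 1)) by (apply Rdiv_lt_0_compat; lra).
  destruct (L (mkposreal _ e0)) as [N hN]. specialize (hN (S N) ltac:(lia)). rewrite Rminus_0_r in hN. simpl pos in hN. apply Rabs_def2 in hN.
  exists (INR (S N)). split. apply lt_0_INR; lia. intros a b Ha Hb. assert (s0 : 0 < INR (S N)) by (apply lt_0_INR; lia).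
  rewrite (CI_FTC H); [|lra|now apply fcont_icont|intros; apply HR].
  replace (H b - H a - 0)%C with (H b - H a)%C by ring. eapply Rle_lt_trans. apply Cmod_minus_le.
  assert (B : forall t, INR (S N) <= Rabs t -> Cmod (H t) <= K * exp (- lam * INR (S N))).
  { intros t Ht. eapply Rle_trans. apply HD. apply Rmult_le_compat_l; auto. apply exp_le. nra. }
  assert (b1 := B a ltac:(rewrite Rabs_left; lra)). assert (b2 := B b ltac:(rewrite Rabs_pos_eq; lra)).
  apply Rle_lt_trans with ((2 * K + 1) * exp (- lam * INR (S N))). assert (p := exp_pos (- lam * INR (S N))). lra.
  destruct hN as [hN _]. apply Rlt_div_r in hN; lra.
Qed.

Lemma ek_rder nu c t : 0 < c -> rder (ek nu c) t ((nu - 1) * ek nu c t + 2 * RtoC (c * c) * (ek nu c t / RtoC (c * c + exp t * exp t)))%C.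
Proof.
  intros Hc. assert (p := sum_sqr_pos c (exp t) Hc).
  set (F := fun z : C => (cexp ((nu + 1) * z) * / (RtoC (c * c) + cexp z * cexp z))%C).
  assert (E : forall s, F (0 + RtoC s * 1)%C = ek nu c s).
  { intros s. unfold F, ek. replace (0 + RtoC s * 1)%C with (RtoC s) by ring. rewrite cexp_RtoC, <- RtoC_mult, <- RtoC_plus. reflexivity. }
  assert (nz : (RtoC (c * c) + cexp (RtoC t) * cexp (RtoC t))%C <> 0).
  { rewrite cexp_RtoC, <- RtoC_mult, <- RtoC_plus. apply RtoC_neq_0. lra. }
  assert (D : hder F (0 + RtoC t * 1)%C ((nu - 1) * ek nu c t + 2 * RtoC (c * c) * (ek nu c t / RtoC (c * c + exp t * exp t)))%C).
  { replace (0 + RtoC t * 1)%C with (RtoC t) by ring. unfold F. eapply hder_eq; [|apply hder_mult;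
      [apply (hder_comp cexp (fun z => (nu + 1) * z)%C); [apply hder_scal, hder_id|apply hder_cexp]
      |apply (hder_comp Cinv (fun z => RtoC (c * c) + cexp z * cexp z)%C); [apply hder_plus; [apply hder_const|apply hder_mult; apply hder_cexp]|now apply hder_inv]]].
    cbv beta. unfold ek. rewrite RtoC_plus, (RtoC_mult (exp t)), <- cexp_RtoC. field. auto. }
  apply hder_line in D. intros e He. destruct (D e He) as [d [d0 hd]]. exists d. split; auto. intros h Hh. specialize (hd h Hh).
  rewrite !E in hd. rewrite Cmult_1_r in hd. exact hd.
Qed.

(** Integration by parts: [ek_rder] expresses the derivative of [ek] through [ek] and [ek] divided
    once more by the denominator. That derivative integrates to zero, so the second integral is a
    multiple of the first. *)
Lemma isI_ek_sqr nu c : 0 < c -> Rabs (Re nu) < 1 ->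
  isI (fun y => ek nu c y / RtoC (c * c + exp y * exp y))%C ((1 - nu) / (2 * RtoC (c * c)) * (cpow c (nu - 1) * (RtoC (PI / 2) / ccos (RtoC PI * nu / 2))))%C.
Proof.
  intros Hc Hnu. destruct (edecay_ek nu c Hc) as [K HK].
  assert (c2 : RtoC (c * c) <> 0) by (apply RtoC_neq_0; nra).
  assert (F2 : fcont (fun y => ek nu c y / RtoC (c * c + exp y * exp y))%C).
  { intros t. assert (p := sum_sqr_pos c (exp t) Hc). apply ccont_div. apply RtoC_neq_0; lra. now apply fcont_ek. apply ccont_RtoC.
    apply (ex_derive_continuous (fun y => c * c + exp y * exp y)). auto_derive; auto. }
  assert (FE := fcont_ek nu c Hc).
  assert (FD : fcont (fun t => (nu - 1) * ek nu c t + 2 * RtoC (c * c) * (ek nu c t / RtoC (c * c + exp t * exp t)))%C).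
  { apply fcont_plus; apply fcont_scal; auto. }
  assert (I0 := isI_derivative _ _ K (1 - Rabs (Re nu)) ltac:(lra) FD HK (fun t => ek_rder nu c t Hc)).
  assert (I1 := isI_ek nu c Hc Hnu).
  set (V := (cpow c (nu - 1) * (RtoC (PI / 2) / ccos (RtoC PI * nu / 2)))%C) in *.
  replace ((1 - nu) / (2 * RtoC (c * c)) * V)%C with (/ (2 * RtoC (c * c)) * (0 - (nu - 1) * V))%C by (field; auto).
  eapply isI_ext; [|apply isI_scal; [|apply isI_minus; [exact FD|apply (fcont_scal (nu - 1) _ FE)|exact I0|apply isI_scal; [exact FE|exact I1]]]].
  - intros y. cbv beta. assert (p := sum_sqr_pos c (exp y) Hc). field. split; auto. apply RtoC_neq_0; lra.
  - intros t. apply ccont_minus. apply FD. apply (fcont_scal (nu - 1) _ FE).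
Qed.

Definition mellin_const (nu : C) : C := (RtoC (PI / 2) / ccos (RtoC PI * nu / 2))%C.

Lemma cpow_div_base a b s : 0 < a -> 0 < b -> cpow (a / b) s = (cpow a s / cpow b s)%C.
Proof.
  intros Ha Hb. unfold cpow. rewrite ln_div by auto. rewrite RtoC_minus. unfold Cdiv. rewrite <- cexp_opp, <- cexp_plus. f_equal. ring.
Qed.

(** In the variable [t^2] the product has poles at [- v^2] and [- (x / u)^2]. Splitting it into
    partial fractions gives two integrals of [ek], proportional to [v^(nu-1)] and [(x/u)^(nu-1)];
    the term [x^nu u^(-nu-1) / v] is separated from their difference because it factors over the two
    indices and sums to a product of zeta values. *)
Lemma isI_product nu u v x : 0 < u -> 0 < v -> 0 < x -> Rabs (Re nu) < 1 ->
  isI (fun y => cexp (nu * RtoC y) * RtoC (poissonk v (exp y) * cpoissonk u (x * exp (- y))))%C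
    (mellin_const nu * (cpow x nu * cpow u (- nu - 1) / RtoC v - RtoC x * Gfun x nu 0 u v))%C.
Proof.
  intros Hu Hv Hx Hnu.
  assert (E1 : forall y, cexp ((nu + 1) * RtoC y) = (cexp (nu * RtoC y) * RtoC (exp y))%C).
  { intros y. replace ((nu + 1) * RtoC y)%C with (nu * RtoC y + RtoC y)%C by ring. now rewrite cexp_plus, cexp_RtoC. }
  assert (Cu := RtoC_neq_0 u ltac:(lra)). assert (Cv := RtoC_neq_0 v ltac:(lra)). assert (Cx := RtoC_neq_0 x ltac:(lra)).
  assert (nU := cpow_neq_0 u nu). assert (nV := cpow_neq_0 v nu). assert (nX := cpow_neq_0 x nu).
  assert (PU : cpow u (- nu - 1) = (/ (cpow u nu * RtoC u))%C).
  { replace (- nu - 1)%C with (- (nu + 1))%C by ring. now rewrite cpow_opp, cpow_plus, cpow_1. }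
  assert (PV : cpow v (nu - 1) = (cpow v nu / RtoC v)%C).
  { unfold Cminus. now rewrite cpow_plus, cpow_opp, cpow_1. }
  unfold Gfun. rewrite PU. change (INR 0) with 0.
  replace (nu - RtoC (2 * 0) + 1)%C with (nu + 1)%C by (rewrite Rmult_0_r; ring).
  destruct (Req_EM_T (u * v) x) as [e|n].
  (* The two poles coincide, and the integral with squared denominator yields the continuous
     extension built into [Gfun]. *)
  - replace (mellin_const nu * (cpow x nu * / (cpow u nu * u) / v - x * (/ (cpow u nu * u) / v * ((nu + 1) / 2 * cpow x (nu + 1 - 2)))))%C
      with (RtoC (v * x / (u * u)) * ((1 - nu) / (2 * RtoC (v * v)) * (cpow v (nu - 1) * mellin_const nu)))%C.
    + eapply isI_ext; [|apply isI_scal; [|apply isI_ek_sqr; auto]].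
      * intros y. unfold ek, poissonk, cpoissonk. rewrite E1. assert (ey := exp_pos y). assert (p := sum_sqr_pos v (exp y) Hv).
        replace (x * exp (- y) / (u * u + x * exp (- y) * (x * exp (- y)))) with (x * exp y / (u * u * (v * v + exp y * exp y))).
        2:{ rewrite <- e, exp_Ropp. field. repeat split; try lra; nra. }
        replace (v / (v * v + exp y * exp y) * (x * exp y / (u * u * (v * v + exp y * exp y)))) with (v * x / (u * u) * (exp y / (v * v + exp y * exp y) / (v * v + exp y * exp y))) by (field; lra).
        rewrite (RtoC_mult (v * x / (u * u))), !(RtoC_div _ (v * v + exp y * exp y)) by lra. unfold Cdiv. ring.
      * intros t. assert (p := sum_sqr_pos v (exp t) Hv). apply ccont_div. apply RtoC_neq_0; lra. now apply fcont_ek. apply ccont_RtoC.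
        apply (ex_derive_continuous (fun y => v * v + exp y * exp y)). auto_derive; auto.
    + replace (nu + 1 - 2)%C with (nu + - (1))%C by ring. rewrite PV, cpow_plus, cpow_opp, cpow_1 by auto.
      rewrite <- e, cpow_mult_base by auto. rewrite RtoC_div, !RtoC_mult by nra. field. repeat split; auto.
  - assert (w0 : x * x - u * v * (u * v) <> 0). { intros h. apply n. assert (0 < u * v) by nra. nra. }
    assert (xu : 0 < x / u) by now apply Rdiv_lt_0_compat.
    assert (w1 : (RtoC x * RtoC x - RtoC u * RtoC v * (RtoC u * RtoC v))%C <> 0). { rewrite <- !RtoC_mult, <- RtoC_minus. now apply RtoC_neq_0. }
    assert (w2 : (RtoC u * RtoC v * (RtoC u * RtoC v) - RtoC x * RtoC x)%C <> 0). { rewrite <- !RtoC_mult, <- RtoC_minus. apply RtoC_neq_0. lra. }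
    replace (mellin_const nu * (cpow x nu * / (cpow u nu * u) / v - x * (/ (cpow u nu * u) / v * ((cpow (u * v) (nu + 1) - cpow x (nu + 1)) / RtoC ((u * v) ^ 2 - x ^ 2)%R))))%C
      with (RtoC (v * x / (x * x - u * v * (u * v))) * (cpow v (nu - 1) * mellin_const nu - cpow (x / u) (nu - 1) * mellin_const nu))%C.
    + eapply isI_ext; [|apply isI_scal; [|apply isI_minus; [| |apply (isI_ek nu v); auto|apply (isI_ek nu (x / u)); auto]]]; try (now apply fcont_ek).
      2:{ intros t. apply ccont_minus; now apply fcont_ek. }
      intros y. unfold ek, poissonk, cpoissonk. rewrite E1. assert (ey := exp_pos y). assert (p := sum_sqr_pos v (exp y) Hv).
      assert (p2 := sum_sqr_pos (x / u) (exp y) xu). assert (p3 : 0 < x * x + u * u * (exp y * exp y)) by nra.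
      replace (v / (v * v + exp y * exp y) * (x * exp (- y) / (u * u + x * exp (- y) * (x * exp (- y)))))
        with (v * x / (x * x - u * v * (u * v)) * (exp y / (v * v + exp y * exp y) - exp y / (x / u * (x / u) + exp y * exp y))).
      2:{ rewrite exp_Ropp. field. repeat split; try lra; nra. }
      rewrite (RtoC_mult (v * x / _)), RtoC_minus, (RtoC_div _ (v * v + exp y * exp y)), (RtoC_div _ (x / u * (x / u) + exp y * exp y)) by lra. unfold Cdiv. ring.
    + rewrite PV, cpow_div_base by auto. replace (nu - 1)%C with (nu + - (1))%C by ring. rewrite !cpow_plus, !cpow_opp, !cpow_1, cpow_mult_base by nra.
      replace (RtoC ((u * v) ^ 2 - x ^ 2)) with (RtoC u * RtoC v * (RtoC u * RtoC v) - RtoC x * RtoC x)%C by (rewrite <- !RtoC_mult, <- RtoC_minus; f_equal; ring).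
      rewrite RtoC_div by auto. rewrite RtoC_minus, !RtoC_mult. field. repeat split; auto.
Qed.

Lemma fcont_pc u v x : 0 < u -> 0 < v -> fcont (fun y => RtoC (poissonk v (exp y) * cpoissonk u (x * exp (- y)))).
Proof.
  intros Hu Hv t. eapply ccont_ext. intros s; symmetry; apply RtoC_mult. apply ccont_mult. now apply fcont_poissonk. now apply fcont_cpoissonk.
Qed.

Definition quad (G : R -> R -> C) (th psi : R) (m n : nat) : C :=
  (G (INR n + psi)%R (INR m + th)%R + G (INR n + 1 - psi)%R (INR m + th)%R
   - G (INR n + psi)%R (INR m + 1 - th)%R - G (INR n + 1 - psi)%R (INR m + 1 - th)%R)%C.

Lemma isI_alpha_beta nu th psi x m n : 0 < th < 1 -> 0 < psi < 1 -> 0 < x -> Rabs (Re nu) < 1 ->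
  isI (fun y => cexp (nu * RtoC y) * RtoC (alphak th m (exp y) * betak psi n (x * exp (- y))))%C
   (mellin_const nu * (cpow x nu * (/ RtoC (INR m + th) - / RtoC (INR m + (1 - th))) * (cpow (INR n + psi) (- (1 + nu)) + cpow (INR n + (1 - psi)) (- (1 + nu)))
       - RtoC x * quad (Gfun x nu 0) th psi m n))%C.
Proof.
  intros Hth Hpsi Hx Hnu. assert (m0 := pos_INR m). assert (n0 := pos_INR n).
  unfold quad. replace (INR n + 1 - psi) with (INR n + (1 - psi)) by ring. replace (INR m + 1 - th) with (INR m + (1 - th)) by ring.
  set (u := INR n + psi). set (u' := INR n + (1 - psi)). set (v := INR m + th). set (v' := INR m + (1 - th)).
  assert (u0 : 0 < u) by (unfold u; lra). assert (u1 : 0 < u') by (unfold u'; lra).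
  assert (v0 : 0 < v) by (unfold v; lra). assert (v1 : 0 < v') by (unfold v'; lra).
  assert (FF : forall a b, 0 < a -> 0 < b -> fcont (fun y => cexp (nu * RtoC y) * RtoC (poissonk b (exp y) * cpoissonk a (x * exp (- y))))%C).
  { intros a b Ha Hb. apply fcont_mult. apply fcont_cexp_lin. now apply fcont_pc. }
  assert (I := isI_minus _ _ _ _ (fcont_plus _ _ (FF u v u0 v0) (FF u' v u1 v0)) (fcont_plus _ _ (FF u v' u0 v1) (FF u' v' u1 v1))
     (isI_plus _ _ _ _ (FF u v u0 v0) (FF u' v u1 v0) (isI_product nu u v x u0 v0 Hx Hnu) (isI_product nu u' v x u1 v0 Hx Hnu))
     (isI_plus _ _ _ _ (FF u v' u0 v1) (FF u' v' u1 v1) (isI_product nu u v' x u0 v1 Hx Hnu) (isI_product nu u' v' x u1 v1 Hx Hnu))).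
  match type of I with isI _ ?l => match goal with |- isI _ ?l' => replace l' with l end end.
  - eapply isI_ext; [|exact I]. intros y. cbv beta. unfold alphak, betak. fold u u' v v'.
    rewrite !RtoC_mult, RtoC_minus, RtoC_plus. ring.
  - replace (- nu - 1)%C with (- (1 + nu))%C by ring. unfold Cdiv. ring.
Qed.

(** [fA] is expanded first, against the bounded factor [fB]; then, for each [m], the function
    [fB + 1 / 2] is expanded. This yields an iterated series of the integrals in [isI_alpha_beta],
    whose separated parts sum to [Z] and [hurwitz_diff_at1 th]. *)
Theorem strip_identity x th psi nu Sv D Z : 0 < x -> 0 < th < 1 -> 0 < psi < 1 -> / 4 < Re nu < 3 / 4 ->
  isI (fun y => cexp (nu * RtoC y) * lapl x th psi y)%C Sv ->
  Cser (fun n => cpow (INR n + th) (- (1 - nu)) - cpow (INR n + (1 - th)) (- (1 - nu)))%C D ->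
  Cser (fun n => cpow (INR n + psi) (- (1 + nu)) + cpow (INR n + (1 - psi)) (- (1 + nu)))%C Z ->
  exists T Tot, (forall m, Cser (quad (Gfun x nu 0) th psi m) (T m)) /\ Cser T Tot /\
    (RtoC (4 * PI) * Sv = - (RtoC (PI / 2) / csin (RtoC PI * nu / 2)) * D
       + cpow x nu / (2 * ccos (RtoC PI * nu / 2)) * hurwitz_diff_at1 th * Z
       - 1 / (2 * ccos (RtoC PI * nu / 2)) * RtoC x * Tot)%C.
Proof.
  intros Hx Hth Hpsi Hnu HS HD HZ. assert (pp := PI_RGT_0).
  (* The distance to the edges of the strip serves as common decay rate for both majorants. *)
  set (sg := Re nu) in *. set (lam := Rmin (sg - / 4) (3 / 4 - sg)).
  assert (l0 : 0 < lam) by (apply Rmin_pos; lra). assert (l1 : lam <= sg - / 4) by apply Rmin_l. assert (l2 : lam <= 3 / 4 - sg) by apply Rmin_r.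
  assert (Hnu1 : Rabs (Re nu) < 1) by (fold sg; apply Rabs_def1; lra).
  destruct (alphak_bound th Hth) as [CA [CA0 HA]]. destruct (betak_bound psi Hpsi) as [CB [CB0 HB]]. destruct (fB_bounded psi Hpsi) as [B [B0 HfB]].
  destruct (Rser_power (5 / 4) 1) as [L HL]; try lra.
  assert (cc : ccos (RtoC PI * nu / 2) <> 0) by (apply (ccot_sum nu); auto).
  assert (c0n : mellin_const nu <> 0).
  { intros e. apply (RtoC_neq_0 (PI / 2)); [lra|].
    replace (RtoC (PI / 2)) with (mellin_const nu * ccos (RtoC PI * nu / 2))%C by (unfold mellin_const; field; auto). rewrite e. ring. }
  assert (PIC : RtoC PI <> 0) by (apply RtoC_neq_0; lra).
  assert (Cx : RtoC x <> 0) by (apply RtoC_neq_0; lra).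
  set (cs := (RtoC (PI / 2) / csin (RtoC PI * nu / 2))%C).
  set (I := fun k => (cs * (cpow (INR k + th) (- (1 - nu)) - cpow (INR k + (1 - th)) (- (1 - nu))))%C).
  assert (FA : forall k, fcont (fun y => cexp (nu * RtoC y) * RtoC (alphak th k (exp y)))%C).
  { intros k. apply fcont_mult. apply fcont_cexp_lin. now apply fcont_alphak. }
  assert (HI : forall k, isI (fun y => cexp (nu * RtoC y) * RtoC (alphak th k (exp y)))%C (I k)).
  { intros k. assert (k0 := pos_INR k).
    assert (FP : forall v, 0 < v -> fcont (fun y => cexp (nu * RtoC y) * RtoC (poissonk v (exp y)))%C).
    { intros v Hv. apply fcont_mult. apply fcont_cexp_lin. now apply fcont_poissonk. }
    assert (P := isI_minus _ _ _ _ (FP (INR k + th) ltac:(lra)) (FP (INR k + (1 - th)) ltac:(lra))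
       (isI_poissonk nu (INR k + th) ltac:(lra) ltac:(fold sg; lra)) (isI_poissonk nu (INR k + (1 - th)) ltac:(lra) ltac:(fold sg; lra))).
    replace (I k) with (cpow (INR k + th) (nu - 1) * (RtoC (PI / 2) / csin (RtoC PI * nu / 2)) - cpow (INR k + (1 - th)) (nu - 1) * (RtoC (PI / 2) / csin (RtoC PI * nu / 2)))%C.
    eapply isI_ext; [|exact P]. intros y. cbv beta. unfold alphak. rewrite RtoC_minus. ring.
    unfold I. replace (- (1 - nu))%C with (nu - 1)%C by ring. unfold cs. ring. }
  set (Kt := fun m n => (mellin_const nu * (cpow x nu * (/ RtoC (INR m + th) - / RtoC (INR m + (1 - th))) * (cpow (INR n + psi) (- (1 + nu)) + cpow (INR n + (1 - psi)) (- (1 + nu)))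
       - RtoC x * quad (Gfun x nu 0) th psi m n))%C).
  assert (HK : forall m, exists l, Cser (fun n => RtoC (/ (2 * PI)) * Kt m n)%C l /\
     isI (fun y => cexp (nu * RtoC y) * RtoC (alphak th m (exp y)) * RtoC (fB psi (x * exp (- y)) + / 2))%C l).
  { intros m. assert (m0 := pos_INR m).
    set (ct := / (2 * PI) * CA * CB * (x + Rpower x (/ 4))).
    destruct (isI_series (fun n y => RtoC (/ (2 * PI)) * (cexp (nu * RtoC y) * RtoC (alphak th m (exp y) * betak psi n (x * exp (- y)))))%C
      (fun y => cexp (nu * RtoC y) * RtoC (alphak th m (exp y)) * RtoC (fB psi (x * exp (- y)) + / 2))%C
      (fun n => ct * Rpower (INR n + 1) (- (5 / 4))) (ct * L) lam (fun n => RtoC (/ (2 * PI)) * Kt m n)%C) as [_ [_ [l [h1 h2]]]]; auto.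
    - intros n. apply fcont_scal. apply fcont_mult. apply fcont_cexp_lin. intros t. eapply ccont_ext. intros s; symmetry; apply RtoC_mult.
      apply ccont_mult. now apply fcont_alphak. now apply fcont_betak.
    - intros n y. assert (n0 := pos_INR n). assert (ey := exp_pos y). assert (ey' := exp_pos (- y)).
      rewrite !Cmod_mult, Cmod_cexp_lin, !Cmod_R, Rabs_mult. fold sg. rewrite (Rabs_pos_eq (/ (2 * PI))) by (left; apply Rinv_0_lt_compat; lra).
      assert (a1 := HA m (exp y)). assert (b1 := HB n (x * exp (- y)) ltac:(nra)).
      assert (a2 : Rabs (alphak th m (exp y)) <= CA * / (1 + exp y * exp y)).
      { eapply Rle_trans. apply a1. apply Rmult_le_compat_l; auto. apply Rinv_le_contravar; nra. }
      assert (s1 := strip_bound_B sg lam (INR n + 1) x y ltac:(lra) Hx l0 l1 l2).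
      assert (e0 := exp_pos (sg * y)). assert (i0 : 0 < / (2 * PI)) by (apply Rinv_0_lt_compat; lra).
      apply Rle_trans with (/ (2 * PI) * (exp (sg * y) * ((CA * / (1 + exp y * exp y)) * (CB * (x * exp (- y) / ((INR n + 1) * (INR n + 1) + x * exp (- y) * (x * exp (- y)))))))).
      + apply Rmult_le_compat_l. lra. apply Rmult_le_compat_l. lra. apply Rmult_le_compat; auto using Rabs_pos.
      + apply Rle_trans with (/ (2 * PI) * CA * CB * ((x + Rpower x (/ 4)) * Rpower (INR n + 1) (- (5 / 4)) * exp (- lam * Rabs y))).
        * apply Rle_trans with (/ (2 * PI) * CA * CB * (exp (sg * y) * / (1 + exp y * exp y) * (x * exp (- y) / ((INR n + 1) * (INR n + 1) + x * exp (- y) * (x * exp (- y)))))).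
          right; ring. apply Rmult_le_compat_l; auto. apply Rmult_le_pos; auto. apply Rmult_le_pos; lra.
        * unfold ct. right; ring.
    - now apply Rser_scal.
    - intros y. assert (FE := Cser_RtoC _ _ (fB_expansion psi (x * exp (- y)) Hpsi)).
      apply (Cser_scal (cexp (nu * RtoC y) * RtoC (alphak th m (exp y)))) in FE.
      eapply Cser_ext; [|exact FE]. intros n. cbv beta. rewrite !RtoC_mult. ring.
    - intros n. apply isI_scal. apply fcont_mult. apply fcont_cexp_lin. intros t. eapply ccont_ext. intros s; symmetry; apply RtoC_mult.
      apply ccont_mult. now apply fcont_alphak. now apply fcont_betak. now apply isI_alpha_beta.
    - exists l. split; auto. }
  set (l := fun m => proj1_sig (constructive_indefinite_description _ (HK m))).
  assert (Hl : forall m, Cser (fun n => RtoC (/ (2 * PI)) * Kt m n)%C (l m) /\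
     isI (fun y => cexp (nu * RtoC y) * RtoC (alphak th m (exp y)) * RtoC (fB psi (x * exp (- y)) + / 2))%C (l m)).
  { intros m. apply (proj2_sig (constructive_indefinite_description _ (HK m))). }
  (* From [fB = (fB + 1 / 2) - 1 / 2]: [l k] integrates the first part against [alphak], and [I k]
     the constant, which produces the series [D]. *)
  set (sk := fun k => (RtoC (/ (2 * PI)) * (l k - RtoC (/ 2) * I k))%C).
  assert (HSS : Cser sk Sv).
  { set (ct := / (2 * PI) * CA * B).
    assert (fbc := fcont_fB psi x Hpsi).
    destruct (isI_series (fun k y => RtoC (/ (2 * PI)) * (cexp (nu * RtoC y) * RtoC (alphak th k (exp y)) * RtoC (fB psi (x * exp (- y)))))%C
      (fun y => cexp (nu * RtoC y) * lapl x th psi y)%C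
      (fun n => ct * Rpower (INR n + 1) (- (5 / 4))) (ct * L) lam sk) as [_ [_ [s' [h1 h2]]]]; auto.
    - intros k. apply fcont_scal. apply fcont_mult; auto.
    - intros k y. assert (k0 := pos_INR k). rewrite !Cmod_mult, Cmod_cexp_lin, !Cmod_R. fold sg. rewrite (Rabs_pos_eq (/ (2 * PI))) by (left; apply Rinv_0_lt_compat; lra).
      assert (a1 := HA k (exp y)). assert (b1 := HfB (x * exp (- y))). assert (e0 := exp_pos (sg * y)). assert (i0 : 0 < / (2 * PI)) by (apply Rinv_0_lt_compat; lra).
      assert (s1 := strip_bound_A sg lam (INR k + 1) y ltac:(lra) l0 ltac:(lra) l2).
      apply Rle_trans with (/ (2 * PI) * (exp (sg * y) * (CA / ((INR k + 1) * (INR k + 1) + exp y * exp y)) * B)).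
      + apply Rmult_le_compat_l. lra. apply Rmult_le_compat; auto using Rabs_pos. apply Rmult_le_pos. lra. apply Rabs_pos. apply Rmult_le_compat_l; lra.
      + apply Rle_trans with (/ (2 * PI) * CA * B * (exp (sg * y) * / ((INR k + 1) * (INR k + 1) + exp y * exp y))). right; unfold Rdiv; ring.
        fold ct. rewrite (Rmult_assoc ct). apply Rmult_le_compat_l; auto. unfold ct. apply Rmult_le_pos; auto. apply Rmult_le_pos; lra.
    - now apply Rser_scal.
    - intros y. assert (FE := Cser_RtoC _ _ (fA_expansion th (exp y) Hth)).
      apply (Cser_scal (cexp (nu * RtoC y) * RtoC (fB psi (x * exp (- y))))) in FE. unfold lapl. rewrite (RtoC_mult (fA _ _)).
      replace (cexp (nu * y) * (fA th (exp y) * fB psi (x * exp (- y))%R))%C with (cexp (nu * RtoC y) * RtoC (fB psi (x * exp (- y))) * RtoC (fA th (exp y)))%C by ring.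
      eapply Cser_ext; [|exact FE]. intros n. cbv beta. rewrite !RtoC_mult. ring.
    - intros k. unfold sk. apply isI_scal. apply fcont_mult; auto.
      assert (F1 : fcont (fun y => cexp (nu * RtoC y) * RtoC (alphak th k (exp y)) * RtoC (fB psi (x * exp (- y)) + / 2))%C).
      { apply fcont_mult; auto. intros t. eapply ccont_ext. intros s; symmetry; apply RtoC_plus. apply ccont_plus. apply fbc. apply ccont_const. }
      eapply isI_ext; [|apply isI_minus; [exact F1|apply (fcont_scal (RtoC (/ 2)) _ (FA k))|apply Hl|apply isI_scal; [apply FA|apply HI]]].
      intros y. cbv beta. rewrite RtoC_plus. ring.
    - rewrite (isI_unique _ _ _ HS h1). exact h2. }
  assert (HID : Cser I (cs * D)%C) by (now apply Cser_scal).
  assert (HL2 : Cser (fun k => 2 * l k)%C (RtoC (4 * PI) * Sv + cs * D)%C).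
  { eapply Cser_ext; [|apply Cser_plus; [apply (Cser_scal (RtoC (4 * PI)) _ _ HSS)|exact HID]].
    intros k. cbv beta. unfold sk. rewrite !RtoC_inv, !RtoC_mult by lra. field. auto. }
  set (a := fun m => (/ RtoC (INR m + th) - / RtoC (INR m + (1 - th)))%C) in *.
  assert (Ha : Cser a (hurwitz_diff_at1 th)).
  { eapply Cser_ext; [|apply (hurwitz_diff_at1_spec th Hth)]. intros m. cbv beta. assert (m0 := pos_INR m). unfold a. rewrite RtoC_minus, !RtoC_inv by lra. reflexivity. }
  (* The termwise formula is solved for the [quad] terms, so row sums and total are linear
     combinations of series already known to converge. *)
  set (T := fun m => (/ RtoC x * (cpow x nu * a m * Z - RtoC PI / mellin_const nu * (2 * l m)))%C).
  set (Tot := (/ RtoC x * (cpow x nu * Z * hurwitz_diff_at1 th - RtoC PI / mellin_const nu * (RtoC (4 * PI) * Sv + cs * D)))%C).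
  exists T, Tot. split; [|split].
  - intros m. unfold T.
    eapply Cser_ext; [|apply Cser_scal; apply Cser_minus; [apply (Cser_scal (cpow x nu * a m)%C _ _ HZ)|
       apply Cser_scal; apply (Cser_scal 2); apply (proj1 (Hl m))]].
    intros n. cbv beta. unfold Kt. fold (a m). rewrite RtoC_inv, RtoC_mult by lra. field. auto.
  - unfold T, Tot. apply Cser_scal. apply Cser_minus.
    + eapply Cser_ext; [|apply (Cser_scal (cpow x nu * Z) _ _ Ha)]. intros m; cbv beta; ring.
    + now apply Cser_scal.
  - unfold Tot. replace (1 / (2 * ccos (RtoC PI * nu / 2)))%C with (mellin_const nu / RtoC PI)%C.
    2:{ unfold mellin_const. rewrite RtoC_div by lra. field. auto. }
    replace (cpow x nu / (2 * ccos (RtoC PI * nu / 2)))%C with (cpow x nu * (mellin_const nu / RtoC PI))%C.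
    2:{ unfold mellin_const. rewrite RtoC_div by lra. field. auto. }
    fold cs. field. auto.
Qed.

(** * The double series *)

Lemma Rpower_between_base w t x b : 0 < w <= t -> t <= x -> Rpower t b <= Rpower w b + Rpower x b.
Proof.
  intros H1 H2. assert (p1 : 0 < Rpower w b) by apply exp_pos. assert (p2 : 0 < Rpower x b) by apply exp_pos.
  assert (l1 : ln w <= ln t). { destruct H1 as [h0 [h| ->]]. left; now apply ln_increasing. right; auto. }
  assert (l2 : ln t <= ln x). { destruct H2 as [h| ->]. left; apply ln_increasing; lra. right; auto. }
  destruct (Rle_lt_dec 0 b).
  - assert (Rpower t b <= Rpower x b) by (apply exp_le; nra). lra.
  - assert (Rpower t b <= Rpower w b) by (apply exp_le; nra). lra.
Qed.

Definition dquot (x : R) (a : C) (w : R) : C :=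
  if Req_EM_T w x then (a / 2 * cpow x (a - 2))%C else ((cpow w a - cpow x a) / RtoC (w ^ 2 - x ^ 2))%C.

Lemma Gfun_dquot x nu N u v : Gfun x nu N u v = (cpow u (- nu - 1) / RtoC v * dquot x (nu - RtoC (2 * INR N) + 1) (u * v))%C.
Proof. unfold Gfun, dquot. destruct Req_EM_T; reflexivity. Qed.

Lemma Rpower_S b r : 0 < b -> Rpower b r = Rpower b (r - 1) * b.
Proof. intros Hb. rewrite <- (Rpower_1 b) at 3 by auto. rewrite <- Rpower_plus. f_equal. ring. Qed.

(** For [w >= 2 x] the denominator is at least [3/4 w^2]. For smaller [w] the mean value inequality
    cancels the factor [w - x], so the bound is uniform across the removable singularity, whose
    value is estimated directly. *)
Lemma dquot_bound x a w A : 0 < x -> 0 < w -> Cmod a <= A ->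
  Cmod (dquot x a w) <= (2 * A + 2) * (Rpower w (Re a) + Rpower x (Re a)) / (w * w).
Proof.
  intros Hx Hw HA. set (al := Re a).
  assert (a0 := Cmod_ge_0 a).
  assert (pw : 0 < Rpower w al) by apply exp_pos. assert (px : 0 < Rpower x al) by apply exp_pos.
  assert (pw1 : 0 < Rpower w (al - 1)) by apply exp_pos. assert (px1 : 0 < Rpower x (al - 1)) by apply exp_pos.
  assert (sw := Rpower_S w al Hw). assert (sx := Rpower_S x al Hx).
  apply Rle_div_r. nra. unfold dquot. destruct (Req_EM_T w x) as [e|n].
  - subst w. rewrite Cmod_mult, Cmod_div, Cmod_cpow, Cmod_R, Rabs_pos_eq, Re_minus, re_RtoC by (try apply RtoC_neq_0; lra). fold al.
    assert (sx2 := Rpower_S x (al - 1) Hx). replace (al - 1 - 1) with (al - 2) in sx2 by ring.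
    assert (px2 : 0 < Rpower x (al - 2)) by apply exp_pos.
    replace (Cmod a / 2 * Rpower x (al - 2) * (x * x)) with (Cmod a / 2 * Rpower x al) by (rewrite sx, sx2; field). nra.
  - assert (wx : w ^ 2 - x ^ 2 <> 0). { intros h. apply n. assert ((w - x) * (w + x) = 0) by lra. apply Rmult_integral in H. lra. }
    rewrite Cmod_div, Cmod_R by now apply RtoC_neq_0.
    destruct (Rle_lt_dec (2 * x) w) as [h|h].
    + rewrite Rabs_pos_eq by nra.
      assert (T : Cmod (cpow w a - cpow x a) <= Rpower w al + Rpower x al). { eapply Rle_trans. apply Cmod_minus_le. rewrite !Cmod_cpow. fold al. lra. }
      assert (q : 3 / 4 * (w * w) <= w ^ 2 - x ^ 2) by nra.
      assert (ww : 0 < w * w) by nra.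
      apply Rle_trans with ((Rpower w al + Rpower x al) / (w ^ 2 - x ^ 2) * (w * w)).
      { apply Rmult_le_compat_r. lra. apply Rmult_le_compat_r; auto. left; apply Rinv_0_lt_compat; lra. }
      replace ((Rpower w al + Rpower x al) / (w ^ 2 - x ^ 2) * (w * w)) with ((Rpower w al + Rpower x al) * ((w * w) / (w ^ 2 - x ^ 2))) by (field; lra).
      assert (q2 : w * w / (w ^ 2 - x ^ 2) <= 2) by (apply Rle_div_l; nra). nra.
    + assert (MV : Cmod (cpow w a - cpow x a) <= A * (Rpower w (al - 1) + Rpower x (al - 1)) * Rabs (w - x)).
      { assert (K : forall p q, 0 < p <= q -> Cmod (cpow q a - cpow p a) <= A * (Rpower p (al - 1) + Rpower q (al - 1)) * (q - p)).
        { intros p q Hpq. apply (rder_mean_value (fun t => cpow t a) (fun t => (a * cpow t (a - 1))%C)). lra.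
          - intros t Ht. apply rder_cpow. lra.
          - intros t Ht. rewrite Cmod_mult, Cmod_cpow, Re_minus, re_RtoC. fold al. apply Rmult_le_compat; auto. left; apply exp_pos.
            apply Rpower_between_base; lra. }
        destruct (Rle_lt_dec w x). rewrite Cmod_minus_sym, Rabs_left1 by lra. replace (- (w - x)) with (x - w) by ring. apply K; lra.
        rewrite Rabs_pos_eq, (Rplus_comm (Rpower w _)) by lra. apply K; lra. }
      replace (w ^ 2 - x ^ 2) with ((w - x) * (w + x)) by ring. rewrite Rabs_mult, (Rabs_pos_eq (w + x)) by lra.
      assert (r0 : 0 < Rabs (w - x)) by (apply Rabs_pos_lt; lra).
      apply Rle_trans with (A * (Rpower w (al - 1) + Rpower x (al - 1)) * Rabs (w - x) / (Rabs (w - x) * (w + x)) * (w * w)).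
      { apply Rmult_le_compat_r. nra. apply Rmult_le_compat_r; auto. left; apply Rinv_0_lt_compat; nra. }
      replace (A * (Rpower w (al - 1) + Rpower x (al - 1)) * Rabs (w - x) / (Rabs (w - x) * (w + x)) * (w * w))
        with (A * ((Rpower w (al - 1) + Rpower x (al - 1)) * (w * w / (w + x)))) by (field; lra).
      assert (q1 : w * w / (w + x) <= w) by (apply Rle_div_l; nra).
      assert (q2 : w * w / (w + x) <= 2 * x) by (apply Rle_div_l; nra).
      assert (Rpower w (al - 1) * (w * w / (w + x)) <= Rpower w al) by (rewrite sw; apply Rmult_le_compat_l; lra).
      assert (Rpower x (al - 1) * (w * w / (w + x)) <= 2 * Rpower x al) by (rewrite sx; replace (2 * (Rpower x (al - 1) * x)) with (Rpower x (al - 1) * (2 * x)) by ring; apply Rmult_le_compat_l; lra).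
      assert (0 <= A) by lra. nra.
Qed.

Lemma hol_Gfun x N u v nu : hol (fun nu => Gfun x nu N u v) nu.
Proof.
  apply hol_ext_loc with (fun nu => cpow u (- nu - 1) / RtoC v * dquot x (nu - RtoC (2 * INR N) + 1) (u * v))%C 1. lra.
  intros; symmetry; apply Gfun_dquot.
  assert (h : hol (fun nu => nu - RtoC (2 * INR N) + 1)%C nu) by (apply hol_plus; auto using hol_const; apply hol_minus; auto using hol_const, hol_id).
  apply hol_mult. apply hol_mult; [|apply hol_const]. apply hol_cpow. apply hol_minus; [|apply hol_const]. apply hol_opp, hol_id.
  unfold dquot. destruct Req_EM_T.
  - apply hol_mult. apply hol_mult; auto using hol_const. apply hol_cpow. apply hol_minus; auto using hol_const.
  - apply hol_mult; [|apply hol_const]. apply hol_minus; apply hol_cpow; auto.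
Qed.

Lemma hol_quad x N th psi m n nu : hol (fun nu => quad (Gfun x nu N) th psi m n) nu.
Proof. unfold quad. repeat apply hol_minus; try apply hol_plus; apply hol_Gfun. Qed.

(** The two summands come from [(u v)^(nu-2N+1)] and [x^(nu-2N+1)] after division by [(u v)^2]; each
    is a product of a power of [u] and a power of [v]. *)
Lemma Gfun_bound x N nu u v A : 0 < x -> 0 < u -> 0 < v -> Cmod (nu - RtoC (2 * INR N) + 1)%C <= A ->
  Cmod (Gfun x nu N u v) <= (2 * A + 2) * (Rpower u (- (2 * INR N + 2)) * Rpower v (- (2 * INR N + 2 - Re nu))
    + Rpower x (Re nu - 2 * INR N + 1) * Rpower u (- (Re nu + 3)) * Rpower v (- (3))).
Proof.
  intros Hx Hu Hv HA. rewrite Gfun_dquot. assert (uv : 0 < u * v) by nra.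
  assert (Q := dquot_bound x _ (u * v) A Hx uv HA). rewrite re_plus, Re_minus, !re_RtoC in Q.
  rewrite Cmod_mult, Cmod_div, Cmod_cpow, Cmod_R, Rabs_pos_eq, Re_minus, re_opp, re_RtoC by (try apply RtoC_neq_0; lra).
  assert (p0 : 0 <= Rpower u (- Re nu - 1) / v). { left. apply Rdiv_lt_0_compat; auto. apply exp_pos. }
  eapply Rle_trans. apply Rmult_le_compat_l; [auto|exact Q].
  right. assert (iv : / v = exp (- ln v)) by (rewrite exp_Ropp, exp_ln; auto).
  assert (iw : / (u * v * (u * v)) = exp (- 2 * ln u - 2 * ln v)).
  { replace (- 2 * ln u - 2 * ln v) with (- (ln u + ln v + (ln u + ln v))) by ring. rewrite exp_Ropp. f_equal.
    rewrite !exp_plus, !exp_ln by auto. ring. }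
  unfold Rdiv. rewrite iv, iw. unfold Rpower. rewrite ln_mult by auto.
  set (a := ln u). set (b := ln v). set (X := exp ((Re nu - 2 * INR N + 1) * ln x)).
  transitivity ((2 * A + 2) * (exp ((- Re nu - 1) * a) * exp (- b) * exp ((Re nu - 2 * INR N + 1) * (a + b)) * exp (- 2 * a - 2 * b)
     + X * (exp ((- Re nu - 1) * a) * exp (- b) * exp (- 2 * a - 2 * b)))). ring.
  f_equal. f_equal; [|rewrite (Rmult_assoc X); f_equal]; rewrite <- !exp_plus; f_equal; ring.
Qed.

Lemma Rser_power4 p c d : 1 < p -> 0 < c -> 0 < d -> exists L, Rser (fun k => Rpower (INR k + c) (- p) + Rpower (INR k + d) (- p)) L.
Proof.
  intros Hp Hc Hd. destruct (Rser_power p c Hp Hc) as [L1 H1]. destruct (Rser_power p d Hp Hd) as [L2 H2].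
  exists (L1 + L2). now apply Rser_plus.
Qed.

(** The upper end makes the exponent [2 N + 2 - Re nu] of [1 / v] exceed [1]; the lower end puts the
    line [Re nu = 0] into the interior. *)
Definition in_strip (N : nat) (nu : C) : Prop := -1 < Re nu < 2 * INR N + 1.

(** Near [nu0] every power is dominated by the sum of its values at the two extreme exponents, so
    one majorant of product form serves a whole disc. The product form lets the two summations be
    treated one after the other. *)
Lemma quad_bound x N th psi nu0 : 0 < x -> 0 < th < 1 -> 0 < psi < 1 -> in_strip N nu0 ->
  exists r U V LU LV, 0 < r /\ Rser U LU /\ Rser V LV /\ (forall n, 0 <= U n) /\ (forall n, 0 <= V n) /\
   forall nu, Cmod (nu - nu0) < r -> in_strip N nu /\ forall m n, Cmod (quad (Gfun x nu N) th psi m n) <= V m * U n.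
Proof.
  unfold in_strip. intros Hx Hth Hpsi H0. set (s0 := Re nu0) in *. set (M := 2 * INR N) in *. assert (N0 := pos_INR N).
  assert (M0 : 0 <= M) by (unfold M; lra).
  set (r := Rmin (s0 + 1) (M + 1 - s0) / 2).
  assert (r0 : 0 < r) by (unfold r; assert (0 < Rmin (s0 + 1) (M + 1 - s0)) by (apply Rmin_pos; lra); lra).
  assert (r1 : 2 * r <= s0 + 1) by (unfold r; assert (h := Rmin_l (s0 + 1) (M + 1 - s0)); lra).
  assert (r2 : 2 * r <= M + 1 - s0) by (unfold r; assert (h := Rmin_r (s0 + 1) (M + 1 - s0)); lra).
  set (A := Cmod nu0 + r + M + 1).
  set (Xc := Rpower x (s0 - r - M + 1) + Rpower x (s0 + r - M + 1)).
  assert (Xc0 : 0 < Xc) by (unfold Xc; apply Rplus_lt_0_compat; apply exp_pos).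
  assert (A0 : 0 <= A) by (unfold A; assert (h := Cmod_ge_0 nu0); lra).
  set (K := (2 * A + 2) * (1 + Xc)). assert (K0 : 0 < K) by (unfold K; apply Rmult_lt_0_compat; lra).
  set (u := fun t => Rpower t (- (M + 2)) + (Rpower t (- (s0 - r + 3)) + Rpower t (- (s0 + r + 3)))).
  set (v := fun t => Rpower t (- (3)) + (Rpower t (- (M + 2 - s0 - r)) + Rpower t (- (M + 2 - s0 + r)))).
  assert (u0 : forall t, 0 < u t). { intros t. unfold u. repeat apply Rplus_lt_0_compat; apply exp_pos. }
  assert (v0 : forall t, 0 < v t). { intros t. unfold v. repeat apply Rplus_lt_0_compat; apply exp_pos. }
  assert (SU : exists L, Rser (fun n => u (INR n + psi) + u (INR n + (1 - psi))) L).
  { destruct (Rser_power4 (M + 2) psi (1 - psi)) as [L1 H1]; try lra. destruct (Rser_power4 (s0 - r + 3) psi (1 - psi)) as [L2 H2]; try lra.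
    destruct (Rser_power4 (s0 + r + 3) psi (1 - psi)) as [L3 H3]; try lra.
    exists (L1 + (L2 + L3)). eapply is_lim_seq_ext; [|apply (Rser_plus _ _ _ _ H1 (Rser_plus _ _ _ _ H2 H3))].
    intros n. apply rpsum_ext. intros k _. unfold u. cbv beta. ring. }
  assert (SV : exists L, Rser (fun n => v (INR n + th) + v (INR n + (1 - th))) L).
  { destruct (Rser_power4 3 th (1 - th)) as [L1 H1]; try lra. destruct (Rser_power4 (M + 2 - s0 - r) th (1 - th)) as [L2 H2]; try lra.
    destruct (Rser_power4 (M + 2 - s0 + r) th (1 - th)) as [L3 H3]; try lra.
    exists (L1 + (L2 + L3)). eapply is_lim_seq_ext; [|apply (Rser_plus _ _ _ _ H1 (Rser_plus _ _ _ _ H2 H3))].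
    intros n. apply rpsum_ext. intros k _. unfold v. cbv beta. ring. }
  destruct SU as [LU HU]. destruct SV as [LV HV].
  exists r, (fun n => K * (u (INR n + psi) + u (INR n + (1 - psi)))), (fun n => v (INR n + th) + v (INR n + (1 - th))), (K * LU), LV.
  split; auto. split. now apply Rser_scal. split; auto.
  split. intros n. assert (h1 := u0 (INR n + psi)). assert (h2 := u0 (INR n + (1 - psi))). apply Rmult_le_pos; lra.
  split. intros n. assert (h1 := v0 (INR n + th)). assert (h2 := v0 (INR n + (1 - th))). lra.
  intros nu Hnu. assert (Rn := Re_close _ _ _ Hnu). fold s0 in Rn. split. lra.
  assert (AB : Cmod (nu - RtoC M + 1)%C <= A).
  { replace (nu - RtoC M + 1)%C with ((nu - nu0) + (nu0 + (RtoC (- M) + 1)))%C by (rewrite RtoC_opp; ring).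
    assert (t1 := Cmod_triangle (nu - nu0) (nu0 + (RtoC (- M) + 1))). assert (t2 := Cmod_triangle nu0 (RtoC (- M) + 1)).
    assert (t3 := Cmod_triangle (RtoC (- M)) 1). rewrite Cmod_1, Cmod_R, Rabs_Ropp, Rabs_pos_eq in t3 by auto. unfold A. lra. }
  assert (GB : forall a b, 0 < a -> 0 < b -> Cmod (Gfun x nu N a b) <= K * u a * v b).
  { intros a b Ha Hb. eapply Rle_trans. apply (Gfun_bound x N nu a b A); auto. fold M.
    assert (e1 : Rpower b (- (M + 2 - Re nu)) <= Rpower b (- (M + 2 - s0 + r)) + Rpower b (- (M + 2 - s0 - r))) by (apply Rpower_between; lra).
    assert (e2 : Rpower x (Re nu - M + 1) <= Xc) by (apply Rpower_between; lra).
    assert (e3 : Rpower a (- (Re nu + 3)) <= Rpower a (- (s0 + r + 3)) + Rpower a (- (s0 - r + 3))) by (apply Rpower_between; lra).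
    assert (q1 : 0 < Rpower a (- (M + 2))) by apply exp_pos. assert (q2 : 0 < Rpower b (- (3))) by apply exp_pos.
    assert (q3 : 0 < Rpower a (- (s0 - r + 3))) by apply exp_pos. assert (q4 : 0 < Rpower a (- (s0 + r + 3))) by apply exp_pos.
    assert (q5 : 0 < Rpower b (- (M + 2 - s0 - r))) by apply exp_pos. assert (q6 : 0 < Rpower b (- (M + 2 - s0 + r))) by apply exp_pos.
    assert (q7 : 0 < Rpower b (- (M + 2 - Re nu))) by apply exp_pos. assert (q8 : 0 < Rpower a (- (Re nu + 3))) by apply exp_pos.
    assert (q9 : 0 < Rpower x (Re nu - M + 1)) by apply exp_pos.
    assert (f1 : Rpower a (- (M + 2)) * Rpower b (- (M + 2 - Re nu)) <= u a * v b) by (apply Rmult_le_compat; unfold u, v; lra).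
    assert (f2 : Rpower a (- (Re nu + 3)) * Rpower b (- (3)) <= u a * v b) by (apply Rmult_le_compat; unfold u, v; lra).
    assert (f3 : Rpower x (Re nu - M + 1) * (Rpower a (- (Re nu + 3)) * Rpower b (- (3))) <= Xc * (u a * v b)) by (apply Rmult_le_compat; nra).
    replace (K * u a * v b) with ((2 * A + 2) * (u a * v b + Xc * (u a * v b))) by (unfold K; ring).
    apply Rmult_le_compat_l. lra. rewrite Rmult_assoc. lra. }
  intros m n. assert (m0 := pos_INR m). assert (n0 := pos_INR n). unfold quad.
  replace (INR n + 1 - psi) with (INR n + (1 - psi)) by ring. replace (INR m + 1 - th) with (INR m + (1 - th)) by ring.
  assert (g1 := GB (INR n + psi) (INR m + th) ltac:(lra) ltac:(lra)). assert (g2 := GB (INR n + (1 - psi)) (INR m + th) ltac:(lra) ltac:(lra)).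
  assert (g3 := GB (INR n + psi) (INR m + (1 - th)) ltac:(lra) ltac:(lra)). assert (g4 := GB (INR n + (1 - psi)) (INR m + (1 - th)) ltac:(lra) ltac:(lra)).
  eapply Rle_trans. apply Cmod_minus_le. eapply Rle_trans. apply Rplus_le_compat_r. apply Cmod_minus_le.
  eapply Rle_trans. apply Rplus_le_compat_r, Rplus_le_compat_r. apply Cmod_triangle. lra.
Qed.

(** Weierstrass' theorem is applied twice: to the inner sums with the majorant [V m * U n], then to
    the outer one with [LU * V m]. *)
Theorem double_series x N th psi : 0 < x -> 0 < th < 1 -> 0 < psi < 1 ->
  exists (T : nat -> C -> C) (Tot : C -> C), forall nu, in_strip N nu ->
    (forall m, Cser (quad (Gfun x nu N) th psi m) (T m nu)) /\ Cser (fun m => T m nu) (Tot nu) /\ hol Tot nu.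
Proof.
  intros Hx Hth Hpsi.
  assert (E1 : forall m, exists F, forall nu, in_strip N nu -> hol F nu /\ Cser (fun n => quad (Gfun x nu N) th psi m n) (F nu)).
  { intros m. apply (hol_series_choice (fun n nu => quad (Gfun x nu N) th psi m n)).
    intros nu0 H0. destruct (quad_bound x N th psi nu0 Hx Hth Hpsi H0) as [r [U [V [LU [LV [r0 [HU [HV [U0 [V0 H]]]]]]]]]].
    exists r, (fun n => V m * U n), (V m * LU). split; auto. split. now apply Rser_scal.
    intros nu Hnu. destruct (H nu Hnu) as [h1 h2]. split; auto. intros n. split. apply hol_quad. apply h2. }
  set (T := fun m => proj1_sig (constructive_indefinite_description _ (E1 m))).
  assert (HT : forall m nu, in_strip N nu -> hol (T m) nu /\ Cser (fun n => quad (Gfun x nu N) th psi m n) (T m nu)).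
  { intros m. apply (proj2_sig (constructive_indefinite_description _ (E1 m))). }
  destruct (hol_series_choice T (in_strip N)) as [Tot HTot].
  { intros nu0 H0. destruct (quad_bound x N th psi nu0 Hx Hth Hpsi H0) as [r [U [V [LU [LV [r0 [HU [HV [U0 [V0 H]]]]]]]]]].
    exists r, (fun m => LU * V m), (LU * LV). split; auto. split. now apply Rser_scal.
    intros nu Hnu. destruct (H nu Hnu) as [h1 h2]. split; auto. intros m. split. now apply HT.
    rewrite Rmult_comm. apply Cser_mod_le with (fun n => quad (Gfun x nu N) th psi m n) (fun n => V m * U n); auto. now apply Rser_scal. now apply HT. }
  exists T, Tot. intros nu Hnu. split; [|split].
  - intros m. now apply HT.
  - now apply HTot.
  - now apply HTot.
Qed.

(** One geometric step: with [w = u v], [(w^a - x^a) / (w^2 - x^2) = w^(a-2) + x^2 (w^(a-2) -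
    x^(a-2)) / (w^2 - x^2)]. The first term separates into a power of [u] times a power of [v]. *)
Lemma Gfun_step x N nu u v : 0 < x -> 0 < u -> 0 < v ->
  Gfun x nu N u v = (RtoC (x * x) * Gfun x nu (S N) u v + cpow u (- RtoC (2 * INR (S N))) * cpow v (- (RtoC (2 * INR (S N)) - nu)))%C.
Proof.
  intros Hx Hu Hv. unfold Gfun.
  assert (Cu := RtoC_neq_0 u ltac:(lra)). assert (Cv := RtoC_neq_0 v ltac:(lra)). assert (Cx := RtoC_neq_0 x ltac:(lra)).
  set (a := (nu - RtoC (2 * INR N) + 1)%C).
  assert (E2 : RtoC (2 * INR (S N)) = (RtoC (2 * INR N) + 2)%C).
  { rewrite S_INR, <- RtoC_plus. f_equal. ring. }
  replace (nu - RtoC (2 * INR (S N)) + 1)%C with (a - 2)%C by (rewrite E2; unfold a; ring). rewrite E2.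
  assert (P2 : forall b s, 0 < b -> cpow b (s - 2) = (cpow b s / (RtoC b * RtoC b))%C).
  { intros b s Hb. replace (s - 2)%C with (s + - (1 + 1))%C by ring. rewrite cpow_plus, cpow_opp, cpow_plus, cpow_1 by auto. reflexivity. }
  replace (- (RtoC (2 * INR N) + 2))%C with (- nu - 1 + (a - 2))%C by (unfold a; ring).
  replace (- (RtoC (2 * INR N) + 2 - nu))%C with (a - 2 + - (1))%C by (unfold a; ring).
  rewrite !(cpow_plus _ _ (a - 2)), (cpow_plus _ (a - 2)), cpow_opp, cpow_1 by auto.
  assert (nU := cpow_neq_0 u a). assert (nX := cpow_neq_0 x a).
  destruct (Req_EM_T (u * v) x) as [e|n].
  - rewrite !P2 by auto. rewrite RtoC_mult. rewrite <- e, cpow_mult_base by auto. rewrite RtoC_mult. field. auto.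
  - rewrite !P2 by nra. rewrite cpow_mult_base by auto. 
    assert (w2 : (RtoC u * RtoC v * (RtoC u * RtoC v) - RtoC x * RtoC x)%C <> 0).
    { rewrite <- !RtoC_mult, <- RtoC_minus. apply RtoC_neq_0. intros h. apply n. assert (0 < u * v) by nra. nra. }
    replace (RtoC ((u * v) ^ 2 - x ^ 2)) with (RtoC u * RtoC v * (RtoC u * RtoC v) - RtoC x * RtoC x)%C by (rewrite <- !RtoC_mult, <- RtoC_minus; f_equal; ring).
    rewrite !RtoC_mult. field. auto.
Qed.

(** * The identity and its analytic continuation *)

Definition cohen_rhs (x th psi : R) (nu : C) (N : nat) (Tot : C) : C :=
  (- (RtoC (PI / 2) / csin (RtoC PI * nu / 2)) *
             (hurwitz (1 - nu) th - hurwitz (1 - nu) (1 - th))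
       + cpow x nu / (2 * ccos (RtoC PI * nu / 2)) * hurwitz_diff_at1 th *
             (hurwitz (1 + nu) psi + hurwitz (1 + nu) (1 - psi))
       - 1 / (2 * ccos (RtoC PI * nu / 2)) *
           csum (seq 1 N)
             (fun j => cpow x (RtoC (2 * INR j - 1)) *
                (hurwitz (RtoC (2 * INR j) - nu) th
                 - hurwitz (RtoC (2 * INR j) - nu) (1 - th)) *
                (hurwitz (RtoC (2 * INR j)) psi
                 + hurwitz (RtoC (2 * INR j)) (1 - psi)))
       - 1 / (2 * ccos (RtoC PI * nu / 2)) *
           cpow x (RtoC (2 * INR N + 1)) * Tot)%C.

Lemma strip_identity_any_N x th psi nu Sv : 0 < x -> 0 < th < 1 -> 0 < psi < 1 -> / 4 < Re nu < 3 / 4 ->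
  isI (fun y => cexp (nu * RtoC y) * lapl x th psi y)%C Sv ->
  forall N T Tot, (forall m, Cser (quad (Gfun x nu N) th psi m) (T m)) -> Cser T Tot ->
  (RtoC (4 * PI) * Sv)%C = cohen_rhs x th psi nu N Tot.
Proof.
  intros Hx Hth Hpsi Hnu HS.
  destruct (hurwitz_diff th Hth) as [Dd [HD1 HD2]].
  assert (Z1 := proj2 (hurwitz_spec psi ltac:(lra))). assert (Z2 := proj2 (hurwitz_spec (1 - psi) ltac:(lra))).
  induction N; intros T Tot HT HTot.
  - assert (R1 : 0 < Re (1 - nu)%C) by (rewrite Re_minus, re_RtoC; lra).
    assert (n1 : (1 - nu)%C <> 1). { intros e. apply (f_equal Re) in e. rewrite Re_minus, !re_RtoC in e. lra. }
    assert (R2 : 1 < Re (1 + nu)%C) by (rewrite re_plus, re_RtoC; lra).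
    destruct (strip_identity x th psi nu Sv _ _ Hx Hth Hpsi Hnu HS (proj2 (HD1 _ R1)) (Cser_plus _ _ _ _ (Z1 _ R2) (Z2 _ R2))) as [T0 [Tot0 [h1 [h2 h3]]]].
    assert (ET : Tot0 = Tot).
    { apply Cser_unique with T0; auto. eapply Cser_ext; [|exact HTot]. intros m. apply Cser_unique with (quad (Gfun x nu 0) th psi m); auto. }
    rewrite h3, ET, <- (HD2 _ R1 n1). unfold cohen_rhs. change (csum (seq 1 0) _) with (RtoC 0).
    replace (cpow x (RtoC (2 * INR 0 + 1))) with (RtoC x). ring.
    simpl INR. replace (2 * 0 + 1) with 1 by ring. now rewrite cpow_1.
  - set (j := RtoC (2 * INR (S N))).
    assert (n0 := pos_INR N).
    assert (Rj : 1 < Re j) by (unfold j; rewrite re_RtoC, S_INR; lra).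
    assert (Rjn : 1 < Re (j - nu)%C) by (rewrite Re_minus; unfold j; rewrite re_RtoC, S_INR; lra).
    set (Zs := (hurwitz j psi + hurwitz j (1 - psi))%C). set (Zd := (hurwitz (j - nu) th - hurwitz (j - nu) (1 - th))%C).
    assert (HZs : Cser (fun n => cpow (INR n + psi) (- j) + cpow (INR n + (1 - psi)) (- j))%C Zs) by (apply Cser_plus; auto).
    assert (HZd : Cser (fun m => cpow (INR m + th) (- (j - nu)) - cpow (INR m + (1 - th)) (- (j - nu)))%C Zd).
    { apply Cser_minus; apply hurwitz_spec; auto; lra. }
    (* The induction hypothesis receives the series for [N] rebuilt from that for [S N] by
       [Gfun_step]; the extra total [Zd * Zs] becomes the term [j = S N] of the finite sum. *)
    assert (HI := IHN (fun m => RtoC (x * x) * T m + (cpow (INR m + th) (- (j - nu)) - cpow (INR m + (1 - th)) (- (j - nu))) * Zs)%C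
      (RtoC (x * x) * Tot + Zd * Zs)%C).
    rewrite HI.
    + unfold cohen_rhs. rewrite seq_S, csum_app, csum_cons. change (csum nil _) with (RtoC 0). change (1 + N)%nat with (S N). cbv beta. fold j Zs Zd.
      assert (E1 : cpow x (RtoC (2 * INR (S N) + 1)) = (cpow x (RtoC (2 * INR N + 1)) * RtoC (x * x))%C).
      { replace (2 * INR (S N) + 1) with (2 * INR N + 1 + (1 + 1)) by (rewrite S_INR; ring). rewrite (RtoC_plus _ (1 + 1)), (RtoC_plus 1 1), cpow_plus, (cpow_plus x 1 1), !cpow_1, RtoC_mult by auto. reflexivity. }
      rewrite E1. replace (2 * INR (S N) - 1) with (2 * INR N + 1) by (rewrite S_INR; ring). ring.
    + intros m. assert (m0 := pos_INR m).
      eapply Cser_ext; [|apply Cser_plus; [apply (Cser_scal (RtoC (x * x)) _ _ (HT m))|apply (Cser_scal (cpow (INR m + th) (- (j - nu)) - cpow (INR m + (1 - th)) (- (j - nu)))%C _ _ HZs)]].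
      intros n. cbv beta. assert (n1 := pos_INR n). unfold quad. rewrite !(Gfun_step x N) by lra. fold j.
      replace (INR n + 1 - psi) with (INR n + (1 - psi)) by ring. replace (INR m + 1 - th) with (INR m + (1 - th)) by ring. ring.
    + apply Cser_plus. now apply Cser_scal. rewrite (Cmult_comm Zd). eapply Cser_ext; [|apply (Cser_scal Zs _ _ HZd)]. intros; cbv beta; ring.
Qed.

(** All singularities of the right side are integers: even ones are zeros of the sine, odd ones of
    the cosine, and the poles of the zeta factors lie at [0] and at [2 j - 1]. *)
Definition nonint (nu : C) : Prop := forall k : Z, nu <> RtoC (IZR k).

Lemma csin_zero z : csin z = 0 -> exists k : Z, z = RtoC (IZR k * PI).
Proof.
  destruct z as [a b]. rewrite csin_pair. intros H. assert (h1 := f_equal Re H). assert (h2 := f_equal Im H). simpl in h1, h2.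
  assert (cp : 0 < cosh b) by (unfold cosh; assert (h := exp_pos b); assert (h' := exp_pos (- b)); lra).
  assert (s0 : sin a = 0) by (apply Rmult_integral in h1; lra).
  assert (c0 : cos a <> 0). { intros c. assert (sc := sin2_cos2 a). rewrite s0, c in sc. unfold Rsqr in sc. lra. }
  assert (sh : sinh b = 0) by (apply Rmult_integral in h2; lra).
  assert (b0 : b = 0). { unfold sinh in sh. assert (e : exp b = exp (- b)) by lra. apply exp_inv in e. lra. }
  destruct (sin_eq_0_0 a s0) as [k hk]. exists k. rewrite <- hk, b0. reflexivity.
Qed.

Lemma nonint_csin nu : nonint nu -> csin (RtoC PI * nu / 2) <> 0.
Proof.
  intros H e. apply csin_zero in e. destruct e as [k hk]. apply (H (2 * k)%Z). assert (pp := PI_RGT_0).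
  assert (PIC : RtoC PI <> 0) by (apply RtoC_neq_0; lra).
  rewrite mult_IZR, RtoC_mult. replace nu with (RtoC PI * nu / 2 * (2 / RtoC PI))%C by (field; auto). rewrite hk, RtoC_mult. field. auto.
Qed.
Lemma nonint_ccos nu : nonint nu -> ccos (RtoC PI * nu / 2) <> 0.
Proof.
  intros H e. assert (pp := PI_RGT_0).
  assert (PIC : RtoC PI <> 0) by (apply RtoC_neq_0; lra).
  rewrite <- ccos_opp in e. replace (- (RtoC PI * nu / 2))%C with ((RtoC PI * (1 - nu) / 2) - RtoC (PI / 2))%C in e by (rewrite RtoC_div by lra; field).
  rewrite csin_shift in e. apply csin_zero in e. destruct e as [k hk]. apply (H (1 - 2 * k)%Z).
  rewrite minus_IZR, mult_IZR, RtoC_minus, RtoC_mult. replace nu with (1 - RtoC PI * (1 - nu) / 2 * (2 / RtoC PI))%C by (field; auto). rewrite hk, RtoC_mult. field. auto.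
Qed.

Lemma hol_csum (f : nat -> C -> C) l z : (forall j, In j l -> hol (f j) z) -> hol (fun w => csum l (fun j => f j w)) z.
Proof.
  induction l as [|d l IH]; intros H. apply (hol_const 0).
  apply (hol_plus (f d) (fun w => csum l (fun j => f j w))). apply H; now left. apply IH. intros; apply H; now right.
Qed.

Lemma hol_hurwitz f a z : 0 < a -> f z <> RtoC 1 -> hol f z -> hol (fun w => hurwitz (f w) a) z.
Proof. intros Ha H1 Hf. apply (hol_comp (fun s => hurwitz s a) f z Hf). now apply hurwitz_spec. Qed.

Lemma hol_cohen_rhs x th psi N (Tot : C -> C) nu : 0 < th < 1 -> 0 < psi < 1 -> nonint nu -> hol Tot nu ->
  hol (fun nu => cohen_rhs x th psi nu N (Tot nu)) nu.
Proof.
  intros Hth Hpsi Hn HT. assert (i := hol_id nu).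
  assert (hp : hol (fun nu => RtoC PI * nu / 2)%C nu) by (apply hol_mult; [apply hol_mult|]; auto using hol_const).
  assert (hs : hol (fun nu => csin (RtoC PI * nu / 2)) nu) by (apply (hol_csin (fun nu => RtoC PI * nu / 2)%C); auto).
  assert (hc : hol (fun nu => 2 * ccos (RtoC PI * nu / 2))%C nu) by (apply hol_mult; auto using hol_const; apply (hol_ccos (fun nu => RtoC PI * nu / 2)%C); auto).
  assert (s0 := nonint_csin nu Hn). assert (c1 := nonint_ccos nu Hn).
  assert (c2 : (2 * ccos (RtoC PI * nu / 2))%C <> 0) by (apply Cmult_neq_0; auto; apply RtoC_neq_0; lra).
  assert (n0 : forall f : C -> C, (f = (fun w => 1 - w) \/ f = (fun w => 1 + w))%C -> f nu <> RtoC 1).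
  { intros f [-> | ->] e; apply (Hn 0%Z). replace nu with (1 - (1 - nu))%C by ring. rewrite e. ring. replace nu with ((1 + nu) - 1)%C by ring. rewrite e. ring. }
  assert (m1 := n0 _ (or_introl eq_refl)). assert (m2 := n0 _ (or_intror eq_refl)). cbv beta in m1, m2.
  assert (h1 : hol (fun w => 1 - w)%C nu) by (apply hol_minus; auto using hol_const).
  assert (h2 : hol (fun w => 1 + w)%C nu) by (apply hol_plus; auto using hol_const).
  unfold cohen_rhs.
  apply hol_minus; [apply hol_minus; [apply hol_plus|]|].
  - apply hol_mult. apply hol_opp. apply hol_div; auto using hol_const.
    apply hol_minus; apply (hol_hurwitz (fun w => 1 - w)%C); auto; lra.
  - apply hol_mult. apply hol_mult; auto using hol_const. apply hol_div; auto. now apply hol_cpow.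
    apply hol_plus; apply (hol_hurwitz (fun w => 1 + w)%C); auto; lra.
  - apply hol_mult. apply hol_div; auto using hol_const.
    apply (hol_csum (fun j nu => cpow x (RtoC (2 * INR j - 1)) * (hurwitz (RtoC (2 * INR j) - nu) th - hurwitz (RtoC (2 * INR j) - nu) (1 - th)) * (hurwitz (RtoC (2 * INR j)) psi + hurwitz (RtoC (2 * INR j)) (1 - psi)))%C).
    intros j _. apply hol_mult; auto using hol_const. apply hol_mult; auto using hol_const.
    assert (hj : (RtoC (2 * INR j) - nu)%C <> 1).
    { intros e. apply (Hn (2 * Z.of_nat j - 1)%Z). rewrite minus_IZR, mult_IZR, <- INR_IZR_INZ, RtoC_minus. replace nu with (RtoC (2 * INR j) - (RtoC (2 * INR j) - nu))%C by ring. rewrite e. reflexivity. }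
    assert (h3 : hol (fun w => RtoC (2 * INR j) - w)%C nu) by (apply hol_minus; auto using hol_const).
    apply hol_minus; apply (hol_hurwitz (fun w => RtoC (2 * INR j) - w)%C); auto; lra.
  - apply hol_mult; auto. apply hol_mult; auto using hol_const. apply hol_div; auto using hol_const.
Qed.

(** The difference of both sides is holomorphic off the integers, the transform because [lapl]
    decays at every rate, and it vanishes for [1/4 < Re nu < 3/4]; [identity_strip] extends this to
    the whole strip. *)
Theorem cohen_identity_continued x th psi N : 0 < x -> 0 < th < 1 -> 0 < psi < 1 ->
  forall nu, in_strip N nu -> nonint nu -> forall Sv T Tot,
  isI (fun y => cexp (nu * RtoC y) * lapl x th psi y)%C Sv ->
  (forall m, Cser (quad (Gfun x nu N) th psi m) (T m)) -> Cser T Tot ->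
  (RtoC (4 * PI) * Sv)%C = cohen_rhs x th psi nu N Tot.
Proof.
  intros Hx Hth Hpsi nu Hnu Hn Sv T Tot HS HT HTot.
  destruct (bessel_series_laplace x th psi Hx) as [Fc [Fd FS]].
  set (S := fun nu => proj1_sig (constructive_indefinite_description _ (FS nu))).
  assert (HSI : forall nu, isI (fun y => cexp (nu * RtoC y) * lapl x th psi y)%C (S nu)).
  { intros w. destruct (proj2_sig (constructive_indefinite_description _ (FS w))) as [L [h _]]. exact h. }
  destruct (double_series x N th psi Hx Hth Hpsi) as [T' [Tot' H']].
  (* Uniqueness of sums and integrals identifies the given values at one [nu] with functions
     holomorphic in [nu], to which continuation applies. *)
  assert (ET : Tot = Tot' nu).
  { destruct (H' nu Hnu) as [h1 [h2 _]]. apply Cser_unique with T; auto. eapply Cser_ext; [|exact h2].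
    intros m. apply Cser_unique with (quad (Gfun x nu N) th psi m); auto. }
  rewrite (isI_unique _ _ _ HS (HSI nu)), ET.
  assert (n0 := pos_INR N). unfold in_strip in *.
  assert (HD : forall w, -1 < Re w < 2 * INR N + 1 -> nonint w -> hol (fun w => RtoC (4 * PI) * S w - cohen_rhs x th psi w N (Tot' w))%C w).
  { intros w Hw Hw'. apply hol_minus.
    - apply hol_mult. apply hol_const. destruct (Fd (Rabs (Re w) + 3)) as [c hc]. assert (h := Rabs_pos (Re w)); lra.
      apply (hol_laplace (lapl x th psi) S c (Rabs (Re w) + 3) w 1); auto; lra.
    - apply hol_cohen_rhs; auto. now apply H'. }
  apply Ceq_minus. apply (identity_strip (fun w => RtoC (4 * PI) * S w - cohen_rhs x th psi w N (Tot' w))%C (-1) (/ 4) (3 / 4) (2 * INR N + 1)); try lra.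
  - intros w Hw Hi. apply HD; auto. intros k e. apply Hi. rewrite e. reflexivity.
  - intros w Hw. apply (proj1 (Ceq_minus _ _)). destruct (H' w ltac:(lra)) as [h1 [h2 _]].
    now apply (strip_identity_any_N x th psi w (S w) Hx Hth Hpsi Hw (HSI w) N (fun m => T' m w)).
  - now apply HD.
Qed.

Theorem theorem3p9 (x th psi : R) (nu : C) (N : nat) :
  0 < x -> 0 < th < 1 -> 0 < psi < 1 ->
  (forall k : Z, nu <> RtoC (IZR k)) ->
  0 <= Re nu ->
  (Int_part ((Re nu + 1) / 2) <= Z.of_nat N)%Z ->
  (forall n r : nat, (1 <= n)%nat -> (1 <= r)%nat ->
     x <> (INR n - th) * (INR r - psi)) ->
  exists Lsum : C,
    @is_series C_AbsRing C_NormedModule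
      (fun k => let n := S k in
         (cpow (INR n) (nu / 2) * besselK nu (4 * PI * sqrt (INR n * x)) *
          csum (divisors_list n)
            (fun d => cpow (INR d) (- nu) *
                      RtoC (sin (2 * PI * INR d * th) *
                            cos (2 * PI * INR n * psi / INR d))))%C) Lsum /\
    exists T : nat -> C, exists Tot : C,
      (forall m : nat,
         @is_series C_AbsRing C_NormedModule
           (fun n => (Gfun x nu N (INR n + psi) (INR m + th)
                    + Gfun x nu N (INR n + 1 - psi) (INR m + th)
                    - Gfun x nu N (INR n + psi) (INR m + 1 - th)
                    - Gfun x nu N (INR n + 1 - psi) (INR m + 1 - th))%C)
           (T m)) /\
      @is_series C_AbsRing C_NormedModule T Tot /\
      (RtoC (8 * PI) * cpow x (nu / 2) * Lsum =
         - (RtoC (PI / 2) / csin (RtoC PI * nu / 2)) *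
             (hurwitz (1 - nu) th - hurwitz (1 - nu) (1 - th))
       + cpow x nu / (2 * ccos (RtoC PI * nu / 2)) * hurwitz_diff_at1 th *
             (hurwitz (1 + nu) psi + hurwitz (1 + nu) (1 - psi))
       - 1 / (2 * ccos (RtoC PI * nu / 2)) *
           csum (seq 1 N)
             (fun j => cpow x (RtoC (2 * INR j - 1)) *
                (hurwitz (RtoC (2 * INR j) - nu) th
                 - hurwitz (RtoC (2 * INR j) - nu) (1 - th)) *
                (hurwitz (RtoC (2 * INR j)) psi
                 + hurwitz (RtoC (2 * INR j)) (1 - psi)))
       - 1 / (2 * ccos (RtoC PI * nu / 2)) *
           cpow x (RtoC (2 * INR N + 1)) * Tot)%C.
Proof.
  intros Hx Hth Hpsi Hn Hre HN _.
  assert (Hstrip : in_strip N nu).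
  (* The floor condition says [(Re nu + 1) / 2 < N + 1], which is the upper edge
     [Re nu < 2 N + 1]. *)
  { unfold in_strip. apply IZR_le in HN. rewrite <- INR_IZR_INZ in HN.
    assert (h := base_Int_part ((Re nu + 1) / 2)). lra. }
  destruct (bessel_series_laplace x th psi Hx) as [_ [_ FS]].
  destruct (FS nu) as [Sv [Lsum [HS [HL E]]]].
  destruct (double_series x N th psi Hx Hth Hpsi) as [T [Tot HT]].
  destruct (HT nu Hstrip) as [h1 [h2 _]].
  exists Lsum. split. now apply Cser_is_series.
  exists (fun m => T m nu), (Tot nu). split; [|split].
  - intros m. apply Cser_is_series. apply (h1 m).
  - now apply Cser_is_series.
  - rewrite E. now apply (cohen_identity_continued x th psi N Hx Hth Hpsi nu Hstrip Hn Sv (fun m => T m nu) (Tot nu)).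
Qed.
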